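(* Let $n,d\ge 1$ be integers, $A$ a real $n\times n$ matrix, $B$ a real $n\times d$ matrix, $Z=\{Z_t,\ t\ge 0\}$ a $d$-dimensional Lévy process without Gaussian part, and $x\in\mathbb{R}^n$. Let $X$ be the Ornstein-Uhlenbeck process solving $\mathrm{d}X_t = AX_t\,\mathrm{d}t + B\,\mathrm{d}Z_t$, $X_0=x$, that is $$X_t = \mathrm{e}^{tA}x+\int_0^t \mathrm{e}^{(t-s)A}B\,\mathrm{d}Z_s,\qquad t\ge 0.$$ Let $\nu^B$ be the Lévy measure of the $\mathbb{R}^n$-valued Lévy process $B_t=BZ_t$, and let $\tau=\inf\{t>0:\ \mathcal{A}_t=\mathbb{R}^n\}$, where $\mathcal{A}_t$ is the random subspace defined in the context. If $A$ is non-singular, then the following three assertions are equivalent: (i) the law of $X_1$ is absolutely continuous with respect to Lebesgue measure on $\mathbb{R}^n$; (ii) $\tau=0$ almost surely; (iii) $\nu^B$ exhausts $\mathbb{R}^n$ with respect to $A$.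
   Context: For a vector subspace $\mathcal{E}\subset\mathbb{R}^n$ with basis $\{e_1,\dots,e_p\}$, set $\langle A,\mathcal{E}\rangle=\mathrm{Span}\{A^{i-1}e_j:\ i=1,\dots,n,\ j=1,\dots,p\}$. For $t>0$ let $\mathcal{B}_t=\mathrm{Span}\{\Delta B_s:\ s\le t\}$ be the (random) linear span of the jumps of $B_t=BZ_t$ up to time $t$ (where $\Delta B_s=B_s-B_{s-}$), and $\mathcal{A}_t=\langle A,\mathcal{B}_t\rangle$. The convention is $\inf\emptyset=+\infty$. Let $\mathcal{B}=\mathrm{Im}\,B\subset\mathbb{R}^n$ and $m=\dim\mathcal{B}=\mathrm{Rank}\,B$. Let $\kappa$ be the cyclic index of $A$, i.e. the maximal dimension of its eigenspaces (over the complex eigenvalues of $A$), equivalently the number of (non-constant) invariant factors of $A$. Definition. The Lévy measure $\nu^B$ is said to exhaust $\mathbb{R}^n$ with respect to $A$ if $\langle A,\mathcal{B}\rangle=\mathbb{R}^n$ and there exist an integer $r\in[\kappa,m]$ and a vector subspace $\mathcal{H}_r\subset\mathcal{B}$ of dimension $r$ such that $\langle A,\mathcal{H}_r\rangle=\mathbb{R}^n$ and $\nu^B(\mathcal{H}_r\cap\mathcal{H}^c)=+\infty$ for every hyperplane $\mathcal{H}\subset\mathcal{H}_r$ (i.e. every linear subspace $\mathcal{H}$ of $\mathcal{H}_r$ of dimension $r-1$). *)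

(* Defs.v *)
From HB Require Import structures.
From mathcomp Require Import all_boot all_order all_algebra.
From mathcomp Require Import all_classical all_reals all_analysis.
From mathcomp Require Import complex.

Set Implicit Arguments.
Unset Strict Implicit.
Unset Printing Implicit Defensive.
Import Order.TTheory GRing.Theory Num.Theory.
Import numFieldNormedType.Exports.

Local Open Scope classical_set_scope.
Local Open Scope ring_scope.
Local Open Scope complex_scope.

Section linear_algebra.
Context {R : realType}.

(* [vspan S] is the linear span of an arbitrary, possibly infinite, set of
   vectors of a finite-dimensional space; it is characterized by [mem_vspan]. *)
Definition vspan {vT : vectType R} (S : set vT) : {vspace vT} :=
  xget 0%VS [set E : {vspace vT} | forall v, v \in E <->
    exists s : seq vT, (forall u, u \in s -> S u) /\ v \in span s].

Lemma mem_vspan (vT : vectType R) (S : set vT) (v : vT) :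
  v \in vspan S <->
  exists s : seq vT, (forall u, u \in s -> S u) /\ v \in span s.
Proof.
rewrite /vspan; case: xgetP => [E _ /(_ v)//|noE]; exfalso.
pose Q k := `[< exists s : seq vT,
  (forall u, u \in s -> S u) /\ \dim (span s) = k >].
have exQ : exists k, Q k.
  by exists (\dim (span ([::] : seq vT))); apply/asboolP; exists [::].
have ubQ k : Q k -> (k <= \dim (fullv : {vspace vT}))%N.
  by move=> /asboolP[s [_ <-]]; exact/dimvS/subvf.
case: (ex_maxnP exQ ubQ) => k /asboolP[s [sS sk]] kmax.
apply: (noE (span s)) => w; split; first by move=> ws; exists s.
move=> [s' [s'S ws']].
have sub : (span s <= span (s ++ s'))%VS by rewrite span_cat addvSl.
have : Q (\dim (span (s ++ s'))).
  apply/asboolP; exists (s ++ s'); split=> // u.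
  by rewrite mem_cat => /orP[/sS|/s'S].
move=> /kmax; rewrite -sk => le.
have /eqP -> : span s == span (s ++ s') by rewrite eqEdim sub.
by rewrite span_cat (subvP (addvSr _ _)).
Qed.

(* <A, E> = Span {A^(i-1) e_j : 1 <= i <= n}, (e_j) a basis of E *)
Definition cyclic_span n (A : 'M[R]_n) (E : {vspace 'cV[R]_n}) :
    {vspace 'cV[R]_n} :=
  <<[seq A ^+ i *m e | i <- iota 0 n, e <- vbasis E]>>%VS.

(* [eigenspace] is about row vectors, hence the transpose. *)
Definition cyclic_index n (A : 'M[R]_n) : nat :=
  \max_(k < n.+1 | `[< exists2 lambda : R[i],
     eigenvalue (map_mx (real_complex R) A^T) lambda &
     \rank (eigenspace (map_mx (real_complex R) A^T) lambda) = k >]) k.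

Definition im_mx n d (B : 'M[R]_(n, d)) : {vspace 'cV[R]_n} :=
  limg (linfun (mulmx B : 'cV[R]_d -> 'cV[R]_n)).

Definition dotv n (u v : 'cV[R]_n) : R := (u^T *m v) 0 0.

End linear_algebra.

(* R^n with its Borel sigma-algebra *)
Notation borelV R n := (g_sigma_algebraType (@open 'cV[R]_n)).

Section lebesgue.
Context {R : realType}.
Local Open Scope ereal_scope.

(* Lebesgue (outer) measure on R^n, by countable covers with boxes
   ]a_1, b_1] x ... x ]a_n, b_n]; on Borel sets it is Lebesgue measure. *)
Definition lebesgue_cV n (S : set (borelV R n)) : \bar R :=
  ereal_inf [set \sum_(0 <= k <oo)
       (\prod_(i < n) (ab.2 k i 0 - ab.1 k i 0))%R%:E |
     ab in [set ab : (nat -> 'cV[R]_n) * (nat -> 'cV[R]_n) |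
       (forall k i, (ab.1 k i 0 <= ab.2 k i 0)%R) /\
       S `<=` \bigcup_k [set v : 'cV[R]_n |
                forall i, (ab.1 k i 0 < v i 0 <= ab.2 k i 0)%R]]].

End lebesgue.

Section levy.
Context {disp : measure_display} {T : measurableType disp} {R : realType}.
Variable P : probability T R.

Definition cadlag d (f : R -> 'cV[R]_d) : Prop :=
  (forall t, 0 <= t -> f s @[s --> t^'+] --> f t) /\
  (forall t, 0 < t -> cvg (f s @[s --> t^'-])).

Definition jump d (f : R -> 'cV[R]_d) (t : R) : 'cV[R]_d :=
  f t - lim (f s @[s --> t^'-]).

(* Processes are indexed by R; only their values at times [0 <= t] matter. *)
Record levy_process d (Z : R -> T -> 'cV[R]_d) : Prop := {
  levy_measurable : forall t, 0 <= t ->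
    measurable_fun setT (Z t : T -> borelV R d) ;
  levy_start : {ae P, forall w, Z 0 w = 0} ;
  levy_independent_increments :
    forall (k : nat) (t : nat -> R) (E : nat -> set (borelV R d)),
      0 <= t 0%N -> (forall i, t i <= t i.+1) ->
      (forall i, measurable (E i)) ->
      P [set w | forall i, (i < k)%N -> E i (Z (t i.+1) w - Z (t i) w)] =
      (\prod_(i < k) P [set w | E i (Z (t i.+1) w - Z (t i) w)%R])%E ;
  levy_stationary_increments :
    forall (s t : R) (E : set (borelV R d)),
      0 <= s -> 0 <= t -> measurable E ->
      P [set w | E (Z (s + t) w - Z s w)] = P [set w | E (Z t w)] ;
  levy_stochastic_continuity :
    forall (t e : R), 0 <= t -> 0 < e ->
      P [set w | e < `|Z s w - Z t w|]
        @[s --> within [set s | 0 <= s] (nbhs t)] --> 0%E ;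
  levy_cadlag : {ae P, forall w, cadlag (Z ^~ w)} }.

Definition cexp (z : R[i]) : R[i] :=
  (expR (complex.Re z))%:C * (cos (complex.Im z) +i* sin (complex.Im z)).

(* E [exp (i <u, Y>)] *)
Definition charfun d (Y : T -> 'cV[R]_d) (u : 'cV[R]_d) : R[i] :=
  (\int[P]_w cos (dotv u (Y w))) +i* (\int[P]_w sin (dotv u (Y w))).

Definition is_levy_measure d
    (nu : {measure set (borelV R d) -> \bar R}) : Prop :=
  nu [set 0 : 'cV[R]_d] = 0%E /\
  (\int[nu]_(z in [set: borelV R d])
     (Num.min 1 (dotv (z : 'cV[R]_d) (z : 'cV[R]_d)))%:E < +oo)%E.

(* i <b, u> - <u, Q u> / 2
   + \int (exp (i <u, z>) - 1 - i <u, z> 1_(|z| <= 1)) nu (dz) *)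
Definition levy_exponent d (b : 'cV[R]_d) (Q : 'M[R]_d)
    (nu : {measure set (borelV R d) -> \bar R}) (u : 'cV[R]_d) : R[i] :=
  (- dotv u (Q *m u) / 2
   + \int[nu]_(z in [set: borelV R d]) (cos (dotv u (z : 'cV[R]_d)) - 1)) +i*
  (dotv b u
   + \int[nu]_(z in [set: borelV R d])
       (sin (dotv u (z : 'cV[R]_d))
        - dotv u (z : 'cV[R]_d)
          * (dotv (z : 'cV[R]_d) (z : 'cV[R]_d) <= 1)%R%:R)).

(* Levy-Khintchine formula: (b, Q, nu) is the characteristic triplet of Y. *)
Definition levy_triplet d (Y : R -> T -> 'cV[R]_d) (b : 'cV[R]_d)
    (Q : 'M[R]_d) (nu : {measure set (borelV R d) -> \bar R}) : Prop :=
  [/\ Q^T = Q, (forall u, 0 <= dotv u (Q *m u)), is_levy_measure nu &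
      forall t u, 0 <= t ->
        charfun (Y t) u = cexp (t%:C * levy_exponent b Q nu u)].

Definition levy_measure_of d (Y : R -> T -> 'cV[R]_d)
    (nu : {measure set (borelV R d) -> \bar R}) : Prop :=
  exists b Q, levy_triplet Y b Q nu.

Definition no_gaussian_part d (Y : R -> T -> 'cV[R]_d) : Prop :=
  exists b nu, levy_triplet Y b 0 nu.

(* The noise being additive, the equation dX = A X dt + B dZ, X_0 = x, is
   the pathwise integral equation X_t = x + \int_0^t A X_s ds + B Z_t. *)
Definition ornstein_uhlenbeck n d (A : 'M[R]_n) (B : 'M[R]_(n, d))
    (x : 'cV[R]_n) (Z : R -> T -> 'cV[R]_d) (X : R -> T -> 'cV[R]_n) : Prop :=
  (forall t, 0 <= t -> measurable_fun setT (X t : T -> borelV R n)) /\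
  {ae P, forall w, cadlag (X ^~ w) /\
    forall t, 0 <= t ->
      X t w = x
        + \col_i (\int[lebesgue_measure]_(s in `[0, t]) (A *m X s w) i 0)
        + B *m Z t w}.

(* The random subspaces B_t = Span {Delta (BZ)_s : s <= t} (there is no jump at
   time 0) and A_t = <A, B_t>, and tau = inf {t > 0 : A_t = R^n}. *)
Definition jump_space n d (B : 'M[R]_(n, d)) (Z : R -> T -> 'cV[R]_d)
    (t : R) (w : T) : {vspace 'cV[R]_n} :=
  vspan [set jump (fun r => B *m Z r w) s | s in `]0, t]].

Definition cyclic_jump_space n d (A : 'M[R]_n) (B : 'M[R]_(n, d))
    (Z : R -> T -> 'cV[R]_d) (t : R) (w : T) : {vspace 'cV[R]_n} :=
  cyclic_span A (jump_space B Z t w).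

Definition filling_time n d (A : 'M[R]_n) (B : 'M[R]_(n, d))
    (Z : R -> T -> 'cV[R]_d) (w : T) : \bar R :=
  ereal_inf [set t%:E | t in
    [set t : R | 0 < t /\ cyclic_jump_space A B Z t w = fullv]].

End levy.

Definition exhausts {R : realType} n d (A : 'M[R]_n) (B : 'M[R]_(n, d))
    (nuB : {measure set (borelV R n) -> \bar R}) : Prop :=
  cyclic_span A (im_mx B) = fullv /\
  exists (r : nat) (Hr : {vspace 'cV[R]_n}),
    [/\ (cyclic_index A <= r <= \rank B)%N,
        (Hr <= im_mx B)%VS,
        \dim Hr = r,
        cyclic_span A Hr = fullv &
        forall H : {vspace 'cV[R]_n}, (H <= Hr)%VS -> (\dim H).+1 = r ->
          nuB [set v : 'cV[R]_n | v \in Hr /\ v \notin H] = +oo%E].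

(* Main.v *)
(** Call the Levy measure nu of Y = BZ heavy if nu(W^c) = +oo for every proper
    A-invariant subspace W.  The three assertions are each equivalent to this.

    If nu is heavy, induction on the codimension gives n sets of jumps, bounded
    and bounded away from 0, of arbitrarily large nu-mass, such that any choice
    of one vector v_c in the c-th set makes the vectors (1 + eta A)^c v_c
    uniformly independent.  Y jumps in each of these sets before time t with
    probability close to 1, hence tau = 0.  Moreover the Euler scheme converges
    almost surely to X_1; by independence, n increments lying in these sets can
    be replaced by an independent copy, and conditionally on their values the
    random times at which they occur spread the scheme: the number of choices
    of times which bring it to a ball of radius r is at most of order r^n times
    the total number, so X_1 does not charge Lebesgue null sets.

    If nu(W^c) < +oo for a proper invariant W = ker Q, two independent copies of
    QY coincide on [0, 1] with positive probability.  By Fubini QY then follows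
    with positive probability a fixed path, which has no jump by stochastic
    continuity: all the jumps of Y lie in W, hence tau >= 1, and QX_1 is
    constant on this event.

    For the exhaustion property, take a subspace E of Im B of minimal dimension
    with nu(E^c) < +oo; its generated space <A, E> is invariant, hence full, and
    left eigenvectors of A restrict injectively to E. *)

Require Import Defs.
From HB Require Import structures.
From mathcomp Require Import all_boot all_order all_algebra.
From mathcomp Require Import all_classical all_reals all_analysis.
From mathcomp Require Import measurable_realfun complex ring lra zify.

Set Implicit Arguments.
Unset Strict Implicit.
Unset Printing Implicit Defensive.
Import Order.TTheory GRing.Theory Num.Theory.
Import numFieldNormedType.Exports.
Local Open Scope classical_set_scope.
Local Open Scope ring_scope.

(** * Measurability and bounded expectations *)

(** The only quantitative input on the jumps is the Levy-Khintchine formula, so masses of sets of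
    jumps are read off characteristic functions. As a function of [h],
    [E cos<u, Y_h> = exp (h a) cos (h b)] has derivative [a] at 0: tested on even functions, the
    drift disappears at first order. This is why the sets of jumps are given by quadratic
    inequalities without linear terms and why indicators are approached by cosine polynomials. The
    cutoffs used for this are periodic, hence a separate tightness bound on the increments. The
    order of quantifiers in [flag] is decisive: [eta] and [rho] fix the length of the time windows,
    and only then is the mass [M] chosen, so large that a jump of each kind is likely in each
    window. The constant in front of the volume may depend on [M]. Invertibility of [A] enters when
    a jump [v] is moved in time: the scheme then changes by the time difference, times [A], times an
    average of powers of the Euler matrix, applied to [v]; the factor [A] has to be undone to
    separate the results. *)

Section norm_cV.
Context {R : realType} {m n : nat}.
Implicit Types v : 'M[R]_(m, n).

Lemma mxnorm_le v e : 0 <= e -> (`|v| <= e) = [forall i, forall j, `|v i j| <= e].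
Proof.
move=> e0; rewrite [leLHS]/Num.Def.normr/= mx_normrE.
apply/bigmax_leP/forallP => [[_ H] i|H]; first by apply/forallP => j; exact: (H (i, j)).
by split => // -[i j] _; exact: (forallP (H i) j).
Qed.

Lemma mxnorm_lt v e : 0 < e -> (`|v| < e) = [forall i, forall j, `|v i j| < e].
Proof.
move=> e0; rewrite [ltLHS]/Num.Def.normr/= mx_normrE.
apply/bigmax_ltP/forallP => [[_ H] i|H]; first by apply/forallP => j; exact: (H (i, j)).
by split => // -[i j] _; exact: (forallP (H i) j).
Qed.

Lemma le_mxnorm v i j : `|v i j| <= `|v|.
Proof.
by have := mxnorm_le v (normr_ge0 v); rewrite lexx => /esym/forallP/(_ i)/forallP.
Qed.

End norm_cV.

Section borel_cV.
Context {R : realType} {n : nat}.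

Lemma cV_ballE (x : 'cV[R]_n) (e : R) : 0 < e ->
  ball x e = [set y : 'cV[R]_n | forall i, `|x i 0 - y i 0| < e].
Proof.
move=> e0; rewrite mx_norm_ball /ball_; apply/seteqP; split => y /=.
  rewrite mxnorm_lt// => /forallP H i; move: (H i) => /forallP /(_ 0).
  by rewrite !mxE.
move=> H; rewrite mxnorm_lt//; apply/forallP => i; apply/forallP => j.
by rewrite !mxE (ord1 j).
Qed.

Lemma open_measurable_cV (U : set 'cV[R]_n) : open U -> measurable (U : set (borelV R n)).
Proof. by move=> oU; apply: sub_sigma_algebra. Qed.

Lemma continuous_measurable_cV (f : 'cV[R]_n -> R) : continuous f ->
  measurable_fun setT (f : borelV R n -> R).
Proof.
move=> cf; apply: (measurability _ (RGenOpens.measurableE R)) => _ [_ [a [b ->] <-]].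
rewrite setTI; apply: open_measurable_cV.
by apply: open_comp; [move=> x _; exact: cf|exact: interval_open].
Qed.

Lemma coord_measurable_cV (i : 'I_n) :
  measurable_fun setT ((fun v => v i 0) : borelV R n -> R).
Proof. by apply: continuous_measurable_cV; exact: coord_continuous. Qed.

(** Every open set is a countable union of balls with rational centre and radius [1 / (m + 1)], and
    the preimage of such a ball is a finite intersection of conditions on single coordinates. *)
Lemma measurable_fun_cV d (T : measurableType d) (f : T -> 'cV[R]_n) :
  (forall i, measurable_fun setT (fun t => f t i 0)) ->
  measurable_fun setT (f : T -> borelV R n).
Proof.
move=> mf; apply: (@measurability _ _ _ (borelV R n) setT f open) => // _ [U oU <-].
rewrite setTI.
pose B (qm : 'cV[rat]_n * nat) : set 'cV[R]_n := ball (map_mx ratr qm.1 : 'cV[R]_n) (qm.2.+1%:R^-1).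
(* Balls not contained in [U] are replaced by the empty set, so that the union runs over a fixed
   countable type. *)
pose F (qm : 'cV[rat]_n * nat) : set T := if `[< B qm `<=` U >] then f @^-1` B qm else set0.
have -> : f @^-1` U = \bigcup_qm F qm.
  apply/seteqP; split => t /=.
    move=> Uft; have : nbhs (f t) U by apply: open_nbhs_nbhs; split.
    move=> /nbhs_ballP[e /= e0 eU].
    (* A radius below [e / 2] suffices: the points of a ball that contains [f t] are at distance
       less than twice the radius from [f t]. *)
    have [m me] : exists m : nat, m.+1%:R^-1 < e / 2.
      exists (Num.truncn (e / 2)^-1); rewrite invf_plt ?posrE ?divr_gt0//.
      by rewrite truncnS_gt.
    have r0 : 0 < m.+1%:R^-1 :> R by rewrite invr_gt0.
    have hq i : exists q : rat, `|f t i 0 - ratr q| < m.+1%:R^-1.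
      have [|q] := @rat_in_itvoo R (f t i 0) (f t i 0 + m.+1%:R^-1).
        by rewrite ltrDl invr_gt0.
      rewrite in_itv/= => /andP[q1 q2]; exists q; rewrite ltr_distl.
      by move: r0 q1 q2; move: (_^-1) (ratr q) => r a *; apply/andP; split; lra.
    have [q hq'] := choice hq.
    exists (\col_i q i, m) => //; rewrite /F.
    have Bt : B (\col_i q i, m) (f t).
      by rewrite /B cV_ballE//= => i; rewrite !mxE distrC.
    case: asboolP => //= -[] y; move: Bt; rewrite /B !cV_ballE// => Bt By.
    apply: eU; rewrite cV_ballE// => i; move: (Bt i) (By i).
    rewrite !ltr_distl; move: r0 me; move: (m.+1%:R^-1) (map_mx _ _ _ _) => r a *.
    by do 2 (match goal with H : is_true (_ && _) |- _ => case/andP: H => ? ? end); apply/andP; split; lra.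
  by move=> [qm _]; rewrite /F; case: asboolP => // sub /sub.
apply: countable_bigcupT_measurable => [|qm]; first exact: countableP.
rewrite /F; case: asboolP => // _.
rewrite /B cV_ballE//; have -> : f @^-1` [set y | forall i, `|map_mx ratr qm.1 i 0 - y i 0| < qm.2.+1%:R^-1]
   = \big[setI/setT]_(i < n) ((fun t => f t i 0) @^-1` [set y | `|map_mx ratr qm.1 i 0 - y| < qm.2.+1%:R^-1]).
  by apply/seteqP; split => t /=; rewrite -bigcap_seq /= => H i; [move=> _; exact: H|apply: H; rewrite /= mem_index_enum].
apply: bigsetI_measurable => i _; rewrite -[X in measurable X]setTI.
apply: mf => //; apply: open_measurable.
have -> : [set y : R | `|map_mx ratr qm.1 i 0 - y| < qm.2.+1%:R^-1] = ball (map_mx ratr qm.1 i 0 : R) (qm.2.+1%:R^-1).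
  by rewrite -ball_normE.
exact: ball_open.
Qed.

End borel_cV.

Section bounded_measurable.
Context {d} {T : measurableType d} {R : realType}.
Implicit Types (f g : T -> R).

(** This class is stable under sums, products and measurable substitution, and integrable for every
    finite measure, so that expectations can be manipulated without integrability conditions. *)
Definition bm f := measurable_fun setT f /\ exists M, forall x, `|f x| <= M.

Lemma bmW f M : measurable_fun setT f -> (forall x, `|f x| <= M) -> bm f.
Proof. by move=> mf fM; split => //; exists M. Qed.

Lemma bm_cst c : bm (cst c).
Proof. by apply: (@bmW _ `|c|) => //; exact: measurable_cst. Qed.

Lemma bmD f g : bm f -> bm g -> bm (fun x => f x + g x).
Proof.
move=> [mf [M fM]] [mg [N gN]]; apply: (@bmW _ (M + N)); first exact: measurable_funD.
by move=> x; apply: le_trans (ler_normD _ _) _; exact: lerD.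
Qed.

Lemma bmN f : bm f -> bm (fun x => - f x).
Proof.
move=> [mf [M fM]]; apply: (@bmW _ M); first exact: measurableT_comp.
by move=> x; rewrite normrN.
Qed.

Lemma bmB f g : bm f -> bm g -> bm (fun x => f x - g x).
Proof. by move=> bf bg; apply: bmD => //; exact: bmN. Qed.

Lemma bmM f g : bm f -> bm g -> bm (fun x => f x * g x).
Proof.
move=> [mf [M fM]] [mg [N gN]]; apply: (@bmW _ (M * N)); first exact: measurable_funM.
by move=> x; rewrite normrM; exact: ler_pM.
Qed.

Lemma bmZ c f : bm f -> bm (fun x => c * f x).
Proof. by move=> bf; apply: bmM => //; exact: bm_cst. Qed.

Lemma bm_sum I (s : seq I) (p : pred I) (F : I -> T -> R) :
  (forall i, p i -> bm (F i)) -> bm (fun x => \sum_(i <- s | p i) F i x).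
Proof.
move=> bF; elim: s => [|i s IH]; first by under eq_fun do rewrite big_nil; exact: bm_cst.
under eq_fun do rewrite big_cons; case: (boolP (p i)) => // pi.
by apply: bmD => //; exact: bF.
Qed.

Lemma bm_prod I (s : seq I) (p : pred I) (F : I -> T -> R) :
  (forall i, p i -> bm (F i)) -> bm (fun x => \prod_(i <- s | p i) F i x).
Proof.
move=> bF; elim: s => [|i s IH]; first by under eq_fun do rewrite big_nil; exact: bm_cst.
under eq_fun do rewrite big_cons; case: (boolP (p i)) => // pi.
by apply: bmM => //; exact: bF.
Qed.

Lemma bm_cos f : measurable_fun setT f -> bm (fun x => cos (f x)).
Proof.
move=> mf; apply: (@bmW _ 1); last by move=> x; rewrite ler_norml cos_geN1 cos_le1.
by apply: measurableT_comp => //; apply: continuous_measurable_fun; exact: continuous_cos.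
Qed.

Lemma bm_sin f : measurable_fun setT f -> bm (fun x => sin (f x)).
Proof.
move=> mf; apply: (@bmW _ 1); last by move=> x; rewrite ler_norml sin_geN1 sin_le1.
by apply: measurableT_comp => //; apply: continuous_measurable_fun; exact: continuous_sin.
Qed.

Lemma bm_indic (E : set T) : measurable E -> bm (\1_E : T -> R).
Proof.
move=> mE; apply: (@bmW _ 1); first exact: measurable_indic.
by move=> x; rewrite indicE; case: (_ \in _); rewrite ?normr1 ?normr0.
Qed.

Lemma bm_integrable (mu : {measure set T -> \bar R}) f :
  (mu setT < +oo)%E -> bm f -> mu.-integrable setT (EFin \o f).
Proof.
move=> muoo [mf [M fM]]; apply: measurable_bounded_integrable => //.
exists M; split; first exact: num_real.
by move=> N MN x _; apply: le_trans (fM x) (ltW MN).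
Qed.

End bounded_measurable.

Lemma bm_comp d d' (T : measurableType d) (T' : measurableType d') (R : realType)
  (g : T' -> R) (f : T -> T') : bm g -> measurable_fun setT f -> bm (fun x => g (f x)).
Proof. by move=> [mg [M gM]] mf; apply: (@bmW _ _ _ _ M) => //; exact: measurableT_comp. Qed.

Section expectation.
Context {d} {T : measurableType d} {R : realType} (P : probability T R).
Implicit Types (f g : T -> R).

Lemma prob_setT_lt : (P setT < +oo)%E.
Proof. by rewrite probability_setT ltry. Qed.
Hint Resolve prob_setT_lt : core.

Definition Ex f := \int[P]_w f w.

Lemma bm_Ex f : bm f -> (\int[P]_w (f w)%:E)%E = (Ex f)%:E.
Proof.
move=> bf; rewrite /Ex /Rintegral fineK//; apply: integrable_fin_num => //.
exact: bm_integrable.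
Qed.

Lemma ExD f g : bm f -> bm g -> Ex (fun x => f x + g x) = Ex f + Ex g.
Proof. by move=> bf bg; rewrite /Ex RintegralD//; exact: bm_integrable. Qed.

Lemma ExB f g : bm f -> bm g -> Ex (fun x => f x - g x) = Ex f - Ex g.
Proof. by move=> bf bg; rewrite /Ex RintegralB//; exact: bm_integrable. Qed.

Lemma ExZ c f : bm f -> Ex (fun x => c * f x) = c * Ex f.
Proof. by move=> bf; rewrite /Ex RintegralZl//; exact: bm_integrable. Qed.

Lemma Ex_cst c : Ex (fun=> c) = c.
Proof. by rewrite /Ex /Rintegral integral_cst//= probability_setT mule1. Qed.

Lemma le_Ex f g : bm f -> bm g -> (forall x, f x <= g x) -> Ex f <= Ex g.
Proof. by move=> bf bg fg; apply: le_Rintegral => //; exact: bm_integrable. Qed.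

Lemma eq_Ex f g : f =1 g -> Ex f = Ex g.
Proof. by move=> fg; apply: eq_Rintegral => x _. Qed.

Lemma Ex_ge0 f : (forall x, 0 <= f x) -> 0 <= Ex f.
Proof. by move=> f0; apply: Rintegral_ge0. Qed.

Lemma Ex_sum I (s : seq I) (p : pred I) (F : I -> T -> R) :
  (forall i, p i -> bm (F i)) ->
  Ex (fun x => \sum_(i <- s | p i) F i x) = \sum_(i <- s | p i) Ex (F i).
Proof.
move=> bF; elim: s => [|i s IH].
  by rewrite big_nil -[RHS](Ex_cst 0); apply: eq_Ex => x; rewrite big_nil.
rewrite big_cons; under eq_Ex do rewrite big_cons.
case: (boolP (p i)) => // pi; rewrite ExD ?IH//; first exact: bF.
exact: bm_sum.
Qed.

Lemma Ex_indic E : measurable E -> Ex (\1_E) = fine (P E).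
Proof. by move=> mE; rewrite /Ex /Rintegral integral_indic// setIT. Qed.

Lemma abs_Ex_le f M : bm f -> (forall x, `|f x| <= M) -> `|Ex f| <= M.
Proof.
move=> bf fM; rewrite ler_norml -[X in _ <= _ <= X](Ex_cst M) -[X in X <= _](Ex_cst (- M)).
by apply/andP; split; apply: le_Ex => //; try exact: bm_cst;
  move=> x; move: (fM x); rewrite ler_norml => /andP[].
Qed.

Lemma Ex_cvg (f_ : nat -> T -> R) f M : (forall n, measurable_fun setT (f_ n)) ->
  (forall n x, `|f_ n x| <= M) -> measurable_fun setT f ->
  {ae P, forall x, f_ ^~ x @ \oo --> f x} ->
  Ex (f_ n) @[n --> \oo] --> Ex f.
Proof.
move=> mf_ fM mf cf.
have [] := @dominated_convergence _ _ _ P setT measurableT (fun n => EFin \o f_ n)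
  (EFin \o f) (cst M%:E).
- by move=> n; exact/measurable_EFinP.
- exact/measurable_EFinP.
- by apply: filterS cf => x cx _; apply: cvg_EFin => //; exact: nearW.
- by apply: bm_integrable => //; exact: bm_cst.
- by apply: aeW => x n _ /=; rewrite lee_fin.
move=> intf _ cvf; rewrite /Ex /Rintegral; apply: fine_cvg; rewrite fineK//.
exact: integrable_fin_num.
Qed.

End expectation.

(** * Laws of independent families *)

Section law_unique.
Context {R : realType}.

Lemma law_eq_Ex d d1 d2 (V : measurableType d) (T1 : measurableType d1)
  (T2 : measurableType d2) (P1 : probability T1 R) (P2 : probability T2 R)
  (f1 : T1 -> V) (f2 : T2 -> V) (F : V -> R) :
  measurable_fun setT f1 -> measurable_fun setT f2 ->
  (forall A, measurable A -> P1 (f1 @^-1` A) = P2 (f2 @^-1` A)) ->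
  bm F -> Ex P1 (fun w => F (f1 w)) = Ex P2 (fun w => F (f2 w)).
Proof.
move=> mf1 mf2 e12 bF.
pose m1 : {measure set V -> \bar R} :=
  measure_function_pushforward__canonical__measure_function_Measure P1 mf1.
pose m2 : {measure set V -> \bar R} :=
  measure_function_pushforward__canonical__measure_function_Measure P2 mf2.
have bi d3 (T3 : measurableType d3) (P3 : probability T3 R) (f3 : T3 -> V) :
    measurable_fun setT f3 -> P3.-integrable setT (EFin \o F \o f3).
  move=> mf3; rewrite -compA; apply: bm_integrable; first exact: prob_setT_lt.
  exact: bm_comp.
have mF : measurable_fun setT (EFin \o F) by apply/measurable_EFinP; case: bF.
have I1 := @integral_pushforward _ _ _ _ R f1 mf1 P1 setT (EFin \o F) mF (bi _ _ P1 _ mf1) measurableT.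
have I2 := @integral_pushforward _ _ _ _ R f2 mf2 P2 setT (EFin \o F) mF (bi _ _ P2 _ mf2) measurableT.
rewrite preimage_setT in I1; rewrite preimage_setT in I2.
congr fine.
transitivity (\int[m1]_y (F y)%:E)%E; first by rewrite -I1.
transitivity (\int[m2]_y (F y)%:E)%E; last by rewrite -I2.
apply: eq_measure_integral => /= A mA _; exact: e12.
Qed.

Lemma Ex_fubini d1 d2 (T1 : measurableType d1) (T2 : measurableType d2)
  (P1 : probability T1 R) (P2 : probability T2 R) (F : T1 * T2 -> R) :
  bm F -> Ex (P1 \x P2)%E F = Ex P1 (fun x => Ex P2 (fun y => F (x, y))).
Proof.
move=> bF; have mF := bF.1.
have iF : (P1 \x P2)%E.-integrable setT (EFin \o F).
  exact: (bm_integrable (prob_setT_lt (P1 \x P2)%E)).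
rewrite {1}/Ex /Rintegral -(integral12_prod_meas1 iF) /Ex /Rintegral.
congr fine; apply: eq_integral => x _; rewrite /fubini_F -/(Rintegral _ _ _).
rewrite (@bm_Ex _ _ _ P2 (fun y => F (x, y)))//.
by apply: (bm_comp bF); apply: measurable_fun_pair; [exact: measurable_cst|exact: measurable_id].
Qed.

Lemma bm_Ex1 d1 d2 (T1 : measurableType d1) (T2 : measurableType d2)
  (P2 : probability T2 R) (F : T1 * T2 -> R) :
  bm F -> bm (fun x => Ex P2 (fun y => F (x, y))).
Proof.
move=> bF; have mF := bF.1; have [M FM] := bF.2.
have bFx x : bm (fun y => F (x, y)).
  by apply: (bm_comp bF); apply: measurable_fun_pair; [exact: measurable_cst|exact: measurable_id].
apply: (@bmW _ _ _ _ M); last by move=> x; apply: abs_Ex_le.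
(* A Dirac mass serves as auxiliary measure on the first factor: the partial integral over the
   second factor does not depend on it. *)
have := @measurable_fubini_F _ _ _ _ _ (dirac point : probability T1 R) P2 (EFin \o F).
rewrite /fubini_F => /(_ _)/=.
have iF : ((dirac point : probability T1 R) \x P2)%E.-integrable setT (EFin \o F).
  exact: (bm_integrable (prob_setT_lt ((dirac point : probability T1 R) \x P2)%E)).
move=> /(_ iF) H; apply/measurable_EFinP; apply: eq_measurable_fun H => x _ /=.
by rewrite bm_Ex.
Qed.

Lemma Ex_prod_indep d1 d2 (T1 : measurableType d1) (T2 : measurableType d2)
  (P1 : probability T1 R) (P2 : probability T2 R) (f : T1 -> R) (g : T2 -> R) :
  bm f -> bm g -> Ex (P1 \x P2)%E (fun z => f z.1 * g z.2) = Ex P1 f * Ex P2 g.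
Proof.
move=> bf bg; rewrite Ex_fubini/=; last first.
  by apply: bmM; apply: bm_comp.
under eq_Ex do rewrite ExZ//.
by under eq_Ex do rewrite mulrC; rewrite ExZ// mulrC.
Qed.

End law_unique.

Section tuple_law.
Context {d'} {V : measurableType d'} {R : realType}.
Variable k : nat.

Definition rectangles : set (set (k.-tuple V)) :=
  [set A | exists2 E : 'I_k -> set V, (forall i, measurable (E i)) &
     A = [set x | forall i, E i (tnth x i)]].

Lemma rectanglesT : rectangles setT.
Proof. by exists (fun=> setT) => //; apply/seteqP; split. Qed.

Lemma rectanglesI : setI_closed rectangles.
Proof.
move=> _ _ [E mE ->] [F mF ->]; exists (fun i => E i `&` F i).
  by move=> i; exact: measurableI.
apply/seteqP; split => x /=; first by move=> [Ex Fx] i; split.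
by move=> EFx; split => i; have [] := EFx i.
Qed.

Lemma measurable_rect (E : 'I_k -> set V) : (forall i, measurable (E i)) ->
  measurable [set x : k.-tuple V | forall i, E i (tnth x i)].
Proof.
move=> mE.
have -> : [set x : k.-tuple V | forall i, E i (tnth x i)] =
   \big[setI/setT]_(i < k) ((fun x => tnth x i) @^-1` E i).
  by apply/seteqP; split => x /=; rewrite -bigcap_seq /= => H i;
    [move=> _; exact: H|apply: H; rewrite /= mem_index_enum].
apply: bigsetI_measurable => i _; rewrite -[X in measurable X]setTI.
exact: (measurable_tnth i).
Qed.

Lemma measurable_tupleE : @measurable _ (k.-tuple V) = <<s rectangles >>.
Proof.
apply/seteqP; split.
  apply: smallest_sub; first exact: smallest_sigma_algebra.
  move=> A; rewrite -bigcup_seq => -[i _ [B mB <-]].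
  apply: sub_sigma_algebra; exists (fun j => if j == i then B else setT).
    by move=> j; case: ifP.
  apply/seteqP; split => x /=.
    by move=> [_ Bx] j; case: eqP => // ->.
  by move=> /(_ i); rewrite eqxx.
apply: smallest_sub; first exact: sigma_algebra_measurable.
by move=> _ [E mE ->]; exact: measurable_rect.
Qed.

(** Rectangles generate the sigma-algebra and are stable under intersection, so two laws that agree
    on them agree. *)
Lemma tuple_law_unique d1 d2 (T1 : measurableType d1) (T2 : measurableType d2)
  (P1 : probability T1 R) (P2 : probability T2 R)
  (f1 : T1 -> k.-tuple V) (f2 : T2 -> k.-tuple V) (F : k.-tuple V -> R) :
  measurable_fun setT f1 -> measurable_fun setT f2 ->
  (forall E, (forall i, measurable (E i)) ->
     P1 (f1 @^-1` [set x | forall i, E i (tnth x i)]) =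
     P2 (f2 @^-1` [set x | forall i, E i (tnth x i)])) ->
  bm F -> Ex P1 (F \o f1) = Ex P2 (F \o f2).
Proof.
move=> mf1 mf2 e12 bF.
pose m1 : {measure set (k.-tuple V) -> \bar R} := measure_function_pushforward__canonical__measure_function_Measure P1 mf1.
pose m2 : {measure set (k.-tuple V) -> \bar R} := measure_function_pushforward__canonical__measure_function_Measure P2 mf2.
have m12 A : measurable A -> m1 A = m2 A.
  apply: (measure_unique rectangles (fun=> setT)).
  - exact: measurable_tupleE.
  - exact: rectanglesI.
  - by move=> _; exact: rectanglesT.
  - by rewrite bigcup_const//; exists 0%N.
  - by move=> _ [E mE ->]; exact: e12.
  - move=> _; rewrite /m1 /= /pushforward preimage_setT probability_setT.
    exact: ltry.
exact: law_eq_Ex.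
Qed.

End tuple_law.

Section decoupling.
Context {d d'} {T : measurableType d} {V : measurableType d'} {R : realType}.
Variable P : probability T R.
Variables (k : nat) (xi : 'I_k -> T -> V) (Y : T -> V).
Hypothesis mY : measurable_fun setT Y.
Hypothesis mxi : forall i, measurable_fun setT (xi i).
Hypothesis indep : forall E : 'I_k -> set V, (forall i, measurable (E i)) ->
  P [set w | forall i, E i (xi i w)] = (\prod_(i < k) P (Y @^-1` E i))%E.

Definition tuple_of (w : T) : k.-tuple V := [tuple xi i w | i < k].

Lemma measurable_tuple_of : measurable_fun setT tuple_of.
Proof.
apply/measurable_fun_tnthP => i.
by rewrite (_ : _ \o _ = xi i)//; apply/funext => w /=; rewrite tnth_mktuple.
Qed.

Let pr (E : set V) : R := fine (P (Y @^-1` E)).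

Let mpre (E : set V) : measurable E -> measurable (Y @^-1` E).
Proof. by move=> mE; rewrite -[X in measurable X]setTI; exact: mY. Qed.

Let prE E : measurable E -> P (Y @^-1` E) = (pr E)%:E.
Proof. by move=> mE; rewrite /pr fineK// fin_num_measure//; exact: mpre. Qed.

Let prT : pr setT = 1.
Proof. by rewrite /pr preimage_setT probability_setT. Qed.

Lemma indep_prod E : (forall i, measurable (E i)) ->
  P [set w | forall i, E i (xi i w)] = (\prod_(i < k) pr (E i))%:E.
Proof. by move=> mE; rewrite indep// -prodEFin; apply: eq_bigr => i _; exact: prE. Qed.

Lemma indep_law i E : measurable E -> P (xi i @^-1` E) = P (Y @^-1` E).
Proof.
move=> mE; rewrite prE//; have -> : xi i @^-1` E =
    [set w | forall j, (if j == i then E else setT) (xi j w)].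
  apply/seteqP; split => w /=; first by move=> Ew j; case: eqP => // ->.
  by move=> /(_ i); rewrite eqxx.
rewrite (@indep_prod (fun j => if j == i then E else setT)); last by move=> j; case: ifP.
by rewrite (bigD1 i)//= eqxx big1 ?mulr1// => j /negbTE ->.
Qed.

Section mix.
Variables (m : nat) (j e : 'I_m -> 'I_k).
Hypotheses (inj_j : injective j) (inj_e : injective e).

(** The coordinates [j c] of the first tuple are overwritten by the coordinates [e c] of the second
    one. Applied to independent copies, this resamples finitely many increments. *)
Definition mix (x x' : k.-tuple V) : k.-tuple V :=
  [tuple if [pick c | j c == i] is Some c then tnth x' (e c) else tnth x i | i < k].

Lemma mix_in x x' c : tnth (mix x x') (j c) = tnth x' (e c).
Proof.
rewrite tnth_mktuple; case: pickP => [c' /eqP /inj_j -> //|/(_ c)].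
by rewrite eqxx.
Qed.

Lemma mix_out x x' i : (forall c, j c != i) -> tnth (mix x x') i = tnth x i.
Proof. by move=> ji; rewrite tnth_mktuple; case: pickP => // c; rewrite (negbTE (ji c)). Qed.

Lemma measurable_mix :
  measurable_fun setT (fun z : T * T => mix (tuple_of z.1) (tuple_of z.2)).
Proof.
apply/measurable_fun_tnthP => i /=.
case: (pickP (fun c => j c == i)) => [c /eqP <-|ji].
  rewrite (_ : _ \o _ = xi (e c) \o snd); first exact: measurableT_comp.
  by apply/funext => z /=; rewrite mix_in tnth_mktuple.
rewrite (_ : _ \o _ = xi i \o fst); first exact: measurableT_comp.
by apply/funext => z /=; rewrite mix_out ?tnth_mktuple// => c; rewrite ji.
Qed.

Lemma decouple (F : k.-tuple V -> R) : bm F ->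
  Ex P (fun w => F (tuple_of w)) =
  Ex (P \x P)%E (fun z => F (mix (tuple_of z.1) (tuple_of z.2))).
Proof.
move=> bF; apply: (tuple_law_unique measurable_tuple_of measurable_mix) => // E mE.
pose E1 i := if [pick c | j c == i] is Some c then setT else E i.
pose E2 i := if [pick c | e c == i] is Some c then E (j c) else setT.
have mE1 i : measurable (E1 i) by rewrite /E1; case: pickP.
have mE2 i : measurable (E2 i) by rewrite /E2; case: pickP.
have -> : tuple_of @^-1` [set x | forall i, E i (tnth x i)] =
    [set w | forall i, E i (xi i w)].
  by apply/seteqP; split => w /= H i; move: (H i); rewrite tnth_mktuple.
have -> : (fun z : T * T => mix (tuple_of z.1) (tuple_of z.2)) @^-1`
      [set x | forall i, E i (tnth x i)] =
    [set w | forall i, E1 i (xi i w)] `*` [set w | forall i, E2 i (xi i w)].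
  apply/seteqP; split => -[w w'] /=.
    move=> H; split => i.
      rewrite /E1; case: pickP => // ji; move: (H i); rewrite mix_out ?tnth_mktuple//.
      by move=> c; rewrite ji.
    rewrite /E2; case: pickP => // c /eqP <-; move: (H (j c)).
    by rewrite mix_in tnth_mktuple.
  move=> [H1 H2] i; case: (pickP (fun c => j c == i)) => [c /eqP <-|ji].
    rewrite mix_in tnth_mktuple; move: (H2 (e c)); rewrite /E2.
    by case: pickP => [c' /eqP /inj_e -> //|/(_ c)]; rewrite eqxx.
  rewrite mix_out ?tnth_mktuple//; last by move=> c; rewrite ji.
  by move: (H1 i); rewrite /E1; case: pickP => // c; rewrite ji.
have mR G : (forall i, measurable (G i)) -> measurable [set w | forall i, G i (xi i w)].
  move=> mG; have -> : [set w | forall i, G i (xi i w)] =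
    tuple_of @^-1` [set x | forall i, G i (tnth x i)].
    by apply/seteqP; split => w /= H i; move: (H i); rewrite tnth_mktuple.
  rewrite -[X in measurable X]setTI; apply: measurable_tuple_of => //.
  exact: measurable_rect.
transitivity (P [set w | forall i, E1 i (xi i w)] * P [set w | forall i, E2 i (xi i w)])%E;
  last by apply/esym; apply: product_measure1E; exact: mR.
rewrite !indep_prod// -EFinM; congr EFin.
have im (f : 'I_m -> 'I_k) (G : 'I_k -> R) : injective f ->
   (forall i, i \notin f @: finset.setT -> G i = 1) ->
   \prod_i G i = \prod_c G (f c).
  move=> injf G1; rewrite (bigID (mem (f @: finset.setT)))/= [X in _ * X]big1// mulr1.
  rewrite big_imset/=; last by move=> ? ? _ _; exact: injf.
  by apply: eq_bigl => c; rewrite inE.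
rewrite (bigID (mem (j @: finset.setT)))/= mulrC; congr (_ * _).
  rewrite [RHS](bigID (mem (j @: finset.setT)))/= [X in X * _]big1 ?mul1r.
    apply: eq_bigr => i ij; rewrite /E1; case: pickP => // c /eqP ci.
    by case/negP: ij; rewrite -ci imset_f.
  move=> i /imsetP[c _ ->]; rewrite /E1; case: pickP => [_ _|/(_ c)]; first exact: prT.
  by rewrite eqxx.
rewrite big_imset/=; last by move=> ? ? _ _; exact: inj_j.
rewrite (im e)//; last first.
  move=> i ie; rewrite /E2; case: pickP => // c /eqP ci.
  by case/negP: ie; rewrite -ci imset_f.
apply: eq_big => [c|c _]; first by rewrite inE.
by rewrite /E2; case: pickP => [c' /eqP /inj_e -> //|/(_ c)]; rewrite eqxx.
Qed.

End mix.

(** Factors are split off one at a time: [decouple] with a single overwritten coordinate makes the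
    last factor independent of the preceding ones. *)
Lemma Ex_indep_prod (g : 'I_k -> V -> R) : (forall i, bm (g i)) ->
  Ex P (fun w => \prod_(i < k) g i (xi i w)) = \prod_(i < k) Ex P (fun w => g i (Y w)).
Proof.
move=> bg.
have lawg i : Ex P (fun w => g i (xi i w)) = Ex P (fun w => g i (Y w)).
  by apply: law_eq_Ex => // A mA; exact: indep_law.
have bgx i : bm (fun w => g i (xi i w)) by exact: bm_comp.
suff H l : (l <= k)%N -> Ex P (fun w => \prod_(i < k | (i < l)%N) g i (xi i w)) =
    \prod_(i < k | (i < l)%N) Ex P (fun w => g i (Y w)).
  have := H k (leqnn k); under eq_Ex do under eq_bigl do rewrite ltn_ord.
  by under [in RHS]eq_bigl do rewrite ltn_ord.
elim: l => [_|l IH lk].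
  under eq_Ex do rewrite big_pred0//; rewrite Ex_cst.
  by rewrite big_pred0.
pose il := Ordinal lk.
have split1 (G : 'I_k -> R) : \prod_(i < k | (i < l.+1)%N) G i =
    (\prod_(i < k | (i < l)%N) G i) * G il.
  rewrite (bigD1 il)/= ?ltnS// mulrC; congr (_ * _).
  apply: eq_bigl => i; rewrite ltnS -val_eqE/= [in RHS]ltn_neqAle andbC.
  by [].
under eq_Ex do rewrite split1; rewrite split1 -IH 1?ltnW// -lawg.
pose F (x : k.-tuple V) := (\prod_(i < k | (i < l)%N) g i (tnth x i)) * g il (tnth x il).
transitivity (Ex P (fun w => F (tuple_of w))).
  apply: eq_Ex => w; rewrite /F tnth_mktuple; congr (_ * _).
  by apply: eq_bigr => i _; rewrite tnth_mktuple.
rewrite (@decouple 1 (fun=> il) (fun=> il) _ _ F)//; last 3 first.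
  by move=> a b _; rewrite !ord1.
  by move=> a b _; rewrite !ord1.
  apply: bmM; last by apply: (bm_comp (bg il)); exact: measurable_tnth.
  by apply: bm_prod => i _; apply: (bm_comp (bg i)); exact: measurable_tnth.
rewrite -Ex_prod_indep//; last by apply: bm_prod.
apply: eq_Ex => z; rewrite /F.
rewrite (@mix_in 1 (fun=> il) (fun=> il) _ _ _ ord0); last by move=> a b _; rewrite !ord1.
rewrite tnth_mktuple; congr (_ * _); apply: eq_bigr => i il'.
rewrite mix_out ?tnth_mktuple// => _; apply/eqP => E; move: il'.
by rewrite -E/= ltnn.
Qed.

End decoupling.

(** * Invariant subspaces and quadratic sets *)

Section mx_bounds.
Context {R : realType}.

(** The matrix norm is the largest absolute entry, which is not submultiplicative; the factor [n]
    turns it into a bound for the action on columns. *)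
Definition bnd m n (M : 'M[R]_(m, n)) : R := n%:R * `|M|.

Lemma bnd_ge0 m n (M : 'M[R]_(m, n)) : 0 <= bnd M.
Proof. by rewrite /bnd mulr_ge0. Qed.

Lemma norm_mulmx m n p (M : 'M[R]_(m, n)) (N : 'M[R]_(n, p)) :
  `|M *m N| <= bnd M * `|N|.
Proof.
rewrite mxnorm_le; last by rewrite mulr_ge0 ?bnd_ge0.
apply/forallP => i; apply/forallP => j; rewrite mxE.
apply: le_trans (ler_norm_sum _ _ _) _.
apply: (@le_trans _ _ (\sum_(l < n) `|M| * `|N|)).
  by apply: ler_sum => l _; rewrite normrM ler_pM// le_mxnorm.
by rewrite sumr_const card_ord /bnd -mulrA mulr_natl.
Qed.

Lemma norm_mulmx_le m n p (M : 'M[R]_(m, n)) (N : 'M[R]_(n, p)) a c :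
  `|M| <= a -> `|N| <= c -> `|M *m N| <= n%:R * a * c.
Proof.
move=> Ma Nc; apply: le_trans (norm_mulmx _ _) _; apply: ler_pM => //.
  exact: bnd_ge0.
by rewrite /bnd ler_wpM2l.
Qed.

Lemma norm_mxX_le n (M : 'M[R]_n) a l : `|M| <= a -> `|M ^+ l| <= `|(1 : 'M[R]_n)| * (n%:R * a) ^+ l.
Proof.
move=> Ma; elim: l => [|l IH]; first by rewrite !expr0 mulr1.
have -> : M ^+ l.+1 = M ^+ l *m M by rewrite exprSr.
rewrite [X in _ * X]exprSr.
apply: le_trans (norm_mulmx_le IH Ma) _.
by rewrite le_eqVlt; apply/orP; left; apply/eqP; ring.
Qed.

Lemma mx1_mul m n (v : 'M[R]_(n, m)) : (1 : 'M[R]_n) *m v = v.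
Proof. exact: mul1mx. Qed.

Lemma sumr_norm_ge m n (F : 'I_m -> 'M[R]_(n, 1)) (a : 'I_m -> R) c :
  (forall i, `|F i| <= c) -> `|\sum_i a i *: F i| <= c * \sum_i `|a i|.
Proof.
move=> Fc; apply: le_trans (ler_norm_sum _ _ _) _; rewrite mulr_sumr.
by apply: ler_sum => i _; rewrite normrZ mulrC ler_wpM2r.
Qed.

End mx_bounds.

Section invariant.
Context {R : realType} {n : nat}.
Implicit Types (A b Q : 'M[R]_n).

(* Invariant subspaces are represented as kernels of matrices. *)
Definition inv_ker b Q := forall v : 'cV[R]_n, Q *m v = 0 -> Q *m (b *m v) = 0.

(** A substitute for being a polynomial in [A]: it passes to sums, products and averages without
    exhibiting a polynomial. *)
Definition pres A b := forall Q, inv_ker A Q -> inv_ker b Q.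

Lemma pres_id A : pres A A. Proof. by []. Qed.

Lemma pres1 A : pres A 1.
Proof. by move=> Q _ v; rewrite mx1_mul. Qed.

Lemma presD A b b' : pres A b -> pres A b' -> pres A (b + b').
Proof. by move=> pb pb' Q iQ v Qv; rewrite mulmxDl mulmxDr pb// pb'// addr0. Qed.

Lemma presZ A b c : pres A b -> pres A (c *: b).
Proof. by move=> pb Q iQ v Qv; rewrite -scalemxAl -scalemxAr pb// scaler0. Qed.

Lemma presB A b b' : pres A b -> pres A b' -> pres A (b - b').
Proof. by move=> pb pb'; rewrite -scaleN1r; apply: presD => //; exact: presZ. Qed.

Lemma presM A b b' : pres A b -> pres A b' -> pres A (b *m b').
Proof. by move=> pb pb' Q iQ v Qv; rewrite -mulmxA; apply: pb => //; exact: pb'. Qed.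

Lemma presX A b l : pres A b -> pres A (b ^+ l).
Proof.
move=> pb; elim: l => [|l IH]; first by rewrite expr0; exact: pres1.
by rewrite exprS; exact: presM.
Qed.

Lemma pres_sum A I (s : seq I) (p : pred I) (F : I -> 'M[R]_n) :
  (forall i, p i -> pres A (F i)) -> pres A (\sum_(i <- s | p i) F i).
Proof.
move=> pF; apply: (big_ind (pres A)) => //; last exact: presD.
by move=> Q _ v _; rewrite mul0mx mulmx0.
Qed.

Lemma inv_ker_section b Q (x : 'cV[R]_n) : inv_ker b Q ->
  Q *m (b *m x) = Q *m (b *m (pinvmx Q *m (Q *m x))).
Proof.
move=> ib; apply/eqP; rewrite -subr_eq0 -!mulmxBr; apply/eqP/ib.
have e : Q *m pinvmx Q *m Q = Q by exact: mulmxKpV (submx_refl Q).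
by rewrite mulmxBr -{1}e -!mulmxA subrr.
Qed.

(** Such a [b] acts on the quotient by the kernel of [Q], so [Q b x] depends on [Q x] alone; the
    pseudo-inverse of [Q] lifts [Q x] with a controlled norm. *)
Lemma norm_inv_ker b Q (x : 'cV[R]_n) : inv_ker b Q ->
  `|Q *m (b *m x)| <= bnd Q * (bnd b * (bnd (pinvmx Q) * `|Q *m x|)).
Proof.
move=> ib; rewrite inv_ker_section//; apply: le_trans (norm_mulmx _ _) _.
apply: ler_wpM2l; first exact: bnd_ge0.
apply: le_trans (norm_mulmx _ _) _; apply: ler_wpM2l; first exact: bnd_ge0.
exact: norm_mulmx.
Qed.

End invariant.

Section continuous_algebra.
Context {R : realType} {T : topologicalType}.
Implicit Types f g : T -> R.

Lemma continuous_addr f g : continuous f -> continuous g -> continuous (fun x => f x + g x).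
Proof. by move=> cf cg x; apply: continuousD; [exact: cf|exact: cg]. Qed.

Lemma continuous_mulr f g : continuous f -> continuous g -> continuous (fun x => f x * g x).
Proof. by move=> cf cg x; apply: continuousM; [exact: cf|exact: cg]. Qed.

Lemma continuous_sumr I (s : seq I) (F : I -> T -> R) : (forall i, continuous (F i)) ->
  continuous (fun x => \sum_(i <- s) F i x).
Proof.
move=> cF; elim: s => [|i s IH].
  by under eq_fun do rewrite big_nil; exact: cst_continuous.
by under eq_fun do rewrite big_cons; exact: continuous_addr.
Qed.

End continuous_algebra.

Section even_quadratic.
Context {R : realType} {n : nat}.

Definition qform (aS : R * 'M[R]_n) (v : 'cV[R]_n) : R := aS.1 + (v^T *m aS.2 *m v) 0 0.

(** Without linear terms these sets are symmetric about 0, as are the test functions available for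
    increments. *)
Definition qset (L : seq (R * 'M[R]_n)) : set 'cV[R]_n :=
  [set v | forall aS, aS \in L -> 0 < qform aS v].

Lemma qform_sum aS v : qform aS v = aS.1 + \sum_(i < n) \sum_(j < n) aS.2 i j * (v i 0 * v j 0).
Proof.
rewrite /qform mxE exchange_big/=; congr (_ + _); apply: eq_bigr => j _.
rewrite mxE mulr_suml; apply: eq_bigr => i _; rewrite mxE; ring.
Qed.

Lemma qform_continuous aS : continuous (qform aS).
Proof.
have -> : qform aS = (fun v => aS.1 + \sum_(i < n) \sum_(j < n) aS.2 i j * (v i 0 * v j 0)).
  by apply/funext => v; rewrite qform_sum.
apply: continuous_addr; first exact: cst_continuous.
apply: continuous_sumr => i; apply: continuous_sumr => j.
apply: continuous_mulr; first exact: cst_continuous.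
by apply: continuous_mulr; exact: coord_continuous.
Qed.

Lemma qset_open L : open (qset L).
Proof.
have -> : qset L = \bigcap_(aS in [set` L]) [set v | 0 < qform aS v].
  by apply/seteqP; split.
rewrite bigcap_seq; apply: (big_ind (fun U : set 'cV[R]_n => open U)).
- exact: openT.
- exact: openI.
move=> aS _; have := open_comp (fun v _ => @qform_continuous aS v) (@open_gt R 0).
by [].
Qed.

Lemma qset_measurable L : measurable (qset L : set (borelV R n)).
Proof. by apply: open_measurable_cV; exact: qset_open. Qed.

Definition outer_qform (q q' : 'rV[R]_n) : 'M[R]_n := q^T *m q'.

Lemma outer_qformE q q' (v : 'cV[R]_n) :
  (v^T *m outer_qform q q' *m v) 0 0 = (q *m v) 0 0 * (q' *m v) 0 0.
Proof.
rewrite /outer_qform mulmxA -mulmxA mxE big_ord1; congr (_ * _).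
by rewrite -[v^T *m q^T]trmx_mul mxE.
Qed.

End even_quadratic.

Section block.
Context {R : realType} {n : nat}.
Implicit Types (A D Q M : 'M[R]_n).

Lemma small_scale (K c : R) : 0 <= K -> 0 < c ->
  exists2 e1 : R, 0 < e1 & forall e, 0 <= e <= e1 -> K * e <= c.
Proof.
move=> K0 c0; exists (c / (K + 1)); first by rewrite divr_gt0// ltr_wpDl.
move=> e /andP[e0 ee]; apply: (@le_trans _ _ ((K + 1) * e)).
  by rewrite ler_wpM2r// lerDl.
by rewrite mulrC -ler_pdivlMr// ltr_wpDl.
Qed.

Lemma pow_perturb M l : exists2 C : R, 0 <= C & forall M' (e : R), e <= 1 -> `|M' - M| <= e ->
  `|M' ^+ l - M ^+ l| <= C * e.
Proof.
elim: l => [|l [C C0 IH]].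
  by exists 0 => // M' e _ _; rewrite !expr0 subrr normr0 mul0r.
exists (n%:R * (`|(1 : 'M[R]_n)| * (n%:R * (`|M| + 1)) ^+ l) + n%:R * C * `|M|).
  by rewrite addr_ge0// !mulr_ge0// exprn_ge0// mulr_ge0// addr_ge0.
move=> M' e e1 Me; have e0 : 0 <= e by exact: le_trans Me.
have -> : M' ^+ l.+1 - M ^+ l.+1 = M' ^+ l *m (M' - M) + (M' ^+ l - M ^+ l) *m M.
  by rewrite !exprSr mulmxBr mulmxBl addrA subrK.
apply: le_trans (ler_normD _ _) _; rewrite mulrDl; apply: lerD.
  apply: norm_mulmx_le => //; apply: norm_mxX_le.
  rewrite -(subrK M M') addrC; apply: le_trans (ler_normD _ _) _.
  by rewrite lerD2l; exact: le_trans Me e1.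
apply: le_trans (norm_mulmx_le (IH M' e e1 Me) (lexx _)) _.
by rewrite le_eqVlt; apply/orP; left; apply/eqP; ring.
Qed.

Lemma exprZ_mx (c : R) M l : (c *: M) ^+ l = c ^+ l *: M ^+ l.
Proof.
elim: l => [|l IH]; first by rewrite !expr0 scale1r.
by rewrite exprS IH -[LHS]/(_ *m _) -scalemxAl -scalemxAr scalerA -exprS -[M *m _]/(M * _) -exprS.
Qed.

(** By the binomial formula the change of coefficients is a triangular matrix with diagonal entries
    [eta ^+ i], hence invertible. The norm of its inverse gives [cT], which depends on [eta]. *)
Lemma binomial_change (eta : R) (d : nat) : 0 < eta ->
  exists2 cT : R, 0 < cT & forall alpha : nat -> R, exists beta : nat -> R,
    (forall M, \sum_(i < d) alpha i *: (1 + eta *: M) ^+ i = \sum_(l < d) beta l *: M ^+ l) /\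
    cT * \sum_(i < d) `|alpha i| <= \sum_(l < d) `|beta l|.
Proof.
move=> eta0.
pose T : 'M[R]_d := \matrix_(i, l) ('C(i, l)%:R * eta ^+ l).
have Tu : T \in unitmx.
  have Tt : is_trig_mx T.
    by apply/is_trig_mxP => i j ij; rewrite mxE bin_small// mul0r.
  rewrite unitmxE det_trig// unitfE; apply/prodf_neq0 => i _.
  by rewrite mxE binn mul1r expf_neq0// gt_eqF.
pose K := d%:R * (d%:R * `|invmx T|) : R.
have K0 : 0 <= K by rewrite !mulr_ge0.
exists (K + 1)^-1; first by rewrite invr_gt0 ltr_wpDl.
move=> alpha; pose a : 'rV[R]_d := \row_i alpha i.
pose bt : 'rV[R]_d := a *m T.
pose beta (l : nat) : R := if insub l is Some l' then bt 0 l' else 0.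
have betaE (l : 'I_d) : beta l = bt 0 l.
  by rewrite /beta; case: insubP => [l' _ /val_inj -> //|]; rewrite ltn_ord.
exists beta; split.
  move=> M; under [RHS]eq_bigr => l _.
    rewrite betaE mxE scaler_suml; under eq_bigr => i _ do rewrite !mxE.
    over.
  rewrite exchange_big/=; apply: eq_bigr => i _.
  rewrite addrC exprD1n scaler_sumr.
  pose G (l : nat) := alpha i *: (eta ^+ l *: M ^+ l *+ 'C(i, l)).
  transitivity (\sum_(l < i.+1) G l).
    by apply: eq_bigr => l _; rewrite /G; congr (_ *: (_ *+ _)); exact: exprZ_mx.
  rewrite -(big_mkord xpredT G) -(big_mkord xpredT (fun l => (alpha i * ('C(i, l)%:R * eta ^+ l)) *: M ^+ l)).
  rewrite [RHS](@big_cat_nat _ _ _ i.+1)//= [X in _ + X]big1_seq ?addr0.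
    apply: eq_bigr => l _; rewrite /G -scaler_nat !scalerA; congr (_ *: _); ring.
  by move=> l /andP[_]; rewrite mem_index_iota => /andP[il _]; rewrite bin_small// mul0r mulr0 scale0r.
have aE : a = bt *m invmx T by rewrite /bt mulmxK.
have S_le (f : nat -> R) (r : 'rV[R]_d) : (forall l : 'I_d, f l = r 0 l) ->
    `|r| <= \sum_(l < d) `|f l|.
  move=> fr; rewrite mxnorm_le ?sumr_ge0//; apply/forallP => i; apply/forallP => j.
  by rewrite (ord1 i) -fr (bigD1 j)//= lerDl sumr_ge0.
have H1 : \sum_(i < d) `|alpha i| <= d%:R * `|a|.
  apply: (@le_trans _ _ (\sum_(i < d) `|a|)); last by rewrite sumr_const card_ord mulr_natl.
  by apply: ler_sum => i _; apply: le_trans (le_mxnorm a 0 i); rewrite mxE.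
have H2 : `|a| <= d%:R * `|bt| * `|invmx T| by rewrite aE; exact: norm_mulmx_le.
have H3 := S_le beta bt betaE.
rewrite mulrC ler_pdivrMr ?ltr_wpDl//.
apply: (le_trans H1); apply: (@le_trans _ _ (d%:R * (d%:R * `|bt| * `|invmx T|))).
  by rewrite ler_wpM2l.
have -> : d%:R * (d%:R * `|bt| * `|invmx T|) = `|bt| * K by rewrite /K; ring.
by apply: ler_pM => //; rewrite lerDl.
Qed.

Lemma ler_norm_sub_sum p (x y : 'M[R]_(p, 1)) : `|x| - `|y| <= `|x + y|.
Proof. by have := lerB_normD x y. Qed.

(** The vectors [Q A^l u] are uniformly independent by assumption. With [M = (D - 1) / eta], powers
    of [D] are combinations of powers of [M], which is within [C eta] of [A]; the shift [D ^+ o] is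
    close to 1 and acts on the quotient by the kernel of [Q]. Both errors are relative and absorbed
    by a small [eta], after which [rho] is chosen. *)
Lemma block_lower A Q (u : 'cV[R]_n) (d o : nat) (C : R) :
  0 <= C -> inv_ker A Q ->
  (exists2 c1 : R, 0 < c1 & forall beta : nat -> R, c1 * \sum_(l < d) `|beta l| <=
      `|\sum_(l < d) beta l *: (Q *m (A ^+ l *m u))|) ->
  exists2 eta1 : R, 0 < eta1 & forall eta, 0 < eta <= eta1 ->
  exists2 rho : R, 0 < rho & exists2 c2 : R, 0 < c2 &
    forall D, pres A D -> `|D - 1 - eta *: A| <= C * eta ^+ 2 ->
    forall (b : nat -> 'M[R]_n) (alpha : nat -> R),
    (forall i, (i < d)%N -> `|b i - D ^+ (o + i)| <= rho) ->
    c2 * \sum_(i < d) `|alpha i| <= `|\sum_(i < d) alpha i *: (Q *m (b i *m u))|.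
Proof.
move=> C0 iQ [c1 c10 Hc1].
have [Cl Cl0 HCl] : exists2 Cl : R, 0 <= Cl & forall l M' (e : R), (l < d)%N -> e <= 1 ->
    `|M' - A| <= e -> `|M' ^+ l - A ^+ l| <= Cl * e.
  clear Hc1; elim: d => [|d [Cl Cl0 IH]]; first by exists 0.
  have [c c0 Hc] := pow_perturb A d.
  exists (Cl + c); first exact: addr_ge0.
  move=> l M' e; rewrite ltnS leq_eqVlt => /predU1P[->|ld] e1 Me.
    apply: le_trans (Hc _ _ e1 Me) _; rewrite ler_wpM2r ?lerDr//; exact: le_trans Me.
  apply: le_trans (IH _ _ _ ld e1 Me) _; rewrite ler_wpM2r ?lerDl//; exact: le_trans Me.
have [Co Co0 HCo] := pow_perturb 1 o.
have half0 : 0 < 1 / 2 :> R by rewrite divr_gt0.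
pose nA := `|A| + C.
have nA0 : 0 <= nA by rewrite addr_ge0.
(* [K1 eta] is the cost of replacing powers of [M] by powers of [A], and [K2 eta] that of the factor
   [D ^+ o]. The conditions with [e3] and [e4] keep the perturbations below 1, as [pow_perturb]
   requires. *)
pose K1 := bnd Q * (n%:R * (Cl * C) * `|u|).
have K10 : 0 <= K1 by rewrite mulr_ge0 ?bnd_ge0// !mulr_ge0.
pose K2 := bnd Q * (n%:R * (Co * nA) * bnd (pinvmx Q)).
have K20 : 0 <= K2 by rewrite !mulr_ge0 ?bnd_ge0.
have [e1 e10 He1] := small_scale K10 (divr_gt0 c10 (ltr0Sn R 1)).
have [e2 e20 He2] := small_scale K20 half0.
have [e3 e30 He3] := small_scale C0 (@ltr01 R).
have [e4 e40 He4] := small_scale nA0 (@ltr01 R).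
exists (Num.min 1 (Num.min (Num.min e1 e2) (Num.min e3 e4))).
  by rewrite !lt_min ltr01 e10 e20 e30 e40.
move=> eta; rewrite !le_min => /and4P[eta0 etale1 /andP[etae1 etae2] /andP[etae3 etae4]].
have {}He1 : K1 * eta <= c1 / 2 by apply: He1; rewrite ltW.
have {}He2 : K2 * eta <= 1 / 2 by apply: He2; rewrite ltW.
have {}He3 : C * eta <= 1 by apply: He3; rewrite ltW.
have {}He4 : nA * eta <= 1 by apply: He4; rewrite ltW.
have [cT cT0 HT] := binomial_change d eta0.
(* One factor [1 / 2] is lost in passing from [A] to [M], the other one through [D ^+ o]. *)
pose c3 := c1 / 2 * cT / 2.
have c30 : 0 < c3 by rewrite !mulr_gt0.
pose K3 := bnd Q * (n%:R * `|u|).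
have K30 : 0 <= K3 by rewrite !mulr_ge0 ?bnd_ge0.
have [rho rho0 Hrho] := small_scale K30 (divr_gt0 c30 (ltr0Sn R 1)).
exists rho => //; exists (c3 / 2); first by rewrite divr_gt0.
move=> D pD HD b alpha Hb.
have {}Hrho : K3 * rho <= c3 / 2 by apply: Hrho; rewrite lexx ltW.
pose M := eta^-1 *: (D - 1).
have DE : D = 1 + eta *: M by rewrite /M scalerA divff ?gt_eqF// scale1r addrC subrK.
have MA : `|M - A| <= C * eta.
  have -> : M - A = eta^-1 *: (D - 1 - eta *: A).
    by rewrite scalerBr scalerA mulVf ?gt_eqF// scale1r.
  rewrite normrZ gtr0_norm ?invr_gt0// mulrC ler_pdivrMr//.
  by move: HD; rewrite expr2 mulrA.
have D1 : `|D - 1| <= nA * eta.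
  rewrite -(subrK (eta *: A) (D - 1)); apply: le_trans (ler_normD _ _) _.
  rewrite normrZ (gtr0_norm eta0) /nA mulrDl addrC (mulrC `|A|) lerD2l.
  apply: (le_trans HD); rewrite expr2 mulrA -[leRHS]mulr1.
  by rewrite ler_wpM2l// mulr_ge0// ltW.
have [beta [Hbeta ab]] := HT alpha.
pose y := \sum_(i < d) alpha i *: (D ^+ i *m u).
have yE : Q *m y = \sum_(l < d) beta l *: (Q *m (A ^+ l *m u)) +
    \sum_(l < d) beta l *: (Q *m ((M ^+ l - A ^+ l) *m u)).
  rewrite -big_split/=; under eq_bigr => l _ do
    rewrite -scalerDr -mulmxDr -mulmxDl addrC subrK.
  have -> : y = (\sum_(i < d) alpha i *: D ^+ i) *m u.
    by rewrite mulmx_suml; apply: eq_bigr => i _; rewrite -scalemxAl.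
  rewrite DE Hbeta mulmx_suml mulmx_sumr; apply: eq_bigr => l _.
  by rewrite -scalemxAl -scalemxAr.
have y1 : c1 / 2 * \sum_(l < d) `|beta l| <= `|Q *m y|.
  rewrite yE; apply: le_trans (ler_norm_sub_sum _ _).
  have : `|\sum_(l < d) beta l *: (Q *m ((M ^+ l - A ^+ l) *m u))| <= K1 * eta * \sum_(l < d) `|beta l|.
    apply: (@sumr_norm_ge R d n (fun l : 'I_d => Q *m ((M ^+ l - A ^+ l) *m u)) beta) => l.
    apply: le_trans (norm_mulmx _ _) _; rewrite /K1 -mulrA ler_wpM2l ?bnd_ge0//.
    have := norm_mulmx_le (HCl l M (C * eta) (ltn_ord l) He3 MA) (lexx `|u|).
    move=> /le_trans; apply; rewrite le_eqVlt; apply/orP; left; apply/eqP; ring.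
  move=> H; have S0 : 0 <= \sum_(l < d) `|beta l| by rewrite sumr_ge0.
  by have := Hc1 beta; have := ler_wpM2r S0 He1; clear - H; lra.
have Do1 : `|D ^+ o - 1| <= Co * (nA * eta).
  by have := HCo D (nA * eta) He4 D1; rewrite expr1n.
have y2 : 1 / 2 * `|Q *m y| <= `|Q *m (D ^+ o *m y)|.
  have -> : Q *m (D ^+ o *m y) = Q *m y + Q *m ((D ^+ o - 1) *m y).
    by rewrite -mulmxDr mulmxBl mx1_mul addrC subrK.
  apply: le_trans (ler_norm_sub_sum _ _).
  have iD : inv_ker (D ^+ o - 1) Q by apply: presB iQ; [exact: presX|exact: pres1].
  have H1 := norm_inv_ker y iD.
  have H2 : bnd (D ^+ o - 1) <= n%:R * (Co * (nA * eta)) by rewrite /bnd ler_wpM2l.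
  have H3 : `|Q *m ((D ^+ o - 1) *m y)| <= K2 * eta * `|Q *m y|.
    apply: (le_trans H1).
    have -> : K2 * eta * `|Q *m y| =
      bnd Q * (n%:R * (Co * (nA * eta)) * (bnd (pinvmx Q) * `|Q *m y|)) by rewrite /K2; ring.
    rewrite ler_wpM2l ?bnd_ge0// ler_wpM2r// mulr_ge0// ?bnd_ge0//.
  by have := ler_wpM2r (normr_ge0 (Q *m y)) He2; clear - H3; lra.
have zE : \sum_(i < d) alpha i *: (Q *m (b i *m u)) = Q *m (D ^+ o *m y) +
    \sum_(i < d) alpha i *: (Q *m ((b i - D ^+ (o + i)) *m u)).
  rewrite /y !mulmx_sumr -big_split/=; apply: eq_bigr => i _.
  rewrite -2!scalemxAr -scalerDr -mulmxDr; congr (_ *: (_ *m _)).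
  by rewrite mulmxA -[D ^+ o *m _]/(D ^+ o * D ^+ i) -exprD -mulmxDl addrC subrK.
have z1 : `|\sum_(i < d) alpha i *: (Q *m ((b i - D ^+ (o + i)) *m u))| <=
    K3 * rho * \sum_(i < d) `|alpha i|.
  apply: (@sumr_norm_ge R d n (fun i : 'I_d => Q *m ((b i - D ^+ (o + i)) *m u)) alpha) => i.
  apply: le_trans (norm_mulmx _ _) _; rewrite /K3 -mulrA ler_wpM2l ?bnd_ge0//.
  have := norm_mulmx_le (Hb i (ltn_ord i)) (lexx `|u|).
  move=> /le_trans; apply; rewrite le_eqVlt; apply/orP; left; apply/eqP; ring.
rewrite zE; apply: le_trans (ler_norm_sub_sum _ _).
have S0 : 0 <= \sum_(i < d) `|alpha i| by rewrite sumr_ge0.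
have G1 := ler_wpM2r S0 Hrho.
have G2 : c1 / 2 * (cT * \sum_(i < d) `|alpha i|) <= c1 / 2 * \sum_(l < d) `|beta l|.
  by rewrite ler_wpM2l// divr_ge0// ltW.
have G3 : c3 * \sum_(i < d) `|alpha i| <= `|Q *m (D ^+ o *m y)|.
  have -> : c3 * \sum_(i < d) `|alpha i| = 1 / 2 * (c1 / 2 * (cT * \sum_(i < d) `|alpha i|)).
    by rewrite /c3; field.
  by clear - G2 y1 y2; lra.
by clear - G1 G3 z1 S0; lra.
Qed.

End block.

(** * Flags of infinite mass *)

Section measurable_comparison.
Context {d} {T : measurableType d} {R : realType}.

Lemma measurable_lt_set (f g : T -> R) : measurable_fun setT f -> measurable_fun setT g ->
  measurable [set v | f v < g v].
Proof.
move=> mf mg; have -> : [set v | f v < g v] = (fun v => g v - f v) @^-1` `]0, +oo[.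
  by apply/seteqP; split => v /=; rewrite in_itv/= andbT subr_gt0.
rewrite -[X in measurable X]setTI; apply: measurable_funB => //.
Qed.

Lemma measurable_le_set (f g : T -> R) : measurable_fun setT f -> measurable_fun setT g ->
  measurable [set v | f v <= g v].
Proof.
move=> mf mg; have -> : [set v | f v <= g v] = ~` [set v | g v < f v].
  by apply/seteqP; split => v /=; rewrite leNgt => /negP.
by apply: measurableC; exact: measurable_lt_set.
Qed.

Lemma measurable_forall_ord m (F : 'I_m -> set T) : (forall i, measurable (F i)) ->
  measurable [set v | forall i, F i v].
Proof.
move=> mF; have -> : [set v | forall i, F i v] = \big[setI/setT]_(i < m) F i.
  by apply/seteqP; split => x /=; rewrite -bigcap_seq /= => H i;
    [move=> _; exact: H|apply: H; rewrite /= mem_index_enum].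
exact: bigsetI_measurable.
Qed.

Lemma measure_bigU_le (nu : {measure set T -> \bar R}) I (s : seq I) (F : I -> set T) :
  (forall i, measurable (F i)) ->
  (nu (\big[setU/set0]_(i <- s) F i) <= \sum_(i <- s) nu (F i))%E.
Proof.
move=> mF; elim: s => [|i s IH]; first by rewrite !big_nil measure0.
rewrite !big_cons; apply: le_trans (measureU2 _ _ _) _ => //.
  exact: bigsetU_measurable.
exact: leeD.
Qed.

End measurable_comparison.

Section directions.
Context {R : realType} {n : nat}.
Implicit Types (A Q : 'M[R]_n).

Lemma mulmx_coord_measurable m (Q : 'M[R]_(m, n)) i :
  measurable_fun setT ((fun v => (Q *m v) i 0) : borelV R n -> R).
Proof.
apply: continuous_measurable_cV.
have -> : (fun v : 'cV[R]_n => (Q *m v) i 0) = (fun v => \sum_j Q i j * v j 0).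
  by apply/funext => v; rewrite mxE.
apply: continuous_sumr => j; apply: continuous_mulr; first exact: cst_continuous.
exact: coord_continuous.
Qed.

Lemma norm_coord_measurable m (Q : 'M[R]_(m, n)) i :
  measurable_fun setT ((fun v => `|(Q *m v) i 0|) : borelV R n -> R).
Proof. by apply: measurableT_comp => //; exact: mulmx_coord_measurable. Qed.

Lemma measurable_mulmx_eq m (Q : 'M[R]_(m, n)) (c : 'cV[R]_m) :
  measurable ([set v | Q *m v = c] : set (borelV R n)).
Proof.
have -> : [set v | Q *m v = c] = [set v : borelV R n | forall i, `|(Q *m v) i 0 - c i 0| <= 0].
  apply/seteqP; split => v /= H; first by move=> i; rewrite H subrr normr0.
  apply/colP => i; apply/eqP; rewrite -subr_eq0 -normr_eq0 eq_le H.
  exact: normr_ge0.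
apply: measurable_forall_ord => i; apply: measurable_le_set => //.
apply: measurableT_comp => //; apply: measurable_funB => //.
exact: mulmx_coord_measurable.
Qed.

Lemma measurable_mulmx_neq0 m (Q : 'M[R]_(m, n)) :
  measurable ([set v | Q *m v != 0] : set (borelV R n)).
Proof.
have -> : [set v | Q *m v != 0] = ~` [set v : borelV R n | Q *m v = 0].
  by apply/seteqP; split => v /= /eqP.
by apply: measurableC; exact: measurable_mulmx_eq.
Qed.

(** Near-proportionality of [Q v] to [Q u], measured by the coordinate [i0], at which [Q u] will be
    normalised to 1. The condition is unchanged when [v] is multiplied by a nonzero scalar, whatever
    its sign. *)
Definition cone Q (u : 'cV[R]_n) (i0 : 'I_n) (e : R) : set 'cV[R]_n :=
  [set v | forall i, `|(Q *m v) i 0 - (Q *m u) i 0 * (Q *m v) i0 0| < e * `|(Q *m v) i0 0|].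

Lemma cone_measurable Q u i0 e : measurable (cone Q u i0 e : set (borelV R n)).
Proof.
apply: measurable_forall_ord => i; apply: measurable_lt_set.
  apply: measurableT_comp => //; apply: measurable_funB; first exact: mulmx_coord_measurable.
  by apply: measurable_funM => //; exact: mulmx_coord_measurable.
by apply: measurable_funM => //; exact: norm_coord_measurable.
Qed.

Lemma arbitrarily_small (x : R) : 0 <= x -> (forall e, 0 < e -> x <= e) -> x = 0.
Proof.
move=> x0 H; apply/eqP; rewrite eq_le x0 andbT leNgt; apply/negP => xp.
by have := H (x / 2) (divr_gt0 xp (ltr0Sn R 1)); rewrite leNgt; move/negP; apply; lra.
Qed.

(** Some coordinate [i0] is the largest one of [Q v] on a set of infinite mass, where the ratios
    [Q v / (Q v)_i0] stay in a compact ball. A cluster point of these ratios, taken modulo sets of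
    finite mass, has infinite mass in each of its neighbourhoods. *)
Lemma heavy_direction (nu : {measure set (borelV R n) -> \bar R}) Q :
  nu [set v | Q *m v != 0] = +oo%E ->
  exists u i0, (Q *m u) i0 0 = 1 /\ forall e, 0 < e -> nu (cone Q u i0 e) = +oo%E.
Proof.
move=> nuQ.
pose Ch (i0 : 'I_n) : set (borelV R n) :=
  [set v | 0 < `|(Q *m v) i0 0|] `&` [set v | forall i, `|(Q *m v) i 0| <= `|(Q *m v) i0 0|].
have mCh i0 : measurable (Ch i0).
  apply: measurableI; first by apply: measurable_lt_set => //; exact: norm_coord_measurable.
  apply: measurable_forall_ord => i; apply: measurable_le_set; exact: norm_coord_measurable.
have [i0 Chi0] : exists i0, nu (Ch i0) = +oo%E.
  apply: contrapT => /forallNP noCh.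
  have fin i0 : (nu (Ch i0) < +oo)%E.
    by rewrite lt_neqAle leey andbT; apply/eqP; exact: noCh.
  have : (nu [set v | Q *m v != 0%R] <= \sum_(i < n) nu (Ch i))%E.
    have mU : measurable (\big[setU/set0]_(i < n) Ch i) by exact: bigsetU_measurable.
    apply: (@le_trans _ _ (nu (\big[setU/set0]_(i < n) Ch i))).
      apply: le_measure; rewrite ?inE//.
        exact: measurable_mulmx_neq0.
      move=> v /= Qv0; rewrite -bigcup_seq/=.
      have : mx_norm (Q *m v) != 0 by apply: contra Qv0 => /eqP/mx_norm_eq0 ->.
      move=> /[dup] /mx_norm_neq0 [[i j]] /=; rewrite (ord1 j) => E N0.
      exists i; first by rewrite /= mem_index_enum.
      have Ei : `|Q *m v| = `|(Q *m v) i 0| by rewrite /Num.Def.normr/=.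
      split => /=; first by rewrite -Ei normr_gt0.
      by move=> l; rewrite -Ei le_mxnorm.
    exact: measure_bigU_le.
  rewrite nuQ leNgt; move/negP; apply.
  by apply: lte_sum_pinfty => i _; exact: fin.
pose ratio (v : 'cV[R]_n) : 'rV[R]_n := \row_i ((Q *m v) i 0 / (Q *m v) i0 0).
pose K := [set x : 'rV[R]_n | `|x| <= 1].
(* [U] belongs to this filter when it contains all the ratios outside a set of finite mass; the
   filter is proper because the mass of [Ch i0] is infinite. *)
pose F : set_system 'rV[R]_n := fun U => exists G : set (borelV R n),
  [/\ measurable G, (nu (Ch i0 `&` G) < +oo)%E & forall v, Ch i0 v -> ~ G v -> U (ratio v)].
have PF : ProperFilter F.
  split.
    move=> [G [mG nuG sub]]; have : Ch i0 `<=` G.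
      by move=> v Cv; apply: contrapT => Gv; exact: (sub v).
    by move=> /setIidl E; move: nuG; rewrite E Chi0.
  split.
  - by exists set0; split => //; rewrite setI0 measure0.
  - move=> U U' [G [mG nuG sub]] [G' [mG' nuG' sub']].
    exists (G `|` G'); split; first exact: measurableU.
      rewrite setIUr; apply: le_lt_trans (measureU2 _ _ _) _.
      - exact: measurableI.
      - exact: measurableI.
      - by rewrite lte_add_pinfty.
    by move=> v Cv /not_orP[nG nG']; split; [exact: sub|exact: sub'].
  - move=> U U' UU' [G [mG nuG sub]]; exists G; split => // v Cv Gv.
    by apply: UU'; exact: sub.
have FK : F K.
  exists set0; split => //; first by rewrite setI0 measure0.
  move=> v [/= v0 Cv] _; rewrite /K /= mxnorm_le//; apply/forallP => i; apply/forallP => j.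
  by rewrite mxE normrM normfV ler_pdivrMr// mul1r.
have cK : compact K.
  apply: bounded_closed_compact.
    by exists 1; split => // M M1 x /= x1; exact: le_trans x1 (ltW M1).
  have -> : K = (fun x : 'rV[R]_n => `|x|) @^-1` [set x | x <= 1] by [].
  by apply: closed_comp (@closed_le R 1) => x _; exact: norm_continuous.
have [t [Kt clt]] := cK F PF FK.
have rE v j : (ratio v - t) 0 j = (Q *m v) j 0 / (Q *m v) i0 0 - t 0 j.
  by rewrite mxE [X in X + _]mxE [X in _ + X]mxE.
pose Gc e : set (borelV R n) :=
  [set v | forall j, `|(Q *m v) j 0 - t 0 j * (Q *m v) i0 0| < e * `|(Q *m v) i0 0| ].
have mG e : measurable (Gc e).
  apply: measurable_forall_ord => i; apply: measurable_lt_set.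
    apply: measurableT_comp => //; apply: measurable_funB; first exact: mulmx_coord_measurable.
    by apply: measurable_funM => //; exact: mulmx_coord_measurable.
  by apply: measurable_funM => //; exact: norm_coord_measurable.
have GcP e v : 0 < e -> Ch i0 v -> Gc e v <-> `|ratio v - t| < e.
  move=> e0 [/= v0 _].
  have E j : (`|(ratio v - t) 0 j| < e) =
      (`|(Q *m v) j 0 - t 0 j * (Q *m v) i0 0| < e * `|(Q *m v) i0 0|).
    rewrite rE -(ltr_pM2r v0) -normrM mulrBl divfK//; first by rewrite -normr_gt0.
  rewrite mxnorm_lt//; split.
    by move=> H; apply/forallP => i; apply/forallP => j; rewrite (ord1 i) E; exact: H.
  by move=> /forallP /(_ 0) /forallP H j; rewrite -E; exact: H.
have hit e : 0 < e -> nu (Ch i0 `&` Gc e) = +oo%E.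
  move=> e0; apply/eqP; rewrite -leye_eq leNgt; apply/negP => fin.
  have FU : F [set x | e <= `|x - t|].
    exists (Gc e); split; [exact: mG|exact: fin|move=> v Cv Gv /=].
    by rewrite leNgt; apply/negP => /(GcP e v e0 Cv).
  have Bt : nbhs t (ball t e) by exact: nbhsx_ballx.
  have [x [/= ex]] := clt _ _ FU Bt.
  by rewrite mx_norm_ball /ball_/= distrC ltNge ex.
have pick e : 0 < e -> exists2 v, Ch i0 v & `|ratio v - t| < e.
  move=> e0; have := hit e e0; have [->|/set0P[v [Cv rv]] _] := eqVneq (Ch i0 `&` Gc e) set0.
    by rewrite measure0.
  by exists v => //; exact/GcP.
have t1 : t 0 i0 = 1.
  apply/eqP; rewrite -subr_eq0 -normr_eq0; apply/eqP; apply: arbitrarily_small => // e e0.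
  have [v [/= v0 _] rv] := pick e e0.
  have : `|(ratio v - t) 0 i0| <= e by apply: le_trans (le_mxnorm _ _ _) (ltW rv).
  have nz : (Q *m v) i0 0 != 0 by rewrite -normr_gt0.
  by rewrite rE (divff nz) distrC.
(* The column space of [Q] is closed: its equations, given by [cokermx Q^T], hold for the ratios,
   hence for [t]. This provides [u] with [Q u = t^T]. *)
have tQ : (t <= Q^T)%MS.
  rewrite submxE; apply/eqP.
  have : `|t *m cokermx Q^T| = 0.
    apply: arbitrarily_small => // e e0.
    pose K1 := n%:R * `|cokermx Q^T| + 1 : R.
    have K10 : 0 < K1 by rewrite ltr_wpDl// mulr_ge0.
    have [v _ rv] := pick (e / K1) (divr_gt0 e0 K10).
    have r0 : ratio v *m cokermx Q^T = 0.
      have -> : ratio v = ((Q *m v) i0 0)^-1 *: (v^T *m Q^T).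
        by apply/rowP => i; rewrite !mxE mulrC; congr (_ * _); apply: eq_bigr => j _; rewrite !mxE mulrC.
      by rewrite -scalemxAl -mulmxA mulmx_coker mulmx0 scaler0.
    have -> : t *m cokermx Q^T = (t - ratio v) *m cokermx Q^T by rewrite mulmxBl r0 subr0.
    apply: le_trans (norm_mulmx_le _ (lexx _)) _; first by rewrite distrC; exact: ltW rv.
    have -> : n%:R * (e / K1) * `|cokermx Q^T| = e / K1 * (n%:R * `|cokermx Q^T|) by ring.
    apply: (@le_trans _ _ (e / K1 * K1)); last by rewrite divfK// gt_eqF.
    by rewrite ler_wpM2l ?lerDl// ltW// divr_gt0.
  by move/normr0_eq0.
have [D tE] := submxP tQ.
have uE : Q *m D^T = t^T by rewrite tE trmx_mul trmxK.
exists D^T, i0; rewrite uE mxE; split => // e e0.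
apply/eqP; rewrite -leye_eq -(hit e e0); apply: le_measure; rewrite ?inE.
- exact: measurableI.
- exact: cone_measurable.
by move=> v [_ Gv] i; rewrite uE [X in _ - X * _]mxE; exact: Gv.
Qed.

End directions.

Section quotient.
Context {R : realType} {n : nat}.
Implicit Types (A Q : 'M[R]_n).

(** Krylov sequence: [d] is the largest length for which [Q u, Q A u, ...] stay independent, and [N]
    collects the equations of their span. The next vector falls in the span, so the kernel of [N Q],
    which is the kernel of [Q] plus the span of the [A^l u], is again invariant. *)
Lemma quotient_step A Q (u : 'cV[R]_n) : inv_ker A Q -> Q *m u != 0 ->
  exists (d : nat) (N : 'M[R]_n),
  [/\ (0 < d)%N, (\rank (N *m Q) + d)%N = \rank Q, inv_ker A (N *m Q), N *m (Q *m u) = 0 &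
   exists2 c1 : R, 0 < c1 & forall beta : nat -> R, c1 * \sum_(l < d) `|beta l| <=
     `|\sum_(l < d) beta l *: (Q *m (A ^+ l *m u))|].
Proof.
move=> iQ Qu0.
pose w (l : nat) : 'cV[R]_n := Q *m (A ^+ l *m u).
pose K d : 'M[R]_(d, n) := \matrix_(l, j) w l j 0.
have KE d (beta : nat -> R) : (\row_(l < d) beta l *m K d)^T = \sum_(l < d) beta l *: w l.
  apply/colP => j; rewrite !mxE summxE; apply: eq_bigr => l _.
  by rewrite mxE [K d _ _]mxE [RHS]mxE.
pose free d := forall beta : nat -> R, \sum_(l < d) beta l *: w l = 0 ->
  forall l, (l < d)%N -> beta l = 0.
have fun_row d (x : 'rV[R]_d) : exists beta : nat -> R, x = \row_(l < d) beta l.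
  exists (fun l => if insub l is Some l' then x 0 l' else 0).
  apply/rowP => l; rewrite mxE; case: insubP => [l' _ /val_inj -> //|]; by rewrite ltn_ord.
have free_row d : free d -> row_free (K d).
  move=> fd; rewrite -kermx_eq0; apply/eqP/row_matrixP => i.
  have : row i (kermx (K d)) *m K d = 0 by rewrite -row_mul mulmx_ker row0.
  have [beta ->] := fun_row _ (row i (kermx (K d))) => /(congr1 trmx).
  rewrite KE trmx0 => /fd H; rewrite row0; apply/rowP => l; rewrite !mxE.
  exact: H.
have free0 : exists d, `[< free d >].
  by exists 0%N; apply/asboolP => beta _ l.
have freen d : `[< free d >] -> (d <= n)%N.
  by move=> /asboolP /free_row; rewrite /row_free => /eqP <-; exact: rank_leq_col.
case: (ex_maxnP free0 freen) => d /asboolP fd dmax.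
have Kd := free_row d fd.
have [B KB] := row_freeP Kd.
pose C := cokermx (K d).
pose N := C^T.
have Nw_lt l : (l < d)%N -> N *m w l = 0.
  move=> ld; have -> : w l = (row (Ordinal ld) (K d))^T.
    by apply/colP => j; rewrite !mxE.
  by rewrite /N -trmx_mul -row_mul mulmx_coker row0 trmx0.
have Nwd : N *m w d = 0.
  have : ~ free d.+1.
    by move=> f; have := dmax d.+1; rewrite ltnn => /(_ (asboolT f)).
  move=> /existsNP[beta /not_implyP[]]; rewrite big_ord_recr/= => sum0 /existsNP[l /not_implyP[ld bl]].
  have bd : beta d != 0.
    apply/eqP => bd; apply: bl; move: sum0; rewrite bd scale0r addr0 => /fd.
    by move: ld; rewrite ltnS leq_eqVlt => /predU1P[->//|ld /(_ _ ld)].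
  have : N *m (\sum_(i < d) beta i *: w i + beta d *: w d) = 0 by rewrite sum0 mulmx0.
  rewrite mulmxDr mulmx_sumr big1 ?add0r.
    by rewrite -scalemxAr => /eqP; rewrite scaler_eq0 (negbTE bd) => /eqP.
  by move=> i _; rewrite -scalemxAr Nw_lt// scaler0.
have Nw l : (l <= d)%N -> N *m w l = 0.
  by rewrite leq_eqVlt => /predU1P[->//|]; exact: Nw_lt.
have d0 : (0 < d)%N.
  apply: (dmax 1%N); apply/asboolP => beta; rewrite big_ord1 => /eqP.
  rewrite scaler_eq0 /w expr0 mx1_mul (negbTE Qu0) orbF => /eqP b0 l.
  by rewrite ltnS leqn0 => /eqP ->.
exists d, N; split => //.
- rewrite -(mxrank_tr Q) -(mxrank_mul_ker Q^T C) -(mxrank_tr (N *m Q)) trmx_mul trmxK.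
  congr (_ + _)%N; apply/eqP; rewrite eqn_leq; apply/andP; split.
    move: Kd; rewrite /row_free => /eqP Kd; rewrite -{1}Kd; apply: mxrankS.
    rewrite sub_capmx; apply/andP; split; last by rewrite sub_kermx mulmx_coker.
    apply/row_subP => l; have -> : row l (K d) = (A ^+ l *m u)^T *m Q^T.
      by rewrite -trmx_mul; apply/rowP => j; rewrite !mxE.
    exact: submxMl.
  apply: leq_trans (rank_leq_row (K d)); apply: mxrankS.
  by apply: submx_trans (capmxSr _ _) _; rewrite submxE mulmx_ker.
- move=> v; rewrite -!mulmxA => NQv.
  have : ((Q *m v)^T <= K d)%MS.
    by rewrite submxE -/C -[C]trmxK -trmx_mul -/N NQv trmx0.
  move=> /submxP[x xE]; have [beta bE] := fun_row _ x.
  have QvE : Q *m v = \sum_(l < d) beta l *: w l by rewrite -KE -bE -xE trmxK.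
  pose y := \sum_(l < d) beta l *: (A ^+ l *m u).
  have : Q *m (v - y) = 0.
    rewrite mulmxBr QvE /y mulmx_sumr; apply/eqP; rewrite subr_eq0; apply/eqP.
    by apply: eq_bigr => l _; rewrite -scalemxAr.
  move=> /iQ; rewrite mulmxBr mulmxBr => /eqP; rewrite subr_eq0 => /eqP ->.
  rewrite /y !mulmx_sumr big1// => l _.
  rewrite -!scalemxAr (_ : Q *m (A *m _) = w l.+1) ?Nw ?scaler0//.
  by rewrite /w exprS; congr (_ *m _); rewrite mulmxA.
- by have := Nw 0%N isT; rewrite /w expr0 mx1_mul.
(* The right inverse [B] of the matrix of these vectors recovers the coefficients from the
   combination, which bounds them by its norm. *)
- pose k1 := d%:R * (n%:R * `|B|) + 1 : R.
  have k10 : 0 < k1 by rewrite ltr_wpDl// !mulr_ge0.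
  exists k1^-1; first by rewrite invr_gt0.
  move=> beta; rewrite mulrC ler_pdivrMr// -/(w _).
  set S := \sum_(l < d) beta l *: w l.
  have bE : \row_(l < d) beta l = S^T *m B.
    by rewrite /S -KE trmxK -mulmxA KB mulmx1.
  have H1 : `|\row_(l < d) beta l| <= n%:R * `|S| * `|B|.
    rewrite bE; apply: norm_mulmx_le => //.
    rewrite mxnorm_le//; apply/forallP => i; apply/forallP => j.
    by rewrite mxE le_mxnorm.
  have H2 : \sum_(l < d) `|beta l| <= d%:R * `|\row_(l < d) beta l|.
    apply: (@le_trans _ _ (\sum_(l < d) `|\row_(l < d) beta l|)); last first.
      by rewrite sumr_const card_ord mulr_natl.
    by apply: ler_sum => l _; apply: le_trans (le_mxnorm _ 0 l); rewrite mxE.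
  apply: (le_trans H2); apply: (@le_trans _ _ (d%:R * (n%:R * `|S| * `|B|))).
    by rewrite ler_wpM2l.
  have -> : d%:R * (n%:R * `|S| * `|B|) = `|S| * (d%:R * (n%:R * `|B|)) by ring.
  by rewrite ler_wpM2l// lerDl.
Qed.

End quotient.

Ltac nng := by repeat first
  [ assumption | exact: ltW | exact: bnd_ge0 | exact: ler0n | exact: ler01 | exact: normr_ge0
  | apply: addr_ge0 | apply: divr_ge0 | apply: mulr_ge0 | apply: exprn_ge0 ].

Section cone_qset.
Context {R : realType} {n : nat}.
Implicit Types (A Q : 'M[R]_n).

Lemma ltr_sqr_norm (a b : R) : (a ^+ 2 < b ^+ 2) = (`|a| < `|b|).
Proof. by rewrite -(real_normK (num_real a)) -(real_normK (num_real b)) ltr_pXn2r// nnegrE. Qed.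

(** Comparisons of absolute values become comparisons of squares. Besides the cone condition,
    [|(Q v)_i0| > a] keeps [v] away from 0, so that the mass is finite for a Levy measure, and
    [|v_j| < b] keeps [v] bounded. *)
Definition cone_forms Q (u : 'cV[R]_n) (i0 : 'I_n) (e a b : R) : seq (R * 'M[R]_n) :=
  (- a ^+ 2, outer_qform (row i0 Q) (row i0 Q)) ::
  [seq (0, e ^+ 2 *: outer_qform (row i0 Q) (row i0 Q)
        - outer_qform (row i Q - (Q *m u) i 0 *: row i0 Q) (row i Q - (Q *m u) i 0 *: row i0 Q))
     | i <- enum 'I_n] ++
  [seq (b ^+ 2, - outer_qform (delta_mx 0 j) (delta_mx 0 j)) | j <- enum 'I_n].

Lemma row_mulmx_coord m (M : 'M[R]_(m, n)) i (v : 'cV[R]_n) : (row i M *m v) 0 0 = (M *m v) i 0.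
Proof. by rewrite -row_mul mxE. Qed.

Lemma delta_mulmx_coord j (v : 'cV[R]_n) : ((delta_mx 0 j : 'rV[R]_n) *m v) 0 0 = v j 0.
Proof. by rewrite -rowE mxE. Qed.

Lemma cone_formsP Q u i0 e a b v : 0 < e -> 0 < a -> 0 < b ->
  qset (cone_forms Q u i0 e a b) v <->
  [/\ a < `|(Q *m v) i0 0|, cone Q u i0 e v & forall j, `|v j 0| < b].
Proof.
move=> e0 a0 b0.
have qf1 : qform (- a ^+ 2, outer_qform (row i0 Q) (row i0 Q)) v = (Q *m v) i0 0 ^+ 2 - a ^+ 2.
  by rewrite /qform/= outer_qformE !row_mulmx_coord addrC expr2.
have qf2 i : qform (0, e ^+ 2 *: outer_qform (row i0 Q) (row i0 Q)
        - outer_qform (row i Q - (Q *m u) i 0 *: row i0 Q) (row i Q - (Q *m u) i 0 *: row i0 Q)) v =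
   (e * (Q *m v) i0 0) ^+ 2 - ((Q *m v) i 0 - (Q *m u) i 0 * (Q *m v) i0 0) ^+ 2.
  rewrite /qform/= add0r mulmxBr mulmxBl -scalemxAr -scalemxAl mxE [X in X + _]mxE [X in _ + X]mxE.
  have e1 c : ((row i Q - c *: row i0 Q) *m v) 0 0 = (Q *m v) i 0 - c * (Q *m v) i0 0.
    rewrite mulmxBl -scalemxAl mxE [X in _ + X]mxE [X in - X]mxE.
    by rewrite !row_mulmx_coord.
  rewrite !outer_qformE !e1 !row_mulmx_coord; ring.
have qf3 j : qform (b ^+ 2, - outer_qform (delta_mx 0 j) (delta_mx 0 j)) v = b ^+ 2 - v j 0 ^+ 2.
  by rewrite /qform/= mulmxN mulNmx mxE outer_qformE delta_mulmx_coord expr2.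
have ab (x : R) : 0 < x -> `|x| = x by exact: gtr0_norm.
split.
  move=> H; split.
  - have := H _ (mem_head _ _); rewrite qf1 subr_gt0 ltr_sqr_norm ab//.
  - move=> i; have := H (_, _) _; rewrite -[X in X * `|_|](ab e)// -normrM -ltr_sqr_norm -subr_gt0 -qf2; apply.
    rewrite inE mem_cat; apply/orP; right; apply/orP; left.
    by apply/mapP; exists i; rewrite ?mem_enum.
  - move=> j; have := H (_, _) _; rewrite -[X in _ < X](ab b)// -ltr_sqr_norm -subr_gt0 -qf3; apply.
    rewrite inE mem_cat; apply/orP; right; apply/orP; right.
    by apply/mapP; exists j; rewrite ?mem_enum.
move=> [H1 H2 H3] aS; rewrite inE mem_cat => /orP[/eqP ->|/orP[/mapP[i _ ->]|/mapP[j _ ->]]].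
- by rewrite qf1 subr_gt0 ltr_sqr_norm ab.
- by rewrite qf2 subr_gt0 ltr_sqr_norm normrM (ab e)//; exact: H2.
- by rewrite qf3 subr_gt0 ltr_sqr_norm (ab b).
Qed.

Lemma cone_qset_exhaust (nu : {measure set (borelV R n) -> \bar R}) Q u i0 e M :
  0 < e -> nu (cone Q u i0 e) = +oo%E ->
  exists a b, [/\ 0 < a, 0 < b & (M%:E <= nu (qset (cone_forms Q u i0 e a b)))%E].
Proof.
move=> e0 nuoo.
pose F m : set (borelV R n) := qset (cone_forms Q u i0 e (m.+1%:R^-1) m.+1%:R).
have FE m v : F m v <-> [/\ m.+1%:R^-1 < `|(Q *m v) i0 0|, cone Q u i0 e v & forall j, `|v j 0| < m.+1%:R].
  by apply: cone_formsP => //; rewrite invr_gt0.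
have mF m : measurable (F m) by exact: qset_measurable.
have UF : \bigcup_m F m = cone Q u i0 e.
  apply/seteqP; split => v; first by move=> [m _ /FE[]].
  move=> cv; have v0 : 0 < `|(Q *m v) i0 0|.
    by have := cv i0; rewrite -(pmulr_rgt0 _ e0); apply: le_lt_trans.
  pose m := (Num.truncn (`|(Q *m v) i0 0|^-1)%R + Num.truncn `|v|%R)%N.
  exists m => //; apply/FE; split => //.
    rewrite invf_plt ?posrE//; apply: lt_le_trans (truncnS_gt _) _.
    by rewrite ler_nat /m -addSn leq_addr.
  move=> j; apply: le_lt_trans (le_mxnorm v j 0) _.
  apply: lt_le_trans (truncnS_gt _) _.
  by rewrite ler_nat /m -addnS leq_addl.
have ndF : {homo F : m m' / (m <= m')%N >-> (m <= m')%O}.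
  move=> m m' mm'; apply/subsetPset => v /FE[H1 H2 H3]; apply/FE; split => //.
    by apply: le_lt_trans H1; rewrite lef_pV2 ?posrE// ler_nat ltnS.
  by move=> j; apply: lt_le_trans (H3 j) _; rewrite ler_nat ltnS.
have cv := @nondecreasing_cvg_mu _ _ _ nu F mF (bigcupT_measurable _ mF) ndF.
rewrite UF nuoo in cv.
have [m _ Hm] := cvgey_ge cv M.
exists m.+1%:R^-1, m.+1%:R; split => //.
by have := Hm m (leqnn m).
Qed.

End cone_qset.

Section flag.
Context {R : realType} {n : nat}.
Implicit Types (A Q : 'M[R]_n).

Definition heavy (nu : {measure set (borelV R n) -> \bar R}) A := forall Q,
  Q != 0 -> inv_ker A Q -> nu [set v | Q *m v != 0] = +oo%E.

(* The matrices [b c] are perturbations of [D ^+ c], where [D] approximates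
   [1 + eta *: A]: they account for the averages of powers of the Euler matrix
   which arise when a jump time is moved. *)
Definition flag (nu : {measure set (borelV R n) -> \bar R}) A Q (C : R) :=
  exists2 eta1 : R, 0 < eta1 & forall eta, 0 < eta <= eta1 ->
  exists2 rho : R, 0 < rho & forall M : R,
  exists (L : nat -> seq (R * 'M[R]_n)) (c0 r0 R0 : R),
  [/\ 0 < c0, 0 < r0,
    (forall c, (c < \rank Q)%N -> (M%:E <= nu (qset (L c)))%E),
    (forall c v, (c < \rank Q)%N -> qset (L c) v -> r0 <= `|v| <= R0) &
    forall D (b : nat -> 'M[R]_n) (v : nat -> 'cV[R]_n) (alpha : nat -> R),
      pres A D -> `|D - 1 - eta *: A| <= C * eta ^+ 2 ->
      (forall c, (c < \rank Q)%N -> pres A (b c)) ->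
      (forall c, (c < \rank Q)%N -> `|b c - D ^+ c| <= rho) ->
      (forall c, (c < \rank Q)%N -> qset (L c) (v c)) ->
      c0 * \sum_(c < \rank Q) `|alpha c| <=
        `|Q *m \sum_(c < \rank Q) alpha c *: (b c *m v c)| ].

Lemma flag_rank0 nu A Q C : \rank Q = 0%N -> flag nu A Q C.
Proof.
move=> rQ; exists 1 => // eta _; exists 1 => // M.
exists (fun=> [::]), 1, 1, 1; rewrite rQ; split => // D b v alpha _ _ _ _ _.
by rewrite !big_ord0 mulr0.
Qed.

Lemma pow_bound (K : R) c r : (c < r)%N -> 0 <= K -> K ^+ c <= (K + 1) ^+ r.
Proof.
move=> cr K0; apply: (@le_trans _ _ ((K + 1) ^+ c)).
  by apply: lerXn2r; rewrite ?nnegrE ?addr_ge0 ?lerDl.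
by apply: ler_weXn2l; [rewrite lerDr|exact: ltnW].
Qed.

(** The sets for [N Q] are completed by [d] copies of one thin truncated cone around [u]. Since [N]
    kills [Q b u], applying [N] to a combination controls the first coefficients up to [eps] times
    the last ones, while [block_lower] controls the last ones up to a multiple of the first ones. *)
Lemma flag_step (nu : {measure set (borelV R n) -> \bar R}) A Q (C : R) (N : 'M[R]_n)
  (u : 'cV[R]_n) i0 d :
  0 <= C -> inv_ker A Q -> inv_ker A (N *m Q) ->
  (Q *m u) i0 0 = 1 -> N *m (Q *m u) = 0 ->
  (forall e, 0 < e -> nu (cone Q u i0 e) = +oo%E) ->
  (\rank (N *m Q) + d)%N = \rank Q ->
  (exists2 c1 : R, 0 < c1 & forall beta : nat -> R, c1 * \sum_(l < d) `|beta l| <=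
     `|\sum_(l < d) beta l *: (Q *m (A ^+ l *m u))|) ->
  flag nu A (N *m Q) C -> flag nu A Q C.
Proof.
move=> C0 iQ iNQ u1 Nu nuoo rk free [etaF etaF0 HF].
set o := \rank (N *m Q) in rk HF.
have [etaB etaB0 HB] := block_lower o C0 iQ free.
exists (Num.min 1 (Num.min etaF etaB)); first by rewrite !lt_min ltr01 etaF0 etaB0.
move=> eta; rewrite !le_min => /and4P[eta0 eta1 etaleF etaleB].
have [rhoF rhoF0 {}HF] := HF eta (introT andP (conj eta0 etaleF)).
have [rhoB rhoB0 [c2 c20 {}HB]] := HB eta (introT andP (conj eta0 etaleB)).
pose rho := Num.min rhoF rhoB.
have rho0 : 0 < rho by rewrite lt_min rhoF0 rhoB0.
exists rho => // M.
have [L' [c0' [r0' [R0' [c0'0 r0'0 nuL' bdL' HL']]]]] := HF M.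
pose KD := `|(1 : 'M[R]_n)| + `|A| + C.
have KD0 : 0 <= KD by rewrite !addr_ge0.
pose CB := `|(1 : 'M[R]_n)| * (n%:R * KD + 1) ^+ \rank Q + rho.
have CB0 : 0 <= CB.
  apply: addr_ge0; last exact: ltW.
  by apply: mulr_ge0 => //; apply: exprn_ge0; rewrite addr_ge0// mulr_ge0.
pose Cb := bnd Q * (n%:R * CB * bnd (pinvmx Q)).
have Cb0 : 0 <= Cb by rewrite !mulr_ge0 ?bnd_ge0.
pose R1 := Num.max R0' 0.
have R10 : 0 <= R1 by rewrite le_max lexx orbT.
pose C3 := bnd Q * (n%:R * CB * R1).
have C30 : 0 <= C3 by rewrite !mulr_ge0 ?bnd_ge0.
pose CN := bnd N.
have CN0 : 0 <= CN := bnd_ge0 _.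
(* The aperture [eps] is chosen after the sets of the quotient, because it has to beat their
   constants [c0'] and [R0']; then the two mutual estimates close up. *)
pose ka := Cb + C3 * (CN * Cb) / c0'.
have ka0 : 0 <= ka by rewrite /ka; nng.
have [eps eps0 Heps] := small_scale ka0 (divr_gt0 c20 (ltr0Sn R 1)).
have {}Heps : ka * eps <= c2 / 2 by apply: Heps; rewrite lexx ltW.
have [a [b0 [a0 b00 nuV]]] := cone_qset_exhaust M eps0 (nuoo eps eps0).
pose LV := cone_forms Q u i0 eps a b0.
pose L c := if (c < o)%N then L' c else LV.
pose lmin := a.
pose kk := (1 + C3 / c0' * CN) / (c2 / 2).
have kk0 : 0 <= kk by rewrite /kk; nng.
pose k2 := (CN + CN * Cb * eps * kk) / c0'.
have k20 : 0 <= k2 by rewrite /k2; nng.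
pose kt := k2 + kk / a + 1.
have kt0 : 0 < kt by rewrite /kt ltr_wpDl//; nng.
exists L, kt^-1, (Num.min r0' (a / (bnd Q + 1))), (Num.max R0' b0); split.
- by rewrite invr_gt0.
- by rewrite lt_min r0'0 divr_gt0// ltr_wpDl// bnd_ge0.
- by move=> c cQ; rewrite /L; case: ifP => // co; exact: nuL'.
- move=> c v cQ; rewrite /L; case: ifP => [co /(bdL' c v co) /andP[H1 H2]|_ /cone_formsP[]//].
    by apply/andP; split; rewrite ?ge_min ?le_max ?H1 ?H2.
  move=> H1 _ H3; apply/andP; split.
    rewrite ge_min; apply/orP; right; rewrite ler_pdivrMr ?ltr_wpDl ?bnd_ge0//.
    apply: le_trans (ltW H1) _; apply: le_trans (le_mxnorm _ _ _) _.
    apply: le_trans (norm_mulmx _ _) _.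
    by rewrite mulrC ler_wpM2l// lerDl.
  rewrite le_max; apply/orP; right; rewrite mxnorm_le ?ltW//.
  by apply/forallP => i; apply/forallP => j; rewrite (ord1 j) ltW.
move=> D b v alpha pD HD pb Hb Hv.
have rkE : \rank Q = (o + d)%N by rewrite rk.
have oQ c : (c < o)%N -> (c < \rank Q)%N by move=> co; rewrite rkE ltn_addr.
have dQ i : (i < d)%N -> (o + i < \rank Q)%N by move=> id'; rewrite rkE ltn_add2l.
have nD : `|D| <= KD.
  rewrite -(subrK 1 D) -(subrK (eta *: A) (D - 1)) /KD.
  apply: le_trans (ler_normD _ _) _; rewrite [leRHS]addrAC -addrA addrC; apply: lerD => //.
  rewrite addrC; apply: le_trans (ler_normD _ _) _; rewrite addrC; apply: lerD.
    apply: (le_trans HD); rewrite -[leRHS]mulr1 ler_wpM2l//.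
    by rewrite exprn_ile1// ltW.
  by rewrite normrZ gtr0_norm// -[leRHS]mul1r ler_wpM2r.
have nb c : (c < \rank Q)%N -> `|b c| <= CB.
  move=> cQ; rewrite -(subrK (D ^+ c) (b c)) addrC; apply: le_trans (ler_normD _ _) _.
  apply: lerD; last exact: Hb.
  apply: le_trans (norm_mxX_le c nD) _; rewrite ler_wpM2l//.
  by apply: pow_bound => //; rewrite mulr_ge0.
pose lam i := (Q *m v (o + i)%N) i0 0.
have VV i : (i < d)%N -> [/\ a < `|lam i|, cone Q u i0 eps (v (o + i)%N) & forall j, `|v (o + i)%N j 0| < b0].
  move=> id'; have := Hv _ (dQ i id'); rewrite /L ltnNge leq_addr/=.
  by move=> /cone_formsP[].
(* [v (o + i)] is [lam i] times a vector whose image under [Q] is within [eps] of [Q u]. The scalar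
   is moved into the coefficients [al i]; the bound [|lam i| > a] undoes this at the end. *)
pose r i := (lam i)^-1 *: v (o + i)%N - u.
have lam0 i : (i < d)%N -> lam i != 0.
  by move=> /VV[H _ _]; rewrite -normr_gt0; exact: lt_trans H.
have vE i : (i < d)%N -> v (o + i)%N = lam i *: (u + r i).
  by move=> id'; rewrite /r addrC subrK scalerA divff ?lam0// scale1r.
have Qr i : (i < d)%N -> `|Q *m r i| <= eps.
  move=> id'; have [H1 H2 _] := VV i id'.
  rewrite mxnorm_le ?ltW//; apply/forallP => j; apply/forallP => j'; rewrite (ord1 j').
  rewrite /r mulmxBr -scalemxAr mxE [X in X + _]mxE [X in _ + X]mxE.
  have L0 : 0 < `|lam i| by rewrite normr_gt0 lam0.
  rewrite -(ler_pM2l L0) -normrM mulrBr mulrA divff ?lam0// mul1r.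
  have := ltW (H2 j); rewrite -/(lam i) [leRHS]mulrC [X in `|_ - X|]mulrC.
  by [].
pose al i := alpha (o + i)%N * lam i.
pose x1 := \sum_(c < o) alpha c *: (b c *m v c).
pose xu := \sum_(i < d) al i *: (Q *m (b (o + i)%N *m u)).
pose xr := \sum_(i < d) al i *: (Q *m (b (o + i)%N *m r i)).
have xE : Q *m \sum_(c < \rank Q) alpha c *: (b c *m v c) = Q *m x1 + (xu + xr).
  rewrite rkE big_split_ord/= mulmxDr; congr (_ + _).
  rewrite /xu /xr -big_split/= mulmx_sumr; apply: eq_bigr => i _.
  by rewrite -scalerDr -mulmxDr -mulmxDr {1}vE// -!scalemxAr scalerA.
pose S1 := \sum_(c < o) `|alpha c|.
pose S2 := \sum_(i < d) `|al i|.
have S10 : 0 <= S1 by rewrite sumr_ge0.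
have S20 : 0 <= S2 by rewrite sumr_ge0.
set X := `|Q *m \sum_(c < \rank Q) alpha c *: (b c *m v c)|.
have X0 : 0 <= X by exact: normr_ge0.
have xr_le : `|xr| <= Cb * eps * S2.
  apply: (@sumr_norm_ge R d n (fun i : 'I_d => Q *m (b (o + i)%N *m r i)) al) => i.
  have id' := ltn_ord i.
  have ib : inv_ker (b (o + i)%N) Q by apply: pb iQ; exact: dQ.
  apply: le_trans (norm_inv_ker _ ib) _; rewrite /Cb.
  have -> : bnd Q * (n%:R * CB * bnd (pinvmx Q)) * eps = bnd Q * (n%:R * CB * (bnd (pinvmx Q) * eps)) by ring.
  rewrite ler_wpM2l ?bnd_ge0//; apply: ler_pM => //.
  - exact: bnd_ge0.
  - by rewrite mulr_ge0// bnd_ge0.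
  - by rewrite /bnd ler_wpM2l// nb// dQ.
  - by rewrite ler_wpM2l ?bnd_ge0// Qr.
have xu_ge : c2 * S2 <= `|xu|.
  apply: (HB D pD HD (fun i => b (o + i)%N) al) => i id'.
  by apply: le_trans (Hb _ (dQ i id')) _; rewrite ge_min lexx orbT.
have x1_le : `|Q *m x1| <= C3 * S1.
  rewrite /x1 mulmx_sumr.
  under eq_bigr => c _ do rewrite -scalemxAr.
  apply: (@sumr_norm_ge R o n (fun c : 'I_o => Q *m (b c *m v c)) alpha) => c.
  apply: le_trans (norm_mulmx _ _) _; rewrite /C3 ler_wpM2l ?bnd_ge0//.
  apply: norm_mulmx_le; first by apply: nb; exact: oQ.
  have := Hv _ (oQ c (ltn_ord c)); rewrite /L ltn_ord => /bdL'-/(_ (ltn_ord c)) /andP[_ H].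
  by rewrite le_max H.
(* Under [N] the term [xu] vanishes, because every [b c] preserves the kernel of [N Q], which
   contains [u]. *)
have NX : c0' * S1 <= CN * X + CN * (Cb * eps * S2).
  have H1 : c0' * S1 <= `|N *m Q *m x1|.
    apply: (HL' D b v alpha pD HD).
    - by move=> c co; exact/pb/oQ.
    - by move=> c co; apply: le_trans (Hb _ (oQ c co)) _; rewrite ge_min lexx.
    - by move=> c co; have := Hv _ (oQ c co); rewrite /L co.
  have Nxu : N *m xu = 0.
    rewrite /xu mulmx_sumr big1// => i _; rewrite -scalemxAr.
    have ib : inv_ker (b (o + i)%N) (N *m Q) by apply: pb iNQ; exact: dQ.
    by have := ib u; rewrite -!mulmxA => ->; rewrite ?scaler0.
  have -> : CN * X + CN * (Cb * eps * S2) = CN * (X + Cb * eps * S2) by ring.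
  apply: (le_trans H1).
  have -> : N *m Q *m x1 = N *m (Q *m \sum_(c < \rank Q) alpha c *: (b c *m v c) - xr).
    by rewrite xE mulmxBr !mulmxDr Nxu add0r addrK mulmxA.
  apply: le_trans (norm_mulmx _ _) _; rewrite ler_wpM2l//.
  by apply: le_trans (ler_normB _ _) _; rewrite lerD2l.
have XX : c2 * S2 <= X + C3 * S1 + Cb * eps * S2.
  apply: (le_trans xu_ge).
  have -> : xu = Q *m \sum_(c < \rank Q) alpha c *: (b c *m v c) - Q *m x1 - xr.
    by rewrite xE (addrC (Q *m x1)) !addrK.
  apply: le_trans (ler_normB _ _) _; apply: lerD => //.
  by apply: le_trans (ler_normB _ _) _; rewrite lerD2l.
have S1_le : S1 <= (CN * X + CN * (Cb * eps * S2)) / c0'.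
  by rewrite ler_pdivlMr// mulrC.
have S2_le : S2 <= kk * X.
  rewrite /kk mulrAC ler_pdivlMr ?divr_gt0// mulrC.
  have H1 := ler_wpM2l C30 S1_le.
  have H2 := ler_wpM2r S20 Heps.
  have E1 : C3 * ((CN * X + CN * (Cb * eps * S2)) / c0') =
     C3 / c0' * CN * X + (C3 * (CN * Cb) / c0') * eps * S2 by field; rewrite gt_eqF.
  have E2 : ka * eps * S2 = Cb * eps * S2 + (C3 * (CN * Cb) / c0') * eps * S2 by rewrite /ka; ring.
  have E3 : (1 + C3 / c0' * CN) * X = X + C3 / c0' * CN * X by ring.
  have E4 : c2 * S2 = c2 / 2 * S2 + c2 / 2 * S2 by field.
  rewrite E1 in H1; rewrite E2 in H2; rewrite E4 in XX; rewrite E3.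
  clear -H1 H2 XX; move: H1 H2 XX; move: (C3 * S1) (C3 / c0' * CN * X) (C3 * (CN * Cb) / c0' * eps * S2).
  move: (Cb * eps * S2) (c2 / 2 * S2) => q1 q2 q3 q4 q5 *; lra.
have S1_le2 : S1 <= k2 * X.
  apply: (le_trans S1_le).
  have -> : k2 * X = (CN * X + CN * Cb * eps * kk * X) / c0' by rewrite /k2; ring.
  rewrite ler_wpM2r ?invr_ge0 ?(ltW c0'0)// lerD2l.
  have -> : CN * Cb * eps * kk * X = CN * (Cb * eps * (kk * X)) by ring.
  by rewrite ler_wpM2l// ler_wpM2l// mulr_ge0// ltW.
have S3_le : \sum_(i < d) `|alpha (o + i)%N| <= kk / a * X.
  rewrite mulrAC ler_pdivlMr//; apply: le_trans S2_le.
  rewrite mulr_suml; apply: ler_sum => i _; rewrite /al normrM ler_wpM2l//.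
  by have [H _ _] := VV i (ltn_ord i); exact: ltW.
rewrite mulrC ler_pdivrMr// rkE big_split_ord/=.
have -> : X * kt = k2 * X + kk / a * X + X by rewrite /kt; ring.
rewrite -[leLHS]addr0; apply: lerD => //; exact: lerD.
Qed.

Lemma heavy_flag nu A Q C : 0 <= C -> heavy nu A -> inv_ker A Q -> flag nu A Q C.
Proof.
move=> C0 hv; have [r] := ubnP (\rank Q); elim: r Q => // r IH Q; rewrite ltnS => rQ iQ.
have [->|Q0] := eqVneq Q 0; first by apply: flag_rank0; rewrite mxrank0.
have [u [i0 [u1 nuoo]]] := heavy_direction (hv Q Q0 iQ).
have Qu0 : Q *m u != 0.
  apply/eqP => Qu; move: u1; rewrite Qu mxE => /eqP; by rewrite eq_sym oner_eq0.
have [d [N [d0 rk iNQ Nu free]]] := quotient_step iQ Qu0.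
apply: (flag_step C0 iQ iNQ u1 Nu nuoo rk free); apply: IH => //.
by apply: leq_trans rQ; rewrite -rk -[X in (X < _)%N]addn0 ltn_add2l.
Qed.

End flag.

(** * Cosine polynomials and small-time asymptotics *)

Section trig_bounds.
Context {R : realType}.
Implicit Types x : R.

Lemma sin_mvt x : exists2 c, `|c| <= `|x| & sin x = cos c * x.
Proof.
have pos (y : R) : 0 <= y -> exists2 c, `|c| <= `|y| & sin y = cos c * y.
  move=> y0; have [|c] := @MVT_segment R sin cos 0 y y0.
    by apply: continuous_subspaceT => z; exact: continuous_sin.
  rewrite in_itv/= sin0 !subr0 => /andP[c0 cy] ->; exists c => //.
  by rewrite !ger0_norm.
have [/pos//|/ltW x0] := leP 0 x.
have [|c cx sE] := pos (- x); first by rewrite oppr_ge0.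
by exists c; [rewrite -(normrN x)|rewrite -[LHS]opprK -sinN sE mulrN opprK].
Qed.

Lemma abs_sin_le x : `|sin x| <= `|x|.
Proof.
have [c _ ->] := sin_mvt x; rewrite normrM -[leRHS]mul1r ler_wpM2r//.
exact: cos_max.
Qed.

Lemma one_sub_cosE x : 1 - cos x = 2 * sin (x / 2) ^+ 2.
Proof.
have -> : cos x = cos ((x / 2) *+ 2) by congr cos; rewrite -mulr_natr; field.
rewrite cos_mulr2n cos2sin2; ring.
Qed.

Lemma one_sub_cos_ge0 x : 0 <= 1 - cos x.
Proof. by rewrite subr_ge0 cos_le1. Qed.

Lemma one_sub_cos_le x : 1 - cos x <= x ^+ 2 / 2.
Proof.
rewrite one_sub_cosE -(real_normK (num_real (sin _))).
have := abs_sin_le (x / 2); move: (normr_ge0 (sin (x / 2))).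
have -> : x ^+ 2 / 2 = 2 * `|x / 2| ^+ 2 by rewrite real_normK ?num_real//; field.
by move=> s0 s1; rewrite ler_wpM2l// lerXn2r// nnegrE.
Qed.

Lemma sin_sub_le x : `|sin x - x| <= `|x| ^+ 3 / 2.
Proof.
have [c cx ->] := sin_mvt x.
have -> : cos c * x - x = - ((1 - cos c) * x) by ring.
rewrite normrN normrM (ger0_norm (one_sub_cos_ge0 c)).
have -> : `|x| ^+ 3 / 2 = (`|x| ^+ 2 / 2) * `|x| by field.
rewrite ler_wpM2r//; apply: le_trans (one_sub_cos_le c) _.
by rewrite ler_wpM2r ?invr_ge0// -(real_normK (num_real c)) lerXn2r// nnegrE.
Qed.

Lemma sin_ge_half x : `|x| <= 1 -> `|x| / 2 <= `|sin x|.
Proof.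
move=> x1; have H := sin_sub_le x.
have H1 : `|x| ^+ 3 <= `|x|.
  by rewrite -[leRHS]expr1; apply: ler_wiXn2l.
have H2 : `|x| <= `|sin x| + `|sin x - x|.
  by rewrite -{1}(subKr (sin x) x); apply: ler_normB.
lra.
Qed.

Lemma one_sub_cos_ge x : `|x| <= 1 -> x ^+ 2 / 8 <= 1 - cos x.
Proof.
move=> x1; rewrite one_sub_cosE.
have x2 : `|x / 2| <= 1.
  by rewrite normrM normfV (ger0_norm (ler0n R 2)) ler_pdivrMr// mul1r (le_trans x1)// ler1n.
have := sin_ge_half x2; rewrite -(real_normK (num_real (sin _))).
have -> : x ^+ 2 / 8 = 2 * (`|x / 2| / 2) ^+ 2.
  by rewrite exprMn real_normK ?num_real//; field.
by move=> H; rewrite ler_wpM2l// lerXn2r// nnegrE// divr_ge0.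
Qed.

Lemma expR_quad x : `|x| <= 1 / 2 -> `|expR x - 1 - x| <= 2 * x ^+ 2.
Proof.
move=> x2; have H1 := expR_ge1Dx x; have H2 := expR_ge1Dx (- x).
have x3 : x <= 1 / 2 by exact: le_trans (ler_norm x) x2.
have x4 : 0 < 1 - x by lra.
have H3 : expR x * (1 - x) <= 1.
  apply: (@le_trans _ _ (expR x * expR (- x))); first by rewrite ler_wpM2l ?expR_ge0.
  by rewrite -expRD subrr expR0.
rewrite ger0_norm; last by lra.
have H4 : expR x <= (1 - x)^-1 by rewrite -ler_pdivlMr// div1r in H3.
have H5 : (1 - x)^-1 <= 1 + x + 2 * x ^+ 2.
  rewrite -[leLHS]mul1r ler_pdivrMr//.
  have : 0 <= x ^+ 2 by exact: sqr_ge0.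
  have := mulr_ge0 (sqr_ge0 x) (ltW x4); rewrite expr2; nra.
lra.
Qed.

End trig_bounds.

Section dyadic.
Context {R : realType}.

Definition dy (p : nat) : R := (2 ^ p)%:R^-1.

Lemma dy_gt0 p : 0 < dy p.
Proof. by rewrite invr_gt0 ltr0n expn_gt0. Qed.

Lemma dyK p : (2 ^ p)%:R * dy p = 1.
Proof. by rewrite divff// pnatr_eq0 -lt0n expn_gt0. Qed.

Lemma dy_le1 p : dy p <= 1.
Proof. by rewrite invf_le1 ?ltr0n ?expn_gt0// ler1n expn_gt0. Qed.

Lemma dy_cvg0 : dy p @[p --> \oo] --> (0 : R).
Proof.
have -> : dy = geometric 1 (1 / 2).
  by apply/funext => p; rewrite /= /dy natrX mul1r expr_div_n expr1n div1r.
by apply: cvg_geometric; rewrite ger0_norm// ltr_pdivrMr// mul1r ltr1n.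
Qed.

Lemma dy_small (e : R) : 0 < e -> \forall p \near \oo, dy p < e.
Proof.
move=> e0; have /cvgrPdist_lt /(_ e e0) := dy_cvg0.
by apply: filterS => p; rewrite sub0r normrN gtr0_norm ?dy_gt0.
Qed.

(** The factor [cos (h b)] differs from 1 by a term of order [h^2], so the imaginary part [b] of the
    exponent leaves no trace in the derivative at 0. *)
Lemma exp_cos_deriv (a b : R) :
  (2 ^ p)%:R * (expR (dy p * a) * cos (dy p * b) - 1) @[p --> \oo] --> a.
Proof.
apply/cvgrPdist_le => e e0.
pose K := 2 * a ^+ 2 + expR `|a| * b ^+ 2.
have K0 : 0 <= K by apply: addr_ge0; apply: mulr_ge0; rewrite ?sqr_ge0 ?expR_ge0.
have K10 : 0 < K + 1 by rewrite ltr_wpDl.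
have a10 : 0 < 2 * (`|a| + 1) by rewrite mulr_gt0// ltr_wpDl.
near=> p.
have d1 : dy p < e / (K + 1) by near: p; apply: dy_small; rewrite divr_gt0.
have d2 : dy p < (2 * (`|a| + 1))^-1 by near: p; apply: dy_small; rewrite invr_gt0.
set h := dy p in d1 d2 *.
have h0 : 0 < h := dy_gt0 p.
have kh : (2 ^ p)%:R = h^-1 by rewrite /h /dy invrK.
have ha : `|h * a| <= 1 / 2.
  rewrite normrM gtr0_norm//; apply: (@le_trans _ _ (h * (`|a| + 1))).
    by rewrite ler_wpM2l ?lerDl ?(ltW h0).
  rewrite -ler_pdivlMr ?ltr_wpDl//; apply: le_trans (ltW d2) _.
  by rewrite invfM div1r.
have H1 := expR_quad ha.
have hle1 : h <= 1 := dy_le1 p.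
have H2 : expR (h * a) <= expR `|a|.
  rewrite ler_expR; apply: le_trans (ler_norm _) _; rewrite normrM gtr0_norm//.
  by rewrite -[leRHS]mul1r ler_wpM2r.
have H3 := one_sub_cos_le (h * b); have H4 := one_sub_cos_ge0 (h * b).
rewrite kh.
have -> : a - h^-1 * (expR (h * a) * cos (h * b) - 1) =
   - h^-1 * ((expR (h * a) - 1 - h * a) - expR (h * a) * (1 - cos (h * b))).
  by field; rewrite gt_eqF.
rewrite normrM normrN (@gtr0_norm _ h^-1) ?invr_gt0// mulrC ler_pdivrMr//.
apply: le_trans (ler_normB _ _) _.
have H5 : `|expR (h * a) * (1 - cos (h * b))| <= expR `|a| * ((h * b) ^+ 2 / 2).
  by rewrite normrM (ger0_norm (expR_ge0 _)) (ger0_norm H4) ler_pM ?expR_ge0.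
apply: (@le_trans _ _ (h ^+ 2 * K)).
  apply: le_trans (lerD H1 H5) _; rewrite /K.
  have -> : 2 * (h * a) ^+ 2 + expR `|a| * ((h * b) ^+ 2 / 2) =
    h ^+ 2 * (2 * a ^+ 2 + expR `|a| * b ^+ 2 / 2) by ring.
  rewrite ler_wpM2l ?sqr_ge0// lerD2l ler_pdivrMr// ler_peMr ?ler1n//.
  by rewrite mulr_ge0 ?expR_ge0 ?sqr_ge0.
rewrite expr2 -mulrA mulrC ler_wpM2r ?(ltW h0)//.
move: d1; rewrite ltr_pdivlMr// => /ltW; apply: le_trans.
by rewrite ler_wpM2l ?(ltW h0)// lerDl.
Unshelve. all: by end_near. Qed.

End dyadic.

Section cospoly.
Context {R : realType} {n : nat}.
Implicit Types (f g : 'cV[R]_n -> R) (u v : 'cV[R]_n).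

Lemma dotvE u v : dotv u v = \sum_i u i 0 * v i 0.
Proof. by rewrite /dotv mxE; apply: eq_bigr => i _; rewrite mxE. Qed.

Lemma dotvDl u u' v : dotv (u + u') v = dotv u v + dotv u' v.
Proof. by rewrite /dotv linearD/= mulmxDl mxE. Qed.

Lemma dotvDr u v v' : dotv u (v + v') = dotv u v + dotv u v'.
Proof. by rewrite /dotv mulmxDr mxE. Qed.

Lemma dotvNr u v : dotv u (- v) = - dotv u v.
Proof. by rewrite /dotv mulmxN mxE. Qed.

Lemma dotvNl u v : dotv (- u) v = - dotv u v.
Proof. by rewrite /dotv linearN/= mulNmx mxE. Qed.

Lemma dotvZl c u v : dotv (c *: u) v = c * dotv u v.
Proof. by rewrite /dotv linearZ/= -scalemxAl mxE. Qed.

Lemma dotv0r u : dotv u 0 = 0.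
Proof. by rewrite /dotv mulmx0 mxE. Qed.

Lemma dotv0l u : dotv 0 u = 0.
Proof. by rewrite /dotv trmx0 mul0mx mxE. Qed.

Lemma dotv_delta i v : dotv (delta_mx i 0) v = v i 0.
Proof. by rewrite /dotv trmx_delta -rowE mxE. Qed.

Lemma dotv_ge0 v : 0 <= dotv v v.
Proof. by rewrite dotvE sumr_ge0// => i _; rewrite -expr2 sqr_ge0. Qed.

Lemma dotv_norm_le u v : `|dotv u v| <= n%:R * `|u| * `|v|.
Proof.
rewrite dotvE; apply: le_trans (ler_norm_sum _ _ _) _.
apply: (@le_trans _ _ (\sum_(i < n) `|u| * `|v|)).
  by apply: ler_sum => i _; rewrite normrM ler_pM// le_mxnorm.
by rewrite sumr_const card_ord -mulrA mulr_natl.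
Qed.

Lemma mxnorm_attained v : v != 0 -> exists i, `|v| = `|v i 0|.
Proof.
move=> v0; have : mx_norm v != 0 by apply: contra v0 => /eqP/mx_norm_eq0 ->.
by move=> /mx_norm_neq0 [[i j]]/=; rewrite (ord1 j) => E; exists i.
Qed.

Lemma sqr_norm_le_dotv v : `|v| ^+ 2 <= dotv v v.
Proof.
have [->|/mxnorm_attained[i ->]] := eqVneq v 0.
  by rewrite normr0 expr0n/= dotv_ge0.
rewrite real_normK ?num_real// dotvE (bigD1 i)//= -expr2 lerDl.
by apply: sumr_ge0 => j _; rewrite -expr2 sqr_ge0.
Qed.

Lemma dotv_measurable u : measurable_fun setT (dotv u : borelV R n -> R).
Proof. exact: mulmx_coord_measurable. Qed.

(** Functions whose expectation under an increment is a combination of real parts of its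
    characteristic function. They form an algebra by the product formula for cosines. *)
Definition cospoly f := exists s : seq (R * 'cV[R]_n),
  forall v, f v = \sum_(cu <- s) cu.1 * cos (dotv cu.2 v).

Lemma cospoly_ext f g : f =1 g -> cospoly f -> cospoly g.
Proof. by move=> fg [s fs]; exists s => v; rewrite -fg. Qed.

Lemma cospoly_cos u : cospoly (fun v => cos (dotv u v)).
Proof. by exists [:: (1, u)] => v; rewrite big_seq1 mul1r. Qed.

Lemma cospoly_cst c : cospoly (cst c).
Proof. by exists [:: (c, 0)] => v; rewrite big_seq1 dotv0l cos0 mulr1. Qed.

Lemma cospolyD f g : cospoly f -> cospoly g -> cospoly (fun v => f v + g v).
Proof. by move=> [s fs] [t gt]; exists (s ++ t) => v; rewrite big_cat/= fs gt. Qed.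

Lemma cospolyZ c f : cospoly f -> cospoly (fun v => c * f v).
Proof.
move=> [s fs]; exists [seq (c * cu.1, cu.2) | cu <- s] => v.
by rewrite big_map fs mulr_sumr; apply: eq_bigr => cu _; rewrite mulrA.
Qed.

Lemma cospoly_sum I (r : seq I) (F : I -> 'cV[R]_n -> R) :
  (forall i, cospoly (F i)) -> cospoly (fun v => \sum_(i <- r) F i v).
Proof.
move=> cF; elim: r => [|i r IH].
  by apply: (@cospoly_ext (cst 0)); [move=> v; rewrite big_nil|exact: cospoly_cst].
apply: (@cospoly_ext (fun v => F i v + \sum_(j <- r) F j v)).
  by move=> v; rewrite big_cons.
exact: cospolyD.
Qed.

Lemma cospolyB f g : cospoly f -> cospoly g -> cospoly (fun v => f v - g v).
Proof.
move=> cf cg; apply: (@cospoly_ext (fun v => f v + -1 * g v)).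
  by move=> v; rewrite mulN1r.
by apply: cospolyD => //; exact: cospolyZ.
Qed.

Lemma cospolyM f g : cospoly f -> cospoly g -> cospoly (fun v => f v * g v).
Proof.
move=> [s fs] [t gt].
apply: (@cospoly_ext (fun v => \sum_(cu <- s) \sum_(du <- t)
   (cu.1 * du.1 / 2) * (cos (dotv (cu.2 + du.2) v) + cos (dotv (cu.2 - du.2) v)))).
  move=> v; rewrite fs gt mulr_suml; apply: eq_bigr => cu _.
  rewrite mulr_sumr; apply: eq_bigr => du _.
  by rewrite !dotvDl dotvNl cosD cosB; field.
do 2 (apply: cospoly_sum => ?); apply: cospolyZ; apply: cospolyD; exact: cospoly_cos.
Qed.

Lemma cospolyX f m : cospoly f -> cospoly (fun v => f v ^+ m).
Proof.
move=> cf; elim: m => [|m IH].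
  by apply: (@cospoly_ext (cst 1)); [move=> v; rewrite expr0|exact: cospoly_cst].
apply: (@cospoly_ext (fun v => f v * f v ^+ m)); first by move=> v; rewrite exprS.
exact: cospolyM.
Qed.

Lemma cospoly_sinM u u' : cospoly (fun v => sin (dotv u v) * sin (dotv u' v)).
Proof.
apply: (@cospoly_ext (fun v => (1 / 2) * (cos (dotv (u - u') v) - cos (dotv (u + u') v)))).
  by move=> v; rewrite !dotvDl dotvNl cosB cosD; field.
by apply: cospolyZ; apply: cospolyB; exact: cospoly_cos.
Qed.

Lemma cospoly_bm f : cospoly f -> bm (f : borelV R n -> R).
Proof.
move=> [s fs]; have -> : f = (fun v => \sum_(cu <- s) cu.1 * cos (dotv cu.2 v)) by apply/funext.
by apply: bm_sum => cu _; apply: bmZ; apply: bm_cos; exact: dotv_measurable.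
Qed.

End cospoly.

Lemma integrable_scale d (T : measurableType d) (R : realType)
  (mu : {measure set T -> \bar R}) (c : R) (f : T -> R) :
  mu.-integrable setT (EFin \o f) -> mu.-integrable setT (EFin \o (fun z => c * f z)).
Proof.
move=> If; rewrite (_ : EFin \o _ = (fun z => c%:E * (EFin \o f) z)%E); last first.
  by apply/funext => z; rewrite /= EFinM.
exact: integrableZl.
Qed.

Section levy_integrals.
Context {R : realType} {n : nat} (nu : {measure set (borelV R n) -> \bar R}).
Hypothesis nu_levy : is_levy_measure nu.
Implicit Types (f g : 'cV[R]_n -> R) (u v z : 'cV[R]_n).

Definition min1 z : R := Num.min 1 (dotv z z).

Lemma min1_ge0 z : 0 <= min1 z.
Proof. by rewrite le_min ler01 dotv_ge0. Qed.

Lemma dotv_continuous_sqr : continuous (fun z : 'cV[R]_n => dotv z z).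
Proof.
have -> : (fun z : 'cV[R]_n => dotv z z) = (fun z => \sum_i z i 0 * z i 0).
  by apply/funext => z; rewrite dotvE.
by apply: continuous_sumr => i; apply: continuous_mulr; exact: coord_continuous.
Qed.

Lemma min1_measurable : measurable_fun setT (min1 : borelV R n -> R).
Proof.
apply: measurable_minr => //; apply: continuous_measurable_cV.
exact: dotv_continuous_sqr.
Qed.

Lemma min1_integrable : nu.-integrable setT (EFin \o min1).
Proof.
apply/integrableP; split; first by apply/measurable_EFinP; exact: min1_measurable.
under eq_integral => z _ do rewrite /= ger0_norm ?min1_ge0//.
exact: nu_levy.2.
Qed.

Lemma levy_integrable f C : measurable_fun setT (f : borelV R n -> R) ->
  (forall z, `|f z| <= C * min1 z) -> nu.-integrable setT (EFin \o (f : borelV R n -> R)).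
Proof.
move=> mf fC; have I2 := integrable_scale C min1_integrable.
apply: (le_integrable _ _ _ I2) => //; first exact/measurable_EFinP.
by move=> z _ /=; rewrite lee_fin; apply: le_trans (fC z) _; exact: ler_norm.
Qed.

Lemma cos_sub_bound u z : `|cos (dotv u z) - 1| <= (2 + (n%:R * `|u|) ^+ 2) * min1 z.
Proof.
rewrite distrC ger0_norm ?one_sub_cos_ge0// /min1.
have c0 : 0 <= (n%:R * `|u|) ^+ 2 by exact: sqr_ge0.
have [z1|z1] := leP 1 (dotv z z).
  have := cos_geN1 (dotv u z); lra.
apply: le_trans (one_sub_cos_le _) _.
have H : dotv u z ^+ 2 <= (n%:R * `|u|) ^+ 2 * dotv z z.
  rewrite -(real_normK (num_real (dotv u z))).
  apply: (@le_trans _ _ ((n%:R * `|u| * `|z|) ^+ 2)).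
    by apply: lerXn2r; rewrite ?nnegrE ?mulr_ge0// dotv_norm_le.
  by rewrite exprMn ler_wpM2l// sqr_norm_le_dotv.
have := dotv_ge0 z; have := sqr_ge0 (dotv u z); lra.
Qed.

(** Real part of the Levy exponent when there is no Gaussian term. *)
Definition aexp u : R := \int[nu]_(z in [set: borelV R n]) (cos (dotv u (z : 'cV[R]_n)) - 1).

Lemma cos_measurable u : measurable_fun setT ((fun z => cos (dotv u z)) : borelV R n -> R).
Proof. by have [] := @bm_cos _ (borelV R n) R _ (dotv_measurable u). Qed.

Lemma cos_sub_integrable u :
  nu.-integrable setT (EFin \o ((fun z => cos (dotv u z) - 1) : borelV R n -> R)).
Proof.
apply: (@levy_integrable (fun z => cos (dotv u z) - 1)); last exact: cos_sub_bound.
by apply: measurable_funB => //; exact: cos_measurable.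
Qed.

Lemma cospoly_sub0_bound f : cospoly f -> exists2 C, 0 <= C & forall z, `|f z - f 0| <= C * min1 z.
Proof.
move=> [s fs]; exists (\sum_(cu <- s) `|cu.1| * (2 + (n%:R * `|cu.2|) ^+ 2)).
  by apply: sumr_ge0 => cu _; rewrite mulr_ge0// addr_ge0// sqr_ge0.
move=> z; rewrite !fs -sumrB mulr_suml; apply: le_trans (ler_norm_sum _ _ _) _.
apply: ler_sum => cu _; rewrite dotv0r cos0 -mulrBr normrM -mulrA ler_wpM2l//.
exact: cos_sub_bound.
Qed.

Lemma cospoly_sub0_integrable f : cospoly f ->
  nu.-integrable setT (EFin \o ((fun z => f z - f 0) : borelV R n -> R)).
Proof.
move=> cf; have [C _ HC] := cospoly_sub0_bound cf.
apply: (@levy_integrable (fun z => f z - f 0) C) => //; apply: measurable_funB => //.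
by have [] := cospoly_bm cf.
Qed.

Lemma cospoly_int f (s : seq (R * 'cV[R]_n)) :
  (forall v, f v = \sum_(cu <- s) cu.1 * cos (dotv cu.2 v)) ->
  \int[nu]_(z in [set: borelV R n]) (f z - f 0) = \sum_(cu <- s) cu.1 * aexp cu.2.
Proof.
move=> fs; have -> : \int[nu]_(z in [set: borelV R n]) (f z - f 0) =
    \int[nu]_(z in [set: borelV R n]) \sum_(cu <- s) cu.1 * (cos (dotv cu.2 (z : 'cV[R]_n)) - 1).
  apply: eq_Rintegral => z _; rewrite !fs -sumrB; apply: eq_bigr => cu _.
  by rewrite dotv0r cos0 -mulrBr.
elim: s {fs} => [|cu s IH].
  rewrite big_nil; under eq_Rintegral do rewrite big_nil.
  by rewrite /Rintegral integral0.
have inE : forall t : seq (R * 'cV[R]_n), nu.-integrable setT (EFin \o ((fun z =>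
    \sum_(cu <- t) cu.1 * (cos (dotv cu.2 z) - 1)) : borelV R n -> R)).
  move=> t; rewrite (_ : (fun z => _) = (fun z => (fun v => \sum_(cu <- t) cu.1 * cos (dotv cu.2 v)) z -
      (fun v => \sum_(cu <- t) cu.1 * cos (dotv cu.2 v)) 0)).
    by apply: (@cospoly_sub0_integrable (fun v => \sum_(cu <- t) cu.1 * cos (dotv cu.2 v))); exists t.
  apply/funext => z; rewrite -sumrB; apply: eq_bigr => du _.
  by rewrite dotv0r cos0 -mulrBr.
rewrite big_cons; under eq_Rintegral do rewrite big_cons.
rewrite RintegralD//; last first.
  by apply: integrable_scale; exact: cos_sub_integrable.
by rewrite IH RintegralZl//; exact: cos_sub_integrable.
Qed.

Section small_time.
Context {d} {T : measurableType d} (P : probability T R).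
Variables (Yp : nat -> T -> 'cV[R]_n) (b : 'cV[R]_n -> R).
Hypothesis mY : forall p, measurable_fun setT (Yp p : T -> borelV R n).
Hypothesis charY : forall p u, Ex P (fun w => cos (dotv u (Yp p w))) =
  expR (dy p * aexp u) * cos (dy p * b u).

Lemma cospoly_Ex f (s : seq (R * 'cV[R]_n)) p :
  (forall v, f v = \sum_(cu <- s) cu.1 * cos (dotv cu.2 v)) ->
  Ex P (fun w => f (Yp p w)) =
  \sum_(cu <- s) cu.1 * (expR (dy p * aexp cu.2) * cos (dy p * b cu.2)).
Proof.
move=> fs; under eq_Ex do rewrite fs.
have bc u : bm (fun w => cos (dotv u (Yp p w))).
  by apply: bm_cos; apply: measurableT_comp (mY p); exact: dotv_measurable.
rewrite Ex_sum => [|cu _]; last exact: bmZ.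
by apply: eq_bigr => cu _; rewrite ExZ// charY.
Qed.

(** The generator at the origin, applied to an even function: by linearity it reduces to
    [exp_cos_deriv] for each frequency. *)
Lemma cospoly_small_time f : cospoly f ->
  (2 ^ p)%:R * (Ex P (fun w => f (Yp p w)) - f 0) @[p --> \oo] -->
  \int[nu]_(z in [set: borelV R n]) (f z - f 0).
Proof.
move=> [s fs]; rewrite (cospoly_int fs).
have -> : (fun p => (2 ^ p)%:R * (Ex P (fun w => f (Yp p w)) - f 0)) =
   (fun p => \sum_(cu <- s) cu.1 * ((2 ^ p)%:R * (expR (dy p * aexp cu.2) * cos (dy p * b cu.2) - 1))).
  apply/funext => p; rewrite (cospoly_Ex _ fs) fs -sumrB mulr_sumr.
  by apply: eq_bigr => cu _; rewrite dotv0r cos0; ring.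
elim: s {fs} => [|cu s IH].
  by under eq_fun do rewrite big_nil; rewrite big_nil; exact: cvg_cst.
under eq_fun do rewrite big_cons; rewrite big_cons.
apply: cvgD => //; apply: cvgM; first exact: cvg_cst.
exact: exp_cos_deriv.
Qed.

End small_time.

End levy_integrals.

(** A rational substitute for [(1 - mu)^k <= exp (- k mu)]: the probability that none of [k]
    independent trials succeeds is at most [1 / (1 + k mu)]. *)
Lemma pow_one_sub_le (R : realType) (mu : R) k : 0 <= mu <= 1 ->
  (1 - mu) ^+ k * (1 + k%:R * mu) <= 1.
Proof.
move=> /andP[mu0 mu1]; elim: k => [|k IH]; first by rewrite expr0 mul0r addr0 mul1r.
apply: le_trans _ IH; rewrite exprS -natr1.
have -> : (1 - mu) * (1 - mu) ^+ k * (1 + (k%:R + 1) * mu) =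
  (1 - mu) ^+ k * (1 + k%:R * mu) - (1 - mu) ^+ k * (mu * mu * (k%:R + 1)) by ring.
rewrite gerBl; apply: mulr_ge0; first by apply: exprn_ge0; rewrite subr_ge0.
by apply: mulr_ge0; [exact: mulr_ge0|rewrite addr_ge0].
Qed.

(** * Uniform closure of the cosine polynomials *)

Section uniform_approximation.
Context {R : realType} {n : nat}.
Implicit Types (f g : 'cV[R]_n -> R).

(** The approximation is uniform on the whole space, because it is integrated against laws of
    increments that need not have bounded support. *)
Definition appr f := forall e, 0 < e -> exists2 g, cospoly g & forall v, `|f v - g v| <= e.

Lemma appr_ext f g : f =1 g -> appr f -> appr g.
Proof. by move=> fg af e /af [h ch Hh]; exists h => // v; rewrite -fg. Qed.

Lemma cospoly_appr f : cospoly f -> appr f.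
Proof. by move=> cf e e0; exists f => // v; rewrite subrr normr0 ltW. Qed.

Lemma appr_uniform_limit f :
  (forall e, 0 < e -> exists2 g, appr g & forall v, `|f v - g v| <= e) -> appr f.
Proof.
move=> H e e0; have e2 : 0 < e / 2 by rewrite divr_gt0.
have [g ag fg] := H _ e2; have [h ch gh] := ag _ e2; exists h => // v.
rewrite -(subrK (g v) (f v)) -addrA; apply: le_trans (ler_normD _ _) _.
by rewrite [leRHS]splitr lerD.
Qed.

Lemma appr_bounded f : appr f -> exists2 M, 0 < M & forall v, `|f v| <= M.
Proof.
move=> /(_ 1 ltr01) [g cg H]; have [_ [M HM]] := cospoly_bm cg.
exists (`|M| + 2); first by rewrite ltr_wpDl.
move=> v; rewrite -(subrK (g v) (f v)); apply: le_trans (ler_normD _ _) _.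
have := H v; have := HM v; have := ler_norm M; lra.
Qed.

Lemma apprD f g : appr f -> appr g -> appr (fun v => f v + g v).
Proof.
move=> af ag e e0; have e2 : 0 < e / 2 by rewrite divr_gt0.
have [f' cf Hf] := af _ e2; have [g' cg Hg] := ag _ e2.
exists (fun v => f' v + g' v); first exact: cospolyD.
move=> v; rewrite opprD addrACA; apply: le_trans (ler_normD _ _) _.
by rewrite [leRHS]splitr lerD.
Qed.

Lemma apprM f g : appr f -> appr g -> appr (fun v => f v * g v).
Proof.
move=> af ag e e0; have [M M0 HM] := appr_bounded af.
have [N N0 HN] := appr_bounded ag.
pose e1 := Num.min 1 (e / (M + N + 1)).
have MN : 0 < M + N + 1 by rewrite !addr_gt0.
have e10 : 0 < e1 by rewrite lt_min ltr01 divr_gt0.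
have [f' cf Hf] := af _ e10; have [g' cg Hg] := ag _ e10.
exists (fun v => f' v * g' v); first exact: cospolyM.
move=> v; have -> : f v * g v - f' v * g' v = f v * (g v - g' v) + (f v - f' v) * g' v by ring.
apply: le_trans (ler_normD _ _) _; rewrite !normrM.
have g'N : `|g' v| <= N + 1.
  rewrite -(subKr (g v) (g' v)); apply: le_trans (ler_normB _ _) _.
  by apply: lerD => //; apply: le_trans (Hg v) _; rewrite ge_min lexx.
apply: (@le_trans _ _ (M * e1 + e1 * (N + 1))); first by rewrite lerD// ler_pM.
rewrite (_ : _ + _ = e1 * (M + N + 1)); last by ring.
by rewrite -ler_pdivlMr// ge_min lexx orbT.
Qed.

Lemma apprZ c f : appr f -> appr (fun v => c * f v).
Proof. by move=> af; apply: apprM => //; apply: cospoly_appr; exact: cospoly_cst. Qed.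

Lemma apprB f g : appr f -> appr g -> appr (fun v => f v - g v).
Proof.
move=> af ag; apply: (@appr_ext (fun v => f v + -1 * g v)).
  by move=> v; rewrite mulN1r.
by apply: apprD => //; exact: apprZ.
Qed.

Lemma appr_prod I (r : seq I) (F : I -> 'cV[R]_n -> R) :
  (forall i, appr (F i)) -> appr (fun v => \prod_(i <- r) F i v).
Proof.
move=> cF; elim: r => [|i r IH].
  apply: (@appr_ext (cst 1)); first by move=> v; rewrite big_nil.
  by apply: cospoly_appr; exact: cospoly_cst.
apply: (@appr_ext (fun v => F i v * \prod_(j <- r) F j v)).
  by move=> v; rewrite big_cons.
exact: apprM.
Qed.

(* Babylonian iteration towards [|x|], which only uses sums and products. *)
Fixpoint absq (k : nat) (x : R) : R :=
  if k is k'.+1 then absq k' x + (x ^+ 2 - absq k' x ^+ 2) / 2 else 0.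

(** The error obeys [|x| - q' = (|x| - q) (1 - (|x| + q) / 2)], so the iterates stay below [|x|] and
    each step multiplies the error by at most [1 - |x| / 2]. *)
Lemma absq_bound k x : `|x| <= 1 ->
  0 <= absq k x <= `|x| /\ `|x| - absq k x <= `|x| * (1 - `|x| / 2) ^+ k.
Proof.
move=> x1; elim: k => [|k [/andP[q0 qx] IH]] /=.
  by rewrite lexx normr_ge0 subr0 expr0 !mulr1.
have -> : x ^+ 2 = `|x| ^+ 2 by rewrite real_normK ?num_real.
move: q0 qx IH.
move: (normr_ge0 x) x1; move: `|x| (absq k x) => y q y0 y1 q0 qx IH.
have E : y - (q + (y ^+ 2 - q ^+ 2) / 2) = (y - q) * (1 - (y + q) / 2) by field.
have d0 : 0 <= y - q by rewrite subr_ge0.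
have d1 : 0 <= 1 - (y + q) / 2 by lra.
have d2 : 0 <= (y - q) * (1 - (y + q) / 2) by exact: mulr_ge0.
split.
  apply/andP; split; last by rewrite -subr_ge0 E.
  apply: addr_ge0 => //; apply: divr_ge0 => //; rewrite subr_ge0.
  by rewrite lerXn2r ?nnegrE.
rewrite E exprS mulrCA [leRHS]mulrC.
apply: ler_pM => //; lra.
Qed.

Lemma appr_absq k f : appr f -> appr (fun v => absq k (f v)).
Proof.
move=> af; elim: k => [|k IH] /=; first by apply: cospoly_appr; exact: cospoly_cst.
apply: apprD => //; apply: (@appr_ext (fun v => 2^-1 * (f v * f v - absq k (f v) * absq k (f v)))).
  by move=> v; rewrite !expr2 mulrC.
by apply: apprZ; apply: apprB; exact: apprM.
Qed.

Lemma appr_abs f : appr f -> appr (fun v => `|f v|).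
Proof.
move=> af; have [M M0 HM] := appr_bounded af.
apply: (@appr_ext (fun v => M * `|M^-1 * f v|)).
  by move=> v; rewrite normrM gtr0_norm ?invr_gt0// mulVKf// gt_eqF.
apply: apprZ; have ag : appr (fun v => M^-1 * f v) by exact: apprZ.
have g1 v : `|M^-1 * f v| <= 1.
  by rewrite normrM gtr0_norm ?invr_gt0// ler_pdivrMl// mulr1.
have [g gE] : exists g, g = (fun v => M^-1 * f v) by exists (fun v => M^-1 * f v).
have {ag} : appr g by rewrite gE.
have {g1} : forall v, `|g v| <= 1 by rewrite gE.
have -> : (fun v => `|M^-1 * f v|) = (fun v => `|g v|) by rewrite gE.
move=> g1 ag; clear gE f af HM.
apply: appr_uniform_limit => e e0.
(* For [y] in [[0, 1]], [y (1 - y / 2)^k <= y / (1 + k y / 2) <= 2 / k], hence this choice of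
   [k]. *)
have [k Hk] : exists k, 2 / e < k%:R.
  by exists (Num.truncn (2 / e)).+1; exact: truncnS_gt.
exists (fun v => absq k (g v)); first exact: appr_absq.
move=> v; have [/andP[q0 qx] H] := absq_bound k (g1 v).
rewrite ger0_norm ?subr_ge0//; apply: le_trans H _.
move: (normr_ge0 (g v)) (g1 v); move: `|g v| => y y0 y1.
have y2 : 0 <= y / 2 <= 1 by apply/andP; split; lra.
have H1 := pow_one_sub_le k y2.
have H2 : 0 < 1 + k%:R * (y / 2).
  by apply: ltr_pwDl => //; rewrite mulr_ge0//; case/andP: y2.
have H3 : (1 - y / 2) ^+ k <= (1 + k%:R * (y / 2))^-1 by rewrite -[leRHS]div1r ler_pdivlMr.
apply: (le_trans (ler_wpM2l y0 H3)); rewrite ler_pdivrMr//.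
move: Hk; rewrite ltr_pdivrMr// => Hk.
have : 0 <= (k%:R * e - 2) * y by rewrite mulr_ge0// subr_ge0 ltW.
by move=> H4; apply: (le_trans (y := k%:R * e * y / 2)); lra.
Qed.

(** Ramp from 0 at [t] to 1 at [2 t], written with absolute values so that [appr] is stable under
    it. *)
Definition clip (t x : R) : R := (1 + `|(x - t) / t| - `|(x - t) / t - 1|) / 2.

Lemma clip_itv t x : 0 <= clip t x <= 1.
Proof.
rewrite /clip; move: ((x - t) / t) => y.
have := ler_normB y 1; have := ler_normD (y - 1) 1.
rewrite normr1 subrK => ? ?; apply/andP; split; first lra.
by rewrite ler_pdivrMr//; lra.
Qed.

Lemma clip0 t x : 0 < t -> x <= t -> clip t x = 0.
Proof.
move=> t0 xt; rewrite /clip.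
have y0 : (x - t) / t <= 0 by rewrite ler_pdivrMr// mul0r subr_le0.
have y1 : (x - t) / t - 1 <= 0 by lra.
by rewrite (ler0_norm y0) (ler0_norm y1); field; rewrite gt_eqF.
Qed.

Lemma clip1 t x : 0 < t -> 2 * t <= x -> clip t x = 1.
Proof.
move=> t0 xt; rewrite /clip.
have y0 : 1 <= (x - t) / t by rewrite ler_pdivlMr// mul1r; lra.
have y1 : 0 <= (x - t) / t by lra.
have y2 : 0 <= (x - t) / t - 1 by lra.
by rewrite (ger0_norm y1) (ger0_norm y2); field; rewrite gt_eqF.
Qed.

Lemma appr_clip t f : appr f -> appr (fun v => clip t (f v)).
Proof.
move=> af; have ac c : appr (fun=> c) by apply: cospoly_appr; exact: cospoly_cst.
have ay : appr (fun v => t^-1 * (f v - t)) by apply: apprZ; apply: apprB.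
apply: (@appr_ext (fun v => 2^-1 * ((1 + `|t^-1 * (f v - t)|) - `|t^-1 * (f v - t) - 1|))).
  by move=> v; rewrite /clip (mulrC t^-1) (mulrC 2^-1).
apply: apprZ; apply: apprB; last by apply: appr_abs; exact: apprB.
by apply: apprD => //; exact: appr_abs.
Qed.

End uniform_approximation.

Section smoothing.
Context {R : realType} {n : nat}.
Implicit Types (u v : 'cV[R]_n) (L : seq (R * 'M[R]_n)) (th : R).

(* [sin_scale th] tends to the identity as [th] tends to 0, and quadratic forms
   in its coordinates are cosine polynomials. *)
Definition sin_scale th v : 'cV[R]_n := \col_i (sin (th * v i 0) / th).

Lemma sin_scale_le th v : 0 < th -> `|sin_scale th v| <= `|v|.
Proof.
move=> th0; rewrite mxnorm_le//; apply/forallP => i; apply/forallP => j.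
rewrite mxE normrM normfV (gtr0_norm th0) ler_pdivrMr//.
apply: le_trans (abs_sin_le _) _; rewrite normrM (gtr0_norm th0) mulrC ler_wpM2r ?(ltW th0)//.
exact: le_mxnorm.
Qed.

Lemma sin_scale_sub th v : 0 < th -> `|sin_scale th v - v| <= th ^+ 2 * `|v| ^+ 3.
Proof.
move=> th0; rewrite mxnorm_le; last by rewrite mulr_ge0 ?exprn_ge0 ?(ltW th0).
apply/forallP => i; apply/forallP => j; rewrite !mxE (ord1 j).
have -> : sin (th * v i 0) / th - v i 0 = (sin (th * v i 0) - th * v i 0) / th.
  by field; rewrite gt_eqF.
rewrite normrM normfV (gtr0_norm th0) ler_pdivrMr//.
apply: le_trans (sin_sub_le _) _; rewrite normrM (gtr0_norm th0).
have -> : th ^+ 2 * `|v| ^+ 3 * th = (th * `|v|) ^+ 3 by ring.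
have H : (th * `|v i 0|) ^+ 3 <= (th * `|v|) ^+ 3.
  by rewrite lerXn2r ?nnegrE ?mulr_ge0 ?(ltW th0)// ler_wpM2l ?(ltW th0)// le_mxnorm.
have : 0 <= (th * `|v i 0|) ^+ 3 by rewrite exprn_ge0// mulr_ge0// ltW.
lra.
Qed.

Lemma sin_scale_ge th v : 0 < th -> th * `|v| <= 1 -> `|v| <= 2 * `|sin_scale th v|.
Proof.
move=> th0 tv; rewrite mxnorm_le; last by rewrite mulr_ge0.
apply/forallP => i; apply/forallP => j; rewrite (ord1 j).
have ti : `|th * v i 0| <= 1.
  rewrite normrM (gtr0_norm th0); apply: le_trans tv.
  by rewrite ler_wpM2l ?(ltW th0)// le_mxnorm.
have := sin_ge_half ti; rewrite normrM (gtr0_norm th0) => H.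
have := le_mxnorm (sin_scale th v) i 0; rewrite mxE normrM normfV (gtr0_norm th0).
rewrite ler_pdivrMr// => H2; have := le_trans H H2.
by rewrite ler_pdivrMr// [_ * th * 2](_ : _ = th * (2 * `|sin_scale th v|)) ?ler_pM2l//; ring.
Qed.

Lemma qform_lipschitz L : exists2 C : R, 0 <= C & forall aS u v, aS \in L ->
  `|qform aS u - qform aS v| <= C * (`|u - v| * (`|u| + `|v|)).
Proof.
exists (\sum_(aS <- L) \sum_(i < n) \sum_(j < n) `|aS.2 i j|).
  by rewrite !sumr_ge0// => ? _; rewrite !sumr_ge0// => ? _; rewrite sumr_ge0.
move=> aS u v aL; rewrite !qform_sum.
have e0 : 0 <= `|u - v| * (`|u| + `|v|) by rewrite mulr_ge0// addr_ge0.
rewrite opprD addrACA subrr add0r -sumrB.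
under eq_bigr do rewrite -sumrB.
apply: (@le_trans _ _ (\sum_(i < n) \sum_(j < n) `|aS.2 i j| * (`|u - v| * (`|u| + `|v|)))).
  apply: le_trans (ler_norm_sum _ _ _) _; apply: ler_sum => i _.
  apply: le_trans (ler_norm_sum _ _ _) _; apply: ler_sum => j _.
  rewrite -mulrBr normrM ler_wpM2l//.
  have -> : u i 0 * u j 0 - v i 0 * v j 0 =
    (u - v) i 0 * u j 0 + (u - v) j 0 * v i 0 by rewrite !mxE; ring.
  apply: le_trans (ler_normD _ _) _; rewrite mulrDr !normrM.
  by apply: lerD; apply: ler_pM => //; exact: le_mxnorm.
under eq_bigr do rewrite -mulr_suml.
rewrite -mulr_suml ler_wpM2r// (big_rem aS)//= lerDl.
by rewrite !sumr_ge0// => ? _; rewrite !sumr_ge0// => ? _; rewrite sumr_ge0.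
Qed.

Lemma appr_qform_sin th aS : appr (fun v => qform aS (sin_scale th v)).
Proof.
apply: cospoly_appr; apply: (@cospoly_ext _ _ (fun v => aS.1 + \sum_(i < n) \sum_(j < n)
   (aS.2 i j / th ^+ 2) * (sin (dotv (th *: delta_mx i 0) v) * sin (dotv (th *: delta_mx j 0) v)))).
  move=> v; rewrite qform_sum; congr (_ + _); apply: eq_bigr => i _; apply: eq_bigr => j _.
  by rewrite !dotvZl !dotv_delta !mxE expr2 invfM; ring.
apply: cospolyD; first exact: cospoly_cst.
by do 2 (apply: cospoly_sum => ?); apply: cospolyZ; exact: cospoly_sinM.
Qed.

(** Approximate indicator of [qset L]. Replacing the coordinates by sines makes it a uniform limit
    of cosine polynomials but also periodic, so it is meaningful only where [th |v| <= 1]. *)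
Definition cutoff L th t v : R := \prod_(aS <- L) clip t (qform aS (sin_scale th v)).

Lemma cutoff_itv L th t v : 0 <= cutoff L th t v <= 1.
Proof.
apply/andP; split; rewrite /cutoff.
  by rewrite prodr_ge0// => aS _; case/andP: (clip_itv t (qform aS (sin_scale th v))).
by apply: numdomain.Num.Theory.prodr_ile1 => aS _; exact: clip_itv.
Qed.

Lemma appr_cutoff L th t : appr (cutoff L th t).
Proof. by apply: appr_prod => aS; apply: appr_clip; exact: appr_qform_sin. Qed.

(** The substitution of sines changes each form by less than [t]. A nonzero ramp means a substituted
    value above [t], hence a positive form; a form above [3 t] means a substituted value above
    [2 t], where the ramp is 1. *)
Lemma cutoff_near L t R0 : 0 < t -> 0 <= R0 ->
  (forall v, qset L v -> `|v| <= R0) ->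
  exists2 th0 : R, 0 < th0 & forall th, 0 < th <= th0 -> forall v, th * `|v| <= 1 ->
    (cutoff L th t v != 0 -> qset L v) /\
    ((forall aS, aS \in L -> 3 * t < qform aS v) -> cutoff L th t v = 1).
Proof.
move=> t0 R00 LR; have [C C0 HC] := qform_lipschitz L.
(* For [|v| <= 2 R0], the distance between [sin_scale th v] and [v] is at most [th (2 R0)^3] and the
   sum of their norms at most [4 R0]; the product gives [32 R0^4]. *)
have K0 : 0 < C * (32 * R0 ^+ 4) + 1.
  by rewrite ltr_wpDl// mulr_ge0// mulr_ge0// exprn_ge0.
pose th0 := Num.min 1 (t / (C * (32 * R0 ^+ 4) + 1)).
have th00 : 0 < th0 by rewrite lt_min ltr01 divr_gt0.
exists th0 => // th /andP[thp thle] v tv.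
have close : `|v| <= 2 * R0 -> forall aS, aS \in L ->
    `|qform aS (sin_scale th v) - qform aS v| < t.
  move=> vR aS aL; apply: le_lt_trans (HC _ _ _ aL) _.
  have H1 : `|sin_scale th v - v| <= th * (8 * R0 ^+ 3).
    apply: le_trans (sin_scale_sub _ thp) _; rewrite expr2 -mulrA.
    rewrite -[leRHS]mul1r mulrCA ler_pM ?mulr_ge0 ?exprn_ge0 ?(ltW thp)//.
      by apply: le_trans thle _; rewrite ge_min lexx.
    rewrite ler_wpM2l ?(ltW thp)//.
    have -> : 8 * R0 ^+ 3 = (2 * R0) ^+ 3 by ring.
    by rewrite lerXn2r// nnegrE// mulr_ge0.
  have H2 : `|sin_scale th v| + `|v| <= 4 * R0.
    have := sin_scale_le v thp; lra.
  apply: (@le_lt_trans _ _ (C * (th * (8 * R0 ^+ 3) * (4 * R0)))).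
    by rewrite ler_wpM2l// ler_pM ?addr_ge0.
  have -> : C * (th * (8 * R0 ^+ 3) * (4 * R0)) = th * (C * (32 * R0 ^+ 4)) by ring.
  apply: (@lt_le_trans _ _ (th * (C * (32 * R0 ^+ 4) + 1))).
    by rewrite ltr_pM2l// ltrDl.
  by rewrite -ler_pdivlMr//; apply: le_trans thle _; rewrite ge_min lexx orbT.
have big_q : (forall aS, aS \in L -> 3 * t < qform aS v) -> `|v| <= 2 * R0.
  move=> Hv; have /LR : qset L v.
    by move=> aS aL; apply: lt_trans (Hv aS aL); rewrite mulr_gt0.
  by move=> vR; lra.
split.
- rewrite /cutoff prodf_seq_neq0 => /allP/= Hall.
  have Hs aS : aS \in L -> t < qform aS (sin_scale th v).
    by move=> aL; rewrite ltNge; apply: contra (Hall _ aL) => H; rewrite clip0.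
  have sR : `|sin_scale th v| <= R0 by apply: LR => aS /Hs; apply: lt_trans.
  have vR : `|v| <= 2 * R0 by have := sin_scale_ge thp tv; lra.
  move=> aS aL; have := close vR _ aL; have := Hs _ aL.
  by rewrite ltr_norml => ? /andP[]; lra.
- move=> Hv; have vR := big_q Hv; rewrite /cutoff big_seq big1// => aS aL.
  apply: clip1 => //; have := close vR _ aL; have := Hv _ aL.
  by rewrite ltr_norml => ? /andP[]; lra.
Qed.

(** A cosine polynomial that vanishes at 0 and dominates a multiple of [(th |v|)^2] where
    [th |v| <= 1]. *)
Definition cosgap th v : R := n%:R^-1 * \sum_(i < n) (1 - cos (th * v i 0)).

Lemma cosgap_cospoly th : cospoly (cosgap th).
Proof.
apply: (@cospoly_ext _ _ (fun v => n%:R^-1 * \sum_(i < n) (1 - cos (dotv (th *: delta_mx i 0) v)))).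
  by move=> v; congr (_ * _); apply: eq_bigr => i _; rewrite dotvZl dotv_delta.
apply: cospolyZ; apply: cospoly_sum => i; apply: cospolyB; last exact: cospoly_cos.
exact: cospoly_cst.
Qed.

Lemma cosgap0 th : cosgap th 0 = 0.
Proof. by rewrite /cosgap big1 ?mulr0// => i _; rewrite mxE mulr0 cos0 subrr. Qed.

Lemma cosgap_itv th v : 0 <= cosgap th v <= 2.
Proof.
rewrite /cosgap; apply/andP; split.
  by rewrite mulr_ge0 ?invr_ge0// sumr_ge0// => i _; exact: one_sub_cos_ge0.
have [n0|n0] := posnP n; first by rewrite [n%:R^-1](_ : _ = 0) ?mul0r// n0 invr0.
rewrite mulrC ler_pdivrMr ?ltr0n//.
apply: (@le_trans _ _ (\sum_(i < n) 2)); last by rewrite sumr_const card_ord mulr_natr.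
by apply: ler_sum => i _; have := cos_geN1 (th * v i 0); lra.
Qed.

Lemma cosgap_ge th v : 0 < th -> th * `|v| <= 1 -> (th * `|v|) ^+ 2 / (8 * n%:R) <= cosgap th v.
Proof.
move=> th0 tv; have [->|v0] := eqVneq v 0; first by rewrite normr0 mulr0 expr0n mul0r cosgap0.
have [i vi] := mxnorm_attained v0; rewrite /cosgap invfM mulrA mulrC ler_wpM2l ?invr_ge0//.
rewrite (bigD1 i)//= ler_wpDr//; first by apply: sumr_ge0 => j _; exact: one_sub_cos_ge0.
have ti : `|th * v i 0| <= 1 by rewrite normrM (gtr0_norm th0) -vi.
apply: le_trans (one_sub_cos_ge ti).
by rewrite vi -(gtr0_norm th0) -normrM real_normK ?num_real// (gtr0_norm th0).
Qed.

(** Uniform approximation leaves an error near 0, where the Levy measure may be infinite.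
    Multiplication by this cosine polynomial, which vanishes at 0 and is close to 1 away from it,
    makes the error integrable. *)
Definition origin_cutoff th K v : R := 1 - (1 - 2^-1 * cosgap th v) ^+ K.

Lemma half_cosgap_itv th v : 0 <= 1 - 2^-1 * cosgap th v <= 1.
Proof. by have /andP[? ?] := cosgap_itv th v; apply/andP; split; lra. Qed.

Lemma origin_cutoff_itv th K v : 0 <= origin_cutoff th K v <= 1.
Proof.
have H := half_cosgap_itv th v; have /andP[H1 H2] := H.
rewrite /origin_cutoff subr_ge0 gerBl exprn_ge0// andbT.
by rewrite exprn_ile1.
Qed.

Lemma origin_cutoff_cospoly th K : cospoly (origin_cutoff th K).
Proof.
apply: cospolyB; first exact: cospoly_cst; apply: cospolyX.
by apply: cospolyB; [exact: cospoly_cst|apply: cospolyZ; exact: cosgap_cospoly].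
Qed.

Lemma origin_cutoff0 th K : origin_cutoff th K 0 = 0.
Proof. by rewrite /origin_cutoff cosgap0 mulr0 subr0 expr1n subrr. Qed.

Lemma origin_cutoff_near1 th w0 e : 0 < w0 -> 0 < e ->
  exists K, forall v, w0 <= cosgap th v -> 1 - e <= origin_cutoff th K v.
Proof.
move=> w00 e0; have [K HK] : exists K, (e * (w0 / 2))^-1 < K%:R.
  by exists (Num.truncn (e * (w0 / 2))^-1).+1; exact: truncnS_gt.
exists K => v wv; rewrite /origin_cutoff lerD2l lerN2.
have /andP[b0 b1] := cosgap_itv th v.
move: (cosgap th v) wv b0 b1 => b wb b0 b1.
have b2 : 0 <= 2^-1 * b <= 1 by apply/andP; split; lra.
have := pow_one_sub_le K b2.
have H0 : 0 < e * (w0 / 2) by rewrite mulr_gt0// divr_gt0.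
have : 1 <= e * (1 + K%:R * (2^-1 * b)).
  move: HK; rewrite -[_^-1]div1r ltr_pdivrMr// => /ltW HK; apply: (le_trans HK).
  have : 0 <= e * K%:R * (b - w0) by rewrite !mulr_ge0 ?subr_ge0// ltW.
  move: (K%:R : R) => k; lra.
have : 0 < 1 + K%:R * (2^-1 * b).
  by apply: ltr_pwDl => //; case/andP: b2 => ? _; rewrite mulr_ge0.
move: (1 + _) => c c0 H1 H2; rewrite -(ler_pM2r c0).
exact: le_trans H2 H1.
Qed.

End smoothing.

Section level_sets.
Context {R : realType} {n : nat} (nu : {measure set (borelV R n) -> \bar R}).
Implicit Types (L : seq (R * 'M[R]_n)).

(** The level [3 t] is the one above which [cutoff_near] makes the cutoff equal to 1. *)
Definition qlevel L (t : R) : set 'cV[R]_n := [set v | forall aS, aS \in L -> 3 * t < qform aS v].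

Lemma qlevelE L t : qlevel L t = qset [seq (aS.1 - 3 * t, aS.2) | aS <- L].
Proof.
apply/seteqP; split => v /= H.
  move=> aS /mapP[bS /H + ->]; rewrite /qform/=; lra.
move=> aS aL; have := H (aS.1 - 3 * t, aS.2).
by rewrite /qform/= => /(_ (map_f (fun aS => (aS.1 - 3 * t, aS.2)) aL)); lra.
Qed.

Lemma qlevel_measurable L t : measurable (qlevel L t : set (borelV R n)).
Proof. by rewrite qlevelE; exact: qset_measurable. Qed.

Lemma qlevel_exhaust L (M : R) : (M%:E < nu (qset L))%E ->
  exists2 t, 0 < t & (M%:E < nu (qlevel L t))%E.
Proof.
move=> HM; pose F k := qlevel L (k.+1%:R^-1 / 3).
have FU : \bigcup_k F k = qset L.
  apply/seteqP; split => v.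
    move=> [k _ Fk] aS aL; apply: lt_trans (Fk aS aL).
    by rewrite mulr_gt0// divr_gt0// invr_gt0.
  move=> vL; suff [k Hk] : exists k, forall aS, aS \in L -> k.+1%:R^-1 < qform aS v.
    exists k => // aS aL; apply: le_lt_trans (Hk aS aL).
    by rewrite mulrC divfK.
  elim: L vL {F HM} => [|aS L IH] vL; first by exists 0%N.
  have [k Hk] : exists k, forall aS, aS \in L -> k.+1%:R^-1 < qform aS v.
    by apply: IH => bS bL; apply: vL; rewrite inE bL orbT.
  have q0 : 0 < qform aS v by apply: vL; rewrite mem_head.
  have [j Hj] : exists j, (qform aS v)^-1 < j%:R.
    by exists (Num.truncn (qform aS v)^-1).+1; exact: truncnS_gt.
  exists (maxn k j) => bS; rewrite inE => /orP[/eqP ->|bL].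
    rewrite invf_plt ?posrE//; apply: lt_le_trans Hj _; rewrite ler_nat.
    by apply: leq_trans (leq_maxr k j) _.
  apply: le_lt_trans (Hk bS bL); rewrite lef_pV2 ?posrE ?ltr0n// ler_nat.
  by rewrite ltnS leq_maxl.
have : nu (F k) @[k --> \oo] --> nu (qset L).
  rewrite -FU; apply: nondecreasing_cvg_mu.
  - by move=> k; exact: qlevel_measurable.
  - by rewrite FU; exact: qset_measurable.
  - apply/nondecreasing_seqP => k; rewrite subsetEset => v Fk aS aL.
    apply: le_lt_trans (Fk aS aL); rewrite ler_wpM2l// ler_wpM2r//.
    by rewrite lef_pV2 ?posrE ?ltr0n// ler_nat.
move=> cv; apply: contrapT => noT; move: HM; rewrite ltNge => /negP; apply.
rewrite -(cvg_lim _ cv)//; apply: lime_le; first by apply/cvg_ex; exists (nu (qset L)).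
apply: nearW => k; rewrite leNgt; apply/negP => Hk; apply: noT.
by exists (k.+1%:R^-1 / 3) => //; rewrite divr_gt0// invr_gt0.
Qed.

End level_sets.

Lemma levy_finite_away (R : realType) (n : nat) (nu : {measure set (borelV R n) -> \bar R})
  (V : set 'cV[R]_n) (r0 : R) : is_levy_measure nu -> 0 < r0 ->
  measurable (V : set (borelV R n)) -> (forall v, V v -> r0 <= `|v|) -> (nu V < +oo)%E.
Proof.
move=> nu_levy r00 mV Vr; set c := Num.min 1 (r0 ^+ 2).
have c0 : 0 < c by rewrite lt_min ltr01 exprn_gt0.
have : nu.-integrable setT (EFin \o (\1_V : borelV R n -> R)).
  apply: (levy_integrable nu_levy (C := c^-1)) => [|z]; first exact: measurable_indic.
  rewrite indicE ger0_norm//; have [/set_mem/= /Vr rz|_] := boolP (z \in _); last first.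
    by apply: mulr_ge0; [rewrite invr_ge0 ltW|exact: min1_ge0].
  rewrite -ler_pdivrMl ?invr_gt0// invrK mulr1 /min1 le_min ge_min lexx/=.
  apply: le_trans (sqr_norm_le_dotv z); apply: (@le_trans _ _ (r0 ^+ 2)).
    by rewrite ge_min lexx orbT.
  by rewrite lerXn2r// nnegrE// ltW.
move=> /integrableP[_]; under eq_integral => z _ do rewrite /= ger0_norm ?indicE//.
by rewrite integral_indic// setIT.
Qed.

(** * Mass of quadratic sets under small increments *)

Section small_time_mass.
Context {R : realType} {n : nat} (nu : {measure set (borelV R n) -> \bar R}).
Hypothesis nu_levy : is_levy_measure nu.
Context {d} {T : measurableType d} (P : probability T R).
Variables (Yp : nat -> T -> 'cV[R]_n) (b : 'cV[R]_n -> R).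
Hypothesis mY : forall p, measurable_fun setT (Yp p : T -> borelV R n).
Hypothesis charY : forall p u, Ex P (fun w => cos (dotv u (Yp p w))) =
  expR (dy p * aexp nu u) * cos (dy p * b u).

Let mass p (V : set 'cV[R]_n) : R := fine (P [set w | V (Yp p w)]).

Let mV p V : measurable (V : set (borelV R n)) -> measurable [set w | V (Yp p w)].
Proof. by move=> mV; rewrite -[X in measurable X]setTI; exact: mY. Qed.

Let kdy p : (2 ^ p)%:R = (dy p)^-1 :> R.
Proof. by rewrite /dy invrK. Qed.

(** Markov's inequality for [cosgap], which is nonnegative and at least [w0] on the set when the
    scale [th] is adapted to [R0]; [cospoly_small_time] gives the order of its expectation. *)
Lemma mass_upper (L : seq (R * 'M[R]_n)) r0 R0 : 0 < r0 ->
  (forall v, qset L v -> r0 <= `|v| <= R0) ->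
  exists2 C, 0 <= C & \forall p \near \oo, mass p (qset L) <= C * dy p.
Proof.
move=> r00 LR; have [nE|n0] := posnP n.
  exists 0 => //; apply: nearW => p; rewrite mul0r /mass.
  rewrite [X in P X](_ : _ = set0) ?measure0//; apply/seteqP; split => // w /= /LR /andP[].
  have [->|/mxnorm_attained[i _]] := eqVneq (Yp p w) 0; first by rewrite normr0; lra.
  by have := ltn_ord i; rewrite {2}nE.
pose th := (`|R0| + 1)^-1; have th0 : 0 < th by rewrite invr_gt0 ltr_wpDl.
pose w0 := (th * r0) ^+ 2 / (8 * n%:R).
have w00 : 0 < w0 by rewrite divr_gt0 ?exprn_gt0 ?mulr_gt0// ltr0n.
have bw v : qset L v -> w0 <= cosgap th v.
  move=> /LR /andP[rv vR]; apply: le_trans (cosgap_ge th0 _).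
    rewrite ler_wpM2r ?invr_ge0 ?mulr_ge0//.
    by rewrite lerXn2r ?nnegrE ?mulr_ge0 ?(ltW th0) ?(ltW r00)// ler_wpM2l// ltW.
  rewrite /th mulrC ler_pdivrMr ?ltr_wpDl// mul1r.
  by apply: le_trans vR _; have := ler_norm R0; lra.
have cv := cospoly_small_time nu_levy mY charY (cosgap_cospoly th).
set I := \int[nu]_(z in _) _ in cv.
exists ((`|I| + 1) / w0); first by rewrite divr_ge0 ?addr_ge0// ltW.
have : \forall p \near \oo, (2 ^ p)%:R * (Ex P (fun w => cosgap th (Yp p w)) - cosgap th (0 : 'cV[R]_n)) < `|I| + 1.
  apply: (cvgr_lt I cv); have := ler_norm I; lra.
apply: filterS => p; rewrite cosgap0 subr0 kdy mulrC ltr_pdivrMr ?dy_gt0// => /ltW H.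
rewrite mulrAC ler_pdivlMr//; apply: le_trans H.
have mS := @mV p _ (qset_measurable L).
rewrite /mass -Ex_indic// mulrC -ExZ; last exact: bm_indic.
apply: le_Ex.
- by apply: bmZ; exact: bm_indic.
- apply: (bm_comp _ (mY p)); exact: (cospoly_bm (cosgap_cospoly th)).
- move=> w; rewrite indicE; have [/set_mem/= /bw|_] := boolP (w \in _).
    by rewrite mulr1.
  by rewrite mulr0; have /andP[] := cosgap_itv th (Yp p w).
Qed.

Hypothesis tight : forall e, 0 < e -> exists2 K : R, 0 < K &
  forall p, (2 ^ p)%:R * mass p [set v | K < `|v|] <= e.

Let mK K : measurable ([set v | K < `|v|] : set (borelV R n)).
Proof.
have -> : [set v : 'cV[R]_n | K < `|v|] = (fun v => `|v|) @^-1` [set x | K < x] by [].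
by apply: open_measurable_cV; apply: open_comp (@open_gt R K) => v _; exact: norm_continuous.
Qed.

(** The test function is [h = eK (a + e1)], where [a] approximates the cutoff within [e1] and [eK]
    is the cutoff at the origin; it lies between [eK] times the cutoff and the same plus [2 e1 eK].
    Its integral is almost at least the mass of [qlevel L t]. Its expectation is at most the wanted
    mass, plus the tail beyond [K1], where periodicity spoils the cutoff, plus [2 e1 E eK]. *)
Lemma mass_lower (L : seq (R * 'M[R]_n)) r0 R0 M : 0 < r0 ->
  (forall v, qset L v -> r0 <= `|v| <= R0) -> (M%:E < nu (qset L))%E ->
  \forall p \near \oo, M * dy p <= mass p (qset L).
Proof.
move=> r00 LR; have [nE|n0] := posnP n.
  rewrite [X in nu X](_ : _ = set0) ?measure0; last first.
    apply/seteqP; split => // v /= /LR /andP[].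
    have [->|/mxnorm_attained[i _]] := eqVneq v 0; first by rewrite normr0; lra.
    by have := ltn_ord i; rewrite {2}nE.
  rewrite lte_fin => M0; apply: nearW => p; apply: (@le_trans _ _ 0).
    by rewrite mulr_le0_ge0 ?ltW// dy_gt0.
  exact: fine_ge0.
move=> /qlevel_exhaust[t t0 HM].
have R00 : 0 <= `|R0| by [].
have LR' v : qset L v -> `|v| <= `|R0|.
  by move=> /LR/andP[_ H]; apply: le_trans H (ler_norm _).
have Lq v : qlevel L t v -> qset L v.
  by move=> H aS aL; apply: lt_trans (H aS aL); rewrite mulr_gt0.
have [th1 th10 Hth1] := cutoff_near t0 R00 LR'.
have mQ := @qlevel_measurable R n L t.
pose Ro := (`|R0| + 1)^-1; have Ro0 : 0 < Ro by rewrite invr_gt0 ltr_wpDl.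
have nuQ : (nu (qlevel L t) < +oo)%E.
  by apply: (levy_finite_away nu_levy r00) => // v /Lq /LR /andP[].
pose m := fine (nu (qlevel L t)).
have mE : nu (qlevel L t) = m%:E by rewrite fineK// ge0_fin_numE.
have m0 : 0 <= m by exact: fine_ge0.
have Mm : M < m by move: HM; rewrite mE lte_fin.
(* The gap [m - M] pays for four losses of size [g]: [dl m], the limit for [h], the tail, and the
   error [2 e1 eK]. *)
pose g := (m - M) / 6; have g0 : 0 < g by rewrite divr_gt0// subr_gt0.
have [K1 K10 HK1] := tight g0.
(* [th <= 1 / K1] makes [cutoff_near] applicable to all [v] with [|v| <= K1]. *)
pose th := Num.min th1 (Num.min Ro K1^-1).
have th0 : 0 < th by rewrite !lt_min th10 Ro0 invr_gt0.
have thR : th <= Ro by rewrite !ge_min lexx orbT.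
have thK : th * K1 <= 1 by rewrite -ler_pdivlMr// div1r !ge_min lexx !orbT.
have {}Hth1 := Hth1 th; rewrite th0 ge_min lexx /= in Hth1; have {}Hth1 := Hth1 isT.
pose w0 := (th * r0) ^+ 2 / (8 * n%:R).
have w00 : 0 < w0 by rewrite divr_gt0 ?exprn_gt0 ?mulr_gt0// ltr0n.
have Lth v : qset L v -> th * `|v| <= 1.
  move=> /LR' vR; apply: (@le_trans _ _ (Ro * `|R0|)).
    by apply: ler_pM => //; exact: ltW.
  by rewrite mulrC ler_pdivrMr ?ltr_wpDl// mul1r lerDl.
have bw v : qset L v -> w0 <= cosgap th v.
  move=> Lv; have /andP[rv _] := LR _ Lv; apply: le_trans (cosgap_ge th0 (Lth _ Lv)).
  rewrite ler_wpM2r ?invr_ge0 ?mulr_ge0//.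
  by rewrite lerXn2r ?nnegrE ?mulr_ge0 ?(ltW th0) ?(ltW r00)// ler_wpM2l// ltW.
pose dl := g / (m + 1); have dl0 : 0 < dl by rewrite divr_gt0// ltr_wpDl.
have [K HK] := @origin_cutoff_near1 R n th _ _ w00 dl0.
pose eK := @origin_cutoff R n th K; have ceK : cospoly eK by exact: origin_cutoff_cospoly.
have cve := cospoly_small_time nu_levy mY charY ceK.
set IK := \int[nu]_(z in _) _ in cve.
pose e1 := g / (2 * `|IK| + 1).
have IK1 : 0 < 2 * `|IK| + 1 by rewrite ltr_wpDl// mulr_ge0.
have e10 : 0 < e1 by rewrite divr_gt0.
have [a ca Ha] := appr_cutoff L th t e10.
pose h v := eK v * (a v + e1).
have ch : cospoly h by apply: cospolyM => //; apply: cospolyD => //; exact: cospoly_cst.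
have h0 : h 0 = 0 by rewrite /h /eK origin_cutoff0 mul0r.
have e0 : eK 0 = 0 by exact: origin_cutoff0.
have cvh := cospoly_small_time nu_levy mY charY ch.
set Ih := \int[nu]_(z in _) _ in cvh.
have hlow v : eK v * cutoff L th t v <= h v.
  have /andP[k0 _] := origin_cutoff_itv th K v.
  rewrite /h ler_wpM2l//; have := Ha v; rewrite ler_norml => /andP[]; lra.
have hup v : h v <= eK v * cutoff L th t v + 2 * e1 * eK v.
  have /andP[k0 _] := origin_cutoff_itv th K v.
  rewrite /h [2 * e1 * _]mulrC -mulrDr ler_wpM2l//.
  have := Ha v; rewrite ler_norml => /andP[]; lra.
have Ihm : (1 - dl) * m <= Ih.
  have IQ : nu.-integrable setT (EFin \o (\1_(qlevel L t) : borelV R n -> R)).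
    apply/integrableP; split; first by apply/measurable_EFinP; exact: measurable_indic.
    under eq_integral => z _ do rewrite /= ger0_norm ?indicE//.
    by rewrite integral_indic// setIT.
  have -> : (1 - dl) * m = \int[nu]_(z in [set: borelV R n]) ((1 - dl) * \1_(qlevel L t) z).
    by rewrite RintegralZl// /Rintegral integral_indic// setIT.
  apply: le_Rintegral => //.
  - exact: integrable_scale.
  - exact: (cospoly_sub0_integrable nu_levy ch).
  move=> z _; rewrite h0 subr0; apply: le_trans (hlow z).
  have /andP[k0 _] := origin_cutoff_itv th K z.
  have /andP[f0 _] := cutoff_itv L th t z.
  rewrite indicE; have [/set_mem/= zQ|_] := boolP (z \in _); last first.
    by rewrite mulr0 mulr_ge0.
  rewrite mulr1 (Hth1 _ (Lth _ (Lq _ zQ))).2// mulr1.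
  by apply: HK; apply: bw; exact: Lq.
have mS := @mV _ _ (qset_measurable L).
have mS1 := @mV _ _ (mK K1).
have hmass p : Ex P (fun w => h (Yp p w)) <=
    mass p (qset L) + mass p [set v | K1 < `|v|] + 2 * e1 * Ex P (fun w => eK (Yp p w)).
  rewrite /mass -!Ex_indic//; have beK := bm_comp (cospoly_bm ceK) (mY p).
  have b1 := @bm_indic _ _ R _ (mS p); have b2 := @bm_indic _ _ R _ (mS1 p).
  rewrite -ExD// -ExZ// -ExD//; [|exact: bmD|exact: bmZ].
  apply: le_Ex; [exact: bm_comp (cospoly_bm ch) (mY p)|by apply: bmD; [exact: bmD|exact: bmZ]|].
  move=> w; apply: le_trans (hup _) _; rewrite lerD2r.
  have /andP[k0 k1] := origin_cutoff_itv th K (Yp p w).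
  have /andP[f0 f1] := cutoff_itv L th t (Yp p w).
  rewrite !indicE.
  have [big|small] := ltP K1 `|Yp p w|.
    have -> : w \in [set w | [set v | K1 < `|v|] (Yp p w)] by exact/mem_set.
    by apply: ler_wpDl => //; exact: mulr_ile1.
  have tw : th * `|Yp p w| <= 1.
    by apply: le_trans thK; rewrite ler_wpM2l// ltW.
  have [->|/(Hth1 _ tw).1 VY] := eqVneq (cutoff L th t (Yp p w)) 0.
    by rewrite mulr0 addr_ge0.
  have -> : w \in [set w | qset L (Yp p w)] by exact/mem_set.
  by apply: ler_wpDr => //; exact: mulr_ile1.
have N1 : \forall p \near \oo, Ih - g < (2 ^ p)%:R * (Ex P (fun w => h (Yp p w)) - h 0).
  by apply: (cvgr_gt Ih cvh); lra.
have N2 : \forall p \near \oo,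
    (2 ^ p)%:R * (Ex P (fun w => eK (Yp p w)) - eK 0) < `|IK| + 1 / 2.
  by apply: (cvgr_lt IK cve); have := ler_norm IK; lra.
apply: filterS2 N1 N2 => p; rewrite h0 e0 !subr0 => N1 N2.
have N3 := HK1 p; have := hmass p.
have dlm : dl * m <= g.
  rewrite /dl mulrAC ler_pdivrMr ?ltr_wpDl// ler_wpM2l ?(ltW g0)//; lra.
have IKg : 2 * e1 * (`|IK| + 1 / 2) = g.
  by rewrite /e1; field; rewrite gt_eqF.
have g6 : 6 * g = m - M by rewrite /g; field.
move: N1; rewrite mulrC kdy ltr_pdivlMr ?dy_gt0// => N1.
move: N2; rewrite mulrC kdy ltr_pdivrMr ?dy_gt0// => N2.
move: N3; rewrite mulrC kdy ler_pdivrMr ?dy_gt0//.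
have dp0 : 0 < dy p :> R := dy_gt0 p.
move: N1 N2 Ihm IKg dlm g6 e10 g0 dp0; clear.
clearbody Ih e1 IK dl g m.
move: (mass p (qset L)) (mass p [set v | K1 < `|v|]) (Ex P (fun w => h (Yp p w))) (Ex P (fun w => eK (Yp p w))) => x1 x2 x3 x4.
move: (dy p) => h'.
move=> N1 N2 Ihm IKg dlm g6 e10 g0 h'0 N3 N4.
have H1 : 2 * e1 * x4 <= g * h'.
  rewrite -IKg -[leRHS]mulrA; apply: ler_wpM2l; last exact: ltW.
  by rewrite mulr_ge0// ltW.
have H2 : (M + 3 * g) * h' <= (Ih - g) * h' by rewrite ler_wpM2r ?(ltW h'0)//; lra.
have : 0 <= g * h' by rewrite mulr_ge0// ltW.
lra.
Qed.

End small_time_mass.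

(** * Cadlag paths and Euler schemes *)

Section cadlag_paths.
Context {R : realType} {n : nat}.
Implicit Types (f : R -> 'cV[R]_n) (s t : R).

Lemma cadlag_rightP f t e : cadlag f -> 0 <= t -> 0 < e ->
  exists2 dl, 0 < dl & forall s, t <= s < t + dl -> `|f s - f t| < e.
Proof.
move=> [rf _] t0 e0; have /cvgrPdist_lt/(_ e e0) := rf t t0.
move=> /nbhs_ballP[dl /= dl0 H]; exists dl => // s /andP[ts sd].
have [->|st] := eqVneq s t; first by rewrite subrr normr0.
have lt_ts : t < s by rewrite lt_neqAle eq_sym st.
rewrite distrC; apply: H => //; rewrite /ball/= distrC gtr0_norm ?subr_gt0//; lra.
Qed.

Lemma cadlag_leftP f t e : cadlag f -> 0 < t -> 0 < e ->
  exists2 dl, 0 < dl & forall s, t - dl < s < t -> `|f s - (f t - jump f t)| < e.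
Proof.
move=> [_ lf] t0 e0; have := lf t t0; rewrite /jump subKr.
move: (lim _) => l /cvgrPdist_lt/(_ e e0) /nbhs_ballP[dl /= dl0 H].
exists dl => // s /andP[ts st]; rewrite distrC; apply: H => //.
rewrite /ball/= gtr0_norm ?subr_gt0//; lra.
Qed.

(** Lebesgue number of a covering of [[0, t]], for a property of pairs of close times instead of
    points. *)
Lemma segment_uniform (t : R) (Q : R -> R -> Prop) :
  (forall x, 0 <= x <= t -> exists2 dl, 0 < dl & forall s s',
     0 <= s -> s' <= t -> s <= s' -> x - dl < s -> s' < x + dl -> Q s s') ->
  exists2 dl, 0 < dl & forall s s', 0 <= s -> s' <= t -> s <= s' -> s' - s < dl -> Q s s'.
Proof.
move=> loc; have /compact_near_coveringP cov := @segment_compact R 0 t.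
have := cov _ (0 : R)^'+ (fun dl s => forall s', 0 <= s -> s' <= t -> s <= s' -> s' - s < dl -> Q s s') _.
case; last first.
  move=> dl /= dl0 H; exists (dl / 2); first by rewrite divr_gt0.
  have dl2 : 0 < dl / 2 by rewrite divr_gt0.
  move=> s s' s0 st ss' sd; apply: (H (dl / 2)) => //=.
    rewrite sub0r normrN gtr0_norm//; lra.
  rewrite in_itv/= s0; lra.
move=> x /=; rewrite in_itv/= => xt; have [dl dl0 H] := loc x xt.
have dl2 : 0 < dl / 2 by rewrite divr_gt0.
near=> x' e => s' /= x0 s't xs sd.
have : ball x (dl / 2) x' by near: x'; exact: nbhsx_ballx.
rewrite /ball/= ltr_distlC => /andP[x1 x2].
have e1 : e < dl / 2 by near: e; exact: nbhs_right_lt.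
apply: H => //; lra.
Unshelve. all: by end_near. Qed.

Lemma cadlag_bounded f t : cadlag f -> exists2 K, 0 <= K & forall s, 0 <= s <= t -> `|f s| <= K.
Proof.
move=> cf; have /compact_near_coveringP cov := @segment_compact R 0 t.
have := cov _ (pinfty_nbhs R) (fun K s => 0 <= s -> `|f s| <= K) _.
case.
  move=> x /=; rewrite in_itv/= => /andP[x0 xt].
  have [d1 d10 H1] := cadlag_rightP cf x0 (@ltr01 R).
  have [l [d2 d20 H2]] : exists l, exists2 d2, 0 < d2 & forall s, 0 <= s -> x - d2 < s < x -> `|f s| <= l.
    have [->|xn0] := eqVneq x 0.
      by exists 0, 1 => // s s0 /andP[_]; rewrite ltNge s0.
    have xp : 0 < x by rewrite lt_neqAle eq_sym xn0.
    have [d2 d20 H2] := cadlag_leftP cf xp (@ltr01 R).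
    exists (`|f x - jump f x| + 1), d2 => // s _ /H2 /ltW.
    by move: (f x - _) => y Hy; rewrite -(subrK y (f s)) addrC (le_trans (ler_normD _ _))// lerD2l.
  near=> x' K => /= x'0.
  have K1 : `|f x| + 1 <= K by near: K; apply: nbhs_pinfty_ge; exact: num_real.
  have K2 : l <= K by near: K; apply: nbhs_pinfty_ge; exact: num_real.
  have : ball x d1 x' by near: x'; exact: nbhsx_ballx.
  rewrite /ball/= ltr_distlC => /andP[_ x1].
  have : ball x d2 x' by near: x'; exact: nbhsx_ballx.
  rewrite /ball/= ltr_distlC => /andP[x2 _].
  have [xx'|x'x] := leP x x'.
    apply: le_trans K1; rewrite -(subrK (f x) (f x')) addrC (le_trans (ler_normD _ _))// lerD2l.
    by apply/ltW/H1; rewrite xx'.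
  by apply: le_trans K2; apply: H2 => //; rewrite x2.
move=> K [_ H]; exists (`|K| + 1); first by rewrite addr_ge0.
move=> s /andP[s0 st]; apply: (H (`|K| + 1)) => //=.
  by apply: le_lt_trans (ler_norm K) _; rewrite ltrDl.
by rewrite in_itv/= s0.
Unshelve. all: by end_near. Qed.

(** Near a time [x], an increment over a short interval is either small, when both ends lie on the
    same side of [x], or close to the jump at [x]. The first kind misses [V] by the bound [r0], the
    second one because the complement of the closure is open. *)
Lemma no_jump_no_increment f t (V : set 'cV[R]_n) (r0 : R) : cadlag f -> 0 < r0 ->
  (forall v, V v -> r0 <= `|v|) -> (forall s, 0 < s <= t -> ~ closure V (jump f s)) ->
  exists2 dl, 0 < dl & forall s s', 0 <= s -> s' <= t -> s <= s' -> s' - s < dl ->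
    ~ V (f s' - f s).
Proof.
move=> cf r00 Vr nj; apply: segment_uniform => x /andP[x0 xt].
have r2 : 0 < r0 / 2 by rewrite divr_gt0.
have near2 y u v : `|u - y| < r0 / 2 -> `|v - y| < r0 / 2 -> ~ V (u - v).
  move=> uy vy /Vr; rewrite leNgt => /negP; apply.
  have -> : u - v = (u - y) - (v - y) by rewrite opprB addrA subrK.
  by apply: le_lt_trans (ler_normB _ _) _; rewrite [ltRHS]splitr ltrD.
have [d1 d10 H1] := cadlag_rightP cf x0 r2.
have [xE|xn0] := eqVneq x 0.
  exists d1 => // s s' s0 s't ss' sx s'x; apply: (near2 (f x)); apply: H1.
    by rewrite xE; apply/andP; split; [exact: le_trans s0 ss'|rewrite -xE].
  by rewrite xE s0 /= -xE; apply: le_lt_trans s'x.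
have xp : 0 < x by rewrite lt_neqAle eq_sym xn0.
have := nj x; rewrite xp xt => /(_ isT).
move=> ncl.
have : nbhs (jump f x) (~` closure V).
  by apply: open_nbhs_nbhs; split => //; apply: closed_openC; exact: closed_closure.
move=> /nbhs_ballP[e /= e0 He].
have e2 : 0 < Num.min (r0 / 2) (e / 2) by rewrite lt_min r2 divr_gt0.
have [d2 d20 H2] := cadlag_leftP cf xp e2.
have [d3 d30 H3] := cadlag_rightP cf x0 e2.
exists (Num.min d2 d3) => [|s s' s0 s't ss' sx s'x]; first by rewrite lt_min d20.
have sx2 : x - d2 < s by apply: le_lt_trans sx; rewrite lerD2l lerN2 ge_min lexx.
have sx3 : s' < x + d3 by apply: lt_le_trans s'x _; rewrite lerD2l ge_min lexx orbT.
have [xs|sltx] := leP x s.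
  apply: (near2 (f x)); apply: lt_le_trans (H3 _ _) _; rewrite ?ge_min ?lexx//.
    by rewrite (le_trans xs ss').
  by rewrite xs (le_lt_trans ss').
have [xs'|s'ltx] := leP x s'; last first.
  apply: (near2 (f x - jump f x)); apply: lt_le_trans (H2 _ _) _; rewrite ?ge_min ?lexx//.
    by rewrite s'ltx andbT (lt_le_trans sx2).
  by rewrite sx2.
move=> VV; apply: (He (f s' - f s)); last exact: subset_closure.
rewrite -ball_normE /ball_/=.
have -> : jump f x - (f s' - f s) = (f s - (f x - jump f x)) - (f s' - f x).
  by apply/matrixP => i j; rewrite !mxE; ring.
apply: le_lt_trans (ler_normB _ _) _; rewrite [ltRHS]splitr; apply: ltrD.
  by apply: lt_le_trans (H2 _ _) _; rewrite ?sx2// ge_min lexx orbT.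
by apply: lt_le_trans (H3 _ _) _; rewrite ?xs'// ge_min lexx orbT.
Qed.

End cadlag_paths.

Section riemann_sums.
Context {R : realType} (g : R -> R) (K : R).
Hypothesis gK : forall s, 0 <= s <= 1 -> `|g s| <= K.
Hypothesis g_right : forall s e, 0 <= s -> 0 < e ->
  exists2 dl, 0 < dl & forall t, s <= t < s + dl -> `|g t - g s| < e.
Let mu := @lebesgue_measure R.
Let D : set R := [set` `]0, 1]].

Definition cell p j : set R := [set` `](j%:R * dy p), (j.+1%:R * dy p)]].

(** The value at the right end of each half-open cell is taken: then right-continuity of [g]
    suffices for pointwise convergence. *)
Definition rstep p (s : R) : R := \sum_(j < 2 ^ p) g (j.+1%:R * dy p) * \1_(cell p j) s.

Lemma cellP p s : 0 < s <= 1 -> exists2 j, (j < 2 ^ p)%N & cell p j s.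
Proof.
move=> /andP[s0 s1].
have ex : exists m, s <= m%:R * dy p by exists (2 ^ p)%N; rewrite dyK.
have [[|m] sm mmin] := ex_minnP ex; first by move: sm; rewrite mul0r leNgt s0.
exists m; first by apply: mmin; rewrite dyK.
rewrite /cell/= in_itv/= sm andbT ltNge; apply/negP => /mmin; by rewrite ltnn.
Qed.

Lemma cell_inj p i j s : cell p i s -> cell p j s -> i = j.
Proof.
rewrite /cell/= !in_itv/= => /andP[i1 i2] /andP[j1 j2].
have := lt_le_trans i1 j2; have := lt_le_trans j1 i2.
rewrite !ltr_pM2r ?dy_gt0// !ltr_nat !ltnS => ? ?.
by apply/eqP; rewrite eqn_leq; apply/andP.
Qed.

Lemma rstepE p j s : (j < 2 ^ p)%N -> cell p j s -> rstep p s = g (j.+1%:R * dy p).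
Proof.
move=> jp cj; rewrite /rstep (bigD1 (Ordinal jp))//= big1 ?addr0.
  by rewrite indicE mem_set// mulr1.
move=> i ij; rewrite indicE memNset ?mulr0// => ci.
by move/eqP: ij; apply; apply/val_inj/(cell_inj ci cj).
Qed.

Lemma rstep_measurable p : measurable_fun setT (rstep p).
Proof.
apply: measurable_sum => j; apply: measurable_funM => //.
apply: measurable_indic; exact: measurable_itv.
Qed.

Lemma grid_itv p j : (j <= 2 ^ p)%N -> 0 <= j%:R * (dy p : R) <= 1.
Proof.
move=> jp; rewrite mulr_ge0 ?(ltW (dy_gt0 _))//= -[leRHS](dyK p).
by rewrite ler_pM2r ?dy_gt0// ler_nat.
Qed.

Lemma rstep_bound p s : D s -> `|rstep p s| <= K.
Proof.
rewrite /D/= in_itv/= => /cellP -/(_ p)[j jp cj]; rewrite (rstepE jp cj).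
by apply: gK; exact: grid_itv.
Qed.

Lemma rstep_cvg s : D s -> rstep p s @[p --> \oo] --> g s.
Proof.
rewrite /D/= in_itv/= => s01; have /andP[s0 _] := s01.
apply/cvgrPdist_lt => e e0; have [dl dl0 H] := g_right (ltW s0) e0.
near=> p; have dp : dy p < dl by near: p; exact: dy_small.
have [j jp cj] := cellP p s01; rewrite (rstepE jp cj) distrC; apply: H.
move: cj; rewrite /cell/= in_itv/= => /andP[s1 ->] /=.
by rewrite -natr1 mulrDl mul1r; lra.
Unshelve. all: by end_near. Qed.

Let mD : measurable D. Proof. exact: measurable_itv. Qed.

Let muD : (mu D < +oo)%E.
Proof. by rewrite /mu lebesgue_measure_itv/= lte_fin ltr01 -EFinB ltry. Qed.

Lemma rcont_measurable : measurable_fun D g.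
Proof.
apply: (@measurable_fun_cvg _ _ _ _ rstep); last exact: rstep_cvg.
by move=> p; apply: measurable_funTS; exact: rstep_measurable.
Qed.

Lemma bounded_integrable_unit (f : R -> R) (C : R) : measurable_fun D f ->
  (forall s, D s -> `|f s| <= C) -> mu.-integrable D (EFin \o f).
Proof.
move=> mf fC; have H := muD.
apply: measurable_bounded_integrable => //.
exists C; split; first exact: num_real.
by move=> M CM s Ds; apply: le_trans (fC _ Ds) (ltW CM).
Qed.

Let Ig : mu.-integrable D (EFin \o g).
Proof.
apply: (@bounded_integrable_unit g K); first exact: rcont_measurable.
by move=> s; rewrite /D/= in_itv/= => /andP[s0 s1]; apply: gK; rewrite ltW.
Qed.

Let dist p s := `|g s - rstep p s|.

Let Idist p : mu.-integrable D (EFin \o dist p).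
Proof.
apply: (@bounded_integrable_unit _ (K + K)).
  apply: measurableT_comp => //; apply: measurable_funB; first exact: rcont_measurable.
  by apply: measurable_funTS; exact: rstep_measurable.
move=> s Ds; rewrite /dist normr_id; apply: le_trans (ler_normB _ _) _.
apply: lerD; last exact: rstep_bound.
by move: Ds; rewrite /D/= in_itv/= => /andP[s0 s1]; apply: gK; rewrite ltW.
Qed.

Lemma rstep_L1 e : 0 < e -> \forall p \near \oo, \int[mu]_(s in D) dist p s <= e.
Proof.
move=> e0.
have := @dominated_convergence _ _ _ mu D mD (fun p => EFin \o rstep p) (EFin \o g) (cst K%:E).
case.
- by move=> p; apply/measurable_EFinP; apply: measurable_funTS; exact: rstep_measurable.
- by apply/measurable_EFinP; exact: rcont_measurable.
- apply: aeW => s Ds /=; apply: cvg_EFin; first exact: nearW.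
  exact: rstep_cvg.
- apply: (@bounded_integrable_unit (cst K) `|K|) => //.
- by apply: aeW => s p Ds; rewrite /= lee_fin; exact: rstep_bound.
move=> _ + _ => /fine_cvgP[_] /cvgrPdist_le/(_ e e0).
apply: filterS => p; rewrite /= sub0r normrN => H; apply: le_trans H.
apply: le_trans (ler_norm _); rewrite le_eqVlt; apply/orP; left; apply/eqP.
by congr fine; apply: eq_integral => s _; rewrite /= distrC.
Qed.

Lemma riemann_bound p m : (m <= 2 ^ p)%N ->
  `|\int[mu]_(s in [set` `]0, (m%:R * dy p)]]) g s - dy p * \sum_(j < m) g (j.+1%:R * dy p)|
  <= \int[mu]_(s in [set` `]0, (m%:R * dy p)]]) dist p s.
Proof.
elim: m => [|m IH] mp.
  rewrite mul0r big_ord0 mulr0 subr0 set_itv_ge ?bnd_simp ?ltxx//.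
  by rewrite !Rintegral_set0 normr0.
have /IH {}IH : (m <= 2 ^ p)%N by exact: ltnW.
set a : R := m%:R * dy p; set b : R := m.+1%:R * dy p.
have a0 : 0 <= a by rewrite mulr_ge0// ltW// dy_gt0.
have ab : a <= b by rewrite ler_wpM2r ?ler_nat// ltW// dy_gt0.
have b1 : b <= 1 by have /andP[] := grid_itv mp.
have sub : [set` `]0, b]] `<=` D.
  by apply: subset_itvl; rewrite bnd_simp.
have subc : [set` `]a, b]] `<=` D.
  by apply: subset_itv; rewrite bnd_simp.
have Igb : mu.-integrable [set` `]0, b]] (EFin \o g).
  by apply: integrableS Ig => //; exact: measurable_itv.
have Igc : mu.-integrable [set` `]a, b]] (EFin \o g).
  by apply: integrableS Ig => //; exact: measurable_itv.
have Idb : mu.-integrable [set` `]0, b]] (EFin \o dist p).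
  by apply: integrableS (Idist p) => //; exact: measurable_itv.
have := Rintegral_itvB Igb; rewrite -/mu => /(_ a); rewrite !bnd_simp => /(_ a0 ab) E1.
have := Rintegral_itvB Idb; rewrite -/mu => /(_ a); rewrite !bnd_simp => /(_ a0 ab) E2.
rewrite big_ord_recr/= mulrDr.
set x := \int[mu]_(s in [set` `]0, b]]) g s in E1 *.
set y := \int[mu]_(s in [set` `]0, a]]) g s in E1 IH *.
set x' := \int[mu]_(s in [set` `]0, b]]) dist p s in E2 *.
set y' := \int[mu]_(s in [set` `]0, a]]) dist p s in E2 IH *.
have cb : dy p * g b = \int[mu]_(s in [set` `]a, b]]) (cst (g b)) s.
  rewrite (@Rintegral_cst _ _ _ mu _ (measurable_itv `]a, b])).
  have muc : mu `]a, b] = (dy p)%:E.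
    rewrite /mu lebesgue_measure_itv/= lte_fin ltr_pM2r ?dy_gt0// ltr_nat ltnSn -EFinB.
    by rewrite /b /a -natr1 mulrDl mul1r addrAC subrr add0r.
  by rewrite [LHS]mulrC; congr (_ * _); have /(congr1 fine) := muc.
have Icb : mu.-integrable [set` `]a, b]] (EFin \o cst (g b)).
  apply: integrableS (bounded_integrable_unit (f := cst (g b)) (C := `|g b|) _ _) => //.
have Ec : `|x - y - dy p * g b| <= x' - y'.
  have mc : measurable ([set` `]a, b]] : set (measurableTypeR R)) by exact: measurable_itv.
  rewrite E1 E2 cb -(RintegralB mc Igc Icb).
  apply: le_trans (le_normr_Rintegral mc _) _; first exact: (integrableB mc Igc Icb).
  rewrite le_eqVlt; apply/orP; left; apply/eqP; apply: eq_Rintegral => s /set_mem cs.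
  by rewrite /dist (rstepE mp).
have -> : x - (dy p * \sum_(j < m) g (j.+1%:R * dy p) + dy p * g b) =
   (y - dy p * \sum_(j < m) g (j.+1%:R * dy p)) + (x - y - dy p * g b) by ring.
apply: le_trans (ler_normD _ _) _; rewrite -(subrK y' x') [leRHS]addrC; exact: lerD.
Qed.

(** The error up to any grid point is at most the L1 distance between [g] and [rstep p] on the whole
    of []0, 1]]. The Gronwall argument needs this uniformity in [m]. *)
Lemma riemann_uniform e : 0 < e -> \forall p \near \oo, forall m, (m <= 2 ^ p)%N ->
  `|\int[mu]_(s in [set` `[0, (m%:R * dy p)]]) g s - dy p * \sum_(j < m) g (j.+1%:R * dy p)| <= e.
Proof.
move=> /rstep_L1; apply: filterS => p H m mp; apply: le_trans H.
have /andP[m0 m1] := grid_itv mp.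
rewrite -Rintegral_itv_obnd_cbnd; last first.
  apply: integrableS Ig => //.
  by apply: subset_itvl; rewrite bnd_simp.
apply: le_trans (riemann_bound mp) _; rewrite -subr_ge0.
rewrite (Rintegral_itvB (Idist p)) ?bnd_simp//.
by apply: Rintegral_ge0 => s _; rewrite /dist.
Qed.

End riemann_sums.

Lemma mxD_E (R : realType) (m n : nat) (M N : 'M[R]_(m, n)) i j : (M + N) i j = M i j + N i j.
Proof. by rewrite mxE. Qed.

Lemma mxB_E (R : realType) (m n : nat) (M N : 'M[R]_(m, n)) i j : (M - N) i j = M i j - N i j.
Proof. by rewrite !mxE. Qed.

Lemma mxZ_E (R : realType) (m n : nat) c (M : 'M[R]_(m, n)) i j : (c *: M) i j = c * M i j.
Proof. by rewrite mxE. Qed.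

Section euler_scheme.
Context {R : realType} {n : nat}.
Implicit Types (A : 'M[R]_n) (x : 'cV[R]_n).

Definition euler_mx A p : 'M[R]_n := 1 + dy p *: A.

Fixpoint euler_steps (M : 'M[R]_n) x (xi : nat -> 'cV[R]_n) m : 'cV[R]_n :=
  if m is m'.+1 then M *m euler_steps M x xi m' + xi m' else x.

Lemma euler_stepsE (M : 'M[R]_n) x xi m :
  euler_steps M x xi m = M ^+ m *m x + \sum_(j < m) M ^+ (m - j.+1) *m xi j.
Proof.
elim: m => [|m IH] /=; first by rewrite big_ord0 addr0 expr0 mx1_mul.
rewrite IH mulmxDr big_ord_recr/= subnn expr0 mx1_mul exprS mulmxA -!addrA.
congr (_ + (_ + _)); rewrite mulmx_sumr; apply: eq_bigr => j _.
by rewrite mulmxA subSn// exprS.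
Qed.

Lemma discrete_gronwall (D : nat -> R) dl c k : 0 <= c -> 0 <= dl ->
  (forall m, (m <= k)%N -> D m <= dl + c * \sum_(j < m) D j) ->
  forall m, (m <= k)%N -> D m <= dl * (1 + c) ^+ m.
Proof.
move=> c0 dl0 H m mk; have c1 : 0 <= 1 + c by rewrite addr_ge0.
suff S j : (j <= m)%N -> dl + c * \sum_(i < j) D i <= dl * (1 + c) ^+ j.
  exact: le_trans (H _ mk) (S _ _).
elim: j => [|j IH] jm; first by rewrite big_ord0 mulr0 addr0 expr0 mulr1.
have {}IH := IH (ltnW jm).
rewrite big_ord_recr/= mulrDr addrA exprSr mulrA mulrDr mulr1; apply: lerD => //.
rewrite mulrC ler_wpM2r//; apply: le_trans IH; apply: H.
exact: leq_trans (ltnW jm) mk.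
Qed.

(** [X] and the scheme satisfy the same discrete integral equation, the former up to a Riemann error
    uniform in time; the noise is additive and cancels in the difference. *)
Lemma euler_converges A x (X Y : R -> 'cV[R]_n) : cadlag X -> Y 0 = 0 ->
  (forall t, 0 <= t -> X t = x
     + \col_i (\int[lebesgue_measure]_(s in [set` `[0, t]]) (A *m X s) i 0) + Y t) ->
  euler_steps (euler_mx A p) x (fun j => Y (j.+1%:R * dy p) - Y (j%:R * dy p)) (2 ^ p)
    @[p --> \oo] --> X 1.
Proof.
move=> cX Y0 XE; have [K K0 HK] := cadlag_bounded 1 cX.
pose g i s := (A *m X s) i 0; set a := bnd A; have a0 : 0 <= a by exact: bnd_ge0.
have gK i s : 0 <= s <= 1 -> `|g i s| <= a * K.
  move=> /HK XK; apply: le_trans (le_mxnorm _ i 0) _.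
  by apply: le_trans (norm_mulmx _ _) _; rewrite ler_wpM2l.
have g_right i s e : 0 <= s -> 0 < e ->
    exists2 dl, 0 < dl & forall t, s <= t < s + dl -> `|g i t - g i s| < e.
  move=> s0 e0; have a1 : 0 < a + 1 by rewrite ltr_wpDl.
  have [dl dl0 H] := cadlag_rightP cX s0 (divr_gt0 e0 a1); exists dl => // t st.
  have -> : g i t - g i s = (A *m (X t - X s)) i 0 by rewrite /g mulmxBr mxB_E.
  apply: le_lt_trans (le_mxnorm _ i 0) _; apply: le_lt_trans (norm_mulmx _ _) _.
  apply: (@le_lt_trans _ _ ((a + 1) * `|X t - X s|)); first by rewrite ler_wpM2r ?lerDl.
  by rewrite mulrC -ltr_pdivlMr//; exact: H.
apply/cvgrPdist_le => e e0.
have ea0 : 0 < expR a by exact: expR_gt0.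
(* Gronwall amplifies the error by at most [(1 + h a)^(2^p) <= exp a]. *)
pose dl := e / expR a; have dl0 : 0 < dl by rewrite divr_gt0.
have dl2 : 0 < dl / 2 by rewrite divr_gt0.
have aK0 : 0 < 4 * (a * K) + 1 by rewrite ltr_wpDl// mulr_ge0// mulr_ge0.
have N1 : \forall p \near \oo, forall i m, (m <= 2 ^ p)%N ->
    `|\int[lebesgue_measure]_(s in [set` `[0, (m%:R * dy p)]]) g i s -
      dy p * \sum_(j < m) g i (j.+1%:R * dy p)| <= dl / 2.
  apply: filter_forall => i; exact: (riemann_uniform (gK i) (g_right i) dl2).
have N2 : \forall p \near \oo, dy p < dl / (4 * (a * K) + 1) by apply: dy_small; rewrite divr_gt0.
apply: filterS2 N1 N2 => p N1 N2; set h := dy p in N1 N2 *.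
have h0 : 0 < h by exact: dy_gt0.
set xi := (fun j => _); set M := euler_mx A p.
pose E := euler_steps M x xi.
have EE m : E m = x + (Y (m%:R * h) - Y 0) + h *: \sum_(j < m) (A *m E j).
  elim: m => [|m IH] /=; first by rewrite mul0r subrr big_ord0 scaler0 !addr0.
  rewrite [E m.+1]/(M *m E m + xi m) big_ord_recr/= scalerDr /M /euler_mx mulmxDl mx1_mul -/h.
  rewrite -scalemxAl {1}IH /xi -/h.
  move: (Y (m.+1%:R * h)) (Y (m%:R * h)) (h *: (A *m E m)) (\sum_(j < m) _) => y1 y2 z1 z2.
  by apply/matrixP => i j; rewrite !mxE; ring.
have XX m i : (m <= 2 ^ p)%N -> `|X (m%:R * h) i 0 - (x + Y (m%:R * h)) i 0 -
    h * \sum_(j < m) g i (j%:R * h)| <= dl.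
  move=> mp; have /andP[m0 m1] := @grid_itv R p m mp; rewrite -/h in m0 m1.
  rewrite XE// -/h; move: (N1 i m mp); rewrite -/h.
  have -> : (x + \col_i0 \int[lebesgue_measure]_(s in [set` `[0, (m%:R * h)]]) (A *m X s) i0 0 + Y (m%:R * h)) i 0 =
     (x + Y (m%:R * h)) i 0 + \int[lebesgue_measure]_(s in [set` `[0, (m%:R * h)]]) g i s.
    by rewrite !mxE; ring.
  move: (\int[_]_(s in _) _) => I HI.
  (* The Riemann sums use right ends and the scheme uses left ends; the difference telescopes to a
     boundary term of size at most [2 a K], then multiplied by [h]. *)
  have -> : \sum_(j < m) g i (j%:R * h) = \sum_(j < m) g i (j.+1%:R * h) + (g i 0 - g i (m%:R * h)).
    elim: m {HI mp m0 m1 I} => [|m IH]; first by rewrite !big_ord0 mul0r subrr addr0.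
    by rewrite !big_ord_recr/= IH; ring.
  move: (\sum_(j < m) _) ((x + _) i 0) HI => S y HI.
  have -> : y + I - y - h * (S + (g i 0 - g i (m%:R * h))) = (I - h * S) - h * (g i 0 - g i (m%:R * h)) by ring.
  apply: le_trans (ler_normB _ _) _; rewrite [leRHS]splitr; apply: lerD => //.
  rewrite normrM (gtr0_norm h0).
  apply: (@le_trans _ _ (h * (2 * (a * K)))).
    rewrite ler_wpM2l ?(ltW h0)//; apply: le_trans (ler_normB _ _) _.
    have : `|g i 0| <= a * K by apply: gK; rewrite lexx ler01.
    have : `|g i (m%:R * h)| <= a * K by apply: gK; rewrite m0.
    lra.
  move: N2; rewrite ltr_pdivlMr// => N2.
  have : h * (4 * (a * K) + 1) <= dl by exact: ltW.
  lra.
pose D m := `|X (m%:R * h) - E m|.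
have HD m : (m <= 2 ^ p)%N -> D m <= dl + (h * a) * \sum_(j < m) D j.
  move=> mp; rewrite /D mxnorm_le; last first.
    by apply: addr_ge0; rewrite ?(ltW dl0)// mulr_ge0 ?sumr_ge0// mulr_ge0// ltW.
  apply/forallP => i; apply/forallP => j; rewrite (ord1 j) {j} EE Y0 subr0.
  have -> : (X (m%:R * h) - (x + Y (m%:R * h) + h *: \sum_(j < m) A *m E j)) i 0 =
    (X (m%:R * h) i 0 - (x + Y (m%:R * h)) i 0 - h * \sum_(j < m) g i (j%:R * h)) +
    h * \sum_(j < m) (A *m (X (j%:R * h) - E j)) i 0.
    rewrite mxB_E (mxD_E (x + _)) mxZ_E summxE.
    under [X in _ = _ + _ * X]eq_bigr do rewrite mulmxBr mxB_E.
    by rewrite sumrB /g; ring.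
  apply: le_trans (ler_normD _ _) _; apply: lerD; first exact: XX.
  rewrite normrM (gtr0_norm h0) -mulrA ler_wpM2l ?(ltW h0)// mulr_sumr.
  apply: le_trans (ler_norm_sum _ _ _) _; apply: ler_sum => j _.
  by apply: le_trans (le_mxnorm _ i 0) _; exact: norm_mulmx.
have ha0 : 0 <= h * a by rewrite mulr_ge0// ltW.
have := discrete_gronwall ha0 (ltW dl0) HD (leqnn _).
rewrite /D dyK => H; apply: le_trans H _.
apply: (@le_trans _ _ (dl * expR (h * a) ^+ (2 ^ p))).
  rewrite ler_wpM2l ?(ltW dl0)// lerXn2r ?nnegrE ?expR_ge0 ?addr_ge0//.
  exact: expR_ge1Dx.
by rewrite -expRM_natl mulrA dyK mul1r divfK// gt_eqF.
Qed.

End euler_scheme.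

(** * Increments of Levy processes *)

Lemma measurable_preim d1 (T : measurableType d1) d2 (V : measurableType d2) (f : T -> V)
  (E : set V) : measurable_fun setT f -> measurable E -> measurable [set w | E (f w)].
Proof. by move=> mf mE; rewrite -[X in measurable X]setTI; exact: mf. Qed.

Section linear_image.
Context {disp : measure_display} {T : measurableType disp} {R : realType}.
Variable P : probability T R.
Context {n d : nat} (B : 'M[R]_(n, d)) (Z : R -> T -> 'cV[R]_d).

Lemma mulmx_measurable : measurable_fun setT (mulmx B : borelV R d -> borelV R n).
Proof. by apply: measurable_fun_cV => i; exact: mulmx_coord_measurable. Qed.

Lemma mulmx_cvg {I : Type} (F : set_system I) {FF : Filter F} (f : I -> 'cV[R]_d) l :
  f s @[s --> F] --> l -> B *m f s @[s --> F] --> B *m l.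
Proof.
move=> /cvgrPdist_lt fl; apply/cvgrPdist_lt => e e0.
have b0 : 0 < bnd B + 1 by rewrite ltr_wpDl// bnd_ge0.
have := fl _ (divr_gt0 e0 b0); apply: filterS => s; rewrite ltr_pdivlMr// => H.
rewrite -mulmxBr; apply: le_lt_trans (norm_mulmx _ _) _.
by apply: le_lt_trans H; rewrite mulrC ler_wpM2l// lerDl ler01.
Qed.

Lemma mulmx_cadlag (f : R -> 'cV[R]_d) : cadlag f -> cadlag (fun t => B *m f t).
Proof.
move=> [rf lf]; split; first by move=> t t0; apply: mulmx_cvg; exact: rf.
by move=> t t0; apply/cvg_ex; exists (B *m lim (f s @[s --> t^'-])); apply: mulmx_cvg; exact: lf.
Qed.

Lemma norm_gt_measurable m (K : R) : measurable ([set v | K < `|v|] : set (borelV R m)).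
Proof.
have -> : [set v : 'cV[R]_m | K < `|v|] = (fun v => `|v|) @^-1` [set x | K < x] by [].
by apply: open_measurable_cV; apply: open_comp (@open_gt R K) => v _; exact: norm_continuous.
Qed.

Lemma sub_measurable m (f g : T -> 'cV[R]_m) :
  measurable_fun setT (f : T -> borelV R m) -> measurable_fun setT (g : T -> borelV R m) ->
  measurable_fun setT ((fun w => f w - g w) : T -> borelV R m).
Proof.
move=> mf mg; apply: measurable_fun_cV => i; under eq_fun do rewrite mxB_E.
by apply: measurable_funB; [exact: (measurableT_comp (coord_measurable_cV i) mf)|exact: (measurableT_comp (coord_measurable_cV i) mg)].
Qed.

Lemma dist_gt_measurable m (f g : T -> 'cV[R]_m) (e : R) :
  measurable_fun setT (f : T -> borelV R m) -> measurable_fun setT (g : T -> borelV R m) ->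
  measurable [set w | e < `|f w - g w|].
Proof.
move=> mf mg; exact: (measurable_preim (sub_measurable mf mg) (norm_gt_measurable e)).
Qed.

Lemma levy_process_mulmx : levy_process P Z -> levy_process P (fun t w => B *m Z t w).
Proof.
case=> mZ Z0 indZ stZ ctZ cZ; split.
- by move=> t t0; apply: measurableT_comp (mZ t t0); exact: mulmx_measurable.
- by apply: filterS Z0 => w ->; rewrite mulmx0.
- move=> k t E t0 tm mE.
  have := indZ k t (fun i => mulmx B @^-1` E i) t0 tm.
  have mE' i : measurable (mulmx B @^-1` E i : set (borelV R d)).
    by rewrite -[X in measurable X]setTI; exact: mulmx_measurable.
  move=> /(_ mE') H.
  transitivity (P [set w | forall i, (i < k)%N -> (mulmx B @^-1` E i) (Z (t i.+1) w - Z (t i) w)]).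
    by congr (P _); apply/funext => w; apply/propext; split => + i ik => /(_ i ik); rewrite /= mulmxBr.
  rewrite H; apply: eq_bigr => i _; congr (P _).
  by apply/funext => w /=; rewrite mulmxBr.
- move=> s t E s0 t0 mE.
  have mE' : measurable (mulmx B @^-1` E : set (borelV R d)).
    by rewrite -[X in measurable X]setTI; exact: mulmx_measurable.
  have := stZ s t _ s0 t0 mE'; rewrite /= => <-; congr (P _).
  by apply/funext => w /=; rewrite mulmxBr.
- move=> t e t0 e0; have b0 : 0 < bnd B + 1 by rewrite ltr_wpDl// bnd_ge0.
  have H := ctZ t _ t0 (divr_gt0 e0 b0).
  apply: (squeeze_cvge _ (cvg_cst 0%E) H).
  have : \forall s \near within [set s | 0 <= s] (nbhs t), 0 <= s by exact: withinT.
  apply: filterS => s s0; rewrite measure_ge0/=; apply: le_measure.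
  + by rewrite inE; apply: dist_gt_measurable; apply: (measurableT_comp mulmx_measurable); exact: mZ.
  + by rewrite inE; apply: dist_gt_measurable; exact: mZ.
  + move=> w /=; rewrite -mulmxBr => H1; rewrite ltr_pdivrMr//.
    apply: lt_le_trans H1 _; apply: le_trans (norm_mulmx _ _) _.
    by rewrite mulrC ler_wpM2l// lerDl ler01.
- by apply: filterS cZ => w; exact: mulmx_cadlag.
Qed.

End linear_image.

Section small_increments.
Context {disp : measure_display} {T : measurableType disp} {R : realType}.
Variable P : probability T R.
Context {n : nat} (Y : R -> T -> 'cV[R]_n).
Hypothesis Y_levy : levy_process P Y.

Definition incr p j (w : T) : 'cV[R]_n := Y (j.+1%:R * dy p) w - Y (j%:R * dy p) w.

Lemma incr_measurable p j : measurable_fun setT (incr p j : T -> borelV R n).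
Proof.
by apply: sub_measurable; apply: levy_measurable Y_levy _ _; rewrite mulr_ge0// ltW// dy_gt0.
Qed.

Lemma incr0_measurable p : measurable_fun setT (Y (dy p) : T -> borelV R n).
Proof. by apply: levy_measurable Y_levy _ _; rewrite ltW// dy_gt0. Qed.

Lemma incr_law p j (E : set 'cV[R]_n) : measurable (E : set (borelV R n)) ->
  P (incr p j @^-1` E) = P (Y (dy p) @^-1` E).
Proof.
move=> mE; have dp0 := ltW (dy_gt0 p : 0 < _ :> R).
have := levy_stationary_increments Y_levy (mulr_ge0 (ler0n R j) dp0) dp0 mE.
by rewrite /incr/= -natr1 mulrDl mul1r.
Qed.

Lemma incr_indep p k (E : 'I_k -> set (borelV R n)) : (forall i, measurable (E i)) ->
  P [set w | forall i, E i (incr p i w)] = (\prod_(i < k) P (Y (dy p) @^-1` E i))%E.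
Proof.
move=> mE; have dp0 := ltW (dy_gt0 p : 0 < _ :> R).
pose E' i := if (i < k)%N =P true is ReflectT H then E (Ordinal H) else setT.
have E'E (i : 'I_k) : E' i = E i.
  rewrite /E'; case: eqP => [H|]; last by rewrite ltn_ord.
  by congr E; exact/val_inj.
have mE' i : measurable (E' i) by rewrite /E'; case: eqP.
have := levy_independent_increments Y_levy k (t := fun i => i%:R * dy p) (E := E').
have p1 : 0 <= 0%:R * (dy p : R) by rewrite mul0r.
have p2 i : i%:R * (dy p : R) <= i.+1%:R * dy p by rewrite ler_wpM2r// ler_nat.
move=> /(_ p1 p2 mE') H.
transitivity (P [set w | forall i, (i < k)%N -> E' i (incr p i w)]).
  congr (P _); apply/funext => w; apply/propext; split => [Hw i ip|Hw i].
    by have := Hw (Ordinal ip); rewrite -E'E.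
  by rewrite -E'E; apply: Hw.
rewrite H; apply: eq_bigr => i _; rewrite -E'E; exact: incr_law.
Qed.

(** Cadlag paths are bounded on [[0, 1]], so the events that some dyadic increment, of any level,
    exceeds [K] decrease to a null set. *)
Lemma unbounded_incr_null :
  exists2 F : nat -> set T, (forall K, measurable (F K)) /\ P (F K) @[K --> \oo] --> 0%E &
  forall K p j, (j < 2 ^ p)%N -> [set w | K%:R < `|incr p j w|] `<=` F K.
Proof.
pose F K := \bigcup_p \bigcup_(j in [set j | (j < 2 ^ p)%N]) [set w | K%:R < `|incr p j w|].
have mF K : measurable (F K).
  apply: bigcupT_measurable => p; apply: bigcup_measurable => j _.
  exact: (measurable_preim (incr_measurable p j) (norm_gt_measurable _)).
exists F; last first.
  by move=> K p j jp w Kw; exists p => //; exists j.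
split=> //; have -> : 0%E = P (\bigcap_K F K).
  apply/esym; have := levy_cadlag Y_levy; rewrite /almost_everywhere => -[N [mN N0 sN]].
  apply: subset_measure0 N0 => //; first exact: bigcapT_measurable.
  move=> w Fw; apply: sN => /= cw; have [K K0 HK] := cadlag_bounded 1 cw.
  have [k Hk] : exists k, K + K < k%:R by exists (Num.truncn (K + K)).+1; exact: truncnS_gt.
  have [p _ [j jp]] := Fw k I; rewrite /= ltNge => /negP; apply.
  apply: le_trans (ltW Hk); apply: le_trans (ler_normB _ _) _.
  by apply: lerD; apply: HK; apply: grid_itv; rewrite // ltnW.
apply: nonincreasing_cvg_mu => //.
- by apply: le_lt_trans (ltry 1); exact: probability_le1.
- exact: bigcapT_measurable.
- apply/nonincreasing_seqP => K; rewrite subsetEset => w [p _ [j jp] H].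
  by exists p => //; exists j => //; apply: lt_trans H; rewrite /= ltr_nat.
Qed.

(** The probability [(1 - mu)^(2^p)] that no increment of level [p] exceeds [K] is close to 1
    uniformly in [p], which bounds [2^p mu]. *)
Lemma incr_tight e : 0 < e -> exists2 K : R, 0 < K &
  forall p, (2 ^ p)%:R * fine (P [set w | K < `|Y (dy p) w|]) <= e.
Proof.
move=> e0; have [F [mF F0] HF] := unbounded_incr_null.
(* With [x = (1 - mu)^(2^p)], the inequalities [2^p mu x <= 1 - x <= dl] and [x >= 1 / 2] give
   [2^p mu <= 2 dl <= e]. *)
pose dl := Num.min (1 / 2) (e / 2).
have dl0 : 0 < dl by rewrite lt_min !divr_gt0.
have /fine_cvgP[_ /cvgrPdist_lt /(_ _ dl0)] := F0.
move=> [K0 _ HK0]; have {HK0} := HK0 (maxn K0 1); rewrite /= leq_maxl => /(_ isT).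
rewrite sub0r normrN; set K := maxn _ _ => FK; exists K%:R.
  by rewrite ltr0n leq_max orbT.
move=> p; set mu := fine (P _).
have mS : measurable [set w | K%:R < `|Y (dy p) w|].
  exact: (measurable_preim (incr0_measurable p) (norm_gt_measurable _)).
have muE : P [set w | K%:R < `|Y (dy p) w|] = mu%:E by rewrite fineK// fin_num_measure.
have mu01 : 0 <= mu <= 1.
  by rewrite fine_ge0//= -lee_fin -muE probability_le1.
pose E := ~` [set v : 'cV[R]_n | K%:R < `|v|].
have mE : measurable (E : set (borelV R n)) by apply: measurableC; exact: norm_gt_measurable.
have := @incr_indep p (2 ^ p) (fun=> E) (fun=> mE).
have -> : P (Y (dy p) @^-1` E) = (1 - mu)%:E.
  rewrite (_ : Y (dy p) @^-1` E = ~` [set w | K%:R < `|Y (dy p) w|])// probability_setC//.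
  by rewrite muE -EFinB.
rewrite prodEFin prodr_const card_ord => HE.
have H1 : 1 - dl <= (1 - mu) ^+ (2 ^ p).
  rewrite -lee_fin -HE; apply: (@le_trans _ _ (P (~` F K))).
    rewrite probability_setC// EFinB leeB//.
    rewrite -[X in (X <= _)%E]fineK ?fin_num_measure// lee_fin.
    by apply: le_trans (ltW FK); exact: ler_norm.
  apply: le_measure; rewrite ?inE; first exact: measurableC.
    have mEi (i : 'I_(2 ^ p)) : measurable (incr p i @^-1` E).
      exact: (measurable_preim (incr_measurable p i) mE).
    rewrite (_ : [set w | _] = \bigcap_(i in [set: 'I_(2 ^ p)]) (incr p i @^-1` E)).
      by apply: fin_bigcap_measurable => // i _.
    by apply/seteqP; split => w H i; [move=> _; exact: H|exact: H].
  by move=> w nF i /= Kw; apply: nF; exact: (HF K p i (ltn_ord i)).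
have H2 := pow_one_sub_le (2 ^ p) mu01.
have dlh : dl <= 1 / 2 by rewrite ge_min lexx.
have dle : dl <= e / 2 by rewrite ge_min lexx orbT.
have k0 : 0 <= (2 ^ p)%:R :> R by [].
move: (_ ^+ _) (_%:R) k0 H1 H2 => x k k0 H1 H2.
have mu0 : 0 <= mu by case/andP: mu01.
have x12 : 1 / 2 <= x by lra.
have : 0 <= (x - 1 / 2) * (k * mu) by rewrite !mulr_ge0// subr_ge0.
lra.
Qed.

End small_increments.

Section characteristic_exponent.
Context {disp : measure_display} {T : measurableType disp} {R : realType}.
Variable P : probability T R.

(** The jump part of the exponent grows slower than [k^2] along a ray, by domination with [min1],
    whereas a Gaussian part is exactly quadratic. *)
Lemma aexp_scale_cvg0 n (nu : {measure set (borelV R n) -> \bar R}) u : is_levy_measure nu ->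
  aexp nu (k.+1%:R *: u) / k.+1%:R ^+ 2 @[k --> \oo] --> (0 : R).
Proof.
move=> nu_levy.
pose f (k : nat) (z : borelV R n) : R := (k.+1%:R ^+ 2)^-1 * (cos (dotv (k.+1%:R *: u) z) - 1).
have mf k : measurable_fun setT (f k).
  apply: measurable_funM => //; apply: measurable_funB => //; exact: cos_measurable.
pose C := 2 + (n%:R * `|u|) ^+ 2.
have C0 : 0 <= C by rewrite addr_ge0 ?sqr_ge0.
have fC k z : `|f k z| <= C * min1 z.
  rewrite /f normrM; have k0 : 0 < k.+1%:R :> R by rewrite ltr0n.
  rewrite ger0_norm ?invr_ge0 ?exprn_ge0// mulrC ler_pdivrMr ?exprn_gt0//.
  apply: le_trans (cos_sub_bound _ _) _; rewrite mulrAC ler_wpM2r ?min1_ge0//.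
  rewrite normrZ (gtr0_norm k0) mulrCA exprMn [leRHS]mulrDl [in leRHS]mulrC [X in _ <= _ + X]mulrC.
  rewrite lerD2r ler_peMl//; apply: exprn_ege1; by rewrite ler1n.
have f0 z : f k z @[k --> \oo] --> (0 : R).
  apply/cvgrPdist_lt => e e0.
  have [m Hm] : exists m, 2 / e < m%:R by exists (Num.truncn (2 / e)).+1; exact: truncnS_gt.
  exists m => // k mk; rewrite sub0r normrN /f normrM.
  have k0 : 0 < k.+1%:R :> R by rewrite ltr0n.
  rewrite ger0_norm ?invr_ge0 ?exprn_ge0// mulrC ltr_pdivrMr ?exprn_gt0//.
  apply: (@le_lt_trans _ _ 2).
    rewrite distrC ger0_norm ?one_sub_cos_ge0//; have := cos_geN1 (dotv (k.+1%:R *: u) z); lra.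
  rewrite mulrC -ltr_pdivrMr//; apply: lt_le_trans Hm _; apply: (@le_trans _ _ k.+1%:R).
    by rewrite ler_nat (leq_trans mk).
  by rewrite expr2 ler_peMl// ler1n.
have H : \int[nu]_(z in [set: borelV R n]) f k z @[k --> \oo] --> (0 : R).
  have := @dominated_convergence _ _ _ nu setT measurableT (fun k => EFin \o f k) (cst 0%E) (fun z => (C * min1 z)%:E).
  case.
  - by move=> k; exact/measurable_EFinP.
  - exact: measurable_cst.
  - apply: aeW => z _ /=; apply: cvg_EFin; [exact: nearW|exact: f0].
  - exact: (integrable_scale _ (min1_integrable nu_levy)).
  - by apply: aeW => z k _; rewrite lee_fin; exact: fC.
  by move=> _ _; rewrite integral0 => /fine_cvgP[].
have -> : (fun k => aexp nu (k.+1%:R *: u) / k.+1%:R ^+ 2) =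
   (fun k => \int[nu]_(z in [set: borelV R n]) f k z); last exact: H.
apply/funext => k; rewrite /f RintegralZl//; first by rewrite mulrC.
exact: cos_sub_integrable.
Qed.

Lemma Re_levy_exponent n b Q (nu : {measure set (borelV R n) -> \bar R}) u :
  complex.Re (levy_exponent b Q nu u) = - dotv u (Q *m u) / 2 + aexp nu u.
Proof. by []. Qed.

Lemma charfun_cos n (Y : R -> T -> 'cV[R]_n) b Q nu t u : levy_triplet P Y b Q nu -> 0 <= t ->
  Ex P (fun w => cos (dotv u (Y t w))) = expR (t * complex.Re (levy_exponent b Q nu u)) *
    cos (t * complex.Im (levy_exponent b Q nu u)).
Proof.
move=> [_ _ _ H] t0; have := congr1 (@complex.Re R) (H t u t0).
rewrite /charfun/= -/(Ex P _) => ->; rewrite /cexp; case: (levy_exponent b Q nu u) => x y /=.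
by rewrite !mul0r !subr0 !addr0.
Qed.

Lemma charfun_sin n (Y : R -> T -> 'cV[R]_n) b Q nu t u : levy_triplet P Y b Q nu -> 0 <= t ->
  Ex P (fun w => sin (dotv u (Y t w))) = expR (t * complex.Re (levy_exponent b Q nu u)) *
    sin (t * complex.Im (levy_exponent b Q nu u)).
Proof.
move=> [_ _ _ H] t0; have := congr1 (@complex.Im R) (H t u t0).
rewrite /charfun/= -/(Ex P _) => ->; rewrite /cexp; case: (levy_exponent b Q nu u) => x y /=.
by rewrite !mul0r !subr0 !addr0.
Qed.

Lemma charfun_modulus n (Y : R -> T -> 'cV[R]_n) b Q nu u : levy_triplet P Y b Q nu ->
  Ex P (fun w => cos (dotv u (Y 1 w))) ^+ 2 + Ex P (fun w => sin (dotv u (Y 1 w))) ^+ 2 =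
  expR (complex.Re (levy_exponent b Q nu u)) ^+ 2.
Proof.
move=> H; rewrite (charfun_cos u H ler01) (charfun_sin u H ler01) !mul1r !exprMn -mulrDr.
by rewrite cos2Dsin2 mulr1.
Qed.

Lemma dotv_mulmx n d (B : 'M[R]_(n, d)) u z : dotv u (B *m z) = dotv (B^T *m u) z.
Proof. by rewrite /dotv trmx_mul trmxK mulmxA. Qed.

Section image_exponent.
Context {n d : nat} (B : 'M[R]_(n, d)) (Z : R -> T -> 'cV[R]_d).
Variables (b : 'cV[R]_n) (Q : 'M[R]_n) (nuB : {measure set (borelV R n) -> \bar R}).
Variables (c : 'cV[R]_d) (nuZ : {measure set (borelV R d) -> \bar R}).
Hypothesis HY : levy_triplet P (fun t w => B *m Z t w) b Q nuB.
Hypothesis HZ : levy_triplet P Z c 0 nuZ.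

(** [<u, B Z_1>] and [<B^T u, Z_1>] are the same variable; the modulus of its characteristic
    function keeps only the real parts of the two exponents. *)
Lemma image_exponentE u : - dotv u (Q *m u) / 2 + aexp nuB u = aexp nuZ (B^T *m u).
Proof.
have HYm := charfun_modulus u HY; have HZm := charfun_modulus (B^T *m u) HZ.
rewrite Re_levy_exponent in HYm; rewrite Re_levy_exponent mul0mx dotv0r oppr0 mul0r add0r in HZm.
have E : expR (- dotv u (Q *m u) / 2 + aexp nuB u) ^+ 2 = expR (aexp nuZ (B^T *m u)) ^+ 2.
  rewrite -HYm -HZm; congr (_ ^+ 2 + _ ^+ 2); apply: eq_Ex => w; by rewrite dotv_mulmx.
apply: expR_inj; apply/eqP; rewrite -(@eqrXn2 _ 2) ?expR_ge0//; exact/eqP.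
Qed.

(** The Gaussian matrix in a triplet of [B Z] is a priori unknown. Replacing [u] by [k u] in
    [image_exponentE] and dividing by [k^2] isolates its quadratic form, which must vanish in the
    limit. *)
Lemma image_no_gaussian u : dotv u (Q *m u) = 0.
Proof.
have [_ _ nuBl _] := HY; have [_ _ nuZl _] := HZ.
have H k : - dotv u (Q *m u) / 2 =
    aexp nuZ (k.+1%:R *: (B^T *m u)) / k.+1%:R ^+ 2 - aexp nuB (k.+1%:R *: u) / k.+1%:R ^+ 2.
  have E := image_exponentE (k.+1%:R *: u); rewrite scalemxAr -E.
  rewrite -scalemxAr dotvZl /dotv -scalemxAr mxZ_E.
  have k0 : k.+1%:R != 0 :> R by rewrite pnatr_eq0.
  by move: (k.+1%:R) k0 => r r0; field.
have := @cvgB _ _ _ \oo _ _ _ _ _ (aexp_scale_cvg0 (B^T *m u) nuZl) (aexp_scale_cvg0 u nuBl).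
rewrite subr0 => /(_ _) cs.
have -> : dotv u (Q *m u) = -2 * (- dotv u (Q *m u) / 2) by field.
suff -> : - dotv u (Q *m u) / 2 = 0 by rewrite mulr0.
have cc : cst (- dotv u (Q *m u) / 2) k @[k --> \oo] --> (0 : R).
  rewrite (_ : cst _ = (fun k => aexp nuZ (k.+1%:R *: (B^T *m u)) / k.+1%:R ^+ 2) -
    (fun k => aexp nuB (k.+1%:R *: u) / k.+1%:R ^+ 2)); first exact: cs.
  by apply/funext => k; rewrite /cst (H k).
exact: (cvg_unique _ (cvg_cst _) cc).
Qed.

Lemma image_charfun p u : Ex P (fun w => cos (dotv u (B *m Z (dy p) w))) =
  expR (dy p * aexp nuB u) * cos (dy p * complex.Im (levy_exponent b Q nuB u)).
Proof.
rewrite (charfun_cos u HY) ?(ltW (dy_gt0 _))// Re_levy_exponent image_no_gaussian.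
by rewrite oppr0 mul0r add0r.
Qed.

End image_exponent.
End characteristic_exponent.

(** * Jumps fill the space *)

Lemma mx_pow_dim (R : realType) (n : nat) (A : 'M[R]_n) :
  exists c : nat -> R, A ^+ n = \sum_(k < n) c k *: A ^+ k.
Proof.
case: n A => [|m] A; first by exists (fun=> 0); rewrite big_ord0; apply/matrixP => -[].
exists (fun k => - (char_poly A)`_k).
have := Cayley_Hamilton A; rewrite -{1}[char_poly A]coefK poly_def size_char_poly.
rewrite linear_sum/=; under eq_bigr do rewrite linearZ/= rmorphXn/= horner_mx_X.
have /monicP := char_poly_monic A; rewrite lead_coefE size_char_poly/= => lc.
rewrite big_ord_recr/= lc scale1r => /eqP; rewrite addrC addr_eq0 => /eqP ->.
by rewrite -sumrN; apply: eq_bigr => k _; rewrite scaleNr.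
Qed.

Section subspaces.
Context {R : realType} {n : nat}.
Implicit Types (A Q : 'M[R]_n) (E W : {vspace 'cV[R]_n}) (v : 'cV[R]_n).

Lemma dim_cV : \dim {: 'cV[R]_n} = n.
Proof. by rewrite dimvf /dim/= muln1. Qed.

Lemma vspace_kernel E : exists Q, forall v, (v \in E) = (Q *m v == 0).
Proof.
pose f v := v - projv E v.
have fl a v w : f (a *: v + w) = a *: f v + f w.
  by rewrite /f linearP/= scalerBr; apply/matrixP => i j; rewrite !mxE; ring.
exists (\matrix_(i, j) f (delta_mx j 0) i 0) => v.
have -> : (\matrix_(i, j) f (delta_mx j 0) i 0) *m v = f v.
  have {2}-> : v = \sum_j v j 0 *: delta_mx j 0.
    apply/matrixP => i k; rewrite (ord1 k) summxE (bigD1 i)//= mxE mxE eqxx mulr1 big1 ?addr0//.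
    by move=> j ji; rewrite !mxE eq_sym (negbTE ji) mulr0.
  have fs (s : seq 'I_n) : f (\sum_(j <- s) v j 0 *: delta_mx j 0) = \sum_(j <- s) v j 0 *: f (delta_mx j 0).
    elim: s => [|j s IH]; first by rewrite !big_nil /f linear0 subr0.
    by rewrite !big_cons fl IH.
  rewrite fs; apply/matrixP => i k; rewrite (ord1 k) mxE summxE; apply: eq_bigr => j _.
  by rewrite [LHS]mulrC !mxE.
apply/idP/idP => [vE|]; first by rewrite /f projv_id// subrr.
by rewrite subr_eq0 => /eqP ->; exact: memv_proj.
Qed.

Lemma mem_cyclic A E i v : (i < n)%N -> v \in E -> A ^+ i *m v \in cyclic_span A E.
Proof.
move=> i_n vE; rewrite (coord_vbasis vE) mulmx_sumr; apply: memv_suml => j _.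
rewrite -scalemxAr; apply: memvZ; apply: memv_span; apply: allpairs_f.
  by rewrite mem_iota.
by apply: mem_nth; rewrite size_tuple.
Qed.

Lemma cyclic_span_min A E W : (E <= W)%VS -> (forall v, v \in W -> A *m v \in W) ->
  (cyclic_span A E <= W)%VS.
Proof.
move=> EW iW; apply/span_subvP => _ /allpairsP[[i e] [/= _ eE ->]].
elim: i => [|i IH]; first by rewrite expr0 mx1_mul; apply: (subvP EW); exact: vbasis_mem.
by rewrite exprS -mulmxA; exact: iW.
Qed.

Lemma memv_cyclic A E v : v \in E -> v \in cyclic_span A E.
Proof.
move=> vE; have [n0|n0] := posnP n.
  suff -> : v = 0 by exact: mem0v.
  by apply/matrixP => i; have := ltn_ord i; rewrite {2}n0.
by have := mem_cyclic A n0 vE; rewrite expr0 mx1_mul.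
Qed.

(** The powers in the span stop at [n - 1]; by the Cayley-Hamilton theorem [A ^+ n] brings nothing
    new. *)
Lemma cyclic_span_invariant A E v : v \in cyclic_span A E -> A *m v \in cyclic_span A E.
Proof.
pose f := linfun (mulmx A : 'cV[R]_n -> 'cV[R]_n).
suff H : (cyclic_span A E <= f @^-1: cyclic_span A E)%VS.
  by move=> /(subvP H); rewrite -memv_preim lfunE.
apply/span_subvP => _ /allpairsP[[i e] [/= + eE ->]]; rewrite mem_iota add0n /= => i_n.
rewrite -memv_preim lfunE/= mulmxA -[A *m _]exprS.
have eE' : e \in E by exact: vbasis_mem.
have [iltn|] := ltnP i.+1 n; first exact: mem_cyclic.
move=> ni; have {ni i_n} -> : i.+1 = n by apply/eqP; rewrite eqn_leq i_n.
suff [c ->] : exists c : nat -> R, A ^+ n = \sum_(k < n) c k *: A ^+ k.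
  rewrite mulmx_suml; apply: memv_suml => k _; rewrite -scalemxAl; apply: memvZ.
  exact: mem_cyclic.
exact: mx_pow_dim.
Qed.

Lemma free_lower_bound (c0 : R) (u : 'I_n -> 'cV[R]_n) W : 0 < c0 ->
  (forall alpha : 'I_n -> R, c0 * \sum_c `|alpha c| <= `|\sum_c alpha c *: u c|) ->
  (forall c, u c \in W) -> W = fullv.
Proof.
move=> c00 H uW; have fr : free [seq u c | c <- enum 'I_n].
  have -> : [seq u c | c <- enum 'I_n] = [tuple u c | c < n] by [].
  apply/freeP => k /eqP kE i.
  have := H k; have -> : \sum_c k c *: u c = 0.
    by rewrite -[RHS](eqP kE); apply: eq_bigr => c _; rewrite -tnth_nth tnth_mktuple.
  rewrite normr0 => Hk; apply/eqP; rewrite -normr_eq0 eq_le normr_ge0 andbT.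
  have : \sum_c `|k c| <= 0 by rewrite -(pmulr_rle0 _ c00).
  by apply: le_trans; rewrite (bigD1 i)//= lerDl sumr_ge0.
apply/eqP; rewrite eqEdim subvf/= dim_cV.
have /dimvS : (<<[seq u c | c <- enum 'I_n]>> <= W)%VS.
  by apply/span_subvP => _ /mapP[c _ ->].
by move: fr; rewrite /free size_map size_enum_ord => /eqP ->.
Qed.

End subspaces.

Section heavy_fills.
Context {disp : measure_display} {T : measurableType disp} {R : realType}.
Variable P : probability T R.
Context {n : nat} (A : 'M[R]_n) (nu : {measure set (borelV R n) -> \bar R}).
Variables (Y : R -> T -> 'cV[R]_n) (b : 'cV[R]_n -> R).
Hypothesis nu_levy : is_levy_measure nu.
Hypothesis Y_levy : levy_process P Y.
Hypothesis charY : forall p u, Ex P (fun w => cos (dotv u (Y (dy p) w))) =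
  expR (dy p * aexp nu u) * cos (dy p * b u).

Lemma incr_mass_lower (L : seq (R * 'M[R]_n)) r0 R0 M : 0 < r0 ->
  (forall v, qset L v -> r0 <= `|v| <= R0) -> (M%:E < nu (qset L))%E ->
  \forall p \near \oo, M * dy p <= fine (P [set w | qset L (Y (dy p) w)]).
Proof.
exact: (mass_lower nu_levy (incr0_measurable Y_levy) charY (incr_tight Y_levy)).
Qed.

Lemma dyadic_sub p q : (q <= p)%N -> (2 ^ (p - q))%:R * dy p = dy q :> R.
Proof.
move=> qp; rewrite /dy -{2}(subnK qp) expnD natrM invfM mulrA divff ?mul1r//.
Qed.

(** Without a jump in the closure of [qset L], all increments of sufficiently fine levels avoid
    [qset L]. The event [S] is the lower limit over [p] of these avoidance events, whose
    probabilities are [(1 - mu)^(2^(p - q))]; it only covers the absence of jumps, whose own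
    measurability is thus not at stake. *)
Lemma no_jump_event (L : seq (R * 'M[R]_n)) r0 R0 M q : 0 <= M -> 0 < r0 ->
  (forall v, qset L v -> r0 <= `|v| <= R0) -> (M%:E < nu (qset L))%E ->
  exists2 S, measurable S /\ (P S <= ((1 + M * dy q)^-1)%:E)%E &
  forall w, cadlag (Y ^~ w) ->
    (forall s, 0 < s <= dy q -> ~ closure (qset L) (jump (Y ^~ w) s)) -> S w.
Proof.
move=> M0 r00 LR HM; have dq0 : 0 < dy q :> R by exact: dy_gt0.
have mV : measurable (~` qset L : set (borelV R n)).
  by apply: measurableC; exact: qset_measurable.
pose G p := [set w | forall j : 'I_(2 ^ (p - q)), (~` qset L) (incr Y p j w)].
have mG p : measurable (G p).
  rewrite (_ : G p = \bigcap_(i in [set: 'I_(2 ^ (p - q))]) (incr Y p i @^-1` (~` qset L))).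
    apply: fin_bigcap_measurable => // i _.
    exact: (measurable_preim (incr_measurable Y_levy p i) mV).
  by apply/seteqP; split => w H i; [move=> _; exact: H|exact: H].
have PG : \forall p \near \oo, (P (G p) <= ((1 + M * dy q)^-1)%:E)%E.
  have H := incr_mass_lower r00 LR HM.
  have Hq : \forall p \near \oo, (q <= p)%N by exact: nbhs_infty_ge.
  apply: filterS2 H Hq => p; set mu := fine _ => Mmu qp.
  have mS : measurable [set w | qset L (Y (dy p) w)].
    exact: (measurable_preim (incr0_measurable Y_levy p) (qset_measurable L)).
  have muE : P [set w | qset L (Y (dy p) w)] = mu%:E by rewrite fineK// fin_num_measure.
  have mu01 : 0 <= mu <= 1.
    by rewrite fine_ge0//= -lee_fin -muE probability_le1.
  rewrite /G (incr_indep Y_levy p (E := fun=> ~` qset L) (fun=> mV)).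
  have -> : P (Y (dy p) @^-1` (~` qset L)) = (1 - mu)%:E.
    rewrite (_ : Y (dy p) @^-1` _ = ~` [set w | qset L (Y (dy p) w)])// probability_setC//.
    by rewrite muE -EFinB.
  rewrite prodEFin prodr_const card_ord lee_fin.
  have H2 := pow_one_sub_le (2 ^ (p - q)) mu01.
  have H3 : M * dy q <= (2 ^ (p - q))%:R * mu.
    by rewrite -(dyadic_sub qp) mulrCA ler_wpM2l.
  have x0 : 0 <= (1 - mu) ^+ (2 ^ (p - q)).
    by apply: exprn_ge0; case/andP: mu01 => _; rewrite subr_ge0.
  have Mq : 0 < 1 + M * dy q by rewrite ltr_wpDr// mulr_ge0// ltW.
  rewrite -[leRHS]div1r ler_pdivlMr//; apply: le_trans H2.
  by rewrite ler_wpM2l// lerD2l.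
pose H k := \bigcap_(p in [set p | (k <= p)%N]) G p.
have mH k : measurable (H k) by apply: bigcap_measurable => //; exists k => /=.
exists (\bigcup_k H k).
  split; first exact: bigcupT_measurable.
  have cv : P (H k) @[k --> \oo] --> P (\bigcup_k H k).
    apply: nondecreasing_cvg_mu => //; first exact: bigcupT_measurable.
    apply/nondecreasing_seqP => k; rewrite subsetEset => w Hk p /= kp.
    by apply: Hk => /=; exact: ltnW.
  rewrite -(cvg_lim _ cv)//; apply: lime_le; first by apply/cvg_ex; eexists; exact: cv.
  move: PG => [N _ HN]; apply: nearW => k.
  apply: (@le_trans _ _ (P (G (maxn k N)))); last by apply: HN; exact: leq_maxr.
  apply: le_measure; rewrite ?inE//.
  by move=> w; apply => /=; exact: leq_maxl.
move=> w cw nj; have [dl dl0 Hdl] := no_jump_no_increment cw r00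
  (fun v (Lv : qset L v) => proj1 (andP (LR v Lv))) nj.
have [N _ HN] := dy_small dl0.
exists (maxn N q) => // p /= Np j.
have qp : (q <= p)%N by apply: leq_trans Np; exact: leq_maxr.
apply: Hdl.
- by rewrite mulr_ge0// ltW// dy_gt0.
- by rewrite -(dyadic_sub qp) ler_wpM2r ?(ltW (dy_gt0 _))// ler_nat.
- by rewrite ler_wpM2r ?(ltW (dy_gt0 _))// ler_nat.
- rewrite -mulrBl -natrB// subSnn mul1r; apply: HN => /=.
  by apply: leq_trans Np; exact: leq_maxl.
Qed.

(** A jump found as a limit of increments lies only in the closure of the chosen set; the lower
    bound passes to the closure by continuity. *)
Lemma closure_lower_bound (c0 : R) (V : 'I_n -> set 'cV[R]_n) (D : 'I_n -> 'M[R]_n)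
    (alpha : 'I_n -> R) (v : 'I_n -> 'cV[R]_n) :
  (forall v, (forall c, V c (v c)) -> c0 * \sum_c `|alpha c| <= `|\sum_c alpha c *: (D c *m v c)|) ->
  (forall c, closure (V c) (v c)) ->
  c0 * \sum_c `|alpha c| <= `|\sum_c alpha c *: (D c *m v c)|.
Proof.
move=> H clv; apply/ler_addgt0Pr => e e0.
pose K := \sum_c `|alpha c| * bnd (D c).
have K0 : 0 <= K by apply: sumr_ge0 => c _; rewrite mulr_ge0// bnd_ge0.
have eK : 0 < e / (K + 1) by rewrite divr_gt0// ltr_wpDl.
have cl c : exists v', V c v' /\ `|v c - v'| < e / (K + 1).
  have [v' [Vv']] := clv c _ (nbhsx_ballx (v c) _ eK).
  by rewrite -ball_normE; exists v'.
have /choice[v' Hv'] := cl.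
apply: le_trans (H v' _) _; first by move=> c; have [] := Hv' c.
have -> : \sum_c alpha c *: (D c *m v' c) =
  \sum_c alpha c *: (D c *m v c) - \sum_c alpha c *: (D c *m (v c - v' c)).
  rewrite -sumrB; apply: eq_bigr => c _; rewrite -scalerBr -mulmxBr.
  by congr (_ *: (_ *m _)); rewrite subKr.
apply: le_trans (ler_normB _ _) _; rewrite lerD2l.
apply: le_trans (ler_norm_sum _ _ _) _.
apply: (@le_trans _ _ (K * (e / (K + 1)))).
  rewrite /K mulr_suml; apply: ler_sum => c _; rewrite normrZ -mulrA ler_wpM2l//.
  apply: le_trans (norm_mulmx _ _) _; rewrite ler_wpM2l ?bnd_ge0//.
  by apply: ltW; have [] := Hv' c.
by rewrite mulrA ler_pdivrMr ?ltr_wpDl// mulrC ler_wpM2l ?(ltW e0)// lerDl.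
Qed.

Lemma presX_shift (eta : R) c : pres A ((1 + eta *: A) ^+ c).
Proof. by apply: presX; apply: presD; [exact: pres1|apply: presZ; exact: pres_id]. Qed.

Lemma pres_cyclic_span (E : {vspace 'cV[R]_n}) (D : 'M[R]_n) v : pres A D ->
  v \in cyclic_span A E -> D *m v \in cyclic_span A E.
Proof.
have [Q HQ] := vspace_kernel (cyclic_span A E) => pD; rewrite !HQ => /eqP Qv.
apply/eqP; apply: pD => // u /eqP; rewrite -HQ => uE; apply/eqP; rewrite -HQ.
exact: cyclic_span_invariant.
Qed.

Definition fills q w := cyclic_span A (vspan [set jump (Y ^~ w) s | s in [set` `]0, dy q]]]) = fullv.

(** If every set of the flag receives a jump [v_c], the vectors [D^c v_c] with [D = 1 + eta1 A] are
    independent and lie in the generated space, which [D] preserves. The probabilities of the [n]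
    possible failures are added. *)
Lemma heavy_fills_event q (k : nat) : heavy nu A ->
  exists2 S, measurable S /\ (P S <= (n%:R / (1 + k%:R * dy q))%:E)%E &
  forall w, cadlag (Y ^~ w) -> ~ fills q w -> S w.
Proof.
move=> hv; have i1 : inv_ker A 1 by move=> v; rewrite !mx1_mul => ->; rewrite mulmx0.
(* The matrix [D] used below is exactly [1 + eta1 A], so its quadratic error is 0 and the constant 1
   is an arbitrary choice. *)
have [eta1 eta10 H1] := heavy_flag (@ler01 R) hv i1.
have eta1l : 0 < eta1 <= eta1 by rewrite eta10 lexx.
have [rho rho0 H2] := H1 _ eta1l.
(* The mass [k + 1] provides the strict inequality that [no_jump_event] asks for with [k]. *)
have [L [c0 [r0 [R0 []]]]] := H2 (k%:R + 1).
rewrite (mxrank1 R n : \rank (1 : 'M[R]_n) = n) => c00 r00 LM LR LB.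
have ex (c : 'I_n) : exists2 S, measurable S /\ (P S <= ((1 + k%:R * dy q)^-1)%:E)%E &
    forall w, cadlag (Y ^~ w) ->
    (forall s, 0 < s <= dy q -> ~ closure (qset (L c)) (jump (Y ^~ w) s)) -> S w.
  apply: (@no_jump_event (L c) r0 R0 k%:R) => //.
    by move=> v; apply: LR.
  by apply: lt_le_trans (LM c (ltn_ord c)); rewrite lte_fin ltrDl.
have /choice[S HS] : forall c : 'I_n, exists S, (measurable S /\ (P S <= ((1 + k%:R * dy q)^-1)%:E)%E) /\
    forall w, cadlag (Y ^~ w) ->
    (forall s, 0 < s <= dy q -> ~ closure (qset (L c)) (jump (Y ^~ w) s)) -> S w.
  by move=> c; have [S ? ?] := ex c; exists S.
exists (\big[setU/set0]_(c < n) S c).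
  split; first by apply: bigsetU_measurable => c _; have [[]] := HS c.
  apply: le_trans (measure_bigU_le _ _ _) _; first by move=> c; have [[]] := HS c.
  apply: (@le_trans _ _ (\sum_(c < n) ((1 + k%:R * dy q)^-1)%:E)%E).
    by apply: lee_sum => c _; have [[]] := HS c.
  by rewrite sumEFin lee_fin sumr_const card_ord -[leLHS]mulr_natl.
move=> w cw nfill; apply: contrapT => nS; apply: nfill.
have jumps (c : 'I_n) : exists s, 0 < s <= dy q /\ closure (qset (L c)) (jump (Y ^~ w) s).
  apply: contrapT => H; apply: nS; rewrite -bigcup_seq; exists c; first by rewrite /= mem_index_enum.
  by have [_] := HS c; apply => // s sq cl; apply: H; exists s.
have {jumps}/choice[s Hs] := jumps.
pose D := 1 + eta1 *: A.
apply: (@free_lower_bound _ _ c0 (fun c : 'I_n => D ^+ c *m jump (Y ^~ w) (s c))) => // [alpha|c].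
  apply: (@closure_lower_bound c0 (fun c : 'I_n => qset (L c)) (fun c : 'I_n => D ^+ c)); last first.
    by move=> c; have [] := Hs c.
  move=> v Lv; have [n0|n0] := posnP n.
    rewrite big1 ?mulr0// => c _; by have := ltn_ord c; rewrite {2}n0.
  pose ext (f : 'I_n -> 'cV[R]_n) (c : nat) := if insub c is Some c' then f c' else 0.
  pose exr (f : 'I_n -> R) (c : nat) := if insub c is Some c' then f c' else 0.
  have extE f (c : 'I_n) : ext f c = f c by rewrite /ext valK.
  have exrE f (c : 'I_n) : exr f c = f c by rewrite /exr valK.
  have := LB D (fun c => D ^+ c) (ext v) (exr alpha); rewrite mx1_mul.
  under eq_bigr do rewrite exrE.
  under [X in _ -> _ -> _ -> _ -> _ -> _ <= `|X|]eq_bigr do rewrite exrE extE.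
  apply.
  - by have := presX_shift eta1 1; rewrite expr1.
  - by rewrite /D [1 + _]addrC addrK subrr normr0 mul1r sqr_ge0.
  - by move=> c _; exact: presX_shift.
  - by move=> c _; rewrite subrr normr0 ltW.
  - by move=> c cn; rewrite -[c]/(val (Ordinal cn)) extE; exact: Lv.
apply: pres_cyclic_span; first exact: presX_shift.
apply: memv_cyclic; apply/mem_vspan; exists [:: jump (Y ^~ w) (s c)].
split; last by rewrite memv_span// mem_head.
move=> u; rewrite inE => /eqP ->; have [sc _] := Hs c.
by exists (s c) => //=; rewrite in_itv.
Qed.

Theorem heavy_fills : heavy nu A -> {ae P, forall w, forall q, fills q w}.
Proof.
move=> hv; apply: ae_foralln => q.
have /choice[S HS] : forall k : nat, exists S, (measurable S /\ (P S <= (n%:R / (1 + k%:R * dy q))%:E)%E) /\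
    forall w, cadlag (Y ^~ w) -> ~ fills q w -> S w.
  by move=> k; have [S ? ?] := heavy_fills_event q k hv; exists S.
have := levy_cadlag Y_levy; apply: filterS2 (_ : {ae P, forall w, ~ (\bigcap_k S k) w}) => [w nS cw|].
  by apply: contrapT => nf; apply: nS => k _; have [_] := HS k; exact.
have mS k : measurable (S k) by have [[]] := HS k.
exists (\bigcap_k S k); split; [exact: bigcapT_measurable| |by move=> w /contrapT].
apply/eqP; rewrite eq_le measure_ge0 andbT.
apply/lee_addgt0Pr => e e0; rewrite add0e.
have dq0 : 0 < dy q :> R by exact: dy_gt0.
have [k Hk] : exists k, n%:R / (e * dy q) < k%:R by exists (Num.truncn (n%:R / (e * dy q))).+1; exact: truncnS_gt.
apply: (@le_trans _ _ (P (S k))).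
  apply: le_measure; rewrite ?inE//; first exact: bigcapT_measurable.
  by move=> w; apply.
have [[_ H] _] := HS k; apply: le_trans H _; rewrite lee_fin.
rewrite ler_pdivrMr; last by rewrite ltr_wpDr// mulr_ge0// ltW.
move: Hk; rewrite ltr_pdivrMr ?mulr_gt0// => /ltW Hk.
rewrite mulrDr mulr1; apply: le_trans Hk _.
by rewrite mulrCA ler_wpDl// ltW.
Qed.

End heavy_fills.

(** * Anticoncentration of the Euler scheme *)

(** Above its minimum [a c] over [S], each coordinate takes at most [truncn r + 1] integer
    values. *)
Lemma card_close_ffun (R : realType) (n m : nat) (S : {set {ffun 'I_n -> 'I_m}}) (r : R) :
  0 <= r -> (forall t t' c, t \in S -> t' \in S -> `|(t c)%:R - (t' c)%:R| <= r) ->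
  #|S|%:R <= (r + 1) ^+ n.
Proof.
move=> r0; have [->|/set0Pn[t0 t0S] H] := eqVneq S finset.set0.
  by move=> _; rewrite cards0 exprn_ge0// addr_ge0.
pose a c : nat := [arg min_(t < t0 in S) t c] c.
have aP c : exists2 t, t \in S & a c = t c /\ forall t', t' \in S -> (a c <= t' c)%N.
  by rewrite /a; case: arg_minnP => // t tS tmin; exists t.
pose K := Num.truncn r.
have close t c : t \in S -> (t c - a c <= K)%N.
  move=> tS; have [t' t'S [-> t'min]] := aP c.
  rewrite /K truncn_ge_nat// natrB ?t'min//; apply: le_trans (ler_norm _) _; exact: H.
pose phi (t : {ffun 'I_n -> 'I_m}) : {ffun 'I_n -> 'I_K.+1} := [ffun c => inord (t c - a c)].
have phi_inj : {in S &, injective phi}.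
  move=> t t' tS t'S /ffunP E; apply/ffunP => c; apply/val_inj.
  have /(congr1 (@nat_of_ord _)) := E c; rewrite !ffunE !inordK ?ltnS ?close// => /eqP.
  have [_ _ [_ amin]] := aP c; have := amin _ tS; have := amin _ t'S.
  by move=> ? ?; rewrite -(eqn_add2r (a c)) !subnK// => /eqP.
have : (#|S| <= K.+1 ^ n)%N.
  rewrite -(card_in_imset phi_inj); apply: leq_trans (max_card _) _.
  by rewrite card_ffun !card_ord.
rewrite -(ler_nat R) natrX => H2; apply: le_trans H2 _.
by rewrite lerXn2r ?nnegrE// ?addr_ge0// -natr1 lerD2r truncn_le.
Qed.

Section euler_matrix.
Context {R : realType} {n : nat} (A : 'M[R]_n) (p : nat).
Let E := euler_mx A p.
Let h : R := dy p.
Let a := bnd A.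
Let C := expR a.

Let h0 : 0 < h. Proof. exact: dy_gt0. Qed.
Let a0 : 0 <= a. Proof. exact: bnd_ge0. Qed.
Let C0 : 0 < C. Proof. exact: expR_gt0. Qed.

Lemma mxnorm1_le : `|1 : 'M[R]_n| <= 1.
Proof.
rewrite mxnorm_le//; apply/forallP => i; apply/forallP => j.
by rewrite mxE; case: (i == j); rewrite ?normr1 ?normr0.
Qed.

Lemma euler_step i : E ^+ i.+1 = E ^+ i + h *: (A *m E ^+ i).
Proof.
rewrite exprS -[E * _]/(E *m E ^+ i).
have -> : E *m E ^+ i = (1 + h *: A) *m E ^+ i by [].
by rewrite mulmxDl mx1_mul scalemxAl.
Qed.

Lemma euler_norm i : (i <= 2 ^ p)%N -> `|E ^+ i| <= C.
Proof.
move=> ip; apply: (@le_trans _ _ ((1 + h * a) ^+ i)).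
  elim: i {ip} => [|i IH]; first by rewrite !expr0 mxnorm1_le.
  rewrite euler_step exprS mulrDl mul1r; apply: le_trans (ler_normD _ _) _.
  apply: lerD => //; rewrite normrZ (gtr0_norm h0) -mulrA ler_wpM2l ?(ltW h0)//.
  by apply: le_trans (norm_mulmx _ _) _; rewrite ler_wpM2l.
have ha1 : 1 <= 1 + h * a by rewrite lerDl mulr_ge0// ltW.
apply: (@le_trans _ _ ((1 + h * a) ^+ (2 ^ p))); first exact: ler_weXn2l.
apply: (@le_trans _ _ (expR (h * a) ^+ (2 ^ p))).
  by rewrite lerXn2r ?nnegrE ?expR_ge0 ?(le_trans ler01)// expR_ge1Dx.
by rewrite -expRM_natl mulrA dyK mul1r.
Qed.

Lemma euler_telescope l l' : (l' <= l)%N ->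
  E ^+ l - E ^+ l' = h *: (A *m \sum_(l' <= i < l) E ^+ i).
Proof.
move=> ll; rewrite -telescope_sumr// mulmx_sumr scaler_sumr; apply: eq_bigr => i _.
by rewrite euler_step addrC addKr.
Qed.

Lemma euler_sub1 s : (s <= 2 ^ p)%N -> `|E ^+ s - 1| <= s%:R * h * (a * C).
Proof.
move=> sp; have := euler_telescope (leq0n s); rewrite expr0 => ->.
have -> : s%:R * h * (a * C) = h * (a * (s%:R * C)) by ring.
rewrite normrZ (gtr0_norm h0) ler_wpM2l ?(ltW h0)//.
apply: le_trans (norm_mulmx _ _) _; rewrite -/a ler_wpM2l//.
apply: le_trans (ler_norm_sum _ _ _) _.
apply: (@le_trans _ _ (\sum_(0 <= i < s) C)).
  rewrite !big_mkord; apply: ler_sum => i _; apply: euler_norm.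
  by apply: leq_trans sp; exact: ltnW.
by rewrite big_mkord sumr_const card_ord mulr_natl.
Qed.

(** The constant is independent of [p], so it can serve as [C] in [flag], with [D = E ^+ N] and
    [eta = N h]. *)
Lemma euler_quad N : (N <= 2 ^ p)%N ->
  `|E ^+ N - 1 - (N%:R * h) *: A| <= a ^+ 2 * C * (N%:R * h) ^+ 2.
Proof.
move=> Np; have := euler_telescope (leq0n N); rewrite expr0 => ->.
have -> : h *: (A *m \sum_(0 <= i < N) E ^+ i) - (N%:R * h) *: A =
    h *: (A *m \sum_(i < N) (E ^+ i - 1)).
  rewrite sumrB mulmxBr scalerBr big_mkord sumr_const card_ord; congr (_ - _).
  have -> : (N%:R : 'M[R]_n) = (N%:R : R) *: (1 : 'M[R]_n) by rewrite scaler_nat.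
  by rewrite -scalemxAr mulmx1 scalerA mulrC.
rewrite normrZ (gtr0_norm h0).
apply: (@le_trans _ _ (h * (a * (N%:R * (N%:R * h * (a * C)))))).
  rewrite ler_wpM2l ?(ltW h0)//; apply: le_trans (norm_mulmx _ _) _; rewrite ler_wpM2l//.
  apply: le_trans (ler_norm_sum _ _ _) _.
  apply: (@le_trans _ _ (\sum_(i < N) N%:R * h * (a * C))).
    apply: ler_sum => i _; apply: le_trans (euler_sub1 _) _.
      by apply: leq_trans Np; exact: ltnW.
    rewrite ler_wpM2r ?mulr_ge0 ?(ltW C0)// ler_wpM2r ?(ltW h0)// ler_nat.
    exact: ltnW.
  by rewrite sumr_const card_ord [leRHS]mulr_natl.
rewrite le_eqVlt; apply/orP; left; apply/eqP; ring.
Qed.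

Lemma euler_pres : pres A E.
Proof. by apply: presD; [exact: pres1|apply: presZ; exact: pres_id]. Qed.

(** Discrete mean value: a difference of two powers of the Euler matrix is the elapsed time, times
    [A], times this average. For [l = l'] the value [E ^+ l] replaces an empty average. *)
Definition euler_avg l l' : 'M[R]_n := if l == l' then E ^+ l else
  (maxn l l' - minn l l')%:R^-1 *: \sum_(minn l l' <= i < maxn l l') E ^+ i.

Lemma euler_avg_pres l l' : pres A (euler_avg l l').
Proof.
rewrite /euler_avg; case: ifP => _; first by apply: presX; exact: euler_pres.
by apply: presZ; apply: pres_sum => i _; apply: presX; exact: euler_pres.
Qed.

Lemma euler_avgE l l' : E ^+ l - E ^+ l' = ((l%:R - l'%:R) * h) *: (A *m euler_avg l l').
Proof.
rewrite /euler_avg; have [->|ll] := eqVneq l l'; first by rewrite !subrr mul0r scale0r.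
wlog lt : l l' ll / (l' < l)%N => [H|].
  move: ll; rewrite neq_ltn => /orP[lt|lt]; last by apply: H => //; rewrite gtn_eqF.
  rewrite -[LHS]opprK opprB (H l' l) ?gtn_eqF// maxnC minnC.
  by rewrite -scaleNr -mulNr opprB.
rewrite (maxn_idPl (ltnW lt)) (minn_idPr (ltnW lt)) (euler_telescope (ltnW lt)).
rewrite -scalemxAr scalerA; congr (_ *: _); rewrite mulrAC natrB; last exact: ltnW.
by rewrite divff ?mul1r// subr_eq0 eqr_nat gtn_eqF.
Qed.

Lemma euler_avg_near l l' M0 m rho : (M0 + m <= 2 ^ p)%N ->
  (M0 <= l < M0 + m)%N -> (M0 <= l' < M0 + m)%N -> n%:R * C * (m%:R * h * (a * C)) <= rho ->
  `|euler_avg l l' - E ^+ M0| <= rho.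
Proof.
move=> Mp /andP[l1 l2] /andP[l1' l2'] Hrho.
have near i : (M0 <= i < M0 + m)%N -> `|E ^+ i - E ^+ M0| <= rho.
  move=> /andP[i1 i2]; apply: le_trans Hrho.
  have -> : E ^+ i - E ^+ M0 = E ^+ M0 *m (E ^+ (i - M0) - 1).
    by rewrite mulmxBr mulmx1; congr (_ - _); rewrite -[_ *m _]/(E ^+ M0 * E ^+ (i - M0)) -exprD subnKC.
  apply: le_trans (norm_mulmx _ _) _; apply: ler_pM => //; first exact: bnd_ge0.
    by rewrite /bnd ler_wpM2l// euler_norm// (leq_trans _ Mp)// leq_addr.
  have im : (i - M0 <= m)%N by rewrite leq_subLR ltnW.
  apply: le_trans (euler_sub1 _) _.
    by apply: leq_trans im _; apply: leq_trans Mp; exact: leq_addl.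
  by rewrite ler_wpM2r ?mulr_ge0 ?(ltW C0)// ler_wpM2r ?(ltW h0)// ler_nat.
rewrite /euler_avg; have [_|ll] := eqVneq l l'; first by apply: near; rewrite l1.
set u := minn l l'; set v := maxn l l'.
have uv : (u < v)%N.
  by rewrite /u /v; move: ll; rewrite neq_ltn => /orP[lt|lt]; rewrite ?(maxn_idPl (ltnW lt)) ?(minn_idPr (ltnW lt)) ?(maxn_idPr (ltnW lt)) ?(minn_idPl (ltnW lt)).
have uv0 : 0 < (v - u)%:R :> R by rewrite ltr0n subn_gt0.
have -> : (v - u)%:R^-1 *: \sum_(u <= i < v) E ^+ i - E ^+ M0 =
   (v - u)%:R^-1 *: \sum_(u <= i < v) (E ^+ i - E ^+ M0).
  rewrite sumrB scalerBr; congr (_ - _); rewrite sumr_const_nat -[E ^+ M0 *+ _]scaler_nat scalerA.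
  by rewrite mulVf ?scale1r// gt_eqF.
rewrite normrZ gtr0_norm ?invr_gt0// mulrC ler_pdivrMr//.
apply: le_trans (ler_norm_sum _ _ _) _.
apply: (@le_trans _ _ (\sum_(u <= i < v) rho)).
  rewrite big_nat_cond [leRHS]big_nat_cond; apply: ler_sum => i /andP[/andP[ui iv] _].
  apply: near; rewrite (leq_trans _ ui)/=; last by rewrite leq_min l1.
  by apply: leq_trans iv _; rewrite geq_max (ltnW l2) (ltnW l2').
by rewrite sumr_const_nat mulr_natr.
Qed.

End euler_matrix.

Section separation.
Context {R : realType} {n : nat} (A : 'M[R]_n).
Hypothesis A_unit : A \in unitmx.

Lemma unit_lower_bound (v : 'cV[R]_n) : `|v| <= (bnd (invmx A) + 1) * `|A *m v|.
Proof.
rewrite -{1}[v](mulKmx A_unit); apply: le_trans (norm_mulmx _ _) _.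
by rewrite ler_wpM2r// lerDl ler01.
Qed.

(** Moving the jumps from the times [t] to [t'] changes the scheme by [A] times a combination of the
    [b c v c], where the averages [b c] stay within [rho] of [D^c] because the [m] slots cover a
    short time. The flag bounds the combination from below, and the inverse of [A] removes the
    remaining factor. *)
Lemma euler_separation p N m c0 (V : nat -> set 'cV[R]_n) (rho : R) (t t' : nat -> nat)
    (v : nat -> 'cV[R]_n) : (n * N <= 2 ^ p)%N -> (m <= N)%N -> 0 < c0 ->
  n%:R * expR (bnd A) * (m%:R * dy p * (bnd A * expR (bnd A))) <= rho ->
  (forall (b : nat -> 'M[R]_n) (v : nat -> 'cV[R]_n) (alpha : nat -> R),
      (forall c, (c < n)%N -> pres A (b c)) ->
      (forall c, (c < n)%N -> `|b c - euler_mx A p ^+ N ^+ c| <= rho) ->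
      (forall c, (c < n)%N -> V c (v c)) ->
      c0 * \sum_(c < n) `|alpha c| <= `|\sum_(c < n) alpha c *: (b c *m v c)|) ->
  (forall c, (c < n)%N -> (t c < m)%N) -> (forall c, (c < n)%N -> (t' c < m)%N) ->
  (forall c, (c < n)%N -> V c (v c)) ->
  c0 / (bnd (invmx A) + 1) * dy p * \sum_(c < n) `|(t c)%:R - (t' c)%:R| <=
  `|\sum_(c < n) euler_mx A p ^+ (c * N + t c) *m v c -
    \sum_(c < n) euler_mx A p ^+ (c * N + t' c) *m v c|.
Proof.
move=> nN mN c00 Hrho LB tm tm' Vv; set E := euler_mx A p.
have b10 : 0 < bnd (invmx A) + 1 by rewrite ltr_wpDl// bnd_ge0.
have -> : \sum_(c < n) E ^+ (c * N + t c) *m v c - \sum_(c < n) E ^+ (c * N + t' c) *m v c =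
   A *m (dy p *: \sum_(c < n) ((t c)%:R - (t' c)%:R) *: (euler_avg A p (c * N + t c)%N (c * N + t' c)%N *m v c)).
  rewrite -sumrB -scalemxAr mulmx_sumr scaler_sumr; apply: eq_bigr => c _.
  rewrite -mulmxBl (euler_avgE A p) -scalemxAl -mulmxA -scalemxAr scalerA; congr (_ *: _).
  by rewrite !natrD opprD addrACA subrr add0r mulrC.
set w := dy p *: _.
apply: (@le_trans _ _ (`|w| / (bnd (invmx A) + 1))); last first.
  by rewrite ler_pdivrMr// mulrC; exact: unit_lower_bound.
have -> : c0 / (bnd (invmx A) + 1) * dy p * \sum_(c < n) `|(t c)%:R - (t' c)%:R| =
  dy p * (c0 * \sum_(c < n) `|(t c)%:R - (t' c)%:R|) / (bnd (invmx A) + 1) by ring.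
rewrite ler_wpM2r ?invr_ge0 ?(ltW b10)// normrZ (gtr0_norm (dy_gt0 p)) ler_wpM2l ?(ltW (dy_gt0 p))//.
have win c : (c < n)%N -> (c * N + m <= 2 ^ p)%N.
  by move=> cn; apply: leq_trans nN; apply: (@leq_trans (c.+1 * N)); [rewrite mulSn addnC leq_add2r|rewrite leq_mul2r cn orbT].
apply: (LB (fun c => euler_avg A p (c * N + t c) (c * N + t' c)) v (fun c => (t c)%:R - (t' c)%:R)) => // c cn.
  exact: euler_avg_pres.
rewrite -exprM mulnC; apply: (euler_avg_near (m := m)) => //; first exact: win.
  by rewrite leq_addr ltn_add2l tm.
by rewrite leq_addr ltn_add2l tm'.
Qed.

End separation.

Section tent.
Context {R : realType} {n : nat}.
Implicit Types (a y : 'cV[R]_n) (l : R).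

(** A bump equal to 1 on the ball of radius [l] and supported in the ball of radius [2 l]. Its
    Lipschitz property allows small increments to be dropped and the limit of the scheme to be
    taken. *)
Definition tent a l y : R := Num.max 0 (Num.min 1 (2 - `|y - a| / l)).

Lemma tent_itv a l y : 0 <= tent a l y <= 1.
Proof. by rewrite /tent le_max lexx/= ge_max ler01 ge_min lexx. Qed.

Lemma tent1 a l y : 0 < l -> `|y - a| <= l -> tent a l y = 1.
Proof.
move=> l0 yl; have H : `|y - a| / l <= 1 by rewrite ler_pdivrMr// mul1r.
by rewrite /tent (min_idPl _) ?(max_idPr _)//; lra.
Qed.

Lemma tent_supp a l y : 0 < l -> tent a l y != 0 -> `|y - a| <= 2 * l.
Proof.
move=> l0; apply: contraNT; rewrite -ltNge => yl.
have H : 2 < `|y - a| / l by rewrite ltr_pdivlMr.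
rewrite /tent; apply/eqP/max_idPl; rewrite ge_min; apply/orP; right; lra.
Qed.

Lemma tent_lip a l y y' : 0 < l -> `|tent a l y - tent a l y'| <= `|y - y'| / l.
Proof.
move=> l0; have clip_lip (u v : R) : `|Num.max 0 (Num.min 1 u) - Num.max 0 (Num.min 1 v)| <= `|u - v|.
  have m1 (u' v' : R) : `|Num.min 1 u' - Num.min 1 v'| <= `|u' - v'|.
    rewrite !minElt; case: ltP => ?; case: ltP => ?; rewrite ?subrr ?normr0// ler_norml;
    apply/andP; split; have := ler_norm (u' - v'); have := ler_norm (v' - u'); rewrite (distrC v'); lra.
  apply: le_trans (m1 u v); move: (Num.min _ _) (Num.min _ _) => u' v'.
  rewrite !maxElt; case: ltP => ?; case: ltP => ?; rewrite ?subrr ?normr0// ler_norml;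
    apply/andP; split; have := ler_norm (u' - v'); have := ler_norm (v' - u'); rewrite (distrC v'); lra.
apply: le_trans (clip_lip _ _) _.
have -> : 2 - `|y - a| / l - (2 - `|y' - a| / l) = (`|y' - a| - `|y - a|) / l by ring.
rewrite normrM normfV (gtr0_norm l0) ler_wpM2r ?invr_ge0 ?(ltW l0)//.
apply: le_trans (ler_dist_dist _ _) _.
by rewrite opprB addrA subrK distrC.
Qed.

Lemma tent_continuous a l : 0 < l -> continuous (tent a l).
Proof.
move=> l0 y; have FF : Filter (nbhs y) := nbhs_filter y.
apply/(@cvgrPdist_lt _ _ _ (nbhs y) FF) => e e0.
have : \forall z \near y, ball y (e * l) z by apply: nbhsx_ballx; rewrite mulr_gt0.
apply: filterS => z; rewrite -ball_normE /= => H.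
by apply: le_lt_trans (tent_lip a y z l0) _; rewrite ltr_pdivrMr.
Qed.

Lemma tent_bm a l : 0 < l -> bm (tent a l : borelV R n -> R).
Proof.
move=> l0; apply: (bmW (M := 1)) => [|y].
  by apply: continuous_measurable_cV; exact: tent_continuous.
by have /andP[t0 t1] := tent_itv a l y; rewrite ger0_norm.
Qed.

End tent.

Section slots.
Variables (n k N m : nat).
Hypotheses (nN : (n * N <= k)%N) (mN : (m <= N)%N).

Lemma lag_lt (c : 'I_n) (s : 'I_m) : (c * N + s < k)%N.
Proof.
apply: leq_trans nN; apply: (@leq_trans (c.+1 * N)).
  by rewrite mulSn addnC ltn_add2r (leq_trans _ mN).
by rewrite leq_mul2r ltn_ord orbT.
Qed.

(* Euler steps are counted from the end: the step [slot c s] is applied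
   [c * N + s] steps before the last one. *)
Definition slot c s : 'I_k := rev_ord (Ordinal (lag_lt c s)).

Lemma slot_lag c s : (k - (slot c s).+1 = c * N + s)%N.
Proof. by rewrite /slot/= -subSn ?lag_lt// subSS subKn// ltnW// lag_lt. Qed.

Lemma slot_inj c c' s s' : slot c s = slot c' s' -> c = c'.
Proof.
move=> /(congr1 (fun j : 'I_k => k - j.+1)%N); rewrite !slot_lag => E.
apply/val_inj => /=; have N0 : (0 < N)%N by apply: leq_trans mN; exact: leq_ltn_trans (ltn_ord s).
have := congr1 (divn^~ N) E; rewrite /= !divnMDl// !divn_small ?addn0//.
  exact: leq_trans (ltn_ord s') mN.
exact: leq_trans (ltn_ord s) mN.
Qed.

End slots.

Section cube_estimate.
Context {disp : measure_display} {T : measurableType disp} {R : realType}.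
Variable P : probability T R.
Context {n : nat} (E : 'M[R]_n) (x0 : 'cV[R]_n).
Variables (Y : R -> T -> 'cV[R]_n) (p N m : nat).
Hypothesis Y_levy : levy_process P Y.
Hypotheses (nN : (n * N <= 2 ^ p)%N) (mN : (m <= N)%N) (np : (n <= 2 ^ p)%N).
Variable V : 'I_n -> set 'cV[R]_n.
Hypothesis mV : forall c, measurable (V c : set (borelV R n)).
Let k := (2 ^ p)%N.
Let xi (i : 'I_k) (w : T) : borelV R n := incr Y p i w.
Let Xi := tuple_of xi.
Let sl := slot nN mN.
Let ind c (v : 'cV[R]_n) : R := \1_(V c : set (borelV R n)) v.

Definition eul (z : k.-tuple (borelV R n)) : 'cV[R]_n :=
  E ^+ k *m x0 + \sum_(j < k) E ^+ (k - j.+1) *m (tnth z j : 'cV[R]_n).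

Lemma eul_steps w : eul (Xi w) = euler_steps E x0 (fun j => incr Y p j w) k.
Proof.
rewrite euler_stepsE /eul; congr (_ + _); apply: eq_bigr => j _.
by rewrite /Xi /tuple_of tnth_mktuple.
Qed.

(** The function [t] selects one slot in each of the [n] windows; expanding the product of the
    numbers of hits enumerates all [m^n] selections. *)
Definition hits (t : {ffun 'I_n -> 'I_m}) (z : k.-tuple (borelV R n)) : R :=
  \prod_c ind c (tnth z (sl c (t c))).

Definition nb_hits c (z : k.-tuple (borelV R n)) : R := \sum_(s < m) ind c (tnth z (sl c s)).

Lemma prod_nb_hits z : \prod_c nb_hits c z = \sum_t hits t z.
Proof. by rewrite /nb_hits bigA_distr_bigA. Qed.

Lemma slot_tuple_inj (t : {ffun 'I_n -> 'I_m}) : injective (fun c => sl c (t c)).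
Proof. by move=> c c' /slot_inj. Qed.

(** The first [n] increments of the second copy are the substitutes. *)
Let e (c : 'I_n) : 'I_k := widen_ord np c.

Let e_inj : injective e.
Proof. by move=> c c' /(congr1 val)/= H; apply/val_inj. Qed.

Lemma eul_mix (t : {ffun 'I_n -> 'I_m}) z z' : eul (mix (fun c => sl c (t c)) e z z') =
  eul z - \sum_(c < n) E ^+ (c * N + t c)%N *m (tnth z (sl c (t c)) : 'cV[R]_n) +
  \sum_(c < n) E ^+ (c * N + t c)%N *m (tnth z' (e c) : 'cV[R]_n).
Proof.
set j := fun c => sl c (t c); have ji : injective j := slot_tuple_inj (t := t).
pose G (i : 'I_k) : 'cV[R]_n := E ^+ (k - i.+1) *m ((tnth (mix j e z z') i : 'cV[R]_n) - (tnth z i : 'cV[R]_n)).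
have : \sum_i G i = \sum_c G (j c).
  rewrite (bigID (fun i => i \in (j @: finset.setT)%SET))/= [X in _ + X]big1 ?addr0.
    rewrite big_imset/=; last by move=> c c' _ _; exact: ji.
    by apply: eq_bigl => c; rewrite finset.in_setT.
  move=> i /imsetP ni; rewrite /G mix_out ?subrr ?mulmx0// => c.
  by apply/eqP => jc; apply: ni; exists c.
rewrite /G; under eq_bigr do rewrite mulmxBr; rewrite sumrB.
under [in RHS]eq_bigr do rewrite (mix_in _ ji) /j slot_lag mulmxBr; rewrite sumrB => H.
by rewrite /eul (canRL (subrK _) H) addrCA [LHS]addrC [X in _ + X = _]addrC addrA.
Qed.

Let mxi i : measurable_fun setT (xi i : T -> borelV R n).
Proof. exact: (incr_measurable Y_levy). Qed.

Let mY : measurable_fun setT (Y (dy p) : T -> borelV R n).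
Proof. exact: (incr0_measurable Y_levy). Qed.

Lemma eul_measurable : measurable_fun setT (eul : k.-tuple (borelV R n) -> borelV R n).
Proof.
apply: measurable_fun_cV => i.
rewrite (_ : (fun _ => _) = (fun z => (E ^+ k *m x0) i 0 + \sum_(j < k) (E ^+ (k - j.+1) *m (tnth z j : 'cV[R]_n)) i 0)).
  apply: measurable_funD => //; apply: measurable_sum => j.
  exact: (measurableT_comp (mulmx_coord_measurable (E ^+ (k - j.+1)) i) (measurable_tnth j)).
by apply/funext => z; rewrite /eul mxD_E summxE.
Qed.

Let bm_ind c : bm (ind c : borelV R n -> R).
Proof. exact: bm_indic. Qed.

Lemma hits_bm t : bm (hits t).
Proof.
apply: bm_prod => c _; apply: (bm_comp (bm_ind c)); exact: measurable_tnth.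
Qed.

Lemma min1_sum (x : 'I_n -> R) : (forall c, 0 <= x c) ->
  Num.min 1 (\sum_c x c) <= \sum_c Num.min 1 (x c).
Proof.
move=> x_ge0; have m0 c : 0 <= Num.min 1 (x c) by rewrite le_min ler01 x_ge0.
have [[c xc]|H] := pselect (exists c, 1 <= x c).
  apply: (@le_trans _ _ 1); first by rewrite ge_min lexx.
  by rewrite (bigD1 c)//= (min_idPl xc) lerDl sumr_ge0.
rewrite [leRHS](_ : _ = \sum_c x c) ?ge_min ?lexx ?orbT//.
apply: eq_bigr => c _; apply/min_idPr; rewrite leNgt; apply/negP => /ltW xc.
by apply: H; exists c.
Qed.

Section estimate.
Variables (a : 'cV[R]_n) (l C r : R).
Hypotheses (l0 : 0 < l) (C0 : 0 <= C) (r0 : 0 <= r).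
Hypothesis EC : forall i, (i <= 2 ^ p)%N -> `|E ^+ i| <= C.
Hypothesis sep : forall (t t' : {ffun 'I_n -> 'I_m}) (v : 'I_n -> 'cV[R]_n),
  (forall c, V c (v c)) ->
  `|\sum_(c < n) E ^+ (c * N + t c)%N *m v c - \sum_(c < n) E ^+ (c * N + t' c)%N *m v c| <= 4 * l ->
  forall c, `|(t c)%:R - (t' c)%:R| <= r.

(** Bounds the effect on [tent] of deleting one increment [v] from the scheme, where it is
    multiplied by a power of norm at most [C]. *)
Definition cap (v : 'cV[R]_n) : R := Num.min 1 (n%:R * C / l * `|v|).

Let cap_ge0 v : 0 <= cap v.
Proof. by rewrite le_min ler01 !mulr_ge0// invr_ge0 ltW. Qed.

Lemma cap_bm : bm (cap : borelV R n -> R).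
Proof.
apply: (bmW (M := 1)) => [|v]; last by rewrite ger0_norm ?ge_min ?lexx.
apply: measurable_minr => //; apply: measurable_funM => //.
by apply: continuous_measurable_cV; exact: norm_continuous.
Qed.

Let g (w : T) : R := \prod_(c < n) ind c (incr Y p c w).
Let S (t : {ffun 'I_n -> 'I_m}) (w : T) : 'cV[R]_n :=
  \sum_(c < n) E ^+ (c * N + t c)%N *m incr Y p c w.

Let g_ge0 w : 0 <= g w.
Proof. by apply: prodr_ge0 => c _; rewrite /ind indicE. Qed.

Let bm_g : bm g.
Proof. by apply: bm_prod => c _; apply: (bm_comp (bm_ind c)); exact: (incr_measurable Y_levy). Qed.

Let S_measurable t : measurable_fun setT (S t : T -> borelV R n).
Proof.
apply: measurable_fun_cV => i.
rewrite (_ : (fun _ => _) = (fun w => \sum_(c < n) (E ^+ (c * N + t c)%N *m incr Y p c w) i 0)).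
  apply: measurable_sum => c.
  exact: (measurableT_comp (mulmx_coord_measurable _ i) (incr_measurable Y_levy p c)).
by apply/funext => w; rewrite /S summxE.
Qed.

Let mXi : measurable_fun setT Xi.
Proof. by apply: measurable_tuple_of; exact: mxi. Qed.

Let G t (z : T * T) : R := tent a l (eul (Xi z.1) + S t z.2) * g z.2.
Let H t (z : T * T) : R := (\sum_(c < n) cap (incr Y p (sl c (t c)) z.1)) * g z.2.

Let bm_G t : bm (G t).
Proof.
apply: bmM; last by apply: (bm_comp bm_g); exact: measurable_snd.
apply: (bm_comp (tent_bm a l0)); apply: measurable_fun_cV => i.
under eq_fun do rewrite mxD_E.
apply: measurable_funD; apply: (measurableT_comp (coord_measurable_cV i)).
  by apply: (measurableT_comp eul_measurable); apply: (measurableT_comp mXi); exact: measurable_fst.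
by apply: (measurableT_comp (S_measurable t)); exact: measurable_snd.
Qed.

Let bm_caps t : bm (fun w => \sum_(c < n) cap (incr Y p (sl c (t c)) w)).
Proof. by apply: bm_sum => c _; apply: (bm_comp cap_bm); exact: (incr_measurable Y_levy). Qed.

Let bm_H t : bm (H t).
Proof.
apply: bmM; last by apply: (bm_comp bm_g); exact: measurable_snd.
by apply: (bm_comp (bm_caps t)); exact: measurable_fst.
Qed.

Let Ft t (z : k.-tuple (borelV R n)) : R := tent a l (eul z) * hits t z.

Let bm_Ft t : bm (Ft t).
Proof. by apply: bmM; [apply: (bm_comp (tent_bm a l0)); exact: eul_measurable|exact: hits_bm]. Qed.

(** After resampling, the selected increments of the first copy no longer occur. Putting them back
    costs at most the sum of their caps and leaves [eul (Xi z.1) + S t z.2], where [t] acts on the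
    second copy only. *)
Let Ft_mix t z : Ft t (mix (fun c => sl c (t c)) e (Xi z.1) (Xi z.2)) <= G t z + H t z.
Proof.
have ji := slot_tuple_inj (t := t).
have hE : hits t (mix (fun c => sl c (t c)) e (Xi z.1) (Xi z.2)) = g z.2.
  apply: eq_bigr => c _; rewrite (mix_in _ ji).
  by rewrite /Xi /tuple_of tnth_mktuple.
rewrite /Ft hE /G /H -mulrDl ler_wpM2r// eul_mix.
have -> : \sum_(c < n) E ^+ (c * N + t c)%N *m (tnth (Xi z.2) (e c) : 'cV[R]_n) = S t z.2.
  by apply: eq_bigr => c _; rewrite /Xi /tuple_of tnth_mktuple.
set u := eul _; set s := S t z.2; set q := \sum_(c < n) _ *m _.
have D1 : tent a l (u - q + s) - tent a l (u + s) <= Num.min 1 (`|q| / l).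
  rewrite le_min; apply/andP; split.
    have /andP[_ ?] := tent_itv a l (u - q + s); have /andP[? _] := tent_itv a l (u + s); lra.
  apply: le_trans (ler_norm _) _; apply: le_trans (tent_lip _ _ _ l0) _.
  by rewrite (_ : u - q + s - (u + s) = - q) ?normrN//; apply/matrixP => i j; rewrite !mxE; ring.
rewrite -lerBlDl; apply: le_trans D1 _.
have le_cap : `|q| / l <= \sum_(c < n) n%:R * C / l * `|incr Y p (sl c (t c)) z.1|.
  rewrite ler_pdivrMr// mulr_suml; apply: le_trans (ler_norm_sum _ _ _) _.
  apply: ler_sum => c _; apply: le_trans (norm_mulmx _ _) _.
  rewrite [tnth _ _]tnth_mktuple.
  have -> : n%:R * C / l * `|incr Y p (sl c (t c)) z.1| * l = n%:R * C * `|incr Y p (sl c (t c)) z.1|.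
    by field; rewrite gt_eqF.
  rewrite ler_wpM2r// /bnd ler_wpM2l//.
  by apply: EC; rewrite ltnW// lag_lt.
apply: le_trans (min1_sum _); last by move=> c; rewrite !mulr_ge0// invr_ge0 ltW.
by rewrite le_min ge_min lexx /= ge_min le_cap orbT.
Qed.

(** Both outcomes are frozen and only [t] varies: two selections that bring the scheme within [2 l]
    of [a] differ by at most [r] in each window, so [card_close_ffun] counts them. *)
Let sum_G z : \sum_t G t z <= (r + 1) ^+ n * g z.2.
Proof.
rewrite /G -mulr_suml; have [->|g0] := eqVneq (g z.2) 0; first by rewrite !mulr0.
rewrite ler_wpM2r//; pose Sup := [set t | tent a l (eul (Xi z.1) + S t z.2) != 0]%SET.
have Vc c : V c (incr Y p c z.2).
  move: g0; rewrite /g prodf_seq_neq0 => /allP/(_ c (mem_index_enum c)).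
  by rewrite /= /ind indicE; case: (boolP (_ \in _)) => [/set_mem//|_]; rewrite eqxx.
apply: (@le_trans _ _ (#|Sup|%:R)); last first.
  apply: card_close_ffun => // t t' c; rewrite !inE => /(tent_supp l0) H1 /(tent_supp l0) H2.
  apply: (sep Vc); rewrite -/(S t z.2) -/(S t' z.2).
  have -> : S t z.2 - S t' z.2 = (eul (Xi z.1) + S t z.2 - a) - (eul (Xi z.1) + S t' z.2 - a).
    by apply/matrixP => i j; rewrite !mxE; ring.
  by apply: le_trans (ler_normB _ _) _; lra.
rewrite -sum1_card natr_sum [leRHS]big_mkcond/=; apply: ler_sum => t _.
rewrite inE; case: (boolP (_ == 0)) => [/eqP ->//|_] /=.
by have /andP[] := tent_itv a l (eul (Xi z.1) + S t z.2).
Qed.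

Let mu c : R := Ex P (fun w => ind c (Y (dy p) w)).
Let eps : R := Ex P (fun w => cap (Y (dy p) w)).

Let Ex_g : Ex P g = \prod_c mu c.
Proof.
apply: (@Ex_indep_prod _ _ _ _ _ P n (fun c w => incr Y p c w : borelV R n) (Y (dy p)) mY) => [i|E' mE'|i].
- exact: (incr_measurable Y_levy).
- exact: (incr_indep Y_levy).
- exact: bm_ind.
Qed.

(** In the main term only [(r + 1)^n] of the [m^n] selections count; the remainder involves all of
    them but carries the small factor [n eps]. *)
Lemma cube_estimate :
  Ex P (fun w => tent a l (eul (Xi w)) * \prod_c nb_hits c (Xi w)) <=
  (\prod_c mu c) * ((r + 1) ^+ n + m%:R ^+ n * (n%:R * eps)).
Proof.
have -> : Ex P (fun w => tent a l (eul (Xi w)) * \prod_c nb_hits c (Xi w)) =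
    \sum_t Ex P (fun w => Ft t (Xi w)).
  rewrite -Ex_sum => [|t _]; last exact: bm_comp (bm_Ft t) mXi.
  by apply: eq_Ex => w; rewrite prod_nb_hits mulr_sumr.
have indepk : forall E' : 'I_k -> set (borelV R n), (forall i, measurable (E' i)) ->
    P [set w | forall i, E' i (xi i w)] = (\prod_(i < k) P (Y (dy p) @^-1` E' i))%E.
  by move=> E' mE'; exact: (incr_indep Y_levy).
apply: (@le_trans _ _ (\sum_t (Ex (P \x P)%E (G t) + Ex (P \x P)%E (H t)))).
  apply: ler_sum => t _.
  rewrite (decouple mY mxi indepk (slot_tuple_inj (t := t)) e_inj (bm_Ft t)).
  rewrite -ExD//; apply: le_Ex; [|exact: bmD|exact: Ft_mix].
  by apply: (bm_comp (bm_Ft t)); apply: measurable_mix; first [exact: mxi|exact: slot_tuple_inj].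
rewrite big_split/= mulrDr; apply: lerD.
  rewrite -Ex_sum//; apply: (@le_trans _ _ (Ex (P \x P)%E (fun z => cst ((r + 1) ^+ n) z.1 * g z.2))).
    apply: le_Ex; [exact: bm_sum| |exact: sum_G].
    by apply: bmM; [exact: bm_cst|apply: (bm_comp bm_g); exact: measurable_snd].
  by rewrite (Ex_prod_indep _ _ (bm_cst _) bm_g) Ex_g Ex_cst mulrC.
have EH t : Ex (P \x P)%E (H t) = n%:R * eps * \prod_c mu c.
  rewrite /H (Ex_prod_indep P P (bm_caps t) bm_g) Ex_g; congr (_ * _).
  rewrite Ex_sum => [|c _]; last by apply: (bm_comp cap_bm); exact: (incr_measurable Y_levy).
  rewrite (eq_bigr (fun=> eps)) => [|c _]; first by rewrite sumr_const card_ord mulr_natl.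
  apply: (law_eq_Ex (incr_measurable Y_levy p _) mY _ cap_bm) => V' mV'.
  exact: (incr_law Y_levy).
under eq_bigr do rewrite EH.
rewrite sumr_const card_ffun !card_ord -[leLHS]mulr_natl natrX.
by rewrite le_eqVlt; apply/orP; left; apply/eqP; ring.
Qed.

End estimate.
End cube_estimate.

Lemma Ex_indep_pow d d' (T : measurableType d) (V : measurableType d') (R : realType)
  (P : probability T R) (k m : nat) (xi : 'I_k -> T -> V) (Y : T -> V) (sg : 'I_m -> 'I_k)
  (g : V -> R) :
  measurable_fun setT Y -> (forall i, measurable_fun setT (xi i)) ->
  (forall E : 'I_k -> set V, (forall i, measurable (E i)) ->
    P [set w | forall i, E i (xi i w)] = (\prod_(i < k) P (Y @^-1` E i))%E) ->
  injective sg -> bm g ->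
  Ex P (fun w => \prod_(s < m) g (xi (sg s) w)) = Ex P (fun w => g (Y w)) ^+ m.
Proof.
move=> mY mxi indep sgi bg; pose I := (sg @: finset.setT)%SET.
pose G i : V -> R := if i \in I then g else cst 1.
have prodI (F : 'I_k -> R) : \prod_i (if i \in I then F i else 1) = \prod_s F (sg s).
  rewrite -big_mkcond big_imset/=; last by move=> s s' _ _; exact: sgi.
  by apply: eq_bigl => s; rewrite finset.in_setT.
transitivity (Ex P (fun w => \prod_i G i (xi i w))).
  apply: eq_Ex => w; rewrite -(prodI (fun i => g (xi i w))); apply: eq_bigr => i _.
  by rewrite /G; case: ifP.
rewrite (Ex_indep_prod mY mxi indep) => [|i]; last first.
  by rewrite /G; case: ifP => _ //; exact: bm_cst.
rewrite -[RHS](_ : \prod_(s < m) Ex P (fun w => g (Y w)) = _).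
  rewrite -(prodI (fun=> Ex P (fun w => g (Y w)))); apply: eq_bigr => i _.
  by rewrite /G; case: ifP => // _; exact: Ex_cst.
by rewrite prodr_const card_ord.
Qed.

Section anticoncentration.
Context {disp : measure_display} {T : measurableType disp} {R : realType}.
Variable P : probability T R.
Context {n : nat} (A : 'M[R]_n) (x0 : 'cV[R]_n) (nu : {measure set (borelV R n) -> \bar R}).
Variables (Y : R -> T -> 'cV[R]_n) (b : 'cV[R]_n -> R).
Hypothesis A_unit : A \in unitmx.
Hypothesis nu_levy : is_levy_measure nu.
Hypothesis Y_levy : levy_process P Y.
Hypothesis Y0 : {ae P, forall w, Y 0 w = 0}.
Hypothesis charY : forall p u, Ex P (fun w => cos (dotv u (Y (dy p) w))) =
  expR (dy p * aexp nu u) * cos (dy p * b u).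
Let E p := euler_mx A p.
Let Xi p := tuple_of (fun (i : 'I_(2 ^ p)) (w : T) => incr Y p i w : borelV R n).
Let XP p w := eul (E p) x0 (Xi p w).
Let ind (V : set 'cV[R]_n) (v : 'cV[R]_n) : R := \1_(V : set (borelV R n)) v.

Lemma cap_cvg0 (l C : R) : 0 < l -> 0 <= C -> Ex P (fun w => cap l C (Y (dy p) w)) @[p --> \oo] --> (0 : R).
Proof.
move=> l0 C0; have cap0 : cap l C (0 : 'cV[R]_n) = 0 by rewrite /cap normr0 mulr0; apply/min_idPr.
have -> : (0 : R) = Ex P (fun w => cap l C (0 : 'cV[R]_n)) by rewrite Ex_cst cap0.
apply: (@Ex_cvg _ _ _ P (fun p w => cap l C (Y (dy p) w)) (fun=> cap l C (0 : 'cV[R]_n)) 1) => //.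
- move=> p; apply: (measurableT_comp _ (incr0_measurable Y_levy p)).
  by apply: measurable_minr => //; apply: measurable_funM => //; apply: continuous_measurable_cV; exact: norm_continuous.
- move=> p w; rewrite ger0_norm ?ge_min ?lexx//.
  by rewrite le_min ler01 mulr_ge0// divr_ge0 ?mulr_ge0// ltW.
apply: filterS2 Y0 (levy_cadlag Y_levy) => w Yw0 cw.
rewrite cap0; apply/cvgrPdist_lt => e e0; set K := n%:R * C / l.
have K0 : 0 < K + 1 by rewrite ltr_wpDl// divr_ge0 ?mulr_ge0// ltW.
have [dl dl0 H] := cadlag_rightP cw (lexx 0) (divr_gt0 e0 K0).
have := dy_small dl0; apply: filterS => p dp.
have := H (dy p); rewrite add0r (ltW (dy_gt0 p)) dp Yw0 subr0 => /(_ isT).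
rewrite ltr_pdivlMr// => HY; rewrite sub0r normrN ger0_norm; last first.
  by rewrite le_min ler01 mulr_ge0// divr_ge0 ?mulr_ge0// ltW.
apply: le_lt_trans HY; rewrite /cap -/K ge_min; apply/orP; right.
by rewrite mulrC ler_wpM2l// lerDl.
Qed.

Lemma incr_mass_upper (L : seq (R * 'M[R]_n)) r0 R0 : 0 < r0 ->
  (forall v, qset L v -> r0 <= `|v| <= R0) ->
  exists2 C, 0 <= C & \forall p \near \oo, fine (P [set w | qset L (Y (dy p) w)]) <= C * dy p.
Proof. exact: (mass_upper nu_levy (incr0_measurable Y_levy) charY). Qed.

Lemma Ex_ind p (V : set 'cV[R]_n) : measurable (V : set (borelV R n)) ->
  Ex P (fun w => ind V (Y (dy p) w)) = fine (P [set w | V (Y (dy p) w)]).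
Proof.
move=> mV; rewrite -Ex_indic; first by apply: eq_Ex => w; rewrite /ind !indicE; congr (nat_of_bool _)%:R; apply/idP/idP => /set_mem H; apply/mem_set.
exact: (measurable_preim (incr0_measurable Y_levy p) mV).
Qed.

Section level.
Variables (p N m : nat).
Hypotheses (nN : (n * N <= 2 ^ p)%N) (mN : (m <= N)%N) (np : (n <= 2 ^ p)%N).
Variable V : 'I_n -> set 'cV[R]_n.
Hypothesis mV : forall c, measurable (V c : set (borelV R n)).

Let miss c (w : T) : R := \prod_(s < m) (1 - ind (V c) (incr Y p (slot nN mN c s) w)).

Let bm_miss c : bm (miss c).
Proof.
apply: bm_prod => s _; apply: bmB; first exact: bm_cst.
apply: (bm_comp (bm_indic (mV c))); exact: (incr_measurable Y_levy).
Qed.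

Lemma Ex_miss c : Ex P (miss c) = (1 - Ex P (fun w => ind (V c) (Y (dy p) w))) ^+ m.
Proof.
have bi : bm (ind (V c) : borelV R n -> R) := bm_indic (mV c).
have b1 : bm (fun v : borelV R n => 1 - ind (V c) v) by apply: bmB => //; exact: bm_cst.
rewrite (@Ex_indep_pow _ _ _ _ _ P _ _ (fun (i : 'I_(2 ^ p)) w => incr Y p i w : borelV R n) (Y (dy p)) (slot nN mN c) _ _ _ _ _ b1).
- rewrite ExB ?Ex_cst//; first exact: bm_cst.
  exact: (bm_comp bi (incr0_measurable Y_levy p)).
- exact: (incr0_measurable Y_levy).
- by move=> i; exact: (incr_measurable Y_levy).
- by move=> E' mE'; exact: (incr_indep Y_levy).
- move=> s s' /(congr1 (fun j : 'I_(2 ^ p) => 2 ^ p - j.+1)%N).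
  by rewrite !slot_lag => /addnI H; exact/val_inj.
Qed.

(** Either some window contains no hit, and its [miss] equals 1, or all the counts are at least 1
    and so is their product. *)
Lemma hit_or_miss (S : seq ('cV[R]_n * R)) w :
  Num.min 1 (\sum_(al <- S) tent al.1 al.2 (XP p w)) <= \sum_c miss c w +
  \sum_(al <- S) tent al.1 al.2 (XP p w) * \prod_c nb_hits nN mN V c (Xi p w).
Proof.
have t0 al : 0 <= tent al.1 al.2 (XP p w) by have /andP[] := tent_itv al.1 al.2 (XP p w).
have i01 c s : 0 <= 1 - ind (V c) (incr Y p (slot nN mN c s) w).
  by rewrite /ind indicE; case: (_ \in _); rewrite ?subrr ?subr0.
have m0 c : 0 <= miss c w by apply: prodr_ge0.
have nb0 c : 0 <= nb_hits nN mN V c (Xi p w).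
  by apply: sumr_ge0 => s _; rewrite indicE.
have [[c mc]|H] := pselect (exists c, nb_hits nN mN V c (Xi p w) < 1).
  apply: (@le_trans _ _ 1); first by rewrite ge_min lexx.
  rewrite -[leLHS]addr0; apply: lerD; last first.
    by apply: sumr_ge0 => al _; apply: mulr_ge0 => //; exact: prodr_ge0.
  suff mE : miss c w = 1 by rewrite (bigD1 c)//= mE lerDl sumr_ge0.
  rewrite /miss big1// => s _; rewrite /ind indicE.
  case: (boolP (_ \in _)) => [Vs|_]; last by rewrite subr0.
  move: mc; rewrite ltNge => /negP; case; rewrite /nb_hits (bigD1 s)//= indicE.
  rewrite [tnth (Xi p w) (slot nN mN c s)]tnth_mktuple Vs/= lerDl.
  by apply: sumr_ge0 => s' _; rewrite indicE.
have pr1 : 1 <= \prod_c nb_hits nN mN V c (Xi p w).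
  elim/big_ind : _ => // [x y x1 y1|c _]; first by rewrite -[leLHS]mulr1 ler_pM.
  by rewrite leNgt; apply/negP => mc; apply: H; exists c.
apply: (@le_trans _ _ (\sum_(al <- S) tent al.1 al.2 (XP p w))); first by rewrite ge_min lexx orbT.
rewrite -[leLHS]add0r; apply: lerD; first exact: sumr_ge0.
by apply: ler_sum => al _; rewrite ler_peMr.
Qed.

End level.

Lemma near_all_seq (I : eqType) (S : seq I) (Q : I -> nat -> Prop) :
  (forall i, i \in S -> \forall p \near \oo, Q i p) ->
  \forall p \near \oo, forall i, i \in S -> Q i p.
Proof.
elim: S => [|i S IH] H; first exact: nearW.
have H1 := H i (mem_head i S).
have H2 : \forall p \near \oo, forall j, j \in S -> Q j p.
  by apply: IH => j jS; apply: H; rewrite inE jS orbT.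
by apply: filterS2 H1 H2 => p Qi QS j; rewrite inE => /orP[/eqP ->|/QS].
Qed.

Lemma XP_measurable p : measurable_fun setT (XP p : T -> borelV R n).
Proof.
apply: (measurableT_comp (eul_measurable (E p) x0 (p := p))).
by apply: measurable_tuple_of => i; exact: (incr_measurable Y_levy).
Qed.

(** [q'] precedes [M] because it comes from [eta1] and [rho] only. The first term bounds the
    probability that some window is missed and is small for large [M]; the constant [K] may grow
    with [M], but it multiplies a volume. *)
Lemma anticoncentration : heavy nu A -> exists q' : nat, forall M, 0 <= M ->
  exists2 K : R, 0 <= K & forall S : seq ('cV[R]_n * R), (forall al, al \in S -> 0 < al.2) ->
  \forall p \near \oo, Ex P (fun w => Num.min 1 (\sum_(al <- S) tent al.1 al.2 (XP p w))) <=
    n%:R / (1 + M * dy q') + K * \sum_(al <- S) al.2 ^+ n.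
Proof.
move=> hv; set a := bnd A; have a0 : 0 <= a by exact: bnd_ge0.
pose C := expR a; have C0 : 0 < C by exact: expR_gt0.
have i1 : inv_ker A 1 by move=> v; rewrite !mx1_mul => ->; rewrite mulmx0.
have Cf0 : 0 <= a ^+ 2 * C by rewrite mulr_ge0 ?exprn_ge0// ltW.
have [eta1 eta10 H1] := heavy_flag Cf0 hv i1.
have n10 : 0 < (n%:R + 1 : R) by rewrite ltr_wpDl.
(* Windows of length [dy q] are short enough for [flag], and [n] of them fit in [[0, 1]]. *)
have [q [qeta qn]] : exists q, dy q <= eta1 /\ n%:R * dy q <= 1 :> R.
  have m0 : 0 < Num.min eta1 (n%:R + 1)^-1 by rewrite lt_min eta10 invr_gt0.
  have [q _ /(_ q (leqnn q)) /= Hq] := dy_small m0.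
  move: Hq; rewrite lt_min => /andP[q1 q2]; exists q; rewrite ltW//; split => //.
  move: q2; rewrite -[ltRHS]div1r ltr_pdivlMr// mulrDr mulr1 mulrC => q2.
  by apply: le_trans (ltW q2); rewrite lerDl ltW// dy_gt0.
have etaq : 0 < (dy q : R) <= eta1 by rewrite dy_gt0.
have [rho rho0 H2] := H1 _ etaq.
have Kr0 : 0 < n%:R * C * (a * C) + 1.
  by rewrite ltr_wpDl// mulr_ge0 ?mulr_ge0// ltW.
(* Within its window a jump is moved only among slots covering a time [dy q'], so that the averages
   in [euler_avg_near] stay within [rho]. *)
have [q' [qq' q'rho]] : exists q', (q <= q')%N /\ n%:R * C * (dy q' * (a * C)) <= rho.
  have [q0 _ Hq0] := dy_small (divr_gt0 rho0 Kr0).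
  exists (maxn q q0); split; first exact: leq_maxl.
  have := Hq0 (maxn q q0) (leq_maxr q q0); rewrite /= ltr_pdivlMr// => /ltW Hr.
  apply: le_trans Hr; rewrite mulrDr mulr1 mulrCA -[leLHS]addr0 lerD// ?ltW ?dy_gt0//.
exists q' => M M0.
have [L [c0 [r0 [R0 []]]]] := H2 (M + 1).
rewrite (mxrank1 R n : \rank (1 : 'M[R]_n) = n) => c00 r00 LM LR LB.
pose V (c : 'I_n) : set 'cV[R]_n := qset (L c).
have mV c : measurable (V c : set (borelV R n)) by exact: qset_measurable.
have up (c : 'I_n) : exists Cc, 0 <= Cc /\ \forall p \near \oo, fine (P [set w | V c (Y (dy p) w)]) <= Cc * dy p.
  have [Cc Cc0 HC] := incr_mass_upper r00 (fun v => LR c v (ltn_ord c)).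
  by exists Cc.
have /choice[Cc HCc] := up.
pose CV := \sum_c Cc c.
have CV0 : 0 <= CV by apply: sumr_ge0 => c _; have [] := HCc c.
have CcCV c : Cc c <= CV by rewrite /CV (bigD1 c)//= lerDl sumr_ge0// => c' _; have [] := HCc c'.
pose c1 := c0 / (bnd (invmx A) + 1).
have c10 : 0 < c1 by rewrite divr_gt0// ltr_wpDl// bnd_ge0.
(* With [r = 4 l / (c1 dy p)], [dy p (r + 1) = 4 l / c1 + dy p <= 6 l / c1] once [dy p <= 2 l / c1].
   Each set has mass at most [CV dy p], and the summand 1 pays for the remainder in
   [cube_estimate]. *)
have K0 : 0 <= CV ^+ n * (6 / c1) ^+ n + 1.
  by rewrite addr_ge0// mulr_ge0// exprn_ge0// divr_ge0// ltW.
exists (CV ^+ n * (6 / c1) ^+ n + 1) => // S S0.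
have N1 : \forall p \near \oo, forall c : 'I_n, fine (P [set w | V c (Y (dy p) w)]) <= CV * dy p.
  apply: filter_forall => c; have [_] := HCc c; apply: filterS => p H.
  by apply: le_trans H _; rewrite ler_wpM2r// ltW// dy_gt0.
have N2 : \forall p \near \oo, forall c : 'I_n, M * dy p <= fine (P [set w | V c (Y (dy p) w)]).
  apply: filter_forall => c.
  apply: (incr_mass_lower nu_levy Y_levy charY r00) => [v|]; first exact: (LR c v (ltn_ord c)).
  by apply: lt_le_trans (LM c (ltn_ord c)); rewrite lte_fin ltrDl.
have N3 : \forall p \near \oo, (q' <= p)%N by exact: nbhs_infty_ge.
have N4 : \forall p \near \oo, forall al, al \in S -> dy p <= 2 * al.2 / c1 /\
    CV ^+ n * (n%:R * Ex P (fun w => cap al.2 C (Y (dy p) w))) <= al.2 ^+ n.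
  apply: near_all_seq => al /S0 al0.
  have B1 : \forall p \near \oo, dy p < 2 * al.2 / c1 by apply: dy_small; rewrite divr_gt0// mulr_gt0.
  have Kn : 0 < CV ^+ n * n%:R + 1 by rewrite ltr_wpDl// mulr_ge0// exprn_ge0.
  have aln : 0 < al.2 ^+ n / (CV ^+ n * n%:R + 1) by rewrite divr_gt0// exprn_gt0.
  have B2 : \forall p \near \oo, Ex P (fun w => cap al.2 C (Y (dy p) w)) < al.2 ^+ n / (CV ^+ n * n%:R + 1).
    by have := cvgr_lt (0 : R) (cap_cvg0 al0 (ltW C0)); apply.
  apply: filterS2 B1 B2 => p b1 b2; split; first exact: ltW.
  move: b2; rewrite ltr_pdivlMr// => /ltW b2; apply: le_trans b2.
  rewrite mulrDr mulr1 mulrA mulrC lerDl; apply: Ex_ge0 => w.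
  by rewrite le_min ler01 mulr_ge0// divr_ge0 ?mulr_ge0// ltW.
apply: filterS2 (filterI N1 N2) (filterI N3 N4) => p [{}N1 {}N2] [{}N3 {}N4].
have qp : (q <= p)%N by exact: leq_trans qq' N3.
pose N := (2 ^ (p - q))%N; pose m := (2 ^ (p - q'))%N.
have d0 : 0 < dy p :> R by exact: dy_gt0.
have NE : N%:R * dy p = dy q :> R by exact: dyadic_sub.
have mE : m%:R * dy p = dy q' :> R by exact: dyadic_sub.
have mN : (m <= N)%N by rewrite leq_exp2l// leq_sub2l.
have nN : (n * N <= 2 ^ p)%N.
  by rewrite -(ler_nat R) -(ler_pM2r d0) dyK natrM -mulrA NE.
have np : (n <= 2 ^ p)%N.
  by apply: leq_trans nN; rewrite leq_pmulr// expn_gt0.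
have Np : (N <= 2 ^ p)%N by rewrite leq_exp2l// leq_subr.
pose miss c (w : T) : R := \prod_(s < m) (1 - ind (V c) (incr Y p (slot nN mN c s) w)).
have mu01 c : 0 <= fine (P [set w | V c (Y (dy p) w)]) <= 1.
  rewrite fine_ge0//= -lee_fin fineK ?fin_num_measure ?probability_le1//;
  exact: (measurable_preim (incr0_measurable Y_levy p) (mV c)).
have Emiss c : Ex P (miss c) <= (1 + M * dy q')^-1.
  rewrite (Ex_miss nN mN mV) (Ex_ind p (mV c)).
  have H := pow_one_sub_le m (mu01 c).
  have Mq : 0 < 1 + M * dy q' by rewrite ltr_wpDr// mulr_ge0// ltW// dy_gt0.
  rewrite -[leRHS]div1r ler_pdivlMr//; apply: le_trans H; rewrite ler_wpM2l//.
    by apply: exprn_ge0; rewrite subr_ge0; case/andP: (mu01 c).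
  by rewrite lerD2l -mE mulrCA ler_wpM2l.
have EC i : (i <= 2 ^ p)%N -> `|E p ^+ i| <= C by exact: euler_norm.
have LBp (b' : nat -> 'M[R]_n) (v : nat -> 'cV[R]_n) (alpha : nat -> R) :
    (forall c, (c < n)%N -> pres A (b' c)) ->
    (forall c, (c < n)%N -> `|b' c - E p ^+ N ^+ c| <= rho) ->
    (forall c, (c < n)%N -> qset (L c) (v c)) ->
    c0 * \sum_(c < n) `|alpha c| <= `|\sum_(c < n) alpha c *: (b' c *m v c)|.
  move=> pb bD Lv; have := LB (E p ^+ N) b' v alpha; rewrite mx1_mul; apply => //.
    by apply: presX; exact: euler_pres.
  by have := euler_quad A Np; rewrite NE.
pose ext (U : Type) (u0 : U) (f : 'I_n -> U) (c : nat) := if insub c is Some c' then f c' else u0.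
have extE (U : Type) (u0 : U) f (c : 'I_n) : ext U u0 f c = f c by rewrite /ext valK.
have sep l (t t' : {ffun 'I_n -> 'I_m}) (v : 'I_n -> 'cV[R]_n) : 0 < l ->
    (forall c, V c (v c)) ->
    `|\sum_(c < n) E p ^+ (c * N + t c)%N *m v c - \sum_(c < n) E p ^+ (c * N + t' c)%N *m v c| <= 4 * l ->
    forall c, `|(t c)%:R - (t' c)%:R| <= 4 * l / (c1 * dy p).
  move=> l0 Vv H c.
  have rhom : n%:R * expR (bnd A) * (m%:R * dy p * (bnd A * expR (bnd A))) <= rho by rewrite mE.
  have := @euler_separation R n A A_unit p N m c0 (fun c => qset (L c)) rho
    (ext nat 0%N (fun c => t c : nat)) (ext nat 0%N (fun c => t' c : nat)) (ext _ 0 v) nN mN c00 rhom LBp.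
  under eq_bigr do rewrite !extE.
  under [X in _ -> _ -> _ -> _ <= `|X - _|]eq_bigr do rewrite !extE.
  under [X in _ -> _ -> _ -> _ <= `|_ - X|]eq_bigr do rewrite !extE.
  have tb (u : {ffun 'I_n -> 'I_m}) c' : (c' < n)%N -> (ext nat 0%N (fun c => u c : nat) c' < m)%N.
    by move=> cn; rewrite -[c']/(val (Ordinal cn)) extE.
  move=> /(_ (tb t) (tb t')) sepH.
  have Vb c' : (c' < n)%N -> qset (L c') (ext _ 0 v c').
    by move=> cn; rewrite -[c']/(val (Ordinal cn)) extE; exact: Vv.
  have {sepH} := le_trans (sepH Vb) H; rewrite -/c1 => sepH.
  have c1d : 0 < c1 * dy p by rewrite mulr_gt0.
  rewrite ler_pdivlMr// mulrC; apply: le_trans sepH.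
  by rewrite ler_wpM2l ?(ltW c1d)// (bigD1 c)//= lerDl sumr_ge0.
have cube al : al \in S ->
    Ex P (fun w => tent al.1 al.2 (XP p w) * \prod_c nb_hits nN mN V c (Xi p w)) <=
    (CV ^+ n * (6 / c1) ^+ n + 1) * al.2 ^+ n.
  move=> alS; have al0 := S0 _ alS; have [b1 b2] := N4 _ alS.
  have c1d : 0 < c1 * dy p by rewrite mulr_gt0.
  have r0' : 0 <= 4 * al.2 / (c1 * dy p) by apply: divr_ge0; [rewrite mulr_ge0 ?ltW|exact: ltW].
  apply: le_trans (cube_estimate x0 Y_levy nN mN np mV al.1 al0 (ltW C0) r0' EC _) _.
    by move=> t t' v; exact: sep.
  set mu := \prod_c _; set eps := Ex P (fun w => cap _ _ _) in b2 *.
  have mu0 : 0 <= mu by apply: prodr_ge0 => c _; apply: Ex_ge0 => w; rewrite indicE.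
  have muCV : mu <= CV ^+ n * dy p ^+ n.
    rewrite -exprMn -[in leRHS](card_ord n) -prodr_const; apply: ler_prod => c _.
    by rewrite (Ex_ind p (mV c)) N1 andbT; case/andP: (mu01 c).
  have eps0 : 0 <= eps.
    by apply: Ex_ge0 => w; rewrite le_min ler01 mulr_ge0// divr_ge0 ?mulr_ge0// ltW.
  apply: (@le_trans _ _ (CV ^+ n * dy p ^+ n * ((4 * al.2 / (c1 * dy p) + 1) ^+ n + m%:R ^+ n * (n%:R * eps)))).
    rewrite ler_wpM2r// addr_ge0 ?exprn_ge0 ?addr_ge0// mulr_ge0 ?exprn_ge0// mulr_ge0//.
  rewrite [leLHS]mulrDr [leRHS]mulrDl mul1r; apply: lerD.
    have Hle : dy p * (4 * al.2 / (c1 * dy p) + 1) <= 6 / c1 * al.2.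
      have -> : dy p * (4 * al.2 / (c1 * dy p) + 1) = 4 * al.2 / c1 + dy p.
        by field; rewrite !gt_eqF.
      have -> : 6 / c1 * al.2 = 4 * al.2 / c1 + 2 * al.2 / c1 by field; rewrite gt_eqF.
      by rewrite lerD2l.
    have Hge : 0 <= dy p * (4 * al.2 / (c1 * dy p) + 1).
      by apply: mulr_ge0; [exact: ltW|exact: addr_ge0].
    rewrite -[leLHS]mulrA -[leRHS]mulrA ler_wpM2l ?exprn_ge0// -!exprMn.
    by apply: lerXn2r => //; rewrite nnegrE//; exact: le_trans Hge Hle.
  apply: le_trans b2; rewrite -[leLHS]mulrA; apply: ler_wpM2l; first exact: exprn_ge0.
  have -> : dy p ^+ n * (m%:R ^+ n * (n%:R * eps)) = (m%:R * dy p) ^+ n * (n%:R * eps).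
    by rewrite exprMn; move: (m%:R ^+ n) (dy p ^+ n) => y1 y2; ring.
  rewrite mE ler_piMl ?mulr_ge0//.
  by rewrite exprn_ile1 ?dy_le1// ltW// dy_gt0.
have bmiss c : bm (miss c).
  apply: bm_prod => s _; apply: bmB; first exact: bm_cst.
  apply: (bm_comp (bm_indic (mV c))); exact: (incr_measurable Y_levy).
have bnb c : bm (fun w => nb_hits nN mN V c (Xi p w)).
  apply: bm_sum => s _; apply: (bm_comp (bm_indic (mV c))).
  rewrite (_ : (fun w => _) = (fun w => incr Y p (slot nN mN c s) w : borelV R n)).
    exact: (incr_measurable Y_levy).
  by apply/funext => w; rewrite [LHS]tnth_mktuple.
have btent al : al \in S -> bm (fun w => tent al.1 al.2 (XP p w)).
  by move=> /S0 al0; exact: (bm_comp (tent_bm al.1 al0) (XP_measurable p)).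
have bsum (F : 'cV[R]_n * R -> T -> R) : (forall al, al \in S -> bm (F al)) ->
    bm (fun w => \sum_(al <- S) F al w).
  move=> bF; rewrite (_ : (fun w => _) = (fun w => \sum_(al <- S | al \in S) F al w)).
    by apply: bm_sum.
  by apply/funext => w; rewrite big_seq.
have bprod al : al \in S -> bm (fun w => tent al.1 al.2 (XP p w) * \prod_c nb_hits nN mN V c (Xi p w)).
  by move=> alS; apply: bmM; [exact: btent|apply: bm_prod].
have bsp : bm (fun w => \sum_(al <- S) tent al.1 al.2 (XP p w) * \prod_c nb_hits nN mN V c (Xi p w)).
  exact: bsum.
have bsm : bm (fun w => \sum_c miss c w) by apply: bm_sum.
apply: (@le_trans _ _ (Ex P (fun w => \sum_c miss c w +
   \sum_(al <- S) tent al.1 al.2 (XP p w) * \prod_c nb_hits nN mN V c (Xi p w)))).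
  apply: le_Ex; [|exact: bmD|exact: hit_or_miss].
  apply: (bmW (M := 1)).
    by apply: measurable_minr => //; have [] := bsum _ btent.
  move=> w; rewrite ger0_norm ?ge_min ?lexx// le_min ler01.
  by apply: sumr_ge0 => al _; case/andP: (tent_itv al.1 al.2 (XP p w)).
rewrite ExD//; apply: lerD.
  rewrite Ex_sum//; apply: (@le_trans _ _ (\sum_(c < n) (1 + M * dy q')^-1)).
    by apply: ler_sum => c _; exact: Emiss.
  by rewrite sumr_const card_ord -[leLHS]mulr_natl.
have -> : (fun w => \sum_(al <- S) tent al.1 al.2 (XP p w) * \prod_c nb_hits nN mN V c (Xi p w)) =
  (fun w => \sum_(al <- S | al \in S) tent al.1 al.2 (XP p w) * \prod_c nb_hits nN mN V c (Xi p w)).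
  by apply/funext => w; rewrite big_seq.
rewrite Ex_sum// mulr_sumr [leRHS]big_seq; apply: ler_sum => al alS; exact: cube.
Qed.

End anticoncentration.

(** * From anticoncentration to Lebesgue null sets *)

Lemma prod_add_small (R : realType) (I : Type) (r : seq I) (x : I -> R) : (forall i, 0 <= x i) ->
  exists2 C : R, 0 <= C & forall l, 0 <= l <= 1 ->
    \prod_(i <- r) (x i + l) <= \prod_(i <- r) x i + C * l.
Proof.
move=> x0; elim: r => [|i r [C C0 IH]].
  by exists 0 => // l _; rewrite !big_nil mul0r addr0.
have P0 : 0 <= \prod_(j <- r) x j by exact: prodr_ge0.
exists (x i * C + \prod_(j <- r) x j + C).
  by rewrite !addr_ge0// mulr_ge0.
move=> l l01; have /andP[l0 l1] := l01; rewrite !big_cons.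
apply: (@le_trans _ _ ((x i + l) * (\prod_(j <- r) x j + C * l))).
  by rewrite ler_wpM2l ?addr_ge0// IH.
move: (\prod_(j <- r) _) P0 => y y0.
have -> : (x i + l) * (y + C * l) = x i * y + (x i * C + y + C * l) * l by ring.
by rewrite lerD2l ler_wpM2r// lerD2l -[leRHS]mulr1 ler_wpM2l.
Qed.

Section boxes.
Context {R : realType} {n : nat}.
Implicit Types (a b : 'cV[R]_n).

Definition box a b : set 'cV[R]_n := [set v | forall i, a i 0 < v i 0 <= b i 0].

(** The balls of radius [l] around the points of a grid of mesh [l] cover the box, and the grid has
    at most [(x i + l) / l] points in direction [i]. *)
Lemma box_cover a b e : (forall i, a i 0 <= b i 0) -> 0 < e ->
  exists S : seq ('cV[R]_n * R), [/\ forall al, al \in S -> 0 < al.2,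
    forall y, box a b y -> exists2 al, al \in S & `|y - al.1| <= al.2 &
    \sum_(al <- S) al.2 ^+ n <= \prod_(i < n) (b i 0 - a i 0) + e].
Proof.
move=> ab e0; pose x i := b i 0 - a i 0.
have x0 i : 0 <= x i by rewrite subr_ge0.
have [C C0 HC] := prod_add_small (index_enum 'I_n) x0.
pose l := Num.min 1 (e / (C + 1)).
have C10 : 0 < C + 1 by rewrite ltr_wpDl.
have l0 : 0 < l by rewrite lt_min ltr01 divr_gt0.
have l1 : l <= 1 by rewrite ge_min lexx.
have Cl : C * l <= e.
  apply: (@le_trans _ _ ((C + 1) * l)); first by rewrite ler_wpM2r ?(ltW l0)// lerDl.
  by rewrite mulrC -ler_pdivlMr// ge_min lexx orbT.
pose m (i : 'I_n) := (Num.truncn (x i / l)).+1.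
pose pt (t : {dffun forall i : 'I_n, 'I_(m i)}) : 'cV[R]_n := \col_i (a i 0 + l * (t i)%:R).
exists [seq (pt t, l) | t <- enum {: {dffun forall i : 'I_n, 'I_(m i)}}]; split.
- by move=> _ /mapP[t _ ->].
- move=> y yb; pose tr i := Num.truncn ((y i 0 - a i 0) / l).
  have tm i : (tr i < m i)%N.
    have /andP[ay yb'] := yb i; rewrite /m ltnS.
    by apply: le_truncn; rewrite ler_wpM2r ?invr_ge0 ?(ltW l0)// lerD2r.
  pose t : {dffun forall i : 'I_n, 'I_(m i)} := [ffun i => Ordinal (tm i)].
  exists (pt t, l); first by apply: map_f; rewrite mem_enum.
  rewrite /= mxnorm_le ?(ltW l0)//; apply/forallP => i; apply/forallP => j.
  rewrite (ord1 j) mxB_E mxE ffunE /=; have /andP[ay _] := yb i.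
  have z0 : 0 <= (y i 0 - a i 0) / l by rewrite divr_ge0 ?subr_ge0 ?ltW.
  have := truncn_itv z0; rewrite -/(tr i); set k := tr i => /andP[k1 k2].
  move: k1 k2; rewrite ler_pdivlMr// ltr_pdivrMr// -natr1 => k1 k2.
  rewrite ler_norml; apply/andP; split; nra.
- rewrite big_map big_enum/= sumr_const.
  have -> : #|{: {dffun forall i : 'I_n, 'I_(m i)}}| = (\prod_i m i)%N.
    by rewrite card_dep_ffun foldrE big_map big_enum; apply: eq_bigr => i _; rewrite card_ord.
  rewrite -mulr_natl natr_prod -[in l ^+ n](card_ord n) -prodr_const -big_split/=.
  apply: (@le_trans _ _ (\prod_(i < n) (x i + l))); last first.
    by apply: le_trans (HC l _) _; rewrite ?(ltW l0)// lerD2l.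
  apply: ler_prod => i _; rewrite mulr_ge0 ?(ltW l0)//= /m -natr1 mulrDl mul1r lerD2r.
  by rewrite -ler_pdivlMr// truncn_le// divr_ge0// ltW.
Qed.

Lemma box_measurable a b : measurable (box a b : set (borelV R n)).
Proof.
rewrite (_ : box a b = \bigcap_(i in [set: 'I_n]) ((fun v : 'cV[R]_n => v i 0) @^-1` [set` `]a i 0, b i 0]])).
  apply: fin_bigcap_measurable => // i _.
  exact: (measurable_preim (coord_measurable_cV i) (measurable_itv _)).
by apply/seteqP; split => v H i /=; rewrite ?in_itv/=; [move=> _; exact: H|have := H i I; rewrite /= in_itv].
Qed.

End boxes.

Section null_hitting.
Context {disp : measure_display} {T : measurableType disp} {R : realType}.
Variable P : probability T R.
Context {n : nat} (XP : nat -> T -> 'cV[R]_n) (X1 : T -> 'cV[R]_n) (dq : R).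
Hypothesis dq0 : 0 < dq.
Hypothesis mXP : forall p, measurable_fun setT (XP p : T -> borelV R n).
Hypothesis mX1 : measurable_fun setT (X1 : T -> borelV R n).
Hypothesis XP_cvg : {ae P, forall w, XP p w @[p --> \oo] --> X1 w}.
Hypothesis anti : forall M, 0 <= M ->
  exists2 K : R, 0 <= K & forall S : seq ('cV[R]_n * R), (forall al, al \in S -> 0 < al.2) ->
  \forall p \near \oo, Ex P (fun w => Num.min 1 (\sum_(al <- S) tent al.1 al.2 (XP p w))) <=
    n%:R / (1 + M * dq) + K * \sum_(al <- S) al.2 ^+ n.

Let F (S : seq ('cV[R]_n * R)) (y : 'cV[R]_n) : R := Num.min 1 (\sum_(al <- S) tent al.1 al.2 y).

Let F_ge0 S y : 0 <= F S y.
Proof.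
rewrite le_min ler01; apply: sumr_ge0 => al _.
by have /andP[] := tent_itv al.1 al.2 y.
Qed.

Let F_bm S : (forall al, al \in S -> 0 < al.2) -> bm (F S : borelV R n -> R).
Proof.
move=> S0; apply: (bmW (M := 1)) => [|y]; last by rewrite ger0_norm ?F_ge0 ?ge_min ?lexx.
apply: measurable_minr => //.
rewrite (_ : (fun y => _) = (fun y => \sum_(al <- S | al \in S) tent al.1 al.2 y)); last first.
  by apply/funext => y; rewrite big_seq.
have [] // := @bm_sum _ (borelV R n) R _ S (fun al => al \in S) (fun al => tent al.1 al.2).
by move=> al /S0; exact: tent_bm.
Qed.

Let F_lip S : (forall al, al \in S -> 0 < al.2) ->
  exists2 C : R, 0 <= C & forall y y', `|F S y - F S y'| <= C * `|y - y'|.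
Proof.
move=> S0; exists (\sum_(al <- S) `|al.2|^-1); first by apply: sumr_ge0 => al _; rewrite invr_ge0.
move=> y y'; have m1 (u v : R) : `|Num.min 1 u - Num.min 1 v| <= `|u - v|.
  rewrite !minElt; case: ltP => ?; case: ltP => ?; rewrite ?subrr ?normr0// ler_norml;
  apply/andP; split; have := ler_norm (u - v); have := ler_norm (v - u); rewrite (distrC v); lra.
apply: le_trans (m1 _ _) _; rewrite -sumrB mulr_suml; apply: le_trans (ler_norm_sum _ _ _) _.
rewrite big_seq [leRHS]big_seq; apply: ler_sum => al /S0 al0.
by apply: le_trans (tent_lip _ _ _ al0) _; rewrite (gtr0_norm al0) mulrC.
Qed.

(** For a fixed list [S] the test function is bounded and Lipschitz, so the estimate, valid for
    large [p], passes to the limit of the schemes. *)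
Lemma limit_bound M : 0 <= M -> exists2 K : R, 0 <= K & forall S : seq ('cV[R]_n * R),
  (forall al, al \in S -> 0 < al.2) ->
  Ex P (fun w => F S (X1 w)) <= n%:R / (1 + M * dq) + K * \sum_(al <- S) al.2 ^+ n.
Proof.
move=> /anti[K K0 HK]; exists K => // S S0; have bF := F_bm S0.
have cv : Ex P (fun w => F S (XP p w)) @[p --> \oo] --> Ex P (fun w => F S (X1 w)).
  apply: (@Ex_cvg _ _ _ P (fun p w => F S (XP p w)) (fun w => F S (X1 w)) 1).
  - by move=> p; have [] := bm_comp bF (mXP p).
  - by move=> p w; rewrite ger0_norm ?F_ge0 ?ge_min ?lexx.
  - by have [] := bm_comp bF mX1.
  apply: filterS XP_cvg => w /cvgrPdist_lt cw; apply/cvgrPdist_lt => e e0.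
  have [C C0 HC] := F_lip S0; have C10 : 0 < C + 1 by rewrite ltr_wpDl.
  have := cw _ (divr_gt0 e0 C10); apply: filterS => p; rewrite ltr_pdivlMr// => H.
  apply: le_lt_trans (HC _ _) _; apply: le_lt_trans H.
  by rewrite mulrC ler_wpM2l// lerDl.
rewrite -(cvg_lim _ cv)//; apply: limr_le; first by apply/cvg_ex; eexists; exact: cv.
exact: HK.
Qed.

Lemma cover_bound M : 0 <= M -> exists2 K : R, 0 <= K & forall (S : seq ('cV[R]_n * R)) U,
  (forall al, al \in S -> 0 < al.2) -> measurable (U : set (borelV R n)) ->
  (forall y, U y -> exists2 al, al \in S & `|y - al.1| <= al.2) ->
  fine (P [set w | U (X1 w)]) <= n%:R / (1 + M * dq) + K * \sum_(al <- S) al.2 ^+ n.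
Proof.
move=> /limit_bound[K K0 HK]; exists K => // S U S0 mU cov; apply: le_trans (HK S S0).
have mS := measurable_preim mX1 mU; rewrite -Ex_indic//; apply: le_Ex.
- exact: bm_indic.
- exact: (bm_comp (F_bm S0) mX1).
move=> w; rewrite indicE; case: (boolP (_ \in _)) => [/set_mem/= /cov[al alS yal]|_]; last exact: F_ge0.
rewrite le_min lexx/= (big_rem al)//= (tent1 (S0 _ alS) yal) lerDl.
by apply: sumr_ge0 => bl _; have /andP[] := tent_itv bl.1 bl.2 (X1 w).
Qed.

Lemma boxes_bound M : 0 <= M -> exists2 K : R, 0 <= K & forall (ab : (nat -> 'cV[R]_n) * (nat -> 'cV[R]_n)) (e : R) m,
  0 < e -> (forall k i, ab.1 k i 0 <= ab.2 k i 0) ->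
  fine (P [set w | (\bigcup_(k in [set k | (k < m)%N]) box (ab.1 k) (ab.2 k)) (X1 w)]) <=
  n%:R / (1 + M * dq) + K * (\sum_(k < m) \prod_(i < n) (ab.2 k i 0 - ab.1 k i 0) + e).
Proof.
move=> /cover_bound[K K0 HK]; exists K => // ab e m e0 Hab.
pose U := \bigcup_(k in [set k | (k < m)%N]) box (ab.1 k) (ab.2 k).
have mU : measurable (U : set (borelV R n)).
  by apply: bigcup_measurable => k _; exact: box_measurable.
have [S [S0 cov SV]] : exists S : seq ('cV[R]_n * R), [/\ forall al, al \in S -> 0 < al.2,
    forall y, U y -> exists2 al, al \in S & `|y - al.1| <= al.2 &
    \sum_(al <- S) al.2 ^+ n <= \sum_(k < m) \prod_(i < n) (ab.2 k i 0 - ab.1 k i 0) + e].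
  rewrite /U; elim: m e e0 {U mU} => [|m IH] e e0.
    by exists [::]; split => //; [move=> y []|rewrite big_nil big_ord0 add0r ltW].
  have e2 : 0 < e / 2 by rewrite divr_gt0.
  have [S [S0 cov SV]] := IH _ e2.
  have [S' [S0' cov' SV']] := box_cover (Hab m) e2.
  exists (S ++ S'); split.
  - by move=> al; rewrite mem_cat => /orP[/S0|/S0'].
  - move=> y [k /=]; rewrite ltnS leq_eqVlt => /orP[/eqP ->|km] By.
      by have [al alS Hal] := cov' _ By; exists al => //; rewrite mem_cat alS orbT.
    have [|al alS Hal] := cov y; first by exists k.
    by exists al => //; rewrite mem_cat alS.
  - rewrite big_cat big_ord_recr/=; move: SV SV'.
    move: (\sum_(al <- S) _) (\sum_(al <- S') _) (\sum_(k < m) _) (\prod_i _) => x1 x2 x3 x4; lra.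
apply: le_trans (HK S U S0 mU cov) _; rewrite lerD2l ler_wpM2l//.
Qed.

(** [M] makes the first term at most [e / 2], this fixes [K], and only then is a cover of volume
    below [e / (4 (K + 1))] taken. The estimate holds for finite unions of its boxes and extends to
    the countable union by monotone continuity. *)
Lemma null_not_hit N : measurable (N : set (borelV R n)) -> @lebesgue_cV R n N = 0%E ->
  P [set w | N (X1 w)] = 0%E.
Proof.
move=> mN N0; apply/eqP; rewrite eq_le measure_ge0 andbT.
apply/lee_addgt0Pr => e e0; rewrite add0e.
pose M := n%:R * 2 / (e * dq).
have edq : 0 < e * dq by exact: mulr_gt0.
have M0 : 0 <= M by apply: divr_ge0; [exact: mulr_ge0|exact: ltW].
have Me : n%:R / (1 + M * dq) <= e / 2.
  have Mq : 0 < 1 + M * dq by rewrite ltr_wpDr// mulr_ge0// ltW.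
  rewrite ler_pdivrMr// /M mulrDr mulr1.
  have -> : e / 2 * (n%:R * 2 / (e * dq) * dq) = n%:R by field; rewrite !gt_eqF.
  by rewrite lerDr ltW// divr_gt0.
have [K K0 HK] := boxes_bound M0.
have K10 : 0 < K + 1 by rewrite ltr_wpDl.
pose dl := e / 4 / (K + 1); have dl0 : 0 < dl by rewrite !divr_gt0.
have : (lebesgue_cV N < dl%:E)%E by rewrite N0 lte_fin.
move=> /ereal_inf_lt[_ [ab [Hab cov] <-] Hs].
pose B k := box (ab.1 k) (ab.2 k).
pose U m := \bigcup_(k in [set k | (k < m)%N]) B k.
have mU m : measurable (U m : set (borelV R n)).
  by apply: bigcup_measurable => k _; exact: box_measurable.
have mXU m : measurable [set w | U m (X1 w)] by exact: (measurable_preim mX1 (mU m)).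
have PU m : (P [set w | U m (X1 w)] <= e%:E)%E.
  rewrite -[leLHS]fineK ?fin_num_measure// lee_fin; apply: le_trans (HK ab dl m dl0 Hab) _.
  have Hsum : \sum_(k < m) \prod_(i < n) (ab.2 k i 0 - ab.1 k i 0) <= dl.
    rewrite -lee_fin; apply: le_trans (ltW Hs); rewrite -sumEFin.
    rewrite -(big_mkord xpredT (fun k => (\prod_(i < n) (ab.2 k i 0 - ab.1 k i 0))%:E)).
    apply: nneseries_lim_ge => k _ _; rewrite lee_fin; apply: prodr_ge0 => i _.
    by rewrite subr_ge0.
  have : K * (\sum_(k < m) \prod_(i < n) (ab.2 k i 0 - ab.1 k i 0) + dl) <= e / 2.
    apply: (@le_trans _ _ ((K + 1) * (dl + dl))).
      apply: ler_pM => //; rewrite ?lerDl ?lerD2r// addr_ge0 ?(ltW dl0)//.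
      by apply: sumr_ge0 => k _; apply: prodr_ge0 => i _; rewrite subr_ge0.
    by rewrite /dl le_eqVlt; apply/orP; left; apply/eqP; field; rewrite gt_eqF.
  lra.
have cv : P [set w | U m (X1 w)] @[m --> \oo] --> P (\bigcup_m [set w | U m (X1 w)]).
  apply: nondecreasing_cvg_mu => //; first exact: bigcupT_measurable.
  apply/nondecreasing_seqP => m; rewrite subsetEset => w [k /= km Bk].
  by exists k => //=; exact: ltnW.
apply: (@le_trans _ _ (P (\bigcup_m [set w | U m (X1 w)]))).
  apply: le_measure; rewrite ?inE; first exact: (measurable_preim mX1 mN).
    exact: bigcupT_measurable.
  move=> w /= /cov[k _ Bk]; exists k.+1 => //; exists k => //=.
rewrite -(cvg_lim _ cv)//; apply: lime_le; first by apply/cvg_ex; eexists; exact: cv.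
exact: nearW.
Qed.

End null_hitting.

(** * Coincidence of two independent copies *)

Section positive_cospoly.
Context {R : realType} {n : nat}.
Implicit Types (f g : 'cV[R]_n -> R).

(** With nonnegative coefficients, a lower bound valid for every frequency can be summed. *)
Definition poscos f := exists2 s : seq (R * 'cV[R]_n), (forall cu, cu \in s -> 0 <= cu.1) &
  forall v, f v = \sum_(cu <- s) cu.1 * cos (dotv cu.2 v).

Lemma poscos_ext f g : f =1 g -> poscos f -> poscos g.
Proof. by move=> fg [s s0 fs]; exists s => // v; rewrite -fg. Qed.

Lemma poscos_cos c u : 0 <= c -> poscos (fun v => c * cos (dotv u v)).
Proof.
by move=> c0; exists [:: (c, u)] => [cu|v]; rewrite ?inE ?big_seq1// => /eqP ->.
Qed.

Lemma poscos_cst c : 0 <= c -> poscos (fun=> c).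
Proof.
move=> c0; apply: (@poscos_ext (fun v => c * cos (dotv 0 v))); last exact: poscos_cos.
by move=> v; rewrite dotv0l cos0 mulr1.
Qed.

Lemma poscosD f g : poscos f -> poscos g -> poscos (fun v => f v + g v).
Proof.
move=> [s s0 fs] [t t0 gt]; exists (s ++ t) => [cu|v]; last by rewrite big_cat/= fs gt.
by rewrite mem_cat => /orP[/s0|/t0].
Qed.

Lemma poscos_sum I (r : seq I) (F : I -> 'cV[R]_n -> R) :
  (forall i, poscos (F i)) -> poscos (fun v => \sum_(i <- r) F i v).
Proof.
move=> cF; elim: r => [|i r IH].
  apply: (@poscos_ext (fun=> 0)); last exact: poscos_cst.
  by move=> v; rewrite big_nil.
apply: (@poscos_ext (fun v => F i v + \sum_(j <- r) F j v)).
  by move=> v; rewrite big_cons.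
exact: poscosD.
Qed.

Lemma poscosM f g : poscos f -> poscos g -> poscos (fun v => f v * g v).
Proof.
move=> [s s0 fs] [t t0 gt].
pose w cu du : seq (R * 'cV[R]_n) :=
  [:: (cu.1 * du.1 / 2, cu.2 + du.2); (cu.1 * du.1 / 2, cu.2 - du.2)].
exists (flatten [seq w cu du | cu <- s, du <- t]).
  move=> cu /flattenP[_ /allpairsP[[au bu] [/= /s0 a0 /t0 b0 ->]]].
  have ab0 : 0 <= au.1 * bu.1 / 2 by rewrite divr_ge0 ?mulr_ge0.
  by rewrite !inE => /orP[] /eqP ->.
move=> v; rewrite big_flatten big_allpairs_dep fs gt mulr_suml; apply: eq_bigr => cu _.
rewrite mulr_sumr; apply: eq_bigr => du _.
by rewrite big_cons big_seq1/= !dotvDl dotvNl cosD cosB; field.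
Qed.

Lemma poscosX f m : poscos f -> poscos (fun v => f v ^+ m).
Proof.
move=> cf; elim: m => [|m IH].
  apply: (@poscos_ext (fun=> 1)); last exact: poscos_cst.
  by move=> v; rewrite expr0.
apply: (@poscos_ext (fun v => f v * f v ^+ m)); first by move=> v; rewrite exprS.
exact: poscosM.
Qed.

(* These cosine polynomials with nonnegative coefficients reduce the question
   whether two copies coincide to a lower bound on |E exp (i <u, Y>)|^2. *)
Definition spike (m : nat) (v : 'cV[R]_n) : R :=
  (1 - 2^-1 * cosgap m.+1%:R^-1 v) ^+ (m.+1 ^ 3).

Lemma spike_poscos m : (0 < n)%N -> poscos (spike m).
Proof.
move=> n0; apply: poscosX.
apply: (@poscos_ext (fun v => 2^-1 + \sum_(i < n) (2^-1 * n%:R^-1) * cos (dotv (m.+1%:R^-1 *: delta_mx i 0) v))).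
  move=> v; rewrite /cosgap -mulr_sumr sumrB sumr_const card_ord.
  have nn : n%:R != 0 :> R by rewrite pnatr_eq0 -lt0n.
  under eq_bigr do rewrite dotvZl dotv_delta.
  by move: (\sum_i _) => y; field.
apply: poscosD; first by apply: poscos_cst.
by apply: poscos_sum => i; apply: poscos_cos; rewrite mulr_ge0 ?invr_ge0.
Qed.

Lemma spike_itv m v : 0 <= spike m v <= 1.
Proof.
have H := half_cosgap_itv m.+1%:R^-1 v; have /andP[h0 h1] := H.
by rewrite /spike exprn_ge0//= exprn_ile1.
Qed.

Lemma spike0 m : spike m 0 = 1.
Proof. by rewrite /spike cosgap0 mulr0 subr0 expr1n. Qed.

(** The gap at scale [1 / (m + 1)] is at least of order [(m + 1)^-2], so the exponent [(m + 1)^3]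
    drives the power to 0. *)
Lemma spike_cvg0 v : v != 0 -> spike m v @[m --> \oo] --> (0 : R).
Proof.
move=> v0; have [i vi] := mxnorm_attained v0.
have n0 : 0 < n%:R :> R by rewrite ltr0n; apply: leq_ltn_trans (ltn_ord i).
have nv : 0 < `|v| by rewrite normr_gt0.
apply/cvgrPdist_lt => e e0.
pose c := `|v| ^+ 2 / (16 * n%:R); have c0 : 0 < c by rewrite divr_gt0 ?exprn_gt0 ?mulr_gt0.
have ec : 0 < e * c by rewrite mulr_gt0.
near=> m; rewrite sub0r normrN ger0_norm; last by case/andP: (spike_itv m v).
have m0 : 0 < m.+1%:R :> R by rewrite ltr0n.
have m1 : `|v| <= m.+1%:R.
  apply: (@le_trans _ _ m%:R); last by rewrite ler_nat.
  by near: m; exact: nbhs_infty_ger.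
have m2 : (e * c)^-1 <= m.+1%:R.
  apply: (@le_trans _ _ m%:R); last by rewrite ler_nat.
  by near: m; exact: nbhs_infty_ger.
have th0 : 0 < (m.+1%:R^-1 : R) by rewrite invr_gt0.
have tv : m.+1%:R^-1 * `|v| <= 1 by rewrite ler_pdivrMl// mulr1.
have gap := cosgap_ge th0 tv; have /andP[g0 g2] := cosgap_itv m.+1%:R^-1 v.
rewrite /spike; set g := cosgap _ _ in gap g0 g2 *.
have mu01 : 0 <= 2^-1 * g <= 1 by apply/andP; split; lra.
have H := pow_one_sub_le (m.+1 ^ 3) mu01.
have K1 : m.+1%:R * c <= (m.+1 ^ 3)%:R * (2^-1 * g).
  have -> : m.+1%:R * c = (m.+1 ^ 3)%:R * (2^-1 * ((m.+1%:R^-1 * `|v|) ^+ 2 / (8 * n%:R))).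
    rewrite natrX /c; move: (m.+1%:R : R) m0 => r r0.
    by field; rewrite !gt_eqF.
  by rewrite ler_wpM2l// ler_wpM2l.
have K2 : 1 <= e * (m.+1%:R * c).
  by rewrite mulrCA mulrC -ler_pdivrMl// mulr1.
have D0 : 0 < 1 + (m.+1 ^ 3)%:R * (2^-1 * g).
  by rewrite ltr_pwDl// mulr_ge0//; case/andP: mu01.
rewrite -(ltr_pM2r D0); apply: le_lt_trans H _.
apply: (@lt_le_trans _ _ (e + e * (m.+1%:R * c))); first by lra.
by rewrite mulrDr mulr1 lerD2l ler_wpM2l// ltW.
Unshelve. all: by end_near. Qed.

End positive_cospoly.

Section twin.
Context {disp : measure_display} {T : measurableType disp} {R : realType}.
Variable P : probability T R.
Context {n : nat} (n_gt0 : (0 < n)%N) (Y : R -> T -> 'cV[R]_n).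
Hypothesis Y_levy : levy_process P Y.
Variables (nu : {measure set (borelV R n) -> \bar R}) (Q : 'M[R]_n).
Hypothesis nu_levy : is_levy_measure nu.
Hypothesis modulus : forall p u, Ex P (fun w => cos (dotv u (Y (dy p) w))) ^+ 2 +
  Ex P (fun w => sin (dotv u (Y (dy p) w))) ^+ 2 = expR (dy p * aexp nu u) ^+ 2.
Hypothesis light : (nu [set v | Q *m v != 0%R] < +oo)%E.

Let D := [set v : 'cV[R]_n | Q *m v != 0%R].
Let lam := fine (nu D).
Let mD : measurable (D : set (borelV R n)). Proof. exact: measurable_mulmx_neq0. Qed.
Let nuD : nu D = lam%:E.
Proof. by rewrite /lam fineK// ge0_fin_numE. Qed.

(** [1 - cos] is at most 2 and vanishes where [Q z = 0]: along the image of [Q^T] the real part of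
    the exponent is bounded, as for a compound Poisson process. *)
Lemma aexp_light u : - (2 * lam) <= aexp nu (Q^T *m u).
Proof.
have iD : nu.-integrable setT (EFin \o (\1_D : borelV R n -> R)).
  apply/integrableP; split; first by apply/measurable_EFinP; exact: measurable_indic.
  under eq_integral do rewrite /= ger0_norm//.
  by rewrite integral_indic// setIT.
have -> : - (2 * lam) = \int[nu]_(z in [set: borelV R n]) ((-2) * \1_D z).
  rewrite RintegralZl// mulNr; congr (- (_ * _)).
  by rewrite /Rintegral integral_indic// setIT.
apply: le_Rintegral => //; first exact: integrable_scale.
  exact: cos_sub_integrable.
move=> z _; rewrite -dotv_mulmx indicE.
have [zD|zD] := boolP (z \in D).
  by rewrite mulr1; have := cos_geN1 (dotv u (Q *m z)); lra.
have -> : Q *m z = 0 by apply/eqP; apply: contraNT zD => H; exact: mem_set.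
by rewrite dotv0r cos0 mulr0 subrr.
Qed.

Let bmc u p : bm (fun w => cos (dotv u (Y (dy p) w))).
Proof.
by apply: bm_cos; apply: measurableT_comp (dotv_measurable u) (incr0_measurable Y_levy p).
Qed.

Let bms u p : bm (fun w => sin (dotv u (Y (dy p) w))).
Proof.
by apply: bm_sin; apply: measurableT_comp (dotv_measurable u) (incr0_measurable Y_levy p).
Qed.

(** For two independent copies, [E cos<u, Q Y - Q Y'>] is the squared modulus of the characteristic
    function at [Q^T u], hence at least [exp (- 4 lam h)] for every [u], with [h = dy p]. *)
Lemma poscos_twin f p : poscos f ->
  expR (- (4 * lam * dy p)) * f 0 <=
  Ex P (fun w' => Ex P (fun w => f (Q *m Y (dy p) w - Q *m Y (dy p) w'))).
Proof.
move=> [s s0 fs].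
pose C u := Ex P (fun w => cos (dotv (Q^T *m u) (Y (dy p) w))).
pose S u := Ex P (fun w => sin (dotv (Q^T *m u) (Y (dy p) w))).
have -> : Ex P (fun w' => Ex P (fun w => f (Q *m Y (dy p) w - Q *m Y (dy p) w'))) =
    \sum_(cu <- s) cu.1 * (C cu.2 ^+ 2 + S cu.2 ^+ 2).
  transitivity (Ex P (fun w' => \sum_(cu <- s) cu.1 * (cos (dotv (Q^T *m cu.2) (Y (dy p) w')) * C cu.2
      + sin (dotv (Q^T *m cu.2) (Y (dy p) w')) * S cu.2))).
    apply: eq_Ex => w'.
    transitivity (Ex P (fun w => \sum_(cu <- s) cu.1 *
       (cos (dotv (Q^T *m cu.2) (Y (dy p) w')) * cos (dotv (Q^T *m cu.2) (Y (dy p) w)) +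
        sin (dotv (Q^T *m cu.2) (Y (dy p) w')) * sin (dotv (Q^T *m cu.2) (Y (dy p) w))))).
      apply: eq_Ex => w; rewrite fs; apply: eq_bigr => cu _.
      rewrite dotvDr dotvNr !dotv_mulmx cosB; congr (_ * (_ + _)); exact: mulrC.
    rewrite Ex_sum => [|cu _]; last by apply: bmZ; apply: bmD; apply: bmZ.
    apply: eq_bigr => cu _; rewrite ExZ; last by apply: bmD; apply: bmZ.
    by rewrite ExD ?ExZ//; apply: bmZ.
  rewrite Ex_sum => [|cu _]; last first.
    by apply: bmZ; apply: bmD; under eq_fun do rewrite mulrC; apply: bmZ.
  apply: eq_bigr => cu _.
  under eq_Ex do rewrite (mulrC _ (C _)) (mulrC _ (S _)).
  rewrite ExZ; last by apply: bmD; apply: bmZ.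
  by rewrite ExD ?ExZ -?expr2//; apply: bmZ.
rewrite fs mulr_sumr big_seq [leRHS]big_seq; apply: ler_sum => cu cus.
rewrite dotv0r cos0 mulr1 mulrC; apply: ler_wpM2l; first exact: s0.
rewrite modulus -expRM_natl ler_expR.
have := aexp_light cu.2; have := dy_gt0 p : 0 < _ :> R.
by move: (dy p) (aexp _ _) => h a h0 ha; nra.
Qed.

Let shift_incr p j (z : T * T) : 'cV[R]_n := incr Y p j z.2 - incr Y p j z.1.

Let shift_incr_measurable p j : measurable_fun setT (shift_incr p j : T * T -> borelV R n).
Proof.
apply: (@sub_measurable _ _ _ _ (fun z : T * T => incr Y p j z.2) (fun z : T * T => incr Y p j z.1)).
  by apply: measurableT_comp (incr_measurable Y_levy p j) _.
by apply: measurableT_comp (incr_measurable Y_levy p j) _.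
Qed.

Definition coincide p : set (T * T) :=
  [set z | forall j : 'I_(2 ^ p), Q *m incr Y p j z.2 = Q *m incr Y p j z.1].

Lemma coincideE p z : coincide p z <-> forall j : 'I_(2 ^ p), Q *m shift_incr p j z = 0.
Proof.
split=> H j; first by rewrite /shift_incr mulmxBr H subrr.
by apply/eqP; rewrite -subr_eq0 -mulmxBr; apply/eqP; exact: H.
Qed.

Lemma coincide_measurable p : measurable (coincide p).
Proof.
have -> : coincide p = [set z | forall j : 'I_(2 ^ p), [set z | Q *m shift_incr p j z = 0] z].
  by apply/seteqP; split => z /coincideE.
apply: measurable_forall_ord => j.
exact: (measurable_preim (shift_incr_measurable p j) (measurable_mulmx_eq Q 0)).
Qed.

Lemma spike_bm m : bm (spike m : borelV R n -> R).
Proof.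
have [s _ fs] := @spike_poscos R n m n_gt0.
by apply: cospoly_bm; exists s.
Qed.

Let mQ : measurable_fun setT (mulmx Q : borelV R n -> borelV R n).
Proof. exact: mulmx_measurable. Qed.

Let spike_prod p m (z : T * T) : R := \prod_(j < 2 ^ p) spike m (Q *m shift_incr p j z).

Let spike_prod_bm p m : bm (spike_prod p m).
Proof.
apply: bm_prod => j _; apply: (bm_comp (spike_bm m)).
exact: measurableT_comp mQ (shift_incr_measurable p j).
Qed.

(** For a fixed first outcome the increments of the second one are independent, and the integral
    over the first then factorises too. The [2^p] factors [exp (- 4 lam dy p)] multiply to a bound
    free of [p] and [m]. *)
Let spike_prod_lower p m : expR (- (4 * lam)) <= Ex (P \x P)%E (spike_prod p m).
Proof.
have mY := incr0_measurable Y_levy p.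
have mxi (i : 'I_(2 ^ p)) : measurable_fun setT (incr Y p i : T -> borelV R n).
  exact: (incr_measurable Y_levy p i).
have indep := @incr_indep _ _ _ _ _ _ Y_levy p (2 ^ p).
pose F (z : borelV R n * borelV R n) : R := spike m (Q *m (z.2 - z.1 : 'cV[R]_n)).
have bF : bm F.
  apply: (bm_comp (spike_bm m)); apply: measurableT_comp mQ _.
  apply: (@sub_measurable _ _ _ _ (snd : borelV R n * borelV R n -> 'cV[R]_n) fst); [exact: measurable_snd|exact: measurable_fst].
have bG : bm (fun v : borelV R n => Ex P (fun w => F (v, Y (dy p) w))).
  apply: (@bm_Ex1 _ _ _ _ _ P (fun vw : borelV R n * T => F (vw.1, Y (dy p) vw.2))).
  apply: (bm_comp bF); apply: measurable_fun_pair => //.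
  exact: measurableT_comp mY _.
rewrite Ex_fubini; last exact: spike_prod_bm.
have -> : Ex P (fun x => Ex P (fun y => spike_prod p m (x, y))) =
    Ex P (fun x => \prod_(j < 2 ^ p) Ex P (fun w => F (incr Y p j x, Y (dy p) w))).
  apply: eq_Ex => x; rewrite -(Ex_indep_prod mY mxi indep (g := fun i v => F (incr Y p i x, v)))//.
  move=> i; apply: (bm_comp bF); apply: measurable_fun_pair => //.
rewrite (Ex_indep_prod mY mxi indep (g := fun=> fun v => Ex P (fun w => F (v, Y (dy p) w))))//.
rewrite prodr_const card_ord.
have -> : - (4 * lam) = - (4 * lam * dy p) * (2 ^ p)%:R.
  by rewrite mulNr -(mulrA _ (dy p)) (mulrC (dy p)) dyK mulr1.
rewrite expRM_natr; apply: lerXn2r; rewrite ?nnegrE ?expR_ge0//.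
  by apply: Ex_ge0 => w; apply: Ex_ge0 => w'; case/andP: (spike_itv m (Q *m (Y (dy p) w' - Y (dy p) w))).
have := poscos_twin p (spike_poscos m n_gt0); rewrite spike0 mulr1.
move=> H; apply: le_trans H _; rewrite le_eqVlt; apply/orP; left; apply/eqP.
by apply: eq_Ex => w; apply: eq_Ex => w'; rewrite /F/= -mulmxBr.
Qed.

Let prod_fin (E : set (T * T)) : measurable E -> (P \x P)%E E \is a fin_num.
Proof.
move=> mE; rewrite ge0_fin_numE//.
by apply: le_lt_trans (probability_le1 (P \x P)%E mE) _; exact: ltry.
Qed.

(** As [m] grows, [spike m] tends to the indicator of 0, hence the products tend to the indicator of
    [coincide p]. *)
Lemma coincide_lower p : ((expR (- (4 * lam)))%:E <= (P \x P)%E (coincide p))%E.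
Proof.
have mC := coincide_measurable p.
have E : Ex (P \x P)%E (\1_(coincide p)) = fine ((P \x P)%E (coincide p)).
  exact: (Ex_indic (P \x P)%E mC).
rewrite -[leRHS]fineK; last exact: prod_fin.
rewrite lee_fin -E.
have cv : Ex (P \x P)%E (spike_prod p m) @[m --> \oo] --> Ex (P \x P)%E (\1_(coincide p)).
  apply: (@Ex_cvg _ _ _ _ _ _ 1).
  - by move=> m; have [] := spike_prod_bm p m.
  - move=> m z; rewrite /spike_prod ger0_norm; last first.
      by apply: prodr_ge0 => j _; case/andP: (spike_itv m (Q *m shift_incr p j z)).
    by apply: prodr_ile1 => j _; exact: spike_itv.
  - exact: measurable_indic.
  apply: aeW => z; rewrite indicE; have [zC|zC] := boolP (z \in coincide p).
    have H := (coincideE p z).1 (set_mem zC).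
    apply: cvg_near_cst; apply: nearW => m.
    by rewrite /spike_prod big1// => j _; rewrite H spike0.
  have [j Hj] : exists j : 'I_(2 ^ p), Q *m shift_incr p j z != 0.
    apply/existsP; move: zC; apply: contraNT; rewrite negb_exists => /forallP H.
    by apply/mem_set/coincideE => j; apply/eqP; rewrite -[_ == _]negbK H.
  rewrite -[_%:R]/(0 : R).
  apply: (@squeeze_cvgr _ _ _ _ (fun=> 0) (fun m => spike m (Q *m shift_incr p j z))).
  - apply: nearW => m; rewrite /spike_prod; apply/andP; split.
      by apply: prodr_ge0 => i _; case/andP: (spike_itv m (Q *m shift_incr p i z)).
    rewrite (bigD1 j)//= ler_piMr//; first by case/andP: (spike_itv m (Q *m shift_incr p j z)).
    by apply: prodr_ile1 => i _; exact: spike_itv.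
  - exact: cvg_cst.
  - exact: spike_cvg0.
rewrite -(cvg_lim _ cv)//; apply: limr_ge; first by apply/cvg_ex; exists (Ex (P \x P)%E (\1_(coincide p))).
by apply: nearW => m; exact: spike_prod_lower.
Qed.

Lemma incr_split p j w : incr Y p j w = incr Y p.+1 (j.*2) w + incr Y p.+1 (j.*2.+1) w.
Proof.
have E k : k.*2%:R * dy p.+1 = k%:R * dy p :> R.
  by rewrite /dy expnS -muln2 !natrM; field; rewrite pnatr_eq0 -lt0n expn_gt0.
by rewrite /incr -doubleS !E [RHS]addrC subrKA.
Qed.

Lemma coincide_nonincreasing : nonincreasing_seq coincide.
Proof.
apply/nonincreasing_seqP => p; apply/subsetPset => z H j.
have j1 : (j.*2.+1 < 2 ^ p.+1)%N by rewrite expnS; have := ltn_ord j; lia.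
have j0 : (j.*2 < 2 ^ p.+1)%N by apply: ltn_trans j1.
rewrite (incr_split p j z.1) (incr_split p j z.2) mulmxDr [RHS]mulmxDr; congr (_ + _).
  exact: (H (Ordinal j0)).
exact: (H (Ordinal j1)).
Qed.

Lemma positive_ae (G E : set T) : {ae P, forall w, G w} -> measurable E -> (0 < P E)%E ->
  exists E', [/\ measurable E', (0 < P E')%E & forall w, E' w -> E w /\ G w].
Proof.
move=> [N [mN N0 GN]] mE E0; exists (E `\` N); split.
- exact: measurableD.
- have H : (P ((E `\` N) `|` N) <= P (E `\` N) + P N)%E by apply: measureU2 => //; exact: measurableD.
  rewrite N0 adde0 in H; apply: lt_le_trans E0 _; apply: le_trans H; apply: le_measure; rewrite ?inE//.
    by apply: measurableU => //; exact: measurableD.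
  by move=> w Ew; have [|] := pselect (N w); [right|left].
by move=> w [Ew Nw]; split=> //; apply: contrapT => nG; apply: Nw; exact: GN.
Qed.

(** The coincidence at all levels has positive probability, so by Fubini's theorem one of its fibres
    does; all outcomes in that fibre share the projected increments of its base point. *)
Lemma twin_path (G : set T) : {ae P, forall w, G w} ->
  exists E : set T, [/\ measurable E, (0 < P E)%E, forall w, E w -> G w &
    forall w w', E w -> E w' -> forall p (j : 'I_(2 ^ p)), Q *m incr Y p j w = Q *m incr Y p j w'].
Proof.
move=> aeG; suff [E [mE E0 [w0 H0]]] : exists E : set T, [/\ measurable E, (0 < P E)%E &
    exists w0, forall w, E w -> forall p (j : 'I_(2 ^ p)), Q *m incr Y p j w = Q *m incr Y p j w0].
  have [E' [mE' E'0 E'G]] := positive_ae aeG mE E0.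
  exists E'; split=> // [w /E'G[]//|w w' /E'G[Ew _] /E'G[Ew' _] p j].
  by rewrite (H0 _ Ew) (H0 _ Ew').
pose C := \bigcap_p coincide p.
have mC : measurable C by apply: bigcap_measurable => // p _; exact: coincide_measurable.
have cC : ((expR (- (4 * lam)))%:E <= (P \x P)%E C)%E.
  have cv : (P \x P)%E (coincide p) @[p --> \oo] --> (P \x P)%E C.
    apply: nonincreasing_cvg_mu => //.
    - apply: le_lt_trans (probability_le1 (P \x P)%E (coincide_measurable 0)) _.
      exact: ltry.
    - exact: coincide_measurable.
    - exact: coincide_nonincreasing.
  rewrite -(cvg_lim _ cv)//; apply: lime_ge; first by apply/cvg_ex; exists ((P \x P)%E C).
  by apply: nearW => p; exact: coincide_lower.
have bC : bm (\1_C : T * T -> R) by exact: bm_indic.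
have mS x : measurable [set w | C (x, w)].
  by apply: (@measurable_preim _ _ _ _ (fun w => (x, w))) => //; exact: measurable_fun_pair.
have SE x : Ex P (fun y => \1_C (x, y) : R) = fine (P [set w | C (x, w)]).
  by rewrite -Ex_indic//; apply: eq_Ex => y; rewrite !indicE; congr ((_ : bool)%:R); apply/idP/idP => /set_mem H; apply/mem_set.
have C0 : 0 < Ex P (fun x => Ex P (fun y => \1_C (x, y) : R)).
  rewrite -Ex_fubini// (Ex_indic (P \x P)%E mC).
  apply: lt_le_trans (expR_gt0 (- (4 * lam))) _; rewrite -lee_fin fineK//.
  exact: prod_fin.
have H x : (0 < P [set w | C (x, w)])%E ->
  exists E : set T, [/\ measurable E, (0 < P E)%E &
    exists w0, forall w, E w -> forall p (j : 'I_(2 ^ p)), Q *m incr Y p j w = Q *m incr Y p j w0].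
  move=> P0; exists [set w | C (x, w)]; split => //; exists x => w Cw p j.
  exact: (Cw p I).
apply: contrapT => H'.
suff : Ex P (fun x => Ex P (fun y => \1_C (x, y) : R)) = 0 by move=> E; rewrite E ltxx in C0.
rewrite -(Ex_cst P 0) /Ex /Rintegral; congr fine.
apply: ae_eq_integral => //; try exact/measurable_EFinP.
  by apply/measurable_EFinP; have [] := bm_Ex1 P bC.
apply: aeW => x _; congr (_%:E); rewrite -[LHS]/(Ex P (fun y => \1_C (x, y))) SE.
have : (P [set w | C (x, w)] = 0)%E.
  by apply/eqP; rewrite -measure_le0 leNgt; apply/negP => P0; apply: H'; exact: (H x).
by move=> ->.
Qed.

End twin.

Section coincident_paths.
Context {R : realType} {n : nat} (Q : 'M[R]_n).
Implicit Types f g : R -> 'cV[R]_n.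

Lemma coincide_dyadic f g p : Q *m f 0 = Q *m g 0 ->
  (forall j : 'I_(2 ^ p), Q *m (f (j.+1%:R * dy p) - f (j%:R * dy p)) =
    Q *m (g (j.+1%:R * dy p) - g (j%:R * dy p))) ->
  forall j, (j <= 2 ^ p)%N -> Q *m f (j%:R * dy p) = Q *m g (j%:R * dy p).
Proof.
move=> fg0 H; elim=> [|j IH] jp; first by rewrite mul0r.
have := H (Ordinal jp); rewrite /= !mulmxBr (IH (ltnW jp)).
by move=> /addIr.
Qed.

Lemma coincide_segment f g : cadlag f -> cadlag g -> Q *m f 0 = Q *m g 0 ->
  (forall p (j : 'I_(2 ^ p)), Q *m (f (j.+1%:R * dy p) - f (j%:R * dy p)) =
    Q *m (g (j.+1%:R * dy p) - g (j%:R * dy p))) ->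
  forall t, 0 <= t <= 1 -> Q *m f t = Q *m g t.
Proof.
move=> cf cg fg0 H t /andP[t0]; rewrite le_eqVlt => /predU1P[->|t1].
  by rewrite -(dyK 0); exact: coincide_dyadic (H 0%N) _ (leqnn _).
apply/eqP; rewrite -subr_eq0 -normr_eq0; apply/eqP; apply: arbitrarily_small => // e e0.
have b0 : 0 < bnd Q + 1 by rewrite ltr_wpDl// bnd_ge0.
have e'0 : 0 < e / (bnd Q + 1) / 2 by rewrite !divr_gt0.
have [d1 d10 H1] := cadlag_rightP cf t0 e'0.
have [d2 d20 H2] := cadlag_rightP cg t0 e'0.
have d0 : 0 < Num.min d1 d2 by rewrite lt_min d10.
have [p Hp] : exists p, dy p < Num.min d1 d2.
  by have [p _ Hp] := dy_small d0; exists p; apply: Hp => /=.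
have dp0 := dy_gt0 p : 0 < _ :> R.
(* First grid point strictly to the right of [t]; right-continuity carries the coincidence there
   back to [t]. *)
pose j := (Num.truncn (t / dy p)).+1.
have tp0 : 0 <= t / dy p by rewrite divr_ge0// ltW.
have j1 : t < j%:R * dy p by rewrite -ltr_pdivrMr// truncnS_gt.
have j2 : j%:R * dy p <= t + dy p.
  by rewrite /j -natr1 mulrDl mul1r lerD2r -ler_pdivlMr// truncn_le.
have jp : (j <= 2 ^ p)%N.
  have : t / dy p < (2 ^ p)%:R by rewrite ltr_pdivrMr// dyK.
  by move=> /(le_lt_trans (_ : (Num.truncn (t / dy p))%:R <= _)); rewrite ltr_nat; apply; rewrite truncn_le.
have := coincide_dyadic fg0 (H p) jp; set s := j%:R * dy p => E.
have st : t <= s < t + d1 by rewrite ltW//=; move: Hp j2; rewrite /s lt_min => /andP[] *; lra.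
have st' : t <= s < t + d2 by rewrite ltW//=; move: Hp j2; rewrite /s lt_min => /andP[] *; lra.
have {H1 st}H1 := H1 _ st; have {H2 st'}H2 := H2 _ st'.
have -> : Q *m f t - Q *m g t = Q *m ((g s - g t) - (f s - f t)).
  rewrite !mulmxBr E; move: (Q *m f t) (Q *m g t) (Q *m g s) => a b c.
  by apply/matrixP => k l; rewrite !mxE; ring.
apply: le_trans (norm_mulmx _ _) _.
have : `|g s - g t - (f s - f t)| <= e / (bnd Q + 1).
  apply: le_trans (ler_normB _ _) _; rewrite [leRHS]splitr; apply: lerD; exact: ltW.
rewrite ler_pdivlMr// => HH; apply: le_trans HH; rewrite mulrC -/(bnd Q).
by rewrite mulrDr mulr1 lerDl.
Qed.

(** The Euler matrix preserves the kernel of [Q], so the projected scheme depends only on the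
    projected increments. *)
Lemma coincide_euler A f g x : inv_ker A Q ->
  (forall p (j : 'I_(2 ^ p)), Q *m (f (j.+1%:R * dy p) - f (j%:R * dy p)) =
    Q *m (g (j.+1%:R * dy p) - g (j%:R * dy p))) ->
  forall p, let S h := euler_steps (euler_mx A p) x (fun j => h (j.+1%:R * dy p) - h (j%:R * dy p)) (2 ^ p) in
  Q *m S f = Q *m S g.
Proof.
move=> iQ H p S; rewrite /S; suff K m : (m <= 2 ^ p)%N ->
    Q *m euler_steps (euler_mx A p) x (fun j => f (j.+1%:R * dy p) - f (j%:R * dy p)) m =
    Q *m euler_steps (euler_mx A p) x (fun j => g (j.+1%:R * dy p) - g (j%:R * dy p)) m.
  exact: K (leqnn _).
elim: m => [//|m IH] mp /=; rewrite mulmxDr [RHS]mulmxDr (H p (Ordinal mp)); congr (_ + _).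
apply/eqP; rewrite -subr_eq0 -!mulmxBr; apply/eqP.
have : pres A (euler_mx A p) by apply: presD; [exact: pres1|apply: presZ; exact: pres_id].
by apply=> //; rewrite mulmxBr (IH (ltnW mp)) subrr.
Qed.

Lemma jump_gap f s : cadlag f -> 0 < s -> Q *m jump f s != 0 ->
  exists2 e, 0 < e & exists2 dl, 0 < dl & forall r, s - dl < r < s -> e < `|Q *m f r - Q *m f s|.
Proof.
move=> cf s0 J; have a0 : 0 < `|Q *m jump f s| by rewrite normr_gt0.
have b0 : 0 < bnd Q + 1 by rewrite ltr_wpDl// bnd_ge0.
exists (`|Q *m jump f s| / 2); first by rewrite divr_gt0.
have e'0 : 0 < `|Q *m jump f s| / 2 / (bnd Q + 1) by rewrite !divr_gt0.
have [dl dl0 H] := cadlag_leftP cf s0 e'0; exists dl => // r /H.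
rewrite ltr_pdivlMr// => Hr.
have E : Q *m jump f s = Q *m (f r - (f s - jump f s)) - (Q *m f r - Q *m f s).
  rewrite !mulmxBr; move: (Q *m f r) (Q *m f s) (Q *m jump f s) => a c d.
  by apply/matrixP => k l; rewrite !mxE; ring.
have := ler_normB (Q *m (f r - (f s - jump f s))) (Q *m f r - Q *m f s); rewrite -E.
have := norm_mulmx Q (f r - (f s - jump f s)); rewrite -/(bnd Q).
have := normr_ge0 (f r - (f s - jump f s)); move: Hr.
set d := f r - _; move: (`|Q *m jump f s|) (`|d|) (`|Q *m d|) (`|_ - _|) (bnd Q) => a x y z b.
by move=> *; lra.
Qed.

Lemma jumps_in_kernel_not_fill A (S : set 'cV[R]_n) : Q != 0 -> inv_ker A Q ->
  (forall v, S v -> Q *m v = 0) -> cyclic_span A (vspan S) <> fullv.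
Proof.
move=> Q0 iQ SQ; pose f := linfun (mulmx Q : 'cV[R]_n -> 'cV[R]_n).
have kE v : (v \in lker f) = (Q *m v == 0) by rewrite memv_ker lfunE.
have sub : (vspan S <= lker f)%VS.
  apply/subvP => v /mem_vspan[s [sS vs]]; suff /subvP : (span s <= lker f)%VS by apply.
  by apply/span_subvP => u /sS/SQ; rewrite kE => ->.
have iK v : v \in lker f -> A *m v \in lker f by rewrite !kE => /eqP/iQ ->.
have H v : v \in cyclic_span A (vspan S) -> v \in lker f by apply/subvP; exact: cyclic_span_min.
move=> E; case/negP: Q0; apply/eqP/matrixP => i j.
have /eqP : Q *m delta_mx j 0 == 0 :> 'cV[R]_n.
  by rewrite -kE; apply: H; rewrite E memvf.
by move=> /(congr1 (fun M : 'cV[R]_n => M i 0)); rewrite -colE !mxE.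
Qed.

End coincident_paths.

(** * Affine subspaces have Lebesgue measure zero *)

Section thin_boxes.
Context {R : realType}.

Definition volume n (ab : 'cV[R]_n * 'cV[R]_n) : R := \prod_(i < n) (ab.2 i 0 - ab.1 i 0).

Lemma lebesgue_finite_cover n (s : seq ('cV[R]_n * 'cV[R]_n)) (S : set 'cV[R]_n) : (0 < n)%N ->
  (forall ab, ab \in s -> forall i, ab.1 i 0 <= ab.2 i 0) ->
  (forall v, S v -> exists2 ab, ab \in s & forall i, ab.1 i 0 < v i 0 <= ab.2 i 0) ->
  (@lebesgue_cV R n S <= (\sum_(ab <- s) volume ab)%:E)%E.
Proof.
(* The finite list is continued by a box with equal corners, of volume 0 because [n > 0]; in
   dimension 0 the empty product would be 1. *)
move=> n0 s_ord cov; pose d0 : 'cV[R]_n * 'cV[R]_n := (0, 0).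
have vol0 : volume d0 = 0.
  by rewrite /volume (bigD1 (Ordinal n0))//= subrr mul0r.
have ord k i : (nth d0 s k).1 i 0 <= (nth d0 s k).2 i 0.
  have [ks|ks] := ltnP k (size s); first by apply: s_ord; exact: mem_nth.
  by rewrite nth_default.
have vol_ge0 k : 0 <= volume (nth d0 s k).
  by apply: prodr_ge0 => i _; rewrite subr_ge0.
apply: (@le_trans _ _ (\sum_(0 <= k <oo) (volume (nth d0 s k))%:E)%E).
  apply: ereal_inf_lbound; exists (fun k => (nth d0 s k).1, fun k => (nth d0 s k).2) => //.
  split=> // v /cov[ab abs Hv]; exists (index ab s) => //=.
  by rewrite nth_index.
apply: lime_le; first by apply: is_cvg_nneseries => k _ _; rewrite lee_fin.
apply: nearW => m; rewrite sumEFin lee_fin big_mkord.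
have -> : \sum_(ab <- s) volume ab = \sum_(k < size s) volume (nth d0 s k).
  by rewrite (big_nth d0) big_mkord.
have le1 : (m <= maxn m (size s))%N by rewrite leq_maxl.
have le2 : (size s <= maxn m (size s))%N by rewrite leq_maxr.
rewrite -(big_mkord predT (fun k => volume (nth d0 s k))) -[leRHS](big_mkord predT (fun k => volume (nth d0 s k))).
have -> : \sum_(0 <= k < size s) volume (nth d0 s k) = \sum_(0 <= k < maxn m (size s)) volume (nth d0 s k).
  rewrite [RHS](big_cat_nat (n := size s))//= -[LHS]addr0; congr (_ + _).
  rewrite big_nat_cond big1// => k; rewrite andbT => /andP[ks _].
  by rewrite nth_default.
by rewrite [leRHS](big_cat_nat (n := m))//= lerDl sumr_ge0.
Qed.

Lemma lebesgue_cV_ge0 n (S : set 'cV[R]_n) : (0 <= @lebesgue_cV R n S)%E.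
Proof.
apply: le_ereal_inf_tmp => _ [ab [ord _] <-]; apply: nneseries_ge0 => k _ _.
by rewrite lee_fin prodr_ge0// => i _; rewrite subr_ge0.
Qed.

(** A nonzero entry [Q i0 j0] makes the coordinate [j0] a Lipschitz function of the others, with
    constant [L]. Above each cell of a grid of mesh [dl] in the other coordinates, a box of height
    [2 (L + 1) dl] suffices, and the total volume is [V / (M + 1)]. *)
Lemma lebesgue_affine_null n m (Q : 'M[R]_(m, n)) (c : 'cV[R]_m) (r : R) : Q != 0 -> 0 < r ->
  @lebesgue_cV R n [set v | Q *m v = c /\ forall i, - r < v i 0 <= r] = 0%E.
Proof.
move=> Q0 r0; have [i0 [j0 q0]] : exists i j, Q i j != 0.
  apply: contrapT => H; case/negP: Q0; apply/eqP/matrixP => i j; rewrite mxE; apply: contrapT => /eqP Hij.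
  by apply: H; exists i, j.
case: n Q j0 Q0 q0 => [|n] Q j0 Q0 q0; first by case: j0 q0.
set q := Q i0 j0 in q0.
pose L := \sum_(j < n) `|Q i0 (lift j0 j)| / `|q|.
have L0 : 0 <= L by apply: sumr_ge0 => j _; rewrite divr_ge0.
apply/eqP; rewrite eq_le lebesgue_cV_ge0 andbT; apply/lee_addgt0Pr => e e0; rewrite add0e.
pose V := (2 * r) ^+ n * (2 * (L + 1) * (2 * r)).
have [M HM] : exists M, V / e < M.+1%:R.
  by exists (Num.truncn (V / e)); exact: truncnS_gt.
have M0 : 0 < M.+1%:R :> R by rewrite ltr0n.
pose dl : R := 2 * r / M.+1%:R; have dl0 : 0 < dl by rewrite divr_gt0// mulr_gt0.
pose x (k : {ffun 'I_n -> 'I_M.+1}) j : R := - r + (k j)%:R * dl.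
pose y k : R := (c i0 0 - \sum_(j < n) Q i0 (lift j0 j) * x k j) / q.
(* [L + 1] in place of [L] leaves the strict inequality required at the lower end of a box. *)
pose lo k : 'cV[R]_n.+1 := \col_i (if unlift j0 i is Some j then x k j else y k - (L + 1) * dl).
pose hi k : 'cV[R]_n.+1 := \col_i (if unlift j0 i is Some j then x k j + dl else y k + (L + 1) * dl).
pose s := [seq (lo k, hi k) | k : {ffun 'I_n -> 'I_M.+1}].
have Ld : 0 < (L + 1) * dl by rewrite mulr_gt0// ltr_wpDl.
have volE k : volume (lo k, hi k) = dl ^+ n * (2 * (L + 1) * dl).
  rewrite /volume (bigD1_ord j0)//= !mxE unlift_none.
  under eq_bigr do rewrite !mxE liftK addrAC subrr add0r.
  by rewrite prodr_const card_ord mulrC; congr (_ * _); ring.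
apply: le_trans (lebesgue_finite_cover (s := s) _ _ _) _ => //.
- move=> ab /mapP[k _ ->] i /=; rewrite !mxE; case: unliftP => [j|] _; first by rewrite lerDl ltW.
  by lra.
- move=> v [Qv vr].
  have cell j : exists k : 'I_M.+1, - r + k%:R * dl < v (lift j0 j) 0 <= - r + k%:R * dl + dl.
    have /andP[v1 v2] := vr (lift j0 j); set t := v _ _ in v1 v2 *.
    have tr0 : 0 < (t + r) / dl by rewrite divr_gt0//; lra.
    have [k k1 k2] : exists2 k : nat, k%:R < (t + r) / dl & (t + r) / dl <= k.+1%:R.
      have ex : exists k : nat, (t + r) / dl <= k%:R by exists (Num.truncn ((t + r) / dl)).+1; rewrite ltW// truncnS_gt.
      case: (ex_minnP ex) => -[|k]; first by rewrite leNgt tr0.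
      move=> k2 kmin; exists k => //; rewrite ltNge; apply/negP => /kmin; by rewrite ltnn.
    have kM : (k < M.+1)%N.
      rewrite -(ltr_nat R); apply: lt_le_trans k1 _; rewrite ler_pdivrMr// /dl mulrCA divff ?gt_eqF// mulr1; lra.
    exists (Ordinal kM) => /=; rewrite ltr_pdivlMr// in k1; rewrite ler_pdivrMr// -natr1 mulrDl mul1r in k2.
    by apply/andP; split; lra.
  have /choice[k Hk] := cell; pose kf := [ffun j => k j].
  have xE j : x kf j = - r + (k j)%:R * dl by rewrite /x ffunE.
  exists (lo kf, hi kf); first by apply/mapP; exists (kf : {ffun 'I_n -> 'I_M.+1}) => //; rewrite mem_enum.
  move=> i; rewrite /= !mxE; case: unliftP => [j ->|->]; first by rewrite !xE.
  have Qv0 : Q i0 j0 * v j0 0 + \sum_j Q i0 (lift j0 j) * v (lift j0 j) 0 = c i0 0.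
    by rewrite -Qv mxE (bigD1_ord j0).
  have E : v j0 0 - y kf = - (\sum_j Q i0 (lift j0 j) * (v (lift j0 j) 0 - x kf j)) / q.
    rewrite /y -Qv0 -/q; under [in RHS]eq_bigr do rewrite mulrBr.
    by rewrite sumrB; field.
  have : `|v j0 0 - y kf| <= L * dl.
    rewrite E mulNr normrN normrM normfV ler_pdivrMr ?normr_gt0// mulrAC /L -mulr_suml divfK ?normr_eq0// mulr_suml.
    apply: le_trans (ler_norm_sum _ _ _) _; apply: ler_sum => j _; rewrite normrM ler_wpM2l//.
    rewrite xE; have /andP[h1 h2] := Hk j; rewrite ger0_norm; lra.
  rewrite ler_norml => /andP[h1 h2]; rewrite mulrDl mul1r.
  by apply/andP; split; lra.
rewrite lee_fin big_map.
under eq_bigr do rewrite volE.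
rewrite big_enum/= sumr_const card_ffun !card_ord -[leLHS]mulr_natl natrX.
have -> : M.+1%:R ^+ n * (dl ^+ n * (2 * (L + 1) * dl)) = V / M.+1%:R.
  rewrite mulrA -exprMn mulrC /dl mulrCA [M.+1%:R * _]mulrC divfK ?gt_eqF// /V; field.
  by rewrite gt_eqF.
by rewrite ler_pdivrMr// mulrC -ler_pdivrMr// ltW.
Qed.

End thin_boxes.

(** * Consequences of a quotient of finite mass *)

Section light.
Context {disp : measure_display} {T : measurableType disp} {R : realType}.
Variable P : probability T R.
Context {n : nat} (n_gt0 : (0 < n)%N) (A : 'M[R]_n) (x0 : 'cV[R]_n) (Y : R -> T -> 'cV[R]_n).
Hypothesis Y_levy : levy_process P Y.
Variables (nu : {measure set (borelV R n) -> \bar R}) (Q : 'M[R]_n) (X1 : T -> 'cV[R]_n).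
Hypothesis nu_levy : is_levy_measure nu.
Hypothesis modulus : forall p u, Ex P (fun w => cos (dotv u (Y (dy p) w))) ^+ 2 +
  Ex P (fun w => sin (dotv u (Y (dy p) w))) ^+ 2 = expR (dy p * aexp nu u) ^+ 2.
Hypothesis mX1 : measurable_fun setT (X1 : T -> borelV R n).
Hypothesis euler_cvg : {ae P, forall w, euler_steps (euler_mx A p) x0 (fun j => incr Y p j w) (2 ^ p)
  @[p --> \oo] --> X1 w}.
Hypothesis Q0 : Q != 0.
Hypothesis iQ : inv_ker A Q.
Hypothesis light : (nu [set v | Q *m v != 0%R] < +oo)%E.

Lemma light_event : exists E : set T, [/\ measurable E, (0 < P E)%E,
  forall w, E w -> cadlag (Y ^~ w),
  forall w w', E w -> E w' -> forall t, 0 <= t <= 1 -> Q *m Y t w = Q *m Y t w' &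
  forall w w', E w -> E w' -> Q *m X1 w = Q *m X1 w'].
Proof.
have [E [mE E0 EG EQ]] := twin_path n_gt0 Y_levy nu_levy modulus light
  (filterI (filterI (levy_cadlag Y_levy) (levy_start Y_levy)) euler_cvg).
exists E; split=> // [w /EG[[]]//|w w' Ew Ew'|w w' Ew Ew'].
  have [[cw w0] _] := EG _ Ew; have [[cw' w'0] _] := EG _ Ew'.
  apply: (@coincide_segment _ _ Q (Y ^~ w) (Y ^~ w') cw cw').
    by rewrite w0 w'0.
  by move=> p j; exact: (EQ w w' Ew Ew' p j).
have [_ cvw] := EG _ Ew; have [_ cvw'] := EG _ Ew'.
have L w1 : euler_steps (euler_mx A p) x0 (fun j => incr Y p j w1) (2 ^ p) @[p --> \oo] --> X1 w1 ->
    Q *m euler_steps (euler_mx A p) x0 (fun j => incr Y p j w1) (2 ^ p) @[p --> \oo] --> Q *m X1 w1.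
  exact: mulmx_cvg.
have Lw := L _ cvw; have Lw' := L _ cvw'.
apply: (cvg_unique _ Lw) => //; apply: cvg_trans Lw'; apply: near_eq_cvg; apply: nearW => p.
by apply/esym; apply: (@coincide_euler _ _ Q A (Y ^~ w) (Y ^~ w') x0 iQ) => q j; exact: EQ.
Qed.

(** All outcomes in [E] share the path of [Q Y] on [[0, 1]]. If it had a jump at [s], the increments
    of [Y] from times just before [s] up to [s] would exceed a fixed size on the whole of [E],
    against stochastic continuity. *)
Lemma light_no_filling :
  ~ {ae P, forall w, exists2 t, 0 < t <= 1 &
    cyclic_span A (vspan [set jump (Y ^~ w) s | s in [set` `]0, t]]]) = fullv}.
Proof.
move=> ae; have [E [mE E0 Ecad EQ _]] := light_event.
have [E' [mE' E'0 E'E]] := positive_ae ae mE E0.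
have [w Ew] : exists w, E' w.
  by apply: contrapT => H; rewrite (_ : E' = set0) ?measure0 ?ltxx// in E'0; apply/seteqP; split=> // w ?; apply: H; exists w.
have [{}Ew [t /andP[t0 t1]]] := E'E _ Ew; apply: (jumps_in_kernel_not_fill Q0 iQ) => _ [s + <-].
rewrite /= in_itv/= => /andP[s0 st]; have s1 : s <= 1 by exact: le_trans t1.
apply/eqP; rewrite -[_ == _]negbK; apply/negP => /(jump_gap (Ecad _ Ew) s0)[e e0 [dl dl0 H]].
have b0 : 0 < bnd Q + 1 by rewrite ltr_wpDl// bnd_ge0.
have e'0 : 0 < e / (bnd Q + 1) by rewrite divr_gt0.
have PE : (P E < +oo)%E by apply: le_lt_trans (probability_le1 P mE) _; exact: ltry.
have := levy_stochastic_continuity Y_levy (ltW s0) e'0.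
have PE0 : 0 < fine (P E) by rewrite fine_gt0// E0.
have FF : Filter (within [set r : R | 0 <= r] (nbhs s)) by exact: within_filter.
move=> /fine_cvgP[_ cv0]; have := (@cvgrPdist_lt _ _ _ _ FF _ _).1 cv0 _ PE0.
rewrite /within/= => /nbhs_ballP[d2 /= d20 H2].
pose m := Num.min dl (Num.min d2 s); have m0 : 0 < m by rewrite !lt_min dl0 d20.
have [md [m2 ms]] : m <= dl /\ m <= d2 /\ m <= s.
  by rewrite /m !ge_min !lexx ?orbT.
pose r := s - m / 2; have rs : s - dl < r < s by rewrite /r; apply/andP; split; lra.
have r0 : 0 <= r by rewrite /r; lra.
have rb : ball s d2 r by rewrite /ball/= /r opprB addrC subrK ger0_norm; lra.
have := H2 r rb r0; rewrite sub0r normrN ger0_norm ?fine_ge0//.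
apply/negP; rewrite -leNgt.
have mD : measurable [set w0 | e / (bnd Q + 1) < `|Y r w0 - Y s w0|].
  by apply: dist_gt_measurable; apply: levy_measurable Y_levy _ _ => //; exact: ltW.
apply: fine_le; [by rewrite ge0_fin_numE| |].
  by rewrite fin_num_measure.
apply: le_measure; rewrite ?inE// => w' Ew' /=.
have := H r rs; rewrite (EQ _ _ Ew Ew' r) ?(EQ _ _ Ew Ew' s) ?r0 ?(ltW s0) ?s1//=; last first.
  by apply: le_trans s1; rewrite ltW//; case/andP: rs.
rewrite -mulmxBr => H3; rewrite ltr_pdivrMr//.
apply: lt_le_trans H3 _; apply: le_trans (norm_mulmx _ _) _.
by rewrite -/(bnd Q) mulrC ler_wpM2l// lerDl.
Qed.

(** On an event of positive probability [X1] lies in a fixed affine subspace. The latter is cut into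
    countably many bounded pieces, one of which must be charged. *)
Lemma light_charges_null_set :
  exists2 N : set 'cV[R]_n, measurable (N : set (borelV R n)) /\ @lebesgue_cV R n N = 0%E &
  (0 < P [set w | N (X1 w)])%E.
Proof.
have [E [mE E0 _ _ EX]] := light_event.
have [w0 Ew0] : exists w, E w.
  by apply: contrapT => H; rewrite (_ : E = set0) ?measure0 ?ltxx// in E0; apply/seteqP; split=> // w ?; apply: H; exists w.
pose N (k : nat) : set 'cV[R]_n := [set v | Q *m v = Q *m X1 w0 /\ forall i, - k.+1%:R < v i 0 <= k.+1%:R].
have mN k : measurable (N k : set (borelV R n)).
  apply: measurableI; first exact: measurable_mulmx_eq.
  have := @box_measurable R n (\col__ (- k.+1%:R)) (\col__ k.+1%:R).
  by congr measurable; apply/seteqP; split => v H i; have := H i; rewrite !mxE.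
have mXN k : measurable [set w | N k (X1 w)] by exact: (measurable_preim mX1 (mN k)).
apply: contrapT => H.
have N0 k : P [set w | N k (X1 w)] = 0%E.
  apply/eqP; rewrite -measure_le0 leNgt; apply/negP => Pk; apply: H; exists (N k) => //; split=> //.
  by apply: lebesgue_affine_null; rewrite ?ltr0n.
move: E0; rewrite ltNge => /negP; apply.
have U0 : P (\bigcup_k [set w | N k (X1 w)]) = 0%E.
  apply/negligibleP; first exact: bigcup_measurable.
  by apply: negligible_bigcup => k; apply/negligibleP; [exact: mXN|exact: N0].
rewrite -U0; apply: le_measure; rewrite ?inE//; first exact: bigcup_measurable.
move=> w Ew; have [k Hk] : exists k : nat, `|X1 w| < k%:R.
  by exists (Num.truncn `|X1 w|).+1; exact: truncnS_gt.
exists k => //; split; first exact: EX.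
move=> i; have : `|X1 w i 0| < k.+1%:R.
  by apply: le_lt_trans (le_mxnorm _ _ _) _; apply: lt_trans Hk _; rewrite ltr_nat.
by rewrite ltr_norml => /andP[-> /ltW ->].
Qed.

End light.

(** * Exhaustion *)

Section exhaustion.
Context {R : realType} {n : nat}.
Implicit Types (E H W : {vspace 'cV[R]_n}) (A Q : 'M[R]_n) (nu : {measure set (borelV R n) -> \bar R}).

Definition mxker Q : {vspace 'cV[R]_n} := lker (linfun (mulmx Q : 'cV[R]_n -> 'cV[R]_n)).

Lemma mem_mxker Q v : (v \in mxker Q) = (Q *m v == 0).
Proof. by rewrite memv_ker lfunE. Qed.

Lemma mxker_full Q : mxker Q = fullv -> Q = 0.
Proof.
move=> E; apply/matrixP => i j; have /eqP : Q *m delta_mx j 0 == 0 :> 'cV[R]_n.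
  by rewrite -mem_mxker E memvf.
by move=> /(congr1 (fun M : 'cV[R]_n => M i 0)); rewrite -colE !mxE.
Qed.

Lemma measurable_notin E : measurable ([set v | v \notin E] : set (borelV R n)).
Proof.
have [Q QE] := vspace_kernel E.
rewrite (_ : [set v | _] = [set v | Q *m v != 0]); first exact: measurable_mulmx_neq0.
by apply/seteqP; split => v /=; rewrite QE.
Qed.

Lemma measurable_in E : measurable ([set v | v \in E] : set (borelV R n)).
Proof.
rewrite -[X in measurable X]setCK; apply: measurableC.
rewrite (_ : ~` _ = [set v | v \notin E]); first exact: measurable_notin.
by apply/seteqP; split => v /= /negP.
Qed.

Lemma hyperplane_above W E : (W <= E)%VS -> W != E ->
  exists H, [/\ (W <= H)%VS, (H <= E)%VS & (\dim H).+1 = \dim E].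
Proof.
move: {2}(\dim E - \dim W)%N (leqnn (\dim E - \dim W)) => k.
elim: k W => [|k IH] W Hk WE W_E.
  case/negP: W_E; rewrite eqEdim WE /=; lia.
have WlE : (\dim W < \dim E)%N by rewrite ltnNge; apply: contra W_E => EW; rewrite eqEdim WE.
have [dW|dW] := eqVneq (\dim W).+1 (\dim E); first by exists W; rewrite subvv.
have /subvPn[v vE vW] : ~~ (E <= W)%VS by apply: contraL WlE => /dimvS; rewrite -leqNgt.
have d1 : (\dim W < \dim (W + <[v]>))%N.
  rewrite ltnNge; apply: contra vW => le.
  have /eqP -> : W == (W + <[v]>)%VS by rewrite eqEdim addvSl.
  by apply: (subvP (addvSr _ _)); exact: memv_line.
have d2 : (\dim (W + <[v]>) <= (\dim W).+1)%N.
  have dl : (\dim <[v]> <= 1)%N by rewrite dim_vline; case: (_ != _).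
  by have := (dimv_add_leqif W <[v]>%VS).1; lia.
have sub : (W + <[v]> <= E)%VS by rewrite subv_add WE -memvE.
have [||H [WH HE dH]] := IH (W + <[v]>)%VS _ sub.
- by lia.
- by apply: contra dW => /eqP <-; rewrite eqn_leq; lia.
by exists H; split=> //; apply: subv_trans WH; exact: addvSl.
Qed.

(** [Hr] generates the whole space, so it is not contained in the invariant kernel of [Q]. Hence
    some hyperplane [H] of [Hr] contains the intersection with this kernel, and [Hr] minus [H]
    avoids the kernel. *)
Lemma exhausts_heavy d A (B : 'M[R]_(n, d)) nu : exhausts A B nu -> heavy nu A.
Proof.
move=> [_ [r [Hr [_ _ dHr fullHr nuH]]]] Q Q0 iQ.
have sub : ~~ (Hr <= mxker Q)%VS.
  apply: contra Q0 => sub; apply/eqP/mxker_full.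
  suff : (cyclic_span A Hr <= mxker Q)%VS by rewrite fullHr => s; apply/eqP; rewrite eqEsubv subvf s.
  by apply: cyclic_span_min => // v; rewrite !mem_mxker => /eqP/iQ ->.
have [||H [WH HHr dH]] := @hyperplane_above (Hr :&: mxker Q) Hr.
- exact: capvSl.
- by apply: contra sub => /eqP {1}<-; exact: capvSr.
apply/eqP; rewrite -leye_eq -(nuH H HHr); last by rewrite dH.
apply: le_measure; rewrite ?inE.
- by apply: measurableI; [exact: measurable_in|exact: measurable_notin].
- exact: measurable_mulmx_neq0.
move=> v /= [vHr vH]; apply: contra vH => vK; apply: (subvP WH).
by rewrite memv_cap vHr mem_mxker.
Qed.

Lemma dim_im_mx d (B : 'M[R]_(n, d)) : (\dim (im_mx B) <= \rank B)%N.
Proof.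
pose s := [seq col j (col_base B) | j : 'I_(\rank B)].
have : (im_mx B <= span s)%VS.
  apply/subvP => _ /memv_imgP[z _ ->]; rewrite lfunE/=.
  rewrite -{1}(mulmx_base B) -mulmxA; set y := row_base B *m z.
  have -> : col_base B *m y = \sum_j y j 0 *: col j (col_base B).
    apply/colP => i; rewrite mxE summxE; apply: eq_bigr => j _; by rewrite !mxE mulrC.
  apply: memv_suml => j _; apply: memvZ; apply: memv_span.
  by apply/mapP; exists j => //; rewrite mem_enum.
move=> /dimvS H; apply: leq_trans H _; apply: leq_trans (dim_span _) _.
by rewrite size_map -cardE card_ord.
Qed.

(** If a left eigenvector [x] kills a basis of [E], then [x A^l e = lam^l x e = 0], so [x] kills the
    whole space. Evaluation on a basis of [E] is thus injective on the left eigenspace. *)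
Lemma rank_eigenspace_le_dim (F : fieldType) (f : {rmorphism R -> F}) A E lam :
  cyclic_span A E = fullv -> (\rank (eigenspace (map_mx f A^T) lam) <= \dim E)%N.
Proof.
move=> full; pose toC m p := @map_mx R F f m p; pose AC := toC n n A.
(* Left and right eigenspaces for [lam] have the same dimension, by transposition of [A - lam]. *)
have rk : \rank (eigenspace (map_mx f A^T) lam) = \rank (eigenspace AC lam).
  rewrite /eigenspace !mxrank_ker -[in RHS]mxrank_tr; congr (_ - \rank _)%N.
  by rewrite linearB/= tr_scalar_mx map_trmx.
rewrite rk; pose L := eigenspace AC lam.
pose Eb : 'M[R]_(n, \dim E) := \matrix_(i, j) (vbasis E)`_j i 0.
have : \rank (L *m toC _ _ Eb) = \rank L.
  rewrite -(mxrank_mul_ker L (toC _ _ Eb)) -[LHS]addn0; congr (_ + _)%N.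
  apply/esym/eqP; rewrite mxrank_eq0; apply/eqP/row_matrixP => i; rewrite row0.
  set x := row i _.
  have xL : (x <= L :&: kermx (toC _ _ Eb))%MS by exact: row_sub.
  have /eigenspaceP xA : (x <= L)%MS by apply: submx_trans xL (capmxSl _ _).
  have /sub_kermxP xE : (x <= kermx (toC _ _ Eb))%MS by apply: submx_trans xL (capmxSr _ _).
  have xpow l e : x *m toC _ 1 e = 0 -> x *m toC _ _ (A ^+ l *m e) = 0.
    move=> xe; elim: l => [|l IH]; first by rewrite expr0 mx1_mul.
    by rewrite exprS -mulmxA /toC map_mxM mulmxA xA -scalemxAl IH scaler0.
  have xbasis e : e \in (vbasis E : seq _) -> x *m toC _ 1 e = 0.
    move=> eE; have ie : (index e (vbasis E) < \dim E)%N by rewrite -[X in (_ < X)%N](size_tuple (vbasis E)) index_mem.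
    apply/matrixP => a b; have /matrixP/(_ a (Ordinal ie)) := xE; rewrite [LHS]mxE [RHS]mxE => H.
    by rewrite [LHS]mxE [RHS]mxE -[RHS]H; apply: eq_bigr => j _; rewrite !mxE nth_index// ord1.
  apply/rowP => j; rewrite [RHS]mxE.
  have : delta_mx j 0 \in cyclic_span A E by rewrite full memvf.
  rewrite /cyclic_span -[X in <<X>>%VS]/(tval (in_tuple _)) => /coord_span E'.
  have : x *m toC _ 1 (delta_mx j 0) = 0.
    rewrite E' /toC raddf_sum mulmx_sumr big1// => l _.
    rewrite /= map_mxZ -scalemxAr.
    suff -> : x *m toC _ 1 ([seq A ^+ i *m e | i <- iota 0 n, e <- vbasis E]`_l) = 0 by rewrite scaler0.
    have /allpairsP[[m e] [/= _ eE ->]] :=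
      mem_nth (0 : 'cV[R]_n) (ltn_ord l : (l < size [seq A ^+ i *m e | i <- iota 0 n, e <- vbasis E])%N).
    exact/xpow/xbasis.
  move=> /(congr1 (fun M : 'cV[F]_1 => M 0 0)); rewrite [RHS]mxE => <-.
  rewrite [RHS]mxE (bigD1 j)//= big1 ?addr0; first by rewrite !mxE !eqxx/= rmorph1 mulr1.
  by move=> l lj; rewrite !mxE (negPf lj)/= rmorph0 mulr0.
by move=> <-; exact: rank_leq_col.
Qed.

Lemma cyclic_index_le_dim A E : cyclic_span A E = fullv -> (cyclic_index A <= \dim E)%N.
Proof.
by move=> full; apply/bigmax_leqP => k /asboolP[lam _ <-]; exact: rank_eigenspace_le_dim.
Qed.

End exhaustion.

Section heavy_exhausts.
Context {disp : measure_display} {T : measurableType disp} {R : realType}.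
Variable P : probability T R.
Context {n d : nat} (A : 'M[R]_n) (B : 'M[R]_(n, d)) (Z : R -> T -> 'cV[R]_d).
Variables (b : 'cV[R]_n) (Qg : 'M[R]_n) (nuB : {measure set (borelV R n) -> \bar R}).
Variables (c : 'cV[R]_d) (nuZ : {measure set (borelV R d) -> \bar R}).
Hypothesis HY : levy_triplet P (fun t w => B *m Z t w) b Qg nuB.
Hypothesis HZ : levy_triplet P Z c 0 nuZ.

Let nuB_levy : is_levy_measure nuB. Proof. by case: HY. Qed.

(** The real exponent vanishes at the multiples of [u], so for every [k], [cos<u / (k + 1), v> = 1]
    for almost all [v]. If [<u, v>] is not 0, this fails once [k] exceeds [|<u, v>|]. *)
Lemma orthogonal_image_null u : B^T *m u = 0 -> nuB [set v | dotv u v != 0] = 0%E.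
Proof.
move=> Bu; have aexp0 k : aexp nuB (k.+1%:R^-1 *: u) = 0.
  have := image_exponentE HY HZ (k.+1%:R^-1 *: u); rewrite (image_no_gaussian HY HZ) oppr0 mul0r add0r => ->.
  rewrite -scalemxAr Bu scaler0 /aexp /Rintegral integral0_eq// => z _.
  by rewrite dotv0l cos0 subrr.
pose N k : set (borelV R n) := [set v | cos (dotv (k.+1%:R^-1 *: u) v) - 1 != 0].
have mN k : measurable (N k).
  rewrite (_ : N k = ~` ((fun v => cos (dotv (k.+1%:R^-1 *: u) v)) @^-1` [set 1])).
    apply: measurableC; rewrite -[X in measurable X]setTI.
    by apply: cos_measurable => //; exact: measurable_set1.
  by apply/seteqP; split => v /=; rewrite /N/= subr_eq0 => /eqP.
have N0 k : nuB (N k) = 0%E.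
  pose f (v : borelV R n) : R := cos (dotv (k.+1%:R^-1 *: u) v) - 1.
  have intf : nuB.-integrable setT (EFin \o f) by exact: cos_sub_integrable.
  have intNf : nuB.-integrable setT (EFin \o (fun v => -1 * f v)) by exact: integrable_scale.
  have I0 : (\int[nuB]_(v in setT) `|(f v)%:E| = 0)%E.
    transitivity (\int[nuB]_(v in setT) (-1 * f v)%:E)%E.
      apply: eq_integral => v _; rewrite /= mulN1r ler0_norm// subr_le0; exact: cos_le1.
    rewrite -[LHS]fineK; last exact: (integrable_fin_num measurableT intNf).
    rewrite -[fine _]/(Rintegral _ _ _) RintegralZl//.
    by rewrite [X in _ * X](aexp0 k) mulr0.
  have mf : measurable_fun setT (EFin \o f) by case/integrableP: intf.
  have [M [mM M0 sub]] := (ae_eq_integral_abs nuB measurableT mf).1 I0.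
  apply/eqP; rewrite -measure_le0 -M0; apply: le_measure; rewrite ?inE//.
  move=> v /eqP Nv; apply: sub => /(_ I) [] H; exact: Nv.
have U0 : nuB (\bigcup_k N k) = 0%E.
  apply/negligibleP; first exact: bigcup_measurable.
  by apply: negligible_bigcup => k; apply/negligibleP; [exact: mN|exact: N0].
apply/eqP; rewrite -measure_le0 -U0; apply: le_measure; rewrite ?inE//.
- have -> : [set v | dotv u v != 0] = [set v | u^T *m v != 0].
    apply/seteqP; split => v /=; apply: contra => /eqP H; first by rewrite /dotv H mxE.
    by apply/eqP/matrixP => i j; rewrite !ord1 [RHS]mxE.
  exact: measurable_mulmx_neq0.
- exact: bigcup_measurable.
move=> v /= uv; have [k Hk] : exists k : nat, `|dotv u v| < k%:R.
  by exists (Num.truncn `|dotv u v|).+1; exact: truncnS_gt.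
exists k => //; rewrite /N/= dotvZl; have k0 : 0 < k.+1%:R :> R by rewrite ltr0n.
have x1 : `|k.+1%:R^-1 * dotv u v| <= 1.
  rewrite normrM gtr0_norm ?invr_gt0// ler_pdivrMl// mulr1 ltW//.
  by apply: lt_trans Hk _; rewrite ltr_nat.
rewrite -oppr_eq0 opprB; apply: lt0r_neq0; apply: lt_le_trans (one_sub_cos_ge x1); rewrite divr_gt0// exprn_even_gt0//=.
by rewrite mulf_neq0// invr_eq0 gt_eqF.
Qed.

(** This makes [im_mx B] itself a subspace whose complement has finite mass, the starting point of
    the minimisation in [heavy_exhausts]. *)
Lemma image_null : nuB [set v | v \notin im_mx B] = 0%E.
Proof.
have [Q QE] := vspace_kernel (im_mx B).
have QB i : B^T *m (row i Q)^T = 0.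
  rewrite -trmx_mul -row_mul; have -> : Q *m B = 0; last by rewrite row0 trmx0.
  apply/matrixP => k j; have : B *m delta_mx j 0 \in im_mx B.
    by apply/memv_imgP; exists (delta_mx j 0); rewrite ?memvf// lfunE.
  rewrite QE mulmxA => /eqP /(congr1 (fun M : 'cV[R]_n => M k 0)).
  by rewrite -colE !mxE.
pose N (i : 'I_n) : set (borelV R n) := [set v | dotv (row i Q)^T v != 0].
have mN i : measurable (N i).
  rewrite (_ : N i = [set v | row i Q *m v != 0]); first exact: measurable_mulmx_neq0.
  apply/seteqP; split => v /=; rewrite /N/= /dotv trmxK; apply: contra => /eqP H; first by rewrite H mxE.
  by apply/eqP/matrixP => k l; rewrite !ord1 [RHS]mxE.
apply/eqP; rewrite -measure_le0; apply: (@le_trans _ _ (nuB (\big[setU/set0]_(i < n) N i))).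
  apply: le_measure; rewrite ?inE; first exact: measurable_notin.
    by apply: bigsetU_measurable.
  move=> v /=; rewrite QE => Qv; rewrite -bigcup_seq.
  have [i Hi] : exists i, (Q *m v) i 0 != 0.
    apply: contrapT => H; case/negP: Qv; apply/eqP/colP => i; rewrite [RHS]mxE.
    by apply: contrapT => /eqP Hi; apply: H; exists i.
  exists i; first by rewrite /= mem_index_enum.
  by rewrite /N/= /dotv trmxK row_mulmx_coord.
apply: le_trans (measure_bigU_le _ _ mN) _.
by rewrite big1// => i _; apply: orthogonal_image_null; exact: QB.
Qed.

Lemma heavy_exhausts : heavy nuB A -> exhausts A B nuB.
Proof.
move=> hv; pose small E := (E <= im_mx B)%VS /\ (nuB [set v | v \notin E] < +oo)%E.
have ex : exists k, `[< exists2 E : {vspace 'cV[R]_n}, small E & \dim E = k >].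
  by exists (\dim (im_mx B)); apply/asboolP; exists (im_mx B) => //; split; rewrite ?subvv// image_null ltry.
have [k /asboolP[E [EB nuE] dE] kmin] := ex_minnP ex.
have full : cyclic_span A E = fullv.
  apply/eqP; rewrite eqEsubv subvf/=; apply/negPn/negP => nsub.
  have [Q QE] := vspace_kernel (cyclic_span A E).
  have Q0 : Q != 0.
    apply: contra nsub => /eqP Q0; apply/subvP => v _; by rewrite QE Q0 mul0mx.
  have iQ : inv_ker A Q.
    by move=> v /eqP; rewrite -QE => /cyclic_span_invariant; rewrite QE => /eqP.
  have := hv Q Q0 iQ; apply/eqP; rewrite lt_eqF//; apply: le_lt_trans nuE.
  apply: le_measure; rewrite ?inE; [exact: measurable_mulmx_neq0|exact: measurable_notin|].
  by move=> v /=; rewrite -QE; apply: contra => vE; exact: memv_cyclic.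
have fullB : cyclic_span A (im_mx B) = fullv.
  apply/eqP; rewrite eqEsubv subvf/= -full; apply: cyclic_span_min; last exact: cyclic_span_invariant.
  by apply/subvP => v vE; apply: memv_cyclic; exact: (subvP EB).
split=> //; exists (\dim E), E; split=> //.
  rewrite cyclic_index_le_dim//=; apply: leq_trans (dimvS EB) _; exact: dim_im_mx.
(* The complement of [H] is covered by that of [E], which has finite mass, and by [E] minus [H]. If
   the latter had finite mass too, [H] would contradict the minimality of [E]. *)
move=> H HE dH; apply/eqP; rewrite -leye_eq leNgt; apply/negP => nuH.
have : (\dim E <= \dim H)%N.
  rewrite dE; apply: kmin; apply/asboolP; exists H => //; split; first exact: subv_trans EB.
  apply: (@le_lt_trans _ _ (nuB ([set v | v \notin E] `|` [set v | v \in E /\ v \notin H]))%E).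
    apply: le_measure; rewrite ?inE; first exact: measurable_notin.
      apply: measurableU; first exact: measurable_notin.
      by apply: measurableI; [exact: measurable_in|exact: measurable_notin].
    move=> v /= vH; have [vE|vE] := boolP (v \in E); [by right|by left].
  apply: le_lt_trans (measureU2 _ _ _) _; first exact: measurable_notin.
    by apply: measurableI; [exact: measurable_in|exact: measurable_notin].
  exact: lte_add_pinfty.
by rewrite -dH ltnn.
Qed.

End heavy_exhausts.

(** * The implications for the given process *)

Section assembly.
Context {disp : measure_display} {T : measurableType disp} {R : realType}.
Variable P : probability T R.
Context {n d : nat} (n_gt0 : (0 < n)%N) (A : 'M[R]_n) (B : 'M[R]_(n, d)).
Variables (Z : R -> T -> 'cV[R]_d) (x : 'cV[R]_n) (X : R -> T -> 'cV[R]_n).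
Variables (b : 'cV[R]_n) (Qg : 'M[R]_n) (nuB : {measure set (borelV R n) -> \bar R}).
Variables (c : 'cV[R]_d) (nuZ : {measure set (borelV R d) -> \bar R}).
Hypothesis Z_levy : levy_process P Z.
Hypothesis X_OU : ornstein_uhlenbeck P A B x Z X.
Hypothesis HY : levy_triplet P (fun t w => B *m Z t w) b Qg nuB.
Hypothesis HZ : levy_triplet P Z c 0 nuZ.

Let Y t w := B *m Z t w.
Let Y_levy : levy_process P Y. Proof. exact: levy_process_mulmx. Qed.
Let nuB_levy : is_levy_measure nuB. Proof. by case: HY. Qed.
Let charY := image_charfun HY HZ.

Let modulus p u : Ex P (fun w => cos (dotv u (Y (dy p) w))) ^+ 2 +
  Ex P (fun w => sin (dotv u (Y (dy p) w))) ^+ 2 = expR (dy p * aexp nuB u) ^+ 2.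
Proof.
have dp0 : 0 <= dy p :> R by rewrite ltW// dy_gt0.
rewrite (charfun_cos u HY dp0) (charfun_sin u HY dp0) Re_levy_exponent.
rewrite (image_no_gaussian HY HZ) oppr0 mul0r add0r !exprMn -mulrDr.
by rewrite cos2Dsin2 mulr1.
Qed.

Let mX1 : measurable_fun setT (X 1 : T -> borelV R n).
Proof. by case: X_OU => + _; apply. Qed.

Let euler_cvg : {ae P, forall w, euler_steps (euler_mx A p) x (fun j => incr Y p j w) (2 ^ p)
  @[p --> \oo] --> X 1 w}.
Proof.
case: X_OU => _; apply: filterS2 (levy_start Y_levy) => w Y0 [cX XE].
exact: (euler_converges (X := X ^~ w) (Y := Y ^~ w) cX Y0 XE).
Qed.

Lemma heavy_filling_time : heavy nuB A -> {ae P, forall w, filling_time A B Z w = 0%E}.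
Proof.
move=> hv; have := heavy_fills nuB_levy Y_levy charY hv; apply: filterS => w fw.
apply/eqP; rewrite eq_le; apply/andP; split; last first.
  by apply: le_ereal_inf_tmp => _ [t [t0 _] <-]; rewrite lee_fin ltW.
apply/lee_addgt0Pr => e e0; rewrite add0e.
have [q _ Hq] := dy_small e0; apply: (@le_trans _ _ (dy q)%:E).
  apply: ereal_inf_lbound; exists (dy q) => //; split; first exact: dy_gt0.
  exact: (fw q).
by rewrite lee_fin ltW//; apply: Hq => /=.
Qed.

Lemma filling_time_heavy : {ae P, forall w, filling_time A B Z w = 0%E} -> heavy nuB A.
Proof.
move=> ft Q Q0 iQ; apply/eqP; rewrite -leye_eq leNgt; apply/negP => light.
apply: (light_no_filling n_gt0 Y_levy nuB_levy modulus euler_cvg Q0 iQ light).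
apply: filterS ft => w ft0; have : (filling_time A B Z w < 1%:E)%E by rewrite ft0 lte_fin.
move=> /ereal_inf_lt[_ [t [t0 full] <-]]; rewrite lte_fin => t1.
by exists t; rewrite ?t0 ?ltW.
Qed.

Lemma heavy_absolutely_continuous : A \in unitmx -> heavy nuB A ->
  pushforward P (X 1 : T -> borelV R n) `<< @lebesgue_cV R n.
Proof.
move=> A_unit hv N N0 S mS SN; have [q' anti] := anticoncentration x A_unit nuB_levy Y_levy
  (levy_start Y_levy) charY hv.
apply: (null_not_hit (dy_gt0 q') _ mX1 _ anti mS); last exact: N0.
  by move=> p; exact: (XP_measurable A x Y_levy p).
apply: filterS euler_cvg => w /cvgrPdist_lt cw; apply/cvgrPdist_lt => e /cw.
by apply: filterS => p; rewrite eul_steps.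
Qed.

Lemma absolutely_continuous_heavy :
  pushforward P (X 1 : T -> borelV R n) `<< @lebesgue_cV R n -> heavy nuB A.
Proof.
move=> ac Q Q0 iQ; apply/eqP; rewrite -leye_eq leNgt; apply/negP => light.
have [N [mN N0]] := light_charges_null_set n_gt0 Y_levy nuB_levy modulus mX1 euler_cvg Q0 iQ light.
(* Domination is stated through the measurable subsets of [N]; each of them has measure 0 because
   the covers of [N] also cover it. *)
rewrite -[X in (_ < X)%E]/(pushforward P (X 1 : T -> borelV R n) N) (ac N _ N mN)// => [|S mS SN].
  by rewrite ltxx.
apply/eqP; rewrite eq_le lebesgue_cV_ge0 andbT -N0; apply: le_ereal_inf => _ [ab [ord cov] <-].
by exists ab => //; split=> //; apply: subset_trans cov.
Qed.

End assembly.

Unset Implicit Arguments.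

Theorem mainTheorem1 (R : realType) (disp : measure_display)
    (T : measurableType disp) (P : probability T R) (n d : nat)
    (n_ge1 : (1 <= n)%N) (d_ge1 : (1 <= d)%N)
    (A : 'M[R]_n) (B : 'M[R]_(n, d))
    (Z : R -> T -> 'cV[R]_d) (x : 'cV[R]_n) (X : R -> T -> 'cV[R]_n)
    (nuB : {measure set (borelV R n) -> \bar R})
    (Z_levy : levy_process P Z) (Z_no_gauss : no_gaussian_part P Z)
    (X_OU : ornstein_uhlenbeck P A B x Z X)
    (nuB_levy : levy_measure_of P (fun t w => B *m Z t w) nuB)
    (A_nonsingular : A \in unitmx) :
  (pushforward P (X 1 : T -> borelV R n) `<< @lebesgue_cV R n <->
   {ae P, forall w, filling_time A B Z w = 0%E}) /\
  ({ae P, forall w, filling_time A B Z w = 0%E} <-> exhausts A B nuB).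
Proof.
have [c [nuZ HZ]] := Z_no_gauss; have [b [Q HY]] := nuB_levy.
have fh := filling_time_heavy n_ge1 Z_levy X_OU HY HZ.
have hf := heavy_filling_time Z_levy HY HZ (A := A).
split; split.
- by move=> /(absolutely_continuous_heavy n_ge1 Z_levy X_OU HY HZ).
- by move=> /fh; exact: heavy_absolutely_continuous Z_levy X_OU HY HZ A_nonsingular.
- by move=> /fh; exact: heavy_exhausts HY HZ.
- by move=> /exhausts_heavy.
Qed.
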